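(* Let $\kappa\le 0$, $\tau>0$, and let $\mathfrak{h}\in\mathfrak{C}^1$. Up to vertical translations, any complete, rotational $\mathfrak{h}$-surface in $\mathbb{E}(\kappa,\tau)$ (that is, in $\mathrm{Nil}_3$ if $\kappa=0$, or in $\widetilde{SL_2}(\mathbb{R})$ if $\kappa<0$) is one of the following: 1. The vertical cylinder with radius $x_0=2\left(\sqrt{4\mathfrak{h}(0)^2+\kappa}+2\mathfrak{h}(0)\right)^{-1}$ and constant mean curvature $\mathfrak{h}(0)$. 2. An embedded $\mathfrak{h}$-sphere with strictly monotone angle function (along its profile curve). 3. A member of a 1-parameter family of properly embedded $\mathfrak{h}$-unduloids. 4. A member of a 1-parameter family of properly immersed $\mathfrak{h}$-nodoids.
   Context: **Ambient space.** For $\tau>0$ and $\kappa\le 0$, $\mathbb{E}(\kappa,\tau)$ is the simply connected homogeneous 3-manifold given by the set $\mathcal{R}(\kappa,\tau)$ of points $(x,y,z)\in\mathbb{R}^3$ (with $x^2+y^2<4/(-\kappa)$ if $\kappa<0$), with metric $$\lambda^2(dx^2+dy^2)+\left(\lambda\tau(y\,dx-x\,dy)+dz\right)^2,\qquad \lambda=\frac{4}{4+\kappa(x^2+y^2)}.$$ It is the Heisenberg space $\mathrm{Nil}_3$ for $\kappa=0$, and the universal cover $\widetilde{SL_2}(\mathbb{R})$ of the special linear group for $\kappa<0$. The field $\xi=E_3=\partial_z$ is a unit Killing field; its flow consists of the vertical translations. The $E_3$-axis is $\{x=y=0\}$, and the maps $(x,y,z)\mapsto(x\cos\theta+y\sin\theta,-x\sin\theta+y\cos\theta,z)$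 are isometries, called the rotations around the $E_3$-axis. **Function class.** $\mathfrak{C}^1=\{\mathfrak{h}\in C^1([-1,1]):\ \mathfrak{h}(y)=\mathfrak{h}(-y)>0 \text{ and } 4\mathfrak{h}(y)^2+\kappa(1-y^2)>0 \text{ for all } y\in[-1,1]\}$. **$\mathfrak{h}$-surfaces.** An immersed oriented surface $\Sigma$ with unit normal $\eta$ is an $\mathfrak{h}$-surface if its mean curvature function (half the trace of the second fundamental form $\langle\nabla_XY,\eta\rangle$) satisfies $H_\Sigma(p)=\mathfrak{h}(\nu_p)$ for all $p\in\Sigma$, where $\nu_p=\langle\eta_p,\xi\rangle$ is the angle function. An $\mathfrak{h}$-sphere is an $\mathfrak{h}$-surface that is topologically a sphere. **Rotational surfaces.** A surface is rotational if it is obtained by rotating a (connected) curve $(x(s),0,z(s))$, $x\ge0$, its profile curve, around the axis of rotation, which is taken to be the $E_3$-axis. The vertical cylinder of radius $x_0$ is $\{x^2+y^2=x_0^2\}$ in these coordinates. **Unduloids and nodoids.** An $\mathfrak{h}$-unduloid is a rotational $\mathfrak{h}$-surface diffeomorphic to $\mathbb{S}^1\times\mathbb{R}$, whose profile curve $(x(s),0,z(s))$, $s\in\mathbb{R}$, has $x(s)>0$ non-constant and periodic, and $z(s)$ strictly monotone. An $\mathfrak{h}$-nodoid is a complete rotational $\mathfrak{h}$-surface whose profile curve has $x(s)>0$ non-constant and periodic, with $z'(s)$ periodic (with a common period) and taking both signs, so the height alternately increases and decreases. The profile curve of a nodoid is allowed to close up, in which case the nodoid is regarded as an immersed torus. A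 1-parameter family is a family indexed by a real parameter ranging over an interval (for unduloids the minimum of $x(s)$, for nodoids the maximum of $x(s)$). *)

(* Defs.v *)
From HB Require Import structures.
From mathcomp Require Import all_boot all_order all_algebra.
From mathcomp Require Import all_classical all_reals all_analysis.

Set Implicit Arguments.
Unset Strict Implicit.
Unset Printing Implicit Defensive.

Import Order.TTheory GRing.Theory Num.Theory.
Import numFieldNormedType.Exports.

Local Open Scope classical_set_scope.
Local Open Scope ring_scope.

Section EuclideanHelpers.
Context {R : realType}.

Definition vec2 (a b : R) : 'rV[R]_2 := \row_(i < 2) [:: a; b]`_i.
Definition vec3 (a b c : R) : 'rV[R]_3 := \row_(i < 3) [:: a; b; c]`_i.

Definition px (p : 'rV[R]_3) : R := p ord0 (inord 0).
Definition py (p : 'rV[R]_3) : R := p ord0 (inord 1).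
Definition pz (p : 'rV[R]_3) : R := p ord0 (inord 2).

(* The library norm on row vectors is the sup norm. *)
Definition enorm2 (w : 'rV[R]_2) : R :=
  Num.sqrt (w ord0 (inord 0) ^+ 2 + w ord0 (inord 1) ^+ 2).

Definition sphere2 : set 'rV[R]_3 :=
  [set p | px p ^+ 2 + py p ^+ 2 + pz p ^+ 2 = 1].

Definition nondegenerate_interval (J : set R) : Prop :=
  is_interval J /\ exists a b, [/\ J a, J b & a < b].

Definition periodic (f : R -> R) (T : R) : Prop := forall s, f (s + T) = f s.
Definition nonconstant (f : R -> R) : Prop := exists s t, f s != f t.

Definition strictly_increasing_on (D : set R) (f : R -> R) : Prop :=
  forall s t, D s -> D t -> s < t -> f s < f t.
Definition strictly_decreasing_on (D : set R) (f : R -> R) : Prop :=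
  forall s t, D s -> D t -> s < t -> f t < f s.
Definition strictly_monotone_on (D : set R) (f : R -> R) : Prop :=
  strictly_increasing_on D f \/ strictly_decreasing_on D f.

Definition is_minimum (f : R -> R) (m : R) : Prop :=
  (exists s, f s = m) /\ forall s, m <= f s.
Definition is_maximum (f : R -> R) (m : R) : Prop :=
  (exists s, f s = m) /\ forall s, f s <= m.

End EuclideanHelpers.

Definition homeomorphic {X Y : topologicalType} (A : set X) (B : set Y) : Prop :=
  exists (f : X -> Y) (g : Y -> X),
    [/\ {within A, continuous f}, {within B, continuous g},
        forall a, A a -> B (f a) /\ g (f a) = a &
        forall b, B b -> A (g b) /\ f (g b) = b].

Section AmbientSpace.
Context {R : realType}.
Variables (kappa tau : R).

Definition ambient : set 'rV[R]_3 :=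
  [set p | kappa < 0 -> px p ^+ 2 + py p ^+ 2 < 4 / (- kappa)].

Definition conf (p : 'rV[R]_3) : R :=
  4 / (4 + kappa * (px p ^+ 2 + py p ^+ 2)).

(* The 1-form lambda * tau * (y dx - x dy) + dz, at p, applied to v. *)
Definition vform (p v : 'rV[R]_3) : R :=
  conf p * tau * (py p * px v - px p * py v) + pz v.

Definition metric (p u v : 'rV[R]_3) : R :=
  conf p ^+ 2 * (px u * px v + py u * py v) + vform p u * vform p v.

Definition xi : 'rV[R]_3 := vec3 0 0 1.

(* Koszul's formula <D_U V, W> at p, for U, V, W extended to vector fields
   with constant components (hence with vanishing brackets). *)
Definition christoffel (p u v w : 'rV[R]_3) : R :=
  2^-1 * ('D_u (fun q => metric q v w) p
          + 'D_v (fun q => metric q u w) p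
          - 'D_w (fun q => metric q u v) p).

End AmbientSpace.

Section Patches.
Context {R : realType}.

Definition pd (a : 'I_2) (Psi : 'rV[R]_2 -> 'rV[R]_3) : 'rV[R]_2 -> 'rV[R]_3 :=
  'D_(delta_mx ord0 a) Psi.

Definition pderivable (a : 'I_2) (Psi : 'rV[R]_2 -> 'rV[R]_3) (w : 'rV[R]_2) :=
  derivable Psi w (delta_mx ord0 a).

Definition C2_near (Psi : 'rV[R]_2 -> 'rV[R]_3) (w0 : 'rV[R]_2) : Prop :=
  \forall w \near w0,
    [/\ {for w, continuous Psi},
        forall a, pderivable a Psi w /\ {for w, continuous (pd a Psi)} &
        forall a b, pderivable b (pd a Psi) w
                    /\ {for w, continuous (pd b (pd a Psi))}].

Definition tangents (Psi : 'rV[R]_2 -> 'rV[R]_3) (w : 'rV[R]_2) : 'M[R]_(2, 3) :=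
  \matrix_(a < 2) pd a Psi w.

Definition C2_immersion_at (Psi : 'rV[R]_2 -> 'rV[R]_3) (w : 'rV[R]_2) : Prop :=
  C2_near Psi w /\ row_free (tangents Psi w).

Variables (kappa tau : R).

(* eta is the unit normal of Psi at w for the orientation sg = 1 or -1. *)
Definition unit_normal (sg : R) (Psi : 'rV[R]_2 -> 'rV[R]_3) (w : 'rV[R]_2)
    (eta : 'rV[R]_3) : Prop :=
  [/\ metric kappa tau (Psi w) eta eta = 1,
      forall a, metric kappa tau (Psi w) (pd a Psi w) eta = 0 &
      0 < sg * \det (col_mx (tangents Psi w) eta : 'M[R]_3)].

Definition first_form (Psi : 'rV[R]_2 -> 'rV[R]_3) (w : 'rV[R]_2) : 'M[R]_2 :=
  \matrix_(a < 2, b < 2) metric kappa tau (Psi w) (pd a Psi w) (pd b Psi w).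

(* <D_(d_a Psi) (d_b Psi), eta>, D being the Levi-Civita connection. *)
Definition second_form (Psi : 'rV[R]_2 -> 'rV[R]_3) (w : 'rV[R]_2)
    (eta : 'rV[R]_3) : 'M[R]_2 :=
  \matrix_(a < 2, b < 2)
    (metric kappa tau (Psi w) (pd a (pd b Psi) w) eta
     + christoffel kappa tau (Psi w) (pd a Psi w) (pd b Psi w) eta).

Definition mean_curvature (Psi : 'rV[R]_2 -> 'rV[R]_3) (w : 'rV[R]_2)
    (eta : 'rV[R]_3) : R :=
  2^-1 * \tr (second_form Psi w eta *m invmx (first_form Psi w)).

Definition angle (Psi : 'rV[R]_2 -> 'rV[R]_3) (w : 'rV[R]_2)
    (eta : 'rV[R]_3) : R :=
  metric kappa tau (Psi w) eta xi.

End Patches.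

(* A curve (cx s, 0, cz s), s in cdom, to be rotated around the axis x = y = 0.
   The values of cx and cz outside cdom are irrelevant. *)
Record profile (R : realType) : Type := Profile {
  cdom : set R;
  cx : R -> R;
  cz : R -> R }.

Section RotationalSurfaces.
Context {R : realType}.
Implicit Types (P Q : profile R).

Definition rotated P (s theta : R) : 'rV[R]_3 :=
  vec3 (cx P s * cos theta) (cx P s * sin theta) (cz P s).

Definition rot_patch P (w : 'rV[R]_2) : 'rV[R]_3 :=
  rotated P (w ord0 (inord 0)) (w ord0 (inord 1)).

(* Patch centred at an end s0 of the profile lying on the axis: for w of polar
   coordinates (r, theta), this is rotated P (s0 + sg * r) theta.  (At w = 0 the
   quotients are 0 by the convention 0^-1 = 0, the correct value.) *)
Definition pole_patch P (s0 sg : R) (w : 'rV[R]_2) : 'rV[R]_3 :=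
  let r := enorm2 w in
  vec3 (cx P (s0 + sg * r) * (w ord0 (inord 0) / r))
       (cx P (s0 + sg * r) * (w ord0 (inord 1) / r))
       (cz P (s0 + sg * r)).

Definition inward P (s0 sg : R) : Prop :=
  (sg = 1 \/ sg = -1) /\ \forall r \near 0^'+, cdom P (s0 + sg * r).

(* chart P s theta Psi w sg: Psi parametrizes the rotational surface around its
   point of parameters (s, theta), which is Psi w; sg compares the orientation
   of Psi with that given by the coordinates (s, theta). *)
Inductive chart P (s theta : R) :
    ('rV[R]_2 -> 'rV[R]_3) -> 'rV[R]_2 -> R -> Prop :=
| chart_regular : interior (cdom P) s ->
    chart P s theta (rot_patch P) (vec2 s theta) 1
| chart_pole sg : cdom P s -> cx P s = 0 -> inward P s sg ->
    chart P s theta (pole_patch P s sg) 0 sg.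

(* The profile closes up with (least) period T. *)
Definition closes_up P (T : R) : Prop :=
  [/\ cdom P = setT, 0 < T, periodic (cx P) T /\ periodic (cz P) T &
      forall T', 0 < T' -> periodic (cx P) T' -> periodic (cz P) T' -> T <= T'].

(* The point of parameter s of the 1-manifold parametrizing the profile: an
   interval or, when the profile closes up, the circle of length T. *)
Definition base_point P (s : R) : R * R :=
  if pselect (exists T, closes_up P T) is left e then
    let T := projT1 (cid e) in
    (cos (2 * pi * s / T), sin (2 * pi * s / T))
  else (s, 0).

(* The abstract surface is realized in R^4: surf_point identifies (s, theta)
   with (s, theta') when theta' - theta is in 2 pi Z or when s is on the axis,
   and identifies s with s + T when the profile closes up with period T. *)
Definition surf_point P (s theta : R) : (R * R) * (R * R) :=
  (base_point P s, (cx P s * cos theta, cx P s * sin theta)).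

Definition carrier P : set ((R * R) * (R * R)) :=
  [set q | exists s theta, cdom P s /\ q = surf_point P s theta].

Variables (kappa tau : R).

(* A connected profile in x >= 0 whose rotation is an immersed C^2 surface
   without boundary, so that the profile has ends only on the axis. *)
Definition rotational_surface P : Prop :=
  [/\ nondegenerate_interval (cdom P),
      forall s, cdom P s -> 0 <= cx P s,
      forall s, cdom P s -> interior (cdom P) s \/ cx P s = 0,
      forall s theta, cdom P s -> ambient kappa (rotated P s theta) &
      forall s theta Psi w sg, chart P s theta Psi w sg ->
        C2_immersion_at Psi w].

Definition oriented_h_surface (h : R -> R) P (eps : R) : Prop :=
  (eps = 1 \/ eps = -1) /\
  forall s theta Psi w sg eta, chart P s theta Psi w sg ->
    unit_normal kappa tau (eps * sg) Psi w eta ->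
    mean_curvature kappa tau Psi w eta = h (angle kappa tau Psi w eta).

Definition h_surface (h : R -> R) P : Prop :=
  rotational_surface P /\ exists eps, oriented_h_surface h P eps.

Definition angle_function P (eps : R) (nu : R -> R) : Prop :=
  forall s theta Psi w sg eta, chart P s theta Psi w sg ->
    unit_normal kappa tau (eps * sg) Psi w eta ->
    nu s = angle kappa tau Psi w eta.

(* The intrinsic distance between the points of parameters a and b is < e:
   they are joined by a C^1 curve of length < e in the surface. *)
Definition intrinsically_close P (a b : R * R) (e : R) : Prop :=
  exists s theta : R -> R,
    let c := fun t => rotated P (s t) (theta t) in
    [/\ forall t, cdom P (s t),
        continuous (fun t => surf_point P (s t) (theta t)),
        surf_point P (s 0) (theta 0) = surf_point P a.1 a.2
        /\ surf_point P (s 1) (theta 1) = surf_point P b.1 b.2,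
        (forall t, derivable c t 1) /\ continuous ('D_1 c : R -> 'rV[R]_3) &
        \int[lebesgue_measure]_(t in `[0, 1])
          Num.sqrt (metric kappa tau (c t) ('D_1 c t) ('D_1 c t)) < e].

Definition complete_surface P : Prop :=
  forall a : nat -> R * R,
    (forall n, cdom P (a n).1) ->
    (forall e, 0 < e -> exists N, forall m n, (N <= m)%N -> (N <= n)%N ->
       intrinsically_close P (a m) (a n) e) ->
    exists b : R * R, cdom P b.1 /\
      (fun n => surf_point P (a n).1 (a n).2) @ \oo --> surf_point P b.1 b.2.

Definition proper_surface P : Prop :=
  forall K : set 'rV[R]_3, K `<=` ambient kappa -> compact K ->
    compact [set q | exists s theta,
      [/\ cdom P s, K (rotated P s theta) & q = surf_point P s theta]].

(* The immersion is a homeomorphism onto its image, with inverse g. *)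
Definition embedded P : Prop :=
  exists g : 'rV[R]_3 -> (R * R) * (R * R),
    {within [set p | exists s theta, cdom P s /\ p = rotated P s theta],
      continuous g} /\
    forall s theta, cdom P s -> g (rotated P s theta) = surf_point P s theta.

(* The surfaces agree, as immersed surfaces, up to a vertical translation. *)
Definition vertically_congruent P Q : Prop :=
  exists (c : R) (phi : R -> R),
    [/\ set_bij (cdom P) (cdom Q) phi,
        {within cdom P, continuous phi} &
        forall s, cdom P s ->
          cx Q (phi s) = cx P s /\ cz Q (phi s) = cz P s + c].

Definition cylinder (r : R) : profile R := Profile setT (fun=> r) id.

Definition h_sphere (h : R -> R) P : Prop :=
  h_surface h P /\ homeomorphic (carrier P) (@sphere2 R).

Definition monotone_angle (h : R -> R) P : Prop :=
  exists eps nu, [/\ oriented_h_surface h P eps, angle_function P eps nu &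
    strictly_monotone_on (cdom P) nu].

(* As cdom P is the line, cx P > 0 and cz P is injective, the parameters
   (s, theta) identify the surface with R x S^1. *)
Definition unduloid (h : R -> R) P : Prop :=
  [/\ h_surface h P, cdom P = setT, forall s, 0 < cx P s,
      nonconstant (cx P) /\ exists2 T, 0 < T & periodic (cx P) T &
      strictly_monotone_on setT (cz P)].

Definition nodoid (h : R -> R) P : Prop :=
  [/\ h_surface h P, complete_surface P,
      cdom P = setT /\ forall s, 0 < cx P s,
      nonconstant (cx P) /\
        (exists2 T, 0 < T & periodic (cx P) T /\ periodic (derive1 (cz P)) T) &
      (exists s, 0 < derive1 (cz P) s) /\ (exists s, derive1 (cz P) s < 0)].

Definition C1_on_unit (h : R -> R) : Prop :=
  exists2 h' : R -> R, {within `[-1, 1]%classic, continuous h'} &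
    forall y, -1 <= y <= 1 ->
      (h t - h y) / (t - y) @[t --> within `[-1, 1]%classic y^'] --> h' y.

Definition C1_class (h : R -> R) : Prop :=
  C1_on_unit h /\
  forall y, -1 <= y <= 1 ->
    [/\ h y = h (- y), 0 < h y & 0 < 4 * h y ^+ 2 + kappa * (1 - y ^+ 2)].

End RotationalSurfaces.

(* Main.v *)
Require Import Defs.
From mathcomp Require Import all_boot all_order all_algebra.
From mathcomp Require Import all_classical all_reals all_analysis.
From mathcomp Require Import ring lra.

(* Let r be the radius of the profile, phi the angle of its tangent in the metric
   plane orthogonal to the rotation field, and p = 1/r + kappa r/4.  In a suitable
   time, the profile equation H = h(nu) is the autonomous planar system
     p' = - p S(p) sin phi,   phi' = S(p) cos phi - 2 h(sin phi / q),
   with S(p) = sqrt(p^2 - kappa) = 1/r - kappa r/4 and q = sqrt(1 + tau^2 r^2); its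
   only equilibrium is the cylinder.  The system is reversible with respect to the
   zeros of sin phi: a complete orbit with two such zeros is periodic, and a complete
   orbit without any zero is impossible, by Barbalat's argument, a Riccati inequality
   at the equilibrium and the gap condition 4 h^2 + kappa (1 - y^2) > 0.  Hence
   every complete orbit has a zero of sin phi, and the value of (p, cos phi) there
   decides between the cylinder, the unduloids (started at the smallest radius with
   cos phi = 1), the nodoids (with cos phi = -1) and, when the orbit has a single
   zero, the sphere, whose profile reaches the axis at both ends.  Completeness of
   the surface enters by ruling out any other end of the orbit at finite time. *)

Set Implicit Arguments.
Unset Strict Implicit.
Unset Printing Implicit Defensive.
Import Order.TTheory GRing.Theory Num.Theory.
Import numFieldNormedType.Exports.
Local Open Scope classical_set_scope.
Local Open Scope ring_scope.

(** The time is arc length for the metric [lam^2 dr^2 + dz^2 / q^2] induced on the half-plane of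
    profiles by projection along the rotation field, [lam] being the conformal factor. In the
    coordinate [p] the axis lies at [p = +oo], and [p = 0] is the far end: infinite radius, or the
    boundary of the disc if [kappa < 0]. For non-constant [h] no first integral is at hand. Its role
    is taken by [cos phi / p], whose derivative [2 h sin phi / p] has the sign of [sin phi]: it
    restricts the value of [cos phi] at the next zero of [sin phi] and keeps [cos phi] positive
    along unduloids and spheres. Corrected by a multiple of [1 / p^2], it bounds [cos phi] by a
    multiple of [1 / p] near the axis. The field is not globally Lipschitz and [h] matters only on
    [[-1, 1]]; both are clamped, and the solutions built never leave the region where the clamping
    is invisible. Two points need separate arguments: the angle of a sphere is monotone by a barrier
    argument at its stationary points, and the largest radii of nodoids fill an interval because
    orbits cannot cross, the relation between the smallest and the largest radius not being
    explicit. *)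

Lemma le_sq (R : realDomainType) (a b : R) : 0 <= b -> a ^+ 2 <= b ^+ 2 -> a <= b.
Proof. by move=> b0; apply: contraTT; rewrite -!ltNge => ba; rewrite ltr_pXn2r ?nnegrE// (le_trans b0)// ltW. Qed.

Lemma lt_sq (R : realDomainType) (a b : R) : 0 <= b -> a ^+ 2 < b ^+ 2 -> a < b.
Proof. by move=> b0; apply: contraTT; rewrite -!leNgt => ba; rewrite ler_pXn2r ?nnegrE// (le_trans b0). Qed.

(** * Rules for derivatives and continuity *)

Section DerivativeRules.
Context {R : realType} {V : normedModType R}.
Implicit Types (f g : V -> R) (x v : V).

Lemma derD f g x v df dg : is_derive x v f df -> is_derive x v g dg ->
  is_derive x v (fun y => f y + g y) (df + dg).
Proof. exact: is_deriveD. Qed.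

Lemma derN f x v df : is_derive x v f df -> is_derive x v (fun y => - f y) (- df).
Proof. exact: is_deriveN. Qed.

Lemma derB f g x v df dg : is_derive x v f df -> is_derive x v g dg ->
  is_derive x v (fun y => f y - g y) (df - dg).
Proof. exact: is_deriveB. Qed.

Lemma derM f g x v df dg : is_derive x v f df -> is_derive x v g dg ->
  is_derive x v (fun y => f y * g y) (f x * dg + g x * df).
Proof. exact: is_deriveM. Qed.

Lemma derX f n x v df : is_derive x v f df ->
  is_derive x v (fun y => f y ^+ n.+1) (n.+1%:R * f x ^+ n * df).
Proof.
move=> fd; have fX := is_deriveX n.+1 fd.
have -> : (fun y => f y ^+ n.+1) = f ^+ n.+1 by apply/funext => y; rewrite exprfctE.
by notypeclasses refine (is_derive_eq fX _); rewrite /GRing.scale/=.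
Qed.

Lemma derV f x v df : f x != 0 -> is_derive x v f df ->
  is_derive x v (fun y => (f y)^-1) (- df / f x ^+ 2).
Proof.
move=> fx0 [dfx <-]; split; first exact: derivableV.
by rewrite deriveV// /GRing.scale/= mulNr mulrC mulNr.
Qed.

Lemma der_cst (c : R) x v : is_derive x v (fun=> c) 0.
Proof. exact: is_derive_cst. Qed.

Lemma derC (f : R -> R) g x v df dg : is_derive (g x) 1 f df ->
  differentiable g x -> is_derive x v g dg ->
  is_derive x v (fun y => f (g y)) (df * dg).
Proof.
move=> [fd <-] gd [_ <-].
have fd' : differentiable f (g x) by exact/derivable1_diffP.
have := differentiable_comp gd fd' => cd.
split; first exact: diff_derivable.
rewrite deriveE// diff_comp//= deriveE// -[in LHS](mulr1 ('d g x v)).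
by rewrite -[_ * 1]/('d g x v *: 1) linearZ/= -deriveE// mulrC.
Qed.

End DerivativeRules.

Section RealDerivatives.
Context {R : realType}.
Implicit Types (f g : R -> R).

Lemma derivable_cont f (x : R) : derivable f x 1 -> {for x, continuous f}.
Proof. by move=> /derivable1_diffP /differentiable_continuous. Qed.

Lemma der_cont {f} {x df : R} : is_derive x 1 f df -> {for x, continuous f}.
Proof. by move=> [/derivable_cont]. Qed.

Lemma derC1 f g (x df dg : R) : is_derive (g x) 1 f df -> is_derive x 1 g dg ->
  is_derive x 1 (fun y => f (g y)) (df * dg).
Proof. exact: is_derive1_comp. Qed.

Lemma der_id (x : R) : is_derive x 1 (fun y : R => y) 1.
Proof. exact: is_derive_id. Qed.

Lemma der_near f g (x df : R) : (\forall y \near x, f y = g y) ->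
  is_derive x 1 f df -> is_derive x 1 g df.
Proof.
exact: near_eq_is_derive.
Qed.

End RealDerivatives.

(** Rules are applied by unification only, keeping instance search for [is_derive] out of the way;
    hypotheses about atoms come first. [der] leaves the equation between the computed and the stated
    derivative. *)
Ltac der_step := first
  [ eassumption
  | notypeclasses refine (der_cst _ _ _)
  | notypeclasses refine (der_id _)
  | notypeclasses refine (derX _ _)
  | notypeclasses refine (derD _ _)
  | notypeclasses refine (derB _ _)
  | notypeclasses refine (derN _)
  | notypeclasses refine (derM _ _)
  | notypeclasses refine (derV _ _)
  | notypeclasses refine (derC1 (is_derive_sin _) _)
  | notypeclasses refine (derC1 (is_derive_cos _) _)].
Ltac der := notypeclasses refine (is_derive_eq _ _); [repeat der_step|cbv beta].

Section ContinuityRules.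
Context {R : realType} {T : topologicalType}.
Implicit Types (f g : T -> R) (x : T).

Lemma contN f x : {for x, continuous f} -> {for x, continuous (fun y => - f y)}.
Proof. exact: cvgN. Qed.
Lemma contD f g x : {for x, continuous f} -> {for x, continuous g} ->
  {for x, continuous (fun y => f y + g y)}.
Proof. exact: cvgD. Qed.
Lemma contB f g x : {for x, continuous f} -> {for x, continuous g} ->
  {for x, continuous (fun y => f y - g y)}.
Proof. exact: cvgB. Qed.
Lemma contM f g x : {for x, continuous f} -> {for x, continuous g} ->
  {for x, continuous (fun y => f y * g y)}.
Proof. exact: cvgM. Qed.
Lemma contX f n x : {for x, continuous f} -> {for x, continuous (fun y => f y ^+ n)}.
Proof. by move=> fx; exact: (@continuous_comp _ _ _ f (@GRing.exp R ^~ n) x fx (@exprn_continuous R n (f x))). Qed.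
Lemma contV f x : f x != 0 -> {for x, continuous f} ->
  {for x, continuous (fun y => (f y)^-1)}.
Proof. by move=> fx0 fx; exact: cvgV. Qed.
Lemma contsqrt f x : {for x, continuous f} -> {for x, continuous (fun y => Num.sqrt (f y))}.
Proof. by move=> fx; exact: (@continuous_comp _ _ _ f Num.sqrt x fx (@sqrt_continuous R (f x))). Qed.
Lemma contC (h : R -> R) f x : {for f x, continuous h} -> {for x, continuous f} ->
  {for x, continuous (fun y => h (f y))}.
Proof. by move=> hx fx; exact: (@continuous_comp _ _ _ f h x fx hx). Qed.
Lemma cont_near f g x : (\forall y \near x, f y = g y) -> {for x, continuous f} ->
  {for x, continuous g}.
Proof.
move=> fg fx; rewrite /prop_for/= /continuous_at -(nbhs_singleton fg).
by apply: cvg_trans fx; apply: near_eq_cvg.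
Qed.
Lemma cont_ext f g x : (forall y, f y = g y) -> {for x, continuous f} ->
  {for x, continuous g}.
Proof. by move=> fg; apply: cont_near; near=> y. Unshelve. all: by end_near. Qed.
Lemma cont_cst (c : R) x : {for x, continuous (fun=> c)}.
Proof. exact: cvg_cst. Qed.

End ContinuityRules.

Lemma cont_id (R : realType) (x : R) : {for x, continuous (fun y : R => y)}.
Proof. exact: cvg_id. Qed.

Ltac cont_search := first
  [ eassumption
  | notypeclasses refine (@cont_cst _ _ _ _)
  | notypeclasses refine (@cont_id _ _)
  | notypeclasses refine (@contX _ _ _ _ _ _)
  | notypeclasses refine (contD _ _)
  | notypeclasses refine (contB _ _)
  | notypeclasses refine (contN _)
  | notypeclasses refine (contM _ _)
  | notypeclasses refine (contV _ _)
  | notypeclasses refine (contsqrt _)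
  | notypeclasses refine (contC (@continuous_sin _ _) _)
  | notypeclasses refine (contC (@continuous_cos _ _) _)].
(* The head of the function selects the rule: trying all of them by unification is much slower. *)
Ltac cont_step := first
  [ match goal with H : ?P |- ?P => exact H end
  | match goal with |- ?G =>
      let G' := eval cbv beta delta [prop_for] in G in
      lazymatch G' with
      | continuous_at _ (fun=> ?c) => notypeclasses refine (@cont_cst _ _ _ _)
      | continuous_at _ (fun y => @?a y - @?b y) => notypeclasses refine (contB _ _)
      | continuous_at _ (fun y => @?a y + @?b y) => notypeclasses refine (contD _ _)
      | continuous_at _ (fun y => - @?a y) => notypeclasses refine (contN _)
      | continuous_at _ (fun y => @?a y * @?b y) => notypeclasses refine (contM _ _)
      | continuous_at _ (fun y => @?a y ^+ _) => notypeclasses refine (@contX _ _ _ _ _ _)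
      | continuous_at _ (fun y => (@?a y)^-1) => notypeclasses refine (contV _ _)
      | continuous_at _ (fun y => Num.sqrt (@?a y)) => notypeclasses refine (contsqrt _)
      | continuous_at _ (fun y => sin (@?a y)) => notypeclasses refine (contC (@continuous_sin _ _) _)
      | continuous_at _ (fun y => cos (@?a y)) => notypeclasses refine (contC (@continuous_cos _ _) _)
      end
    end
  | cont_search].
Ltac cont := repeat cont_step.

(** * Real analysis: mean value bounds, first zeros, primitives, a Riccati inequality *)

Section RealCalculus.
Context {R : realType}.
Implicit Types (f g : R -> R) (a b c t : R).

Lemma cont_within (A : set R) f :
  (forall t, A t -> {for t, continuous f}) -> {within A, continuous f}.
Proof.
move=> fc; apply: continuous_in_subspaceT => t; rewrite inE; exact: fc.
Qed.

Lemma cont_withinI f a b : (forall t, a <= t <= b -> {for t, continuous f}) ->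
  {within `[a, b], continuous f}.
Proof. by move=> fc; apply: cont_within => t; rewrite /= in_itv/=; exact: fc. Qed.

Lemma mean_value_open f df a b : a < b ->
  (forall t, a <= t <= b -> {for t, continuous f}) ->
  (forall t, a < t < b -> is_derive t 1 f (df t)) ->
  exists2 c, a < c < b & f b - f a = df c * (b - a).
Proof.
move=> ab fc fd; have fd' x : x \in `]a, b[ -> is_derive x 1 f (df x) by rewrite in_itv; exact: fd.
have [c cab e] := MVT ab fd' (cont_withinI fc).
by exists c => //; move: cab; rewrite in_itv.
Qed.

Lemma derive_nondecr f df a b : a <= b ->
  (forall t, a <= t <= b -> is_derive t 1 f (df t)) ->
  (forall t, a < t < b -> 0 <= df t) -> f a <= f b.
Proof.
move=> ab fd d0; move: (ab); rewrite le_eqVlt => /predU1P[<-//|ltab].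
have fc t : a <= t <= b -> {for t, continuous f} by move=> /fd; exact: der_cont.
have fd' t : a < t < b -> is_derive t 1 f (df t).
  by move=> /andP[? ?]; apply: fd; rewrite !ltW.
have [c cab e] := mean_value_open ltab fc fd'.
by rewrite -subr_ge0 e mulr_ge0 ?d0// subr_ge0.
Qed.

Lemma derive_incr f df a b : a < b ->
  (forall t, a <= t <= b -> is_derive t 1 f (df t)) ->
  (forall t, a < t < b -> 0 < df t) -> f a < f b.
Proof.
move=> ab fd d0.
have fc t : a <= t <= b -> {for t, continuous f} by move=> /fd; exact: der_cont.
have fd' t : a < t < b -> is_derive t 1 f (df t).
  by move=> /andP[? ?]; apply: fd; rewrite !ltW.
have [c cab e] := mean_value_open ab fc fd'.
by rewrite -subr_gt0 e mulr_gt0 ?d0// subr_gt0.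
Qed.

(** Both [g - f] and [g + f] are nondecreasing. This form of the mean value inequality replaces the
    integration of bounds on derivatives throughout. *)
Lemma derive_bound f g df dg a b : a <= b ->
  (forall t, a <= t <= b -> is_derive t 1 f (df t)) ->
  (forall t, a <= t <= b -> is_derive t 1 g (dg t)) ->
  (forall t, a < t < b -> `|df t| <= dg t) -> `|f b - f a| <= g b - g a.
Proof.
move=> ab fd gd le.
have h1 : g a - f a <= g b - f b.
  apply: (@derive_nondecr (fun t => g t - f t) (fun t => dg t - df t)) => // t tab.
    exact: derB (gd _ tab) (fd _ tab).
  by rewrite subr_ge0 (le_trans (ler_norm _))// le.
have h2 : g a + f a <= g b + f b.
  apply: (@derive_nondecr (fun t => g t + f t) (fun t => dg t + df t)) => // t tab.
    exact: derD (gd _ tab) (fd _ tab).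
  by rewrite -[X in _ + X]opprK subr_ge0 (le_trans (ler_norm _))// normrN le.
rewrite ler_norml; apply/andP; split; lra.
Qed.

Lemma derive0_const f a b : a <= b ->
  (forall t, a <= t <= b -> is_derive t 1 f 0) -> f a = f b.
Proof.
move=> ab fd; apply/eqP; rewrite eq_sym -subr_eq0 -normr_le0.
have := @derive_bound f (fun=> 0) (fun=> 0) (fun=> 0) a b ab fd.
by rewrite subrr; apply => // *; rewrite ?normr0//; exact: der_cst.
Qed.

Lemma ivt f a b v : a <= b -> (forall t, a <= t <= b -> {for t, continuous f}) ->
  f a <= v <= f b -> exists2 c, a <= c <= b & f c = v.
Proof.
move=> ab fc /andP[av vb]; have fab := le_trans av vb.
have [|c] := IVT ab (cont_withinI fc) (v := v).
  by rewrite (min_idPl fab) (max_idPr fab) av.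
by rewrite in_itv; exists c.
Qed.

Lemma ivt_decr f a b v : a <= b -> (forall t, a <= t <= b -> {for t, continuous f}) ->
  f b <= v <= f a -> exists2 c, a <= c <= b & f c = v.
Proof.
move=> ab fc /andP[av vb].
have [||c cab e] := @ivt (fun t => - f t) a b (- v) ab.
- by move=> t tab; exact: contN (fc _ tab).
- by rewrite !lerN2 av vb.
by exists c => //; apply: oppr_inj.
Qed.

Lemma cont_near_gt f (t c : R) : {for t, continuous f} -> c < f t ->
  exists2 d, 0 < d & forall s, `|s - t| < d -> c < f s.
Proof.
move=> fc ct; have /cvgr_gt/(_ _ ct)/nbhs_ballP[d d0 H] := fc.
by exists d => // s st; apply: H; rewrite /ball/= distrC.
Qed.

Lemma cont_near_lt f (t c : R) : {for t, continuous f} -> f t < c ->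
  exists2 d, 0 < d & forall s, `|s - t| < d -> f s < c.
Proof.
move=> fc ct; have /cvgr_lt/(_ _ ct)/nbhs_ballP[d d0 H] := fc.
by exists d => // s st; apply: H; rewrite /ball/= distrC.
Qed.

Lemma cont_dist f t (e : R) : {for t, continuous f} -> 0 < e ->
  \forall s \near t, `|f t - f s| <= e.
Proof. by move=> fc e0; move: fc => /cvgr_dist_le /(_ e e0). Qed.

Lemma cont_eps f t (e : R) : {for t, continuous f} -> 0 < e ->
  exists2 d, 0 < d & forall s, `|s - t| < d -> `|f s - f t| <= e.
Proof.
move=> fc e0; have /nbhs_ballP[d d0 H] := cont_dist fc e0.
by exists d => // s st; rewrite distrC; apply: H; rewrite /ball/= distrC.
Qed.

(** The zero is the infimum of the set where [f <= 0]; continuity excludes both signs there. *)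
Lemma first_zero f a b : a <= b -> (forall t, a <= t <= b -> {for t, continuous f}) ->
  0 < f a -> f b <= 0 ->
  exists c, [/\ a < c <= b, f c = 0 & forall t, a <= t < c -> 0 < f t].
Proof.
move=> ab fc fa fb.
pose S := [set t | a <= t <= b /\ f t <= 0].
have Sb : S b by rewrite /S/= ab lexx.
have lbS : has_lbound S by exists a => t [/andP[]].
have iS : has_inf S by split => //; exists b.
pose c := inf S.
have cb : c <= b by apply: ge_inf.
have ac : a <= c by apply: lb_le_inf; [exists b|move=> t [/andP[]]].
have pos t : a <= t < c -> 0 < f t.
  move=> /andP[at_ tc]; rewrite ltNge; apply/negP => ft.
  have : c <= t by apply: ge_inf => //; split => //; rewrite at_ ltW// (lt_le_trans tc).
  by rewrite leNgt tc.
have cc : {for c, continuous f} by apply: fc; rewrite ac.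
have fc0 : f c <= 0.
  rewrite leNgt; apply/negP => fc_gt0.
  have [d d0 H] := cont_near_gt cc fc_gt0.
  have [t [tS ft] tc] := inf_adherent d0 iS.
  have ct : c <= t by apply: ge_inf.
  have : 0 < f t by apply: H; rewrite ger0_norm ?subr_ge0// ltrBlDl.
  by rewrite ltNge ft.
have ac' : a < c by rewrite lt_neqAle ac andbT; apply: contraTneq fc0 => <-; rewrite -ltNge.
exists c; split => //; first by rewrite ac'.
apply/eqP; rewrite eq_le fc0/= leNgt; apply/negP => fcn.
have [d d0 H] := cont_near_lt cc fcn.
pose t := Num.max a (c - d / 2).
have tc : t < c by rewrite /t gt_max ac'/= gtrDl oppr_lt0 divr_gt0.
have at_ : a <= t by rewrite /t le_max lexx.
have : f t < 0.
  apply: H; rewrite ltr0_norm ?subr_lt0// opprB ltrBlDl -ltrBlDr.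
  by rewrite lt_max; apply/orP; right; rewrite ltrD2l ltrN2 ltr_pdivrMr// ltr_pMr// ltr1n.
by rewrite ltNge ltW// pos// at_.
Qed.

(* For s close to t the integral is taken from a common base point, so that the fundamental theorem applies on both sides of t0. *)
Lemma primitive (I : set R) f : open I -> is_interval I ->
  (forall t, I t -> {for t, continuous f}) ->
  forall t0, I t0 -> exists F, F t0 = 0 /\ forall t, I t -> is_derive t 1 F (f t).
Proof.
move=> oI iI fc t0 It0.
have below t : I t -> exists2 a, I a & a < t.
  move=> It; have /nbhs_ballP[e e0 H] := open_nbhs_nbhs (conj oI It).
  exists (t - e / 2); last by rewrite gtrDl oppr_lt0 divr_gt0.
  apply: H; rewrite /ball/= opprB addrCA subrr addr0 gtr0_norm ?divr_gt0//.
  by rewrite ltr_pdivrMr// ltr_pMr// ltr1n.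
have above t : I t -> exists2 a, I a & t < a.
  move=> It; have /nbhs_ballP[e e0 H] := open_nbhs_nbhs (conj oI It).
  exists (t + e / 2); last by rewrite ltrDl divr_gt0.
  apply: H; rewrite /ball/= opprD addrA subrr sub0r normrN gtr0_norm ?divr_gt0//.
  by rewrite ltr_pdivrMr// ltr_pMr// ltr1n.
pose G a t : R := (\int[lebesgue_measure]_(s in `[a, t]) f s)%R.
have Gd a t : I a -> I t -> a < t -> is_derive t 1 (G a) (f t).
  move=> Ia It at_; have [u Iu tu] := above t It.
  have [|] := @continuous_FTC1_closed R f a t u tu _ at_ (fc t It).
    apply: continuous_compact_integrable; first exact: segment_compact.
    apply: cont_withinI => s /andP[as_ su]; apply: fc.
    by apply: (iI a u) => //; rewrite as_ su.
  by move=> Gt Ge; rewrite -Ge derive1E; exact: derivableP.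
pose H a t := G a t - G a t0.
have Hd a t : I a -> I t -> a < t -> is_derive t 1 (H a) (f t).
  by move=> Ia It at_; rewrite -[f t]subr0; exact: (derB (Gd _ _ Ia It at_) (der_cst _ _ _)).
have HE a a' t : I a -> I a' -> I t -> a < t -> a < t0 -> a' < t -> a' < t0 ->
    H a t = H a' t.
  move=> Ia Ia' It at_ at0 a't a't0.
  apply/eqP; rewrite -subr_eq0; apply/eqP.
  have H0 : H a t0 - H a' t0 = 0 by rewrite /H !subrr.
  have D s : Num.min t t0 <= s <= Num.max t t0 ->
      is_derive s 1 (fun s => H a s - H a' s) 0.
    move=> /andP[]; rewrite ge_min le_max => h1 h2.
    have Is : I s.
      case/orP: h1 => h1; case/orP: h2 => h2.
      - by apply: (iI t t) => //; rewrite h1.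
      - by apply: (iI t t0) => //; rewrite h1.
      - by apply: (iI t0 t) => //; rewrite h1.
      - by apply: (iI t0 t0) => //; rewrite h1.
    have as_ : a < s by case/orP: h1 => h1; [exact: lt_le_trans at_ h1|exact: lt_le_trans at0 h1].
    have a's : a' < s by case/orP: h1 => h1; [exact: lt_le_trans a't h1|exact: lt_le_trans a't0 h1].
    by rewrite -(subrr (f s)); exact: (derB (Hd _ _ Ia Is as_) (Hd _ _ Ia' Is a's)).
  have [tt0|t0t] := leP t t0.
    rewrite -[RHS]H0; apply: (@derive0_const (fun s => H a s - H a' s) t t0) => [//|s].
    by move=> sI; apply: (D s); rewrite (min_idPl tt0) (max_idPr tt0).
  rewrite -[RHS]H0; apply/esym; apply: (@derive0_const (fun s => H a s - H a' s)) => [|s].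
    exact: ltW.
  by move=> sI; apply: (D s); rewrite (min_idPr (ltW t0t)) (max_idPl (ltW t0t)).
have base t : exists a, I t -> [/\ I a, a < t & a < t0].
  have [It|nIt] := pselect (I t); last by exists 0.
  have [a Ia at_] := below t It; have [a' Ia' at0] := below t0 It0.
  exists (Num.min a a') => _; split; rewrite ?gt_min ?at_ ?at0 ?orbT//.
  by have [_|_] := leP a a'.
pose F t := H (projT1 (cid (base t))) t.
have Fprop t : I t -> forall a, I a -> a < t -> a < t0 -> F t = H a t.
  move=> It a Ia at_ at0; rewrite /F; case: (cid (base t)) => a' /= /(_ It)[? ? ?].
  exact: HE.
exists F; split.
  by have [a Ia at0] := below t0 It0; rewrite (Fprop t0 It0 a)// /H subrr.
move=> t It; have [a /(_ It)[Ia at_ at0]] := base t.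
apply: (der_near _ (Hd a t Ia It at_)).
have oIa : open (I `&` [set s | a < s]) by apply: openI => //; exact: open_gt.
have := open_nbhs_nbhs (conj oIa (conj It at_)).
by apply: filterS => s [Is as_]; rewrite (Fprop s Is a).
Qed.

(** The arctangent of [psi] grows at rate at least [c]; over a time [4 / c] it would gain [4], more
    than the length pi of its range. *)
Lemma riccati (psi dpsi : R -> R) (t1 c : R) : 0 < c ->
  (forall t, t1 <= t -> is_derive t 1 psi (dpsi t)) ->
  ~ (forall t, t1 <= t -> c * (1 + psi t ^+ 2) <= dpsi t).
Proof.
move=> c0 pd le; pose t2 := t1 + 4 / c.
have t12 : t1 <= t2 by rewrite lerDl divr_ge0// ltW.
have D t : t1 <= t <= t2 ->
    is_derive t 1 (fun t => atan (psi t)) ((1 + psi t ^+ 2)^-1 * dpsi t).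
  by move=> /andP[t1t _]; exact: (derC1 (is_derive1_atan _) (pd t t1t)).
have : `|c * t2 - c * t1| <= atan (psi t2) - atan (psi t1).
  apply: (@derive_bound (fun t => c * t) _ (fun=> c) _ t1 t2 t12 _ D).
    by move=> t _; der; ring.
  move=> t /andP[/ltW t1t _]; rewrite gtr0_norm// ler_pdivlMl.
    by rewrite mulrC le.
  by rewrite ltr_pwDl// sqr_ge0.
have -> : c * t2 - c * t1 = 4 by rewrite /t2; field; rewrite gt_eqF.
rewrite ger0_norm//.
have := atan_gtNpi2 (psi t1); have := atan_ltpi2 (psi t2); have := @pihalf_lt2 R.
by lra.
Qed.

End RealCalculus.

(** * Continuous inverses of increasing functions *)

Section Inverse.
Context {R : realType}.
Implicit Types (f g : R -> R) (a b x y t : R).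

Lemma inverse_line f : (forall x, {for x, continuous f}) ->
  (forall x y, x < y -> f x < f y) -> (forall y, exists x, y <= f x) ->
  (forall y, exists x, f x <= y) ->
  exists g, [/\ cancel f g, cancel g f & forall y, {for y, continuous g}].
Proof.
move=> fc fi up dn.
have fm x y : x <= y -> f x <= f y by rewrite le_eqVlt => /predU1P[->//|/fi/ltW].
have sur y : exists x, f x = y.
  have [b yb] := up y; have [a ay] := dn y.
  have [ab|ba] := leP a b.
    by have [|c _ <-] := ivt ab (fun t _ => fc t) (v := y); [rewrite ay|exists c].
  exists a; apply/eqP; rewrite eq_le ay (le_trans yb)//; exact: fm (ltW ba).
pose g y := projT1 (cid (sur y)).
have gK : cancel g f by move=> y; rewrite /g; case: (cid _).
have fK : cancel f g.
  move=> x; have := gK (f x); have [/fi|/fi|//] := ltgtP (g (f x)) x.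
    by move=> + e; rewrite e ltxx.
  by move=> + e; rewrite e ltxx.
exists g; split => // y; rewrite -(gK y).
have n1 : {near g y, cancel f g} by near=> x; exact: fK.
have n2 : {near g y, continuous f} by near=> x; exact: fc.
exact: nbhs_singleton (near_can_continuous n1 n2).
Unshelve. all: by end_near. Qed.

Lemma clampI a b x : a <= b -> a <= Num.max a (Num.min b x) <= b.
Proof. by move=> ab; rewrite le_max lexx ge_max ab ge_min lexx. Qed.

Lemma clampI_id a b x : a <= x <= b -> Num.max a (Num.min b x) = x.
Proof. by move=> /andP[ax xb]; rewrite (min_idPr xb) (max_idPr ax). Qed.

Lemma cont_clampI a b : forall x, {for x, continuous (fun x => Num.max a (Num.min b x))}.
Proof.
move=> x; apply: (@continuous_max R R (fun=> a) (fun x => Num.min b x)); first exact: (@cont_cst R R).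
by apply: (@continuous_min R R (fun=> b) (fun x => x)); [exact: (@cont_cst R R)|exact: (@cont_id R)].
Qed.

(** The function is extended to the line with slope one outside the segment, inverted there, and the
    inverse is clamped back. The result is continuous on the whole line, so it composes without side
    conditions. *)
Lemma inverse_segment f a b : a <= b -> (forall x, a <= x <= b -> {for x, continuous f}) ->
  (forall x y, a <= x -> x < y -> y <= b -> f x < f y) ->
  exists g, [/\ forall x, a <= x <= b -> g (f x) = x,
    forall y, a <= g y <= b,
    forall y, f a <= y <= f b -> f (g y) = y & forall y, {for y, continuous g}].
Proof.
move=> ab fc fi; pose c x := Num.max a (Num.min b x).
have cI x : a <= c x <= b by exact: clampI.
have cid x : a <= x <= b -> c x = x by exact: clampI_id.
have cc x : {for x, continuous c} by exact: cont_clampI.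
pose F x := f (c x) + (x - c x).
have cP x : [\/ x <= a /\ c x = a, b <= x /\ c x = b | a <= x <= b /\ c x = x].
  have [xa|xa] := leP x a.
    by apply: Or31; split => //; rewrite /c max_l// ge_min xa orbT.
  have [bx|bx] := leP b x; first by apply: Or32; rewrite /c min_l// max_r.
  by apply: Or33; rewrite cid ?ltW.
have fm x y : a <= x -> x <= y -> y <= b -> f x <= f y.
  by move=> ax; rewrite le_eqVlt => /predU1P[->//|xy] yb; exact: ltW (fi x y ax xy yb).
have Fi x y : x < y -> F x < F y.
  move=> xy; rewrite /F; have := fm a b (lexx a) ab (lexx b).
  have [[xa ->]|[bx ->]|[xI ->]] := cP x; have [[ya ->]|[by_ ->]|[yI ->]] := cP y => ?.
  - lra.
  - move: (ab); rewrite le_eqVlt => /predU1P[abE|ltab]; first by rewrite -abE in by_ *; lra.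
    by have := fi a b (lexx a) ltab (lexx b); lra.
  - have /andP[ay yb] := yI; have := fm a y (lexx a) ay yb.
    move: xa; rewrite le_eqVlt => /predU1P[xa|xa]; last by lra.
    by rewrite xa in xy *; have := fi a y (lexx a) xy yb; lra.
  - lra.
  - lra.
  - have /andP[ay yb] := yI; lra.
  - have /andP[ax xb] := xI; lra.
  - have /andP[ax xb] := xI; have := fm x b ax xb (lexx b).
    move: by_; rewrite le_eqVlt => /predU1P[yb|yb]; last by lra.
    by rewrite -yb in xy *; have := fi x b ax xy (lexx b); lra.
  - have /andP[ax xb] := xI; have /andP[ay yb] := yI; have := fi x y ax xy yb; lra.
have Fc x : {for x, continuous F}.
  have cx := cc x; have h : {for x, continuous (fun x => f (c x))}.
    exact: (contC (h := f) (f := c) (fc _ (cI x)) cx).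
  by rewrite /F; cont.
have up y : exists x, y <= F x.
  exists (Num.max b (y - f b + b)); rewrite /F.
  have -> : c (Num.max b (y - f b + b)) = b.
    by rewrite /c (min_idPl _) ?le_max ?lexx// (max_idPr ab).
  have : y - f b + b <= Num.max b (y - f b + b) by rewrite le_max lexx orbT.
  by lra.
have dn y : exists x, F x <= y.
  exists (Num.min a (y - f a + a)); rewrite /F.
  have -> : c (Num.min a (y - f a + a)) = a.
    rewrite /c max_l// ge_min; apply/orP; right; rewrite ge_min lexx//.
  have : Num.min a (y - f a + a) <= y - f a + a by rewrite ge_min lexx orbT.
  by lra.
have [G [FG GF Gc]] := inverse_line Fc Fi up dn.
have FE x : a <= x <= b -> F x = f x by move=> xI; rewrite /F cid// subrr addr0.
exists (fun y => c (G y)); split => //.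
- by move=> x xI; have <- := FE x xI; rewrite FG cid.
- move=> y /andP[ay yb].
  have [z zI fz] := ivt ab fc (v := y) (ltac:(by rewrite ay yb)).
  by rewrite -fz; have h := FE z zI; rewrite -{1}h FG cid.
- by move=> y; exact: (contC (h := c) (f := G) (cc _) (Gc y)).
Qed.

End Inverse.

(** * Global existence and uniqueness for planar Lipschitz systems *)

Section PlanarODE.
Context {R : realType}.
Implicit Types (f g df : R -> R) (t : R).

(** The intervals centred at [u n] of radius [2 C / 2^n] are nested; the limit is the supremum of
    their left ends. *)
Lemma geometric_limit (u : nat -> R) (C : R) :
  (forall n, `|u n.+1 - u n| <= C / 2 ^+ n) ->
  exists Y, forall n, `|Y - u n| <= 2 * C / 2 ^+ n.
Proof.
move=> uC.
have C0 : 0 <= C by have := uC 0%N; rewrite expr0 divr1; exact: le_trans.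
pose w n := u n - 2 * C / 2 ^+ n; pose v n := u n + 2 * C / 2 ^+ n.
have step n : 2 * C / 2 ^+ n.+1 = C / 2 ^+ n.
  by rewrite exprS; field; rewrite expf_neq0.
have eps n : 0 <= 2 * C / 2 ^+ n by rewrite divr_ge0 ?mulr_ge0 ?exprn_ge0.
have two n : 2 * C / 2 ^+ n = C / 2 ^+ n + C / 2 ^+ n by ring.
have wS n : w n <= w n.+1.
  by have := uC n; rewrite ler_norml /w step two => /andP[h _]; lra.
have vS n : v n.+1 <= v n.
  by have := uC n; rewrite ler_norml /v step two => /andP[_ h]; lra.
have wmono n k : w n <= w (n + k)%N.
  by elim: k => [|k IH]; [rewrite addn0|rewrite addnS (le_trans IH)].
have vmono n k : v (n + k)%N <= v n.
  by elim: k => [|k IH]; [rewrite addn0|rewrite addnS (le_trans _ IH)].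
have wv m n : w m <= v n.
  apply: (le_trans (wmono m n)); rewrite addnC; apply: le_trans (vmono n m).
  by rewrite /w /v; have := eps (n + m)%N; lra.
pose S := [set x | exists n, x = w n].
have hS : has_sup S by split; [exists (w 0%N), 0%N|exists (v 0%N) => _ [n ->]].
exists (sup S) => n; rewrite ler_norml; apply/andP; split.
  have : w n <= sup S by apply: sup_upper_bound => //; exists n.
  by rewrite /w; lra.
have : sup S <= v n by apply: ge_sup; [exists (w 0%N), 0%N|move=> _ [m ->]].
by rewrite /v; lra.
Qed.

(** In the norm weighted by [exp (- K |t|)], taking a primitive gains a factor [1 / K]. This makes
    Picard iteration contract on the whole line at once, with no gluing of local solutions. *)
Lemma exp_bound f df (C K : R) : 0 < K -> f 0 = 0 ->
  (forall t, is_derive t 1 f (df t)) -> (forall t, `|df t| <= C * expR (K * `|t|)) ->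
  forall t, `|f t| <= C / K * expR (K * `|t|).
Proof.
move=> K0 f0 fd le.
have C0 : 0 <= C.
  by have := le 0; rewrite normr0 mulr0 expR0 mulr1; exact: le_trans.
have pos g dg t : g 0 = 0 -> (forall t, is_derive t 1 g (dg t)) ->
    (forall t, `|dg t| <= C * expR (K * `|t|)) -> 0 <= t -> `|g t| <= C / K * expR (K * t).
  move=> g0 gd gle t0.
  have H1 s : 0 <= s <= t -> is_derive s 1 g (dg s) by move=> _; exact: gd.
  have H2 s : 0 <= s <= t ->
      is_derive s 1 (fun t => C / K * expR (K * t)) (C * expR (K * s)).
    move=> _; have L : is_derive s 1 (fun t => K * t) K by der; ring.
    have D : is_derive s 1 (fun t => expR (K * t)) (expR (K * s) * K).
      exact: (derC1 (is_derive_expR _) L).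
    by der; field; rewrite gt_eqF.
  have H3 s : 0 < s < t -> `|dg s| <= C * expR (K * s).
    by move=> /andP[s0 _]; have := gle s; rewrite (gtr0_norm s0).
  have := derive_bound t0 H1 H2 H3.
  rewrite g0 subr0 mulr0 expR0 mulr1 => /le_trans; apply.
  by rewrite gerBl divr_ge0// ltW.
move=> t; have [t0|t0] := leP 0 t; first by rewrite (ger0_norm t0); exact: pos.
have h1 : f (- 0) = 0 by rewrite oppr0.
have h2 (s : R) : is_derive s 1 (fun s => f (- s)) (- df (- s)).
  have L : is_derive s 1 (fun s : R => - s) (-1) by der.
  have D := derC1 (fd (- s)) L.
  by notypeclasses refine (is_derive_eq D _); ring.
have h3 (s : R) : `|- df (- s)| <= C * expR (K * `|s|) by rewrite normrN -[X in expR (_ * X)]normrN.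
have h4 : 0 <= - t by rewrite oppr_ge0 ltW.
have := @pos (fun t => f (- t)) (fun t => - df (- t)) (- t) h1 h2 h3 h4.
by rewrite /= opprK (ltr0_norm t0).
Qed.

Variables (F G : R -> R -> R) (L : R).
Hypothesis L_gt0 : 0 < L.
Hypothesis FL : forall a b a' b', `|F a b - F a' b'| <= L * (`|a - a'| + `|b - b'|).
Hypothesis GL : forall a b a' b', `|G a b - G a' b'| <= L * (`|a - a'| + `|b - b'|).

Lemma lip_continuous (H : R -> R -> R) f g t :
  (forall a b a' b', `|H a b - H a' b'| <= L * (`|a - a'| + `|b - b'|)) ->
  {for t, continuous f} -> {for t, continuous g} ->
  {for t, continuous (fun s => H (f s) (g s))}.
Proof.
move=> HL fc gc; apply/cvgrPdist_le => e e0.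
have e1 : 0 < e / (2 * L) by rewrite divr_gt0// mulr_gt0.
near=> s; apply: le_trans (HL _ _ _ _) _.
rewrite mulrC -ler_pdivlMr//.
have -> : e / L = e / (2 * L) + e / (2 * L) by field; rewrite gt_eqF.
apply: lerD; near: s; [exact: cont_dist fc e1 | exact: cont_dist gc e1].
Unshelve. all: by end_near. Qed.

(** Total in [f], so that the Picard iterates can be defined by recursion before they are known to
    be continuous. *)
Let prim_ex f : exists P : R -> R, (forall t, {for t, continuous f}) ->
  P 0 = 0 /\ forall t, is_derive t 1 P (f t).
Proof.
have [fc|nfc] := pselect (forall t, {for t, continuous f}); last by exists f.
have [||t _|//|P [P0 Pd]] := @primitive R setT f _ _ _ 0; [exact: openT|by []|exact: fc|].
by exists P => _; split => // t; exact: Pd.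
Qed.
Let prim f := projT1 (cid (prim_ex f)).
Let primP f : (forall t, {for t, continuous f}) ->
  prim f 0 = 0 /\ forall t, is_derive t 1 (prim f) (f t).
Proof. by rewrite /prim; case: (cid _). Qed.

Let shift_prim f c : (forall t, {for t, continuous f}) ->
  c + prim f 0 = c /\ forall t, is_derive t 1 (fun t => c + prim f t) (f t).
Proof.
move=> fc; have [p0 pd] := primP fc; rewrite p0 addr0; split => // t.
by have := pd t => pt; der; ring.
Qed.

(** Picard iteration in the weighted norm with [K = 4 L]: each component of the new difference is at
    most [L / K = 1 / 4] of the old total, so the total is halved at every step. The limits exist
    pointwise by [geometric_limit], are continuous as locally uniform limits, and agree with their
    own Picard transforms [PY] and [PZ]. *)
Theorem ode_global (a0 b0 : R) : exists Y Z : R -> R,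
  [/\ Y 0 = a0, Z 0 = b0, forall t, is_derive t 1 Y (F (Y t) (Z t)) &
      forall t, is_derive t 1 Z (G (Y t) (Z t))].
Proof.
pose it := fix it n := if n is m.+1 then
  (fun t => a0 + prim (fun s => F ((it m).1 s) ((it m).2 s)) t,
   fun t => b0 + prim (fun s => G ((it m).1 s) ((it m).2 s)) t)
  else (fun=> a0, fun=> b0).
have itc n t : {for t, continuous (it n).1} /\ {for t, continuous (it n).2}.
  elim: n t => [|n IH] t; first by split; exact: (@cont_cst R R).
  have Fc s : {for s, continuous (fun s => F ((it n).1 s) ((it n).2 s))}.
    by have [? ?] := IH s; exact: (lip_continuous FL).
  have Gc s : {for s, continuous (fun s => G ((it n).1 s) ((it n).2 s))}.
    by have [? ?] := IH s; exact: (lip_continuous GL).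
  by split; [exact: (der_cont ((shift_prim a0 Fc).2 t))|exact: (der_cont ((shift_prim b0 Gc).2 t))].
have itd n : ((it n.+1).1 0 = a0 /\ forall t, is_derive t 1 (it n.+1).1 (F ((it n).1 t) ((it n).2 t))) /\
  ((it n.+1).2 0 = b0 /\ forall t, is_derive t 1 (it n.+1).2 (G ((it n).1 t) ((it n).2 t))).
  have Fc s : {for s, continuous (fun s => F ((it n).1 s) ((it n).2 s))}.
    by have [? ?] := itc n s; exact: (lip_continuous FL).
  have Gc s : {for s, continuous (fun s => G ((it n).1 s) ((it n).2 s))}.
    by have [? ?] := itc n s; exact: (lip_continuous GL).
  by split; [exact: (shift_prim a0 Fc)|exact: (shift_prim b0 Gc)].
pose K := 4 * L; have K0 : 0 < K by rewrite mulr_gt0.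
pose B := (`|F a0 b0| + `|G a0 b0|) / K.
have Kn0 : K != 0 by rewrite gt_eqF.
have key1 (y1 y2 H1 H2 : R -> R) C : y1 0 = y2 0 ->
  (forall t, is_derive t 1 y1 (H1 t)) -> (forall t, is_derive t 1 y2 (H2 t)) ->
  (forall t, `|H1 t - H2 t| <= C * expR (K * `|t|)) ->
  forall t, `|y1 t - y2 t| <= C / K * expR (K * `|t|).
  move=> e d1 d2 le; have h0 : y1 0 - y2 0 = 0 by rewrite e subrr.
  exact: (exp_bound K0 h0 (fun t => derB (d1 t) (d2 t)) le).
have est n t : `|(it n.+1).1 t - (it n).1 t| + `|(it n.+1).2 t - (it n).2 t| <=
    B / 2 ^+ n * expR (K * `|t|).
  elim: n t => [|n IH] t.
    have e1 s : 1 <= expR (K * `|s|).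
      by rewrite -expR0 ler_expR mulr_ge0// ltW.
    have [[i1 d1] [i2 d2]] := itd 0%N.
    have h1 := key1 (it 1%N).1 (fun=> a0) (fun=> F a0 b0) (fun=> 0) `|F a0 b0| i1 d1
      (fun t => der_cst _ _ _).
    have h2 := key1 (it 1%N).2 (fun=> b0) (fun=> G a0 b0) (fun=> 0) `|G a0 b0| i2 d2
      (fun t => der_cst _ _ _).
    rewrite expr0 divr1 /B !mulrDl; apply: lerD; [apply: h1|apply: h2] => s;
      by rewrite subr0 ler_peMr.
  have [[i1 d1] [i2 d2]] := itd n.+1; have [[j1 c1] [j2 c2]] := itd n.
  have h1 := key1 (it n.+2).1 (it n.+1).1 _ _ (L * (B / 2 ^+ n)) (etrans i1 (esym j1)) d1 c1.
  have h2 := key1 (it n.+2).2 (it n.+1).2 _ _ (L * (B / 2 ^+ n)) (etrans i2 (esym j2)) d2 c2.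
  have -> : B / 2 ^+ n.+1 * expR (K * `|t|) = L * (B / 2 ^+ n) / K * expR (K * `|t|) +
      L * (B / 2 ^+ n) / K * expR (K * `|t|).
    by rewrite /K exprS; field; rewrite expf_neq0//= gt_eqF.
  apply: lerD; [apply: h1|apply: h2] => s; rewrite -[leRHS]mulrA;
    [apply: le_trans (FL _ _ _ _) _ | apply: le_trans (GL _ _ _ _) _];
    by rewrite ler_pM2l.
have lim1 t : exists y, forall n, `|y - (it n).1 t| <= 2 * (B * expR (K * `|t|)) / 2 ^+ n.
  apply: geometric_limit => n; rewrite mulrAC.
  by apply: le_trans (est n t); rewrite lerDl.
have lim2 t : exists y, forall n, `|y - (it n).2 t| <= 2 * (B * expR (K * `|t|)) / 2 ^+ n.
  apply: geometric_limit => n; rewrite mulrAC.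
  by apply: le_trans (est n t); rewrite lerDr.
pose Y t := projT1 (cid (lim1 t)); pose Z t := projT1 (cid (lim2 t)).
have YE t n : `|Y t - (it n).1 t| <= 2 * (B * expR (K * `|t|)) / 2 ^+ n.
  by rewrite /Y; case: (cid _).
have ZE t n : `|Z t - (it n).2 t| <= 2 * (B * expR (K * `|t|)) / 2 ^+ n.
  by rewrite /Z; case: (cid _).
have B0 : 0 <= B by rewrite divr_ge0 ?addr_ge0// ltW.
have small C e : 0 < e -> exists n, C / 2 ^+ n <= e :> R.
  move=> e0; pose n := Num.bound (`|C| / e); exists n.
  have h : `|C| / e < n%:R by apply: archi_boundP; rewrite divr_ge0// ltW.
  rewrite ler_pdivrMr ?exprn_gt0//; apply: (le_trans (ler_norm _)).
  rewrite mulrC -ler_pdivrMr//; apply: ltW; apply: (lt_le_trans h).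
  rewrite -natrX ler_nat; exact: ltnW (ltn_expl _ _).
(* A three-epsilon estimate, uniform on the ball of radius one around [t], where the exponential
   weight is bounded. *)
have contY (y : R -> R) (yn : nat -> R -> R) t : (forall n t, {for t, continuous (yn n)}) ->
    (forall t n, `|y t - yn n t| <= 2 * (B * expR (K * `|t|)) / 2 ^+ n) -> {for t, continuous y}.
  move=> ync yE; apply/cvgrPdist_le => e e0.
  have e3 : 0 < e / 3 by rewrite divr_gt0.
  have [n hn] := small (2 * (B * expR (K * (`|t| + 1)))) _ e3.
  have bd s : `|s| <= `|t| + 1 -> `|y s - yn n s| <= e / 3.
    move=> st; apply: le_trans hn; apply: (le_trans (yE s n)).
    by rewrite ler_pM2r ?invr_gt0 ?exprn_gt0// ler_pM2l// ler_wpM2l// ler_expR ler_pM2l.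
  near=> s.
  have -> : y t - y s = (y t - yn n t) + (yn n t - yn n s) - (y s - yn n s) by ring.
  have -> : e = e / 3 + e / 3 + e / 3 by field.
  apply: (le_trans (ler_normB _ _)); apply: lerD.
    apply: (le_trans (ler_normD _ _)); apply: lerD; first by apply: bd; rewrite lerDl.
    near: s; exact: (cont_dist (ync n t) e3).
  apply: bd; rewrite -[s](subrK t) (le_trans (ler_normD _ _))// addrC lerD2l distrC.
  near: s; exact: (cont_dist (cont_id (x := t)) ltr01).
have Yc t : {for t, continuous Y} by apply: (contY _ (fun n => (it n).1)) => // n s; case: (itc n s).
have Zc t : {for t, continuous Z} by apply: (contY _ (fun n => (it n).2)) => // n s; case: (itc n s).
have [PY0 PYd] := shift_prim a0 (fun t => lip_continuous FL (Yc t) (Zc t)).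
have [PZ0 PZd] := shift_prim b0 (fun t => lip_continuous GL (Yc t) (Zc t)).
set PY := fun t => a0 + _ in PYd; set PZ := fun t => b0 + _ in PZd.
have fin (y p : R -> R) (yn : nat -> R -> R) C t : (forall n, `|y t - yn n.+1 t| <= C / 2 ^+ n) ->
    (forall n, `|p t - yn n.+1 t| <= C / 2 ^+ n) -> y t = p t.
  move=> h1 h2; apply/eqP; rewrite -subr_eq0 -normr_le0; apply/ler_addgt0Pl => e e0.
  rewrite addr0; have [n hn] := small (2 * C) _ e0; apply: le_trans hn.
  have -> : y t - p t = (y t - yn n.+1 t) - (p t - yn n.+1 t) by ring.
  apply: (le_trans (ler_normB _ _)).
  have -> : 2 * C / 2 ^+ n = C / 2 ^+ n + C / 2 ^+ n by ring.
  exact: lerD.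
have half C n : 2 * C / 2 ^+ n.+1 = C / 2 ^+ n :> R by rewrite exprS; field; rewrite expf_neq0.
have dist n s : L * (`|Y s - (it n).1 s| + `|Z s - (it n).2 s|) <=
    (L * (4 * B / 2 ^+ n)) * expR (K * `|s|).
  rewrite -mulrA ler_pM2l//; have := YE s n; have := ZE s n.
  have -> : 2 * (B * expR (K * `|s|)) / 2 ^+ n = 2 * B / 2 ^+ n * expR (K * `|s|) by ring.
  have -> : 4 * B / 2 ^+ n * expR (K * `|s|) = 2 * B / 2 ^+ n * expR (K * `|s|) +
    2 * B / 2 ^+ n * expR (K * `|s|) by ring.
  by move=> h1 h2; exact: lerD.
have KL C n : L * (4 * C / 2 ^+ n) / K = C / 2 ^+ n :> R.
  by rewrite /K; field; rewrite expf_neq0//= gt_eqF.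
have YP t : Y t = PY t.
  apply: (fin _ _ (fun n => (it n).1) (B * expR (K * `|t|))) => n.
    by rewrite -half; exact: YE.
  have [[i1 d1] _] := itd n.
  rewrite [leRHS]mulrAC -KL.
  apply: (key1 PY (it n.+1).1 _ _ (L * (4 * B / 2 ^+ n)) (etrans PY0 (esym i1)) PYd d1) => s.
  exact: le_trans (FL _ _ _ _) (dist n s).
have ZP t : Z t = PZ t.
  apply: (fin _ _ (fun n => (it n).2) (B * expR (K * `|t|))) => n.
    by rewrite -half; exact: ZE.
  have [_ [i1 d1]] := itd n.
  rewrite [leRHS]mulrAC -KL.
  apply: (key1 PZ (it n.+1).2 _ _ (L * (4 * B / 2 ^+ n)) (etrans PZ0 (esym i1)) PZd d1) => s.
  exact: le_trans (GL _ _ _ _) (dist n s).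
have YPf : Y = PY by apply/funext.
have ZPf : Z = PZ by apply/funext.
exists Y, Z; split.
- by rewrite YPf.
- by rewrite ZPf.
- by move=> t; rewrite {1}YPf; exact: PYd.
- by move=> t; rewrite {1}ZPf; exact: PZd.
Unshelve. all: by end_near. Qed.

(** The squared distance [E] satisfies [|E'| <= 4 L E], so [E] times [exp (- 4 L t)] decreases to
    the right of [t0] and [E] times [exp (4 L t)] increases to the left. *)
Theorem ode_unique (J : set R) (Y Z Y' Z' : R -> R) t0 : is_interval J -> J t0 ->
  (forall t, J t -> is_derive t 1 Y (F (Y t) (Z t))) ->
  (forall t, J t -> is_derive t 1 Z (G (Y t) (Z t))) ->
  (forall t, J t -> is_derive t 1 Y' (F (Y' t) (Z' t))) ->
  (forall t, J t -> is_derive t 1 Z' (G (Y' t) (Z' t))) ->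
  Y t0 = Y' t0 -> Z t0 = Z' t0 -> forall t, J t -> Y t = Y' t /\ Z t = Z' t.
Proof.
move=> iJ J0 Yd Zd Yd' Zd' Y0 Z0.
pose E t := (Y t - Y' t) ^+ 2 + (Z t - Z' t) ^+ 2.
pose dE t := 2 * (Y t - Y' t) * (F (Y t) (Z t) - F (Y' t) (Z' t)) +
             2 * (Z t - Z' t) * (G (Y t) (Z t) - G (Y' t) (Z' t)).
have Ed t : J t -> is_derive t 1 E (dE t).
  move=> Jt; have := Yd t Jt; have := Zd t Jt; have := Yd' t Jt; have := Zd' t Jt.
  move=> ? ? ? ?; rewrite /E; der; rewrite /dE; ring.
have dE_le t : `|dE t| <= 4 * L * E t.
  rewrite /dE /E; set y := Y t - Y' t; set z := Z t - Z' t.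
  have hF := FL (Y t) (Z t) (Y' t) (Z' t); have hG := GL (Y t) (Z t) (Y' t) (Z' t).
  rewrite -/y -/z in hF hG.
  apply: (le_trans (ler_normD _ _)); rewrite !normrM !normr_nat -(real_normK (num_real y)) -(real_normK (num_real z)).
  move: hF hG; set a := `|F _ _ - _|; set b := `|G _ _ - _|; set p := `|y|; set q := `|z|.
  have p0 : 0 <= p := normr_ge0 _; have q0 : 0 <= q := normr_ge0 _.
  move=> ha hb.
  have h1 := ler_wpM2l p0 ha; have h2 := ler_wpM2l q0 hb.
  have : 0 <= L * (p - q) ^+ 2 by rewrite mulr_ge0 ?sqr_ge0// ltW.
  have -> : L * (p - q) ^+ 2 = L * p ^+ 2 - 2 * L * p * q + L * q ^+ 2 by ring.
  move: h1 h2; have -> : p * (L * (p + q)) = L * p ^+ 2 + L * p * q by ring.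
  have -> : q * (L * (p + q)) = L * q ^+ 2 + L * p * q by ring.
  lra.
have E00 : E t0 = 0 by rewrite /E Y0 Z0 !subrr expr0n addr0.
suff E0 t : J t -> E t <= 0.
  move=> t Jt; have := E0 t Jt; rewrite /E => h.
  have y2 := sqr_ge0 (Y t - Y' t); have z2 := sqr_ge0 (Z t - Z' t).
  by split; apply/eqP; rewrite -subr_eq0 -sqrf_eq0 eq_le; apply/andP; split=> //; lra.
move=> Jt.
have expd (c s : R) : is_derive s 1 (fun s => expR (c * s)) (expR (c * s) * c).
  have Lc : is_derive s 1 (fun t => c * t) c by der; ring.
  exact: (derC1 (is_derive_expR _) Lc).
have [tt|tt] := leP t0 t.
  have : E t0 * expR (- (4 * L) * t0) >= E t * expR (- (4 * L) * t).
    rewrite -lerN2.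
    apply: (@derive_nondecr R (fun s => - (E s * expR (- (4 * L) * s)))
      (fun s => (4 * L * E s - dE s) * expR (- (4 * L) * s))) => //.
      move=> s st; have := Ed s (iJ t0 t J0 Jt _ st) => Es; have := expd (- (4 * L)) s => es.
      by der; ring.
    move=> s _; rewrite mulr_ge0 ?expR_ge0// subr_ge0.
    exact: le_trans (ler_norm _) (dE_le s).
  by rewrite E00 mul0r pmulr_lle0 ?expR_gt0.
have : E t * expR ((4 * L) * t) <= E t0 * expR ((4 * L) * t0).
  apply: (@derive_nondecr R (fun s => E s * expR ((4 * L) * s))
    (fun s => (4 * L * E s + dE s) * expR ((4 * L) * s))) => //; first exact: ltW.
    move=> s st; have := Ed s (iJ t t0 Jt J0 _ st) => Es; have := expd (4 * L) s => es.
    by der; ring.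
  move=> s _; rewrite mulr_ge0 ?expR_ge0//.
  have := dE_le s; rewrite ler_norml => /andP[h _]; lra.
by rewrite E00 mul0r pmulr_lle0 ?expR_gt0.
Qed.

End PlanarODE.

(** * The prescribed curvature, extended to the whole line *)

Section PrescribedCurvature.
Context {R : realType}.
Implicit Types (h k : R -> R) (x y z d e t s m M L : R).

Definition clamp1 (y : R) : R := Num.max (-1) (Num.min 1 y).

(** What the dynamics uses of the curvature. Compactness of [[-1, 1]] turns the strict inequalities
    of the class into uniform margins; [cf_flat] records that an even differentiable function has
    zero derivative at the origin; [cf_der] is restricted to the open interval because clamping may
    create corners at its ends. *)
Record curvature_fun (kappa : R) (k : R -> R) : Prop := CurvatureFun {
  cf_lip : exists2 L, 0 < L & forall x y, `|k x - k y| <= L * `|x - y|;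
  cf_even : forall y, k (- y) = k y;
  cf_low : exists2 m, 0 < m & forall y, m <= k y;
  cf_up : exists M, forall y, k y <= M;
  cf_gap : exists2 d, 0 < d &
    forall y, y ^+ 2 <= 1 -> d <= 4 * k y ^+ 2 + kappa * (1 - y ^+ 2);
  cf_flat : forall e, 0 < e -> exists2 d, 0 < d &
    forall y, `|y| <= d -> `|k y - k 0| <= e * `|y|;
  cf_der : exists k', forall y, y ^+ 2 < 1 -> is_derive y 1 k (k' y) }.

Lemma clamp1P y : [\/ y <= -1 /\ clamp1 y = -1, 1 <= y /\ clamp1 y = 1 |
  -1 <= y <= 1 /\ clamp1 y = y].
Proof.
rewrite /clamp1; have [y1|y1] := leP 1 y.
  by apply: Or32; split => //; rewrite max_r//; lra.
have [y2|y2] := leP y (-1); first by apply: Or31.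
by apply: Or33; rewrite !ltW.
Qed.

Lemma clamp1_itv y : -1 <= clamp1 y <= 1.
Proof. by have [[_ ->]|[_ ->]|[? ->]] := clamp1P y => //; apply/andP; split; lra. Qed.

Lemma clamp1_id y : -1 <= y <= 1 -> clamp1 y = y.
Proof. by move=> /andP[h1 h2]; have [[? ->]|[? ->]|[? ->]] := clamp1P y => //; lra. Qed.

Lemma clamp1_lip x y : `|clamp1 x - clamp1 y| <= `|x - y|.
Proof.
have h1 := ler_norm (x - y); have h2 := ler_norm (y - x); rewrite distrC in h2.
rewrite ler_norml; have [[? ->]|[? ->]|[/andP[? ?] ->]] := clamp1P x;
  have [[? ->]|[? ->]|[/andP[? ?] ->]] := clamp1P y; apply/andP; split; lra.
Qed.

Lemma clamp1N y : clamp1 (- y) = - clamp1 y.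
Proof.
by have [[? ->]|[? ->]|[/andP[? ?] ->]] := clamp1P y;
  have [[? ->]|[? ->]|[/andP[? ?] ->]] := clamp1P (- y); lra.
Qed.

Variables (kappa : R) (h : R -> R).
Hypothesis hh : C1_class kappa h.
Let k y := h (clamp1 y).

(** The same derivative without division: the estimate includes [t = y] and covers the one-sided
    derivatives at the ends. *)
Lemma k_taylor : exists2 h' : R -> R, {within `[-1, 1]%classic, continuous h'} &
  forall y, -1 <= y <= 1 -> forall e, 0 < e -> exists2 d, 0 < d &
   forall t, `|t - y| < d -> -1 <= t <= 1 -> `|h t - h y - h' y * (t - y)| <= e * `|t - y|.
Proof.
have [[h' h'c H] _] := hh; exists h' => // y yI e e0.
have /cvgr_dist_le/(_ e e0) := H y yI.
rewrite !near_withinE => /nbhs_ballP[d d0 B]; exists d => // t td tI.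
have [->|ty] := eqVneq t y; first by rewrite !subrr mulr0 subrr normr0 mulr0.
have := B t; rewrite /ball/= distrC => /(_ td ty).
rewrite in_itv/= => /(_ tI) le1.
have t0 : t - y != 0 by rewrite subr_eq0.
have -> : h t - h y - h' y * (t - y) = - (h' y - (h t - h y) / (t - y)) * (t - y) by field.
by rewrite normrM normrN ler_wpM2r.
Qed.

Lemma curvature_fun_clamp : curvature_fun kappa k.
Proof.
have [h' h'c T] := k_taylor; have [_ cls] := hh.
have kc t : {for t, continuous k}.
  apply/cvgrPdist_le => e e0.
  have [d d0 B] := T _ (clamp1_itv t) 1 ltr01.
  pose C := `|h' (clamp1 t)| + 1; have C0 : 0 < C by rewrite ltr_wpDl.
  have e1 : 0 < Num.min d (e / C) by rewrite lt_min d0 divr_gt0.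
  have nb : \forall s \near t, `|s - t| < Num.min d (e / C).
    by apply/nbhs_ballP; exists (Num.min d (e / C)) => // s; rewrite /ball/= distrC.
  apply: filterS nb => s; rewrite lt_min => /andP[sd se].
  have sc := clamp1_lip s t.
  have := B _ (le_lt_trans sc sd) (clamp1_itv s).
  rewrite -/(k s) -/(k t) distrC => le1.
  have -> : k t - k s = (k t - k s - h' (clamp1 t) * (clamp1 s - clamp1 t) * -1) +
     h' (clamp1 t) * (clamp1 s - clamp1 t) * -1 by ring.
  apply: (le_trans (ler_normD _ _)).
  have -> : k t - k s - h' (clamp1 t) * (clamp1 s - clamp1 t) * -1 =
    h' (clamp1 t) * (clamp1 s - clamp1 t) - (k s - k t) by ring.
  rewrite mulrN1 normrN normrM mul1r in le1 *.
  apply: (le_trans (lerD le1 (lexx _))); rewrite -[X in X + _]mul1r -mulrDl addrC.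
  apply: (@le_trans _ _ (C * `|s - t|)); first by rewrite /C ler_wpM2l// ltW.
  by rewrite mulrC -ler_pdivlMr// ltW.
have kE y : -1 <= y <= 1 -> k y = h y by move=> yI; rewrite /k clamp1_id.
have kd y : -1 < y < 1 -> is_derive y 1 k (h' y).
  move=> /andP[y1 y2]; have yI : -1 <= y <= 1 by rewrite !ltW.
  apply/is_derive1_caratheodory.
  exists (fun z => if z == y then h' y else (k z - k y) / (z - y)); split; last by rewrite eqxx.
    move=> z; case: eqVneq => [->|zy]; first by rewrite !subrr mulr0.
    by rewrite divfK// subr_eq0.
  apply/cvgrPdist_le => e e0; rewrite eqxx.
  have [d d0 B] := T y yI e e0.
  pose d' := Num.min d (Num.min (1 - y) (y + 1)).
  have d'0 : 0 < d' by rewrite !lt_min d0 subr_gt0 y2/=; lra.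
  have nb : \forall s \near y, `|s - y| < d'.
    by apply/nbhs_ballP; exists d' => // s; rewrite /ball/= distrC.
  apply: filterS nb => z; rewrite !lt_min => /and3P[zd].
  rewrite !ltr_norml => /andP[z1 z2] /andP[z3 z4].
  case: eqVneq => [_|zy]; first by rewrite subrr normr0 ltW.
  have zI : -1 <= z <= 1 by apply/andP; split; lra.
  have z0 : z - y != 0 by rewrite subr_eq0.
  rewrite (kE z zI) (kE y yI).
  have -> : h' y - (h z - h y) / (z - y) = - (h z - h y - h' y * (z - y)) / (z - y) by field.
  by rewrite normrM normrN normfV ler_pdivrMr ?normr_gt0//; exact: B.
have i11 : (-1 : R) <= 1 by lra.
have [a aI amax] := EVT_max i11 h'c; have [b bI bmin] := EVT_min i11 h'c.
(* The derivative lies between its minimum and its maximum on the interval, so the two absolute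
   values together bound it. *)
pose C := `|h' a| + `|h' b|; have C0 : 0 <= C by rewrite addr_ge0.
have cmax t : t \in `[-1, 1] -> `|h' t| <= C.
  move=> tI; have := amax t tI; have := bmin t tI.
  have := ler_norm (h' a); have := ler_norm (- h' b); rewrite normrN.
  have := normr_ge0 (h' a); have := normr_ge0 (h' b).
  by rewrite ler_norml /C => *; apply/andP; split; lra.
have lipI x y : -1 <= x <= 1 -> -1 <= y <= 1 -> x < y -> `|k y - k x| <= (C + 1) * `|y - x|.
  move=> /andP[x1 x2] /andP[y1 y2] xy.
  have [t xty ->] := @mean_value_open R k h' x y xy (fun t _ => kc t)
    (fun t xt => kd t (ltac:(by move/andP: xt => [? ?]; apply/andP; split; lra))).
  rewrite normrM ler_wpM2r// ler_wpDr// cmax//.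
  by rewrite in_itv/=; move/andP: xty => [? ?]; apply/andP; split; lra.
have klip x y : `|k x - k y| <= (C + 1) * `|x - y|.
  have kk z : k (clamp1 z) = k z by rewrite /k (clamp1_id (clamp1_itv z)).
  apply: (@le_trans _ _ ((C + 1) * `|clamp1 x - clamp1 y|)); last first.
    by rewrite ler_wpM2l ?addr_ge0// clamp1_lip.
  rewrite -(kk x) -(kk y); have [xy|xy|->] := ltgtP (clamp1 x) (clamp1 y).
  - by rewrite distrC (distrC (clamp1 x)); apply: lipI => //; exact: clamp1_itv.
  - by apply: lipI => //; exact: clamp1_itv.
  - by rewrite !subrr normr0 mulr0.
have kcont (f : R -> R) : (forall y, {for y, continuous f}) -> {within `[-1, 1]%classic, continuous f}.
  by move=> fc; apply: cont_within => t _; exact: fc.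
have [c1 c1I c1min] := EVT_min i11 (kcont _ kc).
have [c2 c2I c2max] := EVT_max i11 (kcont _ kc).
rewrite !in_itv/= in c1I c2I.
split.
- by exists (C + 1) => //; rewrite ltr_wpDl.
- by move=> y; rewrite /k clamp1N; have [-> _ _] := cls _ (clamp1_itv y).
- exists (k c1); first by rewrite kE//; have [_] := cls _ c1I.
  move=> y; have -> : k y = k (clamp1 y) by rewrite /k (clamp1_id (clamp1_itv y)).
  by apply: c1min; rewrite in_itv/= clamp1_itv.
- exists (k c2) => y; have -> : k y = k (clamp1 y) by rewrite /k (clamp1_id (clamp1_itv y)).
  by apply: c2max; rewrite in_itv/= clamp1_itv.
- pose g (y : R) : R := 4 * k y ^+ 2 + kappa * (1 - y ^+ 2).
  have gc y : {for y, continuous g}.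
    by have kcy := kc y; rewrite /g; cont.
  have [c3 c3I c3min] := EVT_min i11 (kcont _ gc); rewrite in_itv/= in c3I.
  exists (4 * k c3 ^+ 2 + kappa * (1 - c3 ^+ 2)).
    by rewrite kE//; have [_ _] := cls _ c3I.
  move=> y y1; apply: c3min; rewrite in_itv/=.
  by rewrite -ler_norml -(ler_pXn2r (n := 2)) ?nnegrE// expr1n real_normK// num_real.
- move=> e e0; have z0 : -1 <= (0 : R) <= 1 by apply/andP; split; lra.
  (* By evenness, subtracting the Taylor estimates at [t] and [- t] leaves [2 t h'(0)], which is
     then at most [2 t e']. *)
  have h0 : h' 0 = 0.
    apply/eqP; rewrite -normr_le0; apply/ler_addgt0Pl => e' e'0; rewrite addr0.
    have [d d0 B] := T 0 z0 _ e'0.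
    pose t := Num.min (d / 2) 1.
    have t0 : 0 < t by rewrite lt_min divr_gt0 /=.
    have t1 : t <= 1 by rewrite ge_min lexx orbT.
    have td : t < d by rewrite gt_min ltr_pdivrMr// ltr_pMr// ltr1n.
    have tI : -1 <= t <= 1 by apply/andP; split; lra.
    have tI' : -1 <= - t <= 1 by apply/andP; split; lra.
    have b1 := B t; rewrite subr0 gtr0_norm// in b1; have {}b1 := b1 td tI.
    have b2 := B (- t); rewrite subr0 normrN gtr0_norm// in b2; have {}b2 := b2 td tI'.
    have [ev _ _] := cls t tI; rewrite -ev in b2.
    have : `|h' 0 * (2 * t)| <= e' * t + e' * t.
      have -> : h' 0 * (2 * t) = (h t - h 0 - h' 0 * - t) - (h t - h 0 - h' 0 * t) by ring.
      exact: (le_trans (ler_normB _ _) (lerD b2 b1)).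
    rewrite normrM (gtr0_norm (_ : 0 < 2 * t)) ?mulr_gt0//.
    have -> : e' * t + e' * t = e' * (2 * t) by ring.
    by rewrite ler_pM2r// mulr_gt0.
  have [d d0 B] := T 0 z0 _ e0.
  exists (Num.min (d / 2) 1); first by rewrite lt_min divr_gt0/=.
  move=> y; rewrite le_min => /andP[yd y1].
  have yI : -1 <= y <= 1 by rewrite -ler_norml.
  have := B y; rewrite subr0 => /(_ _ yI); rewrite h0 mul0r subr0 !kE//; apply.
  by apply: (le_lt_trans yd); rewrite ltr_pdivrMr// ltr_pMr// ltr1n.
- exists h' => y y1; apply: kd; rewrite -ltr_norml -(ltr_pXn2r (n := 2)) ?nnegrE//.
  by rewrite expr1n real_normK// num_real.
Qed.

End PrescribedCurvature.

(** * Bounded Lipschitz functions of two variables *)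

Section BoundedLipschitz.
Context {R : realType}.
Implicit Types (f g : R -> R -> R) (a b L M t : R).

(** Boundedness is kept together with the Lipschitz bound because only the conjunction is stable
    under products. *)
Definition blip f := exists2 M, 0 <= M & (forall a b, `|f a b| <= M) /\
  forall a b a' b', `|f a b - f a' b'| <= M * (`|a - a'| + `|b - b'|).

Lemma blipD f g : blip f -> blip g -> blip (fun a b => f a b + g a b).
Proof.
move=> [M M0 [fb fl]] [N N0 [gb gl]]; exists (M + N); first exact: addr_ge0.
split=> [a b|a b a' b']; first exact: le_trans (ler_normD _ _) (lerD (fb _ _) (gb _ _)).
rewrite opprD addrACA mulrDl; apply: le_trans (ler_normD _ _) (lerD (fl _ _ _ _) (gl _ _ _ _)).
Qed.

Lemma blipN f : blip f -> blip (fun a b => - f a b).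
Proof.
move=> [M M0 [fb fl]]; exists M => //; split=> [a b|a b a' b']; first by rewrite normrN.
by rewrite -opprD normrN.
Qed.

Lemma blipM f g : blip f -> blip g -> blip (fun a b => f a b * g a b).
Proof.
move=> [M M0 [fb fl]] [N N0 [gb gl]]; exists (2 * M * N); first by rewrite !mulr_ge0.
split=> [a b|a b a' b'].
  rewrite normrM; apply: (@le_trans _ _ (M * N)); first exact: ler_pM.
  have : 0 <= M * N by rewrite mulr_ge0.
  lra.
have -> : f a b * g a b - f a' b' * g a' b' =
  f a b * (g a b - g a' b') + (f a b - f a' b') * g a' b' by ring.
have -> : 2 * M * N * (`|a - a'| + `|b - b'|) =
  M * (N * (`|a - a'| + `|b - b'|)) + (M * (`|a - a'| + `|b - b'|)) * N by ring.
by apply: le_trans (ler_normD _ _) _; rewrite !normrM; apply: lerD; apply: ler_pM.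
Qed.

Lemma blip_cst c : blip (fun _ _ => c).
Proof.
exists `|c| => //; split => // a b a' b'.
by rewrite subrr normr0 mulr_ge0 ?addr_ge0.
Qed.

Lemma blip_comp f k L M : blip f -> 0 <= L -> (forall x, `|k x| <= M) ->
  (forall x y, `|k x - k y| <= L * `|x - y|) -> blip (fun a b => k (f a b)).
Proof.
move=> [N N0 [fb fl]] L0 kb kl.
have M0 : 0 <= M by apply: le_trans (kb 0).
exists (M + L * N); first by rewrite addr_ge0 ?mulr_ge0.
split=> [a b|a b a' b']; first by rewrite (le_trans (kb _))// lerDl mulr_ge0.
apply: (le_trans (kl _ _)); apply: (@le_trans _ _ (L * (N * (`|a - a'| + `|b - b'|)))).
  exact: ler_wpM2l.
by rewrite mulrA ler_wpM2r ?addr_ge0// lerDr.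
Qed.

Lemma trig_lip (s s' : R -> R) : (forall t, is_derive t 1 s (s' t)) ->
  (forall t, `|s t| <= 1) -> (forall t, `|s' t| <= 1) -> blip (fun _ b => s b).
Proof.
move=> sd sb sb'; exists 1 => //; split=> // a b a' b'; rewrite mul1r.
apply: (@le_trans _ _ `|b - b'|); last by rewrite lerDr.
wlog bb : b b' / b' <= b.
  move=> H; have [|/ltW] := leP b' b; first exact: H.
  by rewrite distrC (distrC b); exact: H.
rewrite (ger0_norm (_ : 0 <= b - b')) ?subr_ge0//.
exact: (derive_bound bb (fun t _ => sd t) (fun t _ => der_id t) (fun t _ => sb' t)).
Qed.

Lemma norm_sin_le1 t : `|sin t| <= 1.
Proof. by rewrite ler_norml sin_geN1 sin_le1. Qed.
Lemma norm_cos_le1 t : `|cos t| <= 1.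
Proof. by rewrite ler_norml cos_geN1 cos_le1. Qed.

Lemma blip_sin : blip (fun _ b => sin b).
Proof. exact: (trig_lip (@is_derive_sin R) norm_sin_le1 norm_cos_le1). Qed.
Lemma blip_cos : blip (fun _ b => cos b).
Proof.
apply: (trig_lip (@is_derive_cos R) norm_cos_le1) => t.
by rewrite normrN norm_sin_le1.
Qed.

End BoundedLipschitz.

(** * The planar vector field and its clamped version *)

Section Field.
Context {R : realType} (kappa tau : R) (k : R -> R).
Hypothesis kappa_le0 : kappa <= 0.
Hypothesis tau_gt0 : 0 < tau.
Hypothesis cf : curvature_fun kappa k.
Implicit Types (p phi t a b : R).

(* In terms of the radius r, [p = 1/r + kappa r/4], [Sig p = 1/r - kappa r/4], and [angmax p] is the maximal value [(1 + tau^2 r^2)^(-1/2)] of the angle function. *)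
Definition Sig p := Num.sqrt (p ^+ 2 - kappa).
Definition twice_inv_rad p := p + Sig p.
Definition angmax_of (d : R) := d / Num.sqrt (d ^+ 2 + 4 * tau ^+ 2).
Definition angmax p := angmax_of (twice_inv_rad p).
Definition flowP p phi := - (p * Sig p * sin phi).
Definition flowPhi p phi := Sig p * cos phi - 2 * k (sin phi * angmax p).

Lemma Sig_sq p : Sig p ^+ 2 = p ^+ 2 - kappa.
Proof. by rewrite sqr_sqrtr// addr_ge0 ?sqr_ge0// oppr_ge0. Qed.
Lemma Sig_ge0 p : 0 <= Sig p. Proof. exact: sqrtr_ge0. Qed.
Lemma Sig_ge p : p <= Sig p.
Proof.
have [p0|p0] := leP p 0; first exact: le_trans (Sig_ge0 p).
by apply: le_sq; rewrite ?Sig_ge0// Sig_sq lerDl oppr_ge0.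
Qed.
Lemma Sig_gt0 p : 0 < p -> 0 < Sig p.
Proof. by move=> p0; apply: lt_le_trans (Sig_ge p). Qed.
Lemma Sig_lt a b : 0 <= a -> a < b -> Sig a < Sig b.
Proof.
move=> a0 ab; apply: lt_sq; rewrite ?Sig_ge0// !Sig_sq ltrD2r.
by rewrite ltr_pXn2r ?nnegrE// (le_trans a0)// ltW.
Qed.
Lemma Sig_le a b : 0 <= a -> a <= b -> Sig a <= Sig b.
Proof. by move=> a0; rewrite le_eqVlt => /predU1P[->//|/(Sig_lt a0)/ltW]. Qed.
(** By differences of squares rather than by a derivative: for [kappa = 0] the function is the
    absolute value, not differentiable at the origin. *)
Lemma Sig_lip a b : 0 <= a -> 0 <= b -> `|Sig a - Sig b| <= `|a - b|.
Proof.
wlog ab : a b / b <= a.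
  move=> H a0 b0; have [|/ltW] := leP b a => ?; first exact: H.
  by rewrite distrC (distrC a); exact: H.
move=> a0 b0; rewrite !ger0_norm ?subr_ge0//; last exact: Sig_le.
have [->|ba] := eqVneq a b; first by rewrite !subrr.
have a_gt0 : 0 < a by rewrite (le_lt_trans b0)// lt_neqAle eq_sym ba.
have S0 : 0 < Sig a + Sig b by rewrite ltr_pwDl ?Sig_ge0 ?Sig_gt0.
rewrite -(ler_pM2r S0).
have -> : (Sig a - Sig b) * (Sig a + Sig b) = (a - b) * (a + b).
  by transitivity (Sig a ^+ 2 - Sig b ^+ 2); [ring|rewrite !Sig_sq; ring].
by rewrite ler_wpM2l ?subr_ge0// lerD ?Sig_ge.
Qed.

Let den_gt0 (d : R) : 0 < d ^+ 2 + 4 * tau ^+ 2.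
Proof. by rewrite ltr_wpDl ?sqr_ge0// mulr_gt0// exprn_gt0. Qed.

Lemma angmax_of_der (d : R) : is_derive d 1 angmax_of
  (4 * tau ^+ 2 / (Num.sqrt (d ^+ 2 + 4 * tau ^+ 2)) ^+ 3).
Proof.
set s := Num.sqrt (d ^+ 2 + 4 * tau ^+ 2); have s0 : 0 < s by rewrite sqrtr_gt0.
have s2 : s ^+ 2 = d ^+ 2 + 4 * tau ^+ 2 by rewrite sqr_sqrtr// ltW.
have D1 : is_derive d 1 (fun d => d ^+ 2 + 4 * tau ^+ 2) (2 * d) by der; ring.
have D2 := derC1 (f := Num.sqrt) (g := fun d : R => d ^+ 2 + 4 * tau ^+ 2) (is_derive1_sqrt (den_gt0 d)) D1.
have sn : s != 0 by rewrite gt_eqF.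
rewrite /angmax_of; der; rewrite -/s.
have -> : 4 * tau ^+ 2 = s ^+ 2 - d ^+ 2 by rewrite s2; ring.
by field.
Qed.

(** The derivative is [4 tau^2 / s^3] with [s >= tau] and [s^2 >= 4 tau^2], hence at most
    [1 / tau]. *)
Lemma angmax_of_lip (d e : R) : `|angmax_of d - angmax_of e| <= tau^-1 * `|d - e|.
Proof.
wlog de : d e / e <= d.
  move=> H; have [|/ltW] := leP e d => ?; first exact: H.
  by rewrite distrC (distrC d); exact: H.
rewrite (ger0_norm (_ : 0 <= d - e)) ?subr_ge0// mulrBr.
have H2 t : e <= t <= d -> is_derive t 1 (fun t => tau^-1 * t) tau^-1 by move=> _; der; ring.
apply: (derive_bound de (fun t _ => angmax_of_der t) H2).
move=> t _; set s := Num.sqrt _; have s0 : 0 < s by rewrite sqrtr_gt0.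
have s2 : s ^+ 2 = t ^+ 2 + 4 * tau ^+ 2 by rewrite sqr_sqrtr// ltW.
have st : tau <= s.
  apply: le_sq; [exact: ltW | rewrite s2].
  by have := sqr_ge0 t; have := sqr_ge0 tau; lra.
rewrite ger0_norm; last by rewrite divr_ge0 ?mulr_ge0 ?sqr_ge0 ?exprn_ge0 ?ltW.
rewrite ler_pdivrMr ?exprn_gt0// ler_pdivlMl//.
have : tau * (4 * tau ^+ 2) <= s * s ^+ 2.
  apply: ler_pM => //; [exact: ltW|by rewrite mulr_ge0 ?sqr_ge0|].
  by rewrite s2; have := sqr_ge0 t; lra.
by rewrite -exprS.
Qed.

Lemma angmax_of_bound (d : R) : `|angmax_of d| <= 1.
Proof.
rewrite /angmax_of normrM normfV (gtr0_norm (_ : 0 < Num.sqrt _)) ?sqrtr_gt0//.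
rewrite ler_pdivrMr ?sqrtr_gt0// mul1r -sqrtr_sqr ler_wsqrtr// lerDl.
by rewrite mulr_ge0 ?sqr_ge0.
Qed.

Lemma twice_inv_rad_gt0 p : 0 < p -> 0 < twice_inv_rad p.
Proof. by move=> p0; rewrite ltr_pwDl ?Sig_ge0. Qed.

Lemma angmax_gt0 p : 0 < p -> 0 < angmax p.
Proof. by move=> p0; rewrite divr_gt0 ?twice_inv_rad_gt0 ?sqrtr_gt0. Qed.

Lemma angmax_lt1 p : 0 < p -> angmax p < 1.
Proof.
move=> p0; rewrite ltr_pdivrMr ?sqrtr_gt0// mul1r.
rewrite -{1}[twice_inv_rad p]gtr0_norm ?twice_inv_rad_gt0// -sqrtr_sqr.
by rewrite ltr_sqrt ?ltrDl ?mulr_gt0 ?exprn_gt0.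
Qed.

Definition clampP (P1 p : R) := Num.max 0 (Num.min P1 p).

Lemma clampP_ge0 P1 p : 0 <= clampP P1 p. Proof. by rewrite le_max lexx. Qed.
Lemma clampP_le P1 p : 0 <= P1 -> clampP P1 p <= P1.
Proof. by move=> P0; rewrite ge_max P0 ge_min lexx. Qed.
Lemma clampP_id P1 p : 0 <= p <= P1 -> clampP P1 p = p.
Proof. by move=> /andP[p0 pP]; rewrite /clampP (min_idPr pP) (max_idPr p0). Qed.
Lemma clampP_le_id P1 p : 0 <= p -> clampP P1 p <= p.
Proof. by move=> p0; rewrite ge_max p0 ge_min lexx orbT. Qed.
Lemma clampP_lip P1 a b : 0 <= P1 -> `|clampP P1 a - clampP P1 b| <= `|a - b|.
Proof.
move=> P0.
have cP c : [\/ c <= 0 /\ clampP P1 c = 0, P1 <= c /\ clampP P1 c = P1 |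
    0 <= c <= P1 /\ clampP P1 c = c].
  have [c0|c0] := leP c 0.
    by apply: Or31; split=> //; rewrite /clampP max_l// ge_min c0 orbT.
  have [cP|cP] := leP P1 c; first by apply: Or32; rewrite /clampP min_l// max_r.
  by apply: Or33; rewrite clampP_id; rewrite ?ltW.
have h1 := ler_norm (a - b); have h2 := ler_norm (b - a); rewrite distrC in h2.
rewrite ler_norml; have [[? ->]|[? ->]|[/andP[? ?] ->]] := cP a;
  have [[? ->]|[? ->]|[/andP[? ?] ->]] := cP b; apply/andP; split; lra.
Qed.

Lemma blip_clamp (g : R -> R) P1 L M : 0 <= P1 -> 0 <= L ->
  (forall a, 0 <= a <= P1 -> `|g a| <= M) ->
  (forall a b, 0 <= a -> 0 <= b -> `|g a - g b| <= L * `|a - b|) ->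
  blip (fun a _ => g (clampP P1 a)).
Proof.
move=> P0 L0 gb gl; have M0 : 0 <= M by apply: le_trans (gb 0 _); rewrite // lexx.
exists (M + L); first exact: addr_ge0.
split=> [a _|a b a' b'].
  by apply: (le_trans (gb _ _)); rewrite ?clampP_ge0 ?clampP_le// lerDl.
apply: (le_trans (gl _ _ (clampP_ge0 _ _) (clampP_ge0 _ _))).
apply: (@le_trans _ _ (L * `|a - a'|)); first by rewrite ler_wpM2l// clampP_lip.
apply: (@le_trans _ _ ((M + L) * `|a - a'|)); first by rewrite ler_wpM2r// lerDr.
by rewrite ler_wpM2l ?addr_ge0// lerDl.
Qed.

Definition cflowP P1 p phi := flowP (clampP P1 p) phi.
Definition cflowPhi P1 p phi := flowPhi (clampP P1 p) phi.

Lemma cfield_blip P1 : 0 <= P1 -> blip (cflowP P1) /\ blip (cflowPhi P1).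
Proof.
move=> P0.
have Bp : blip (fun a _ => clampP P1 a).
  apply: (@blip_clamp id P1 1 P1) => // [a /andP[a0 aP]|a b _ _]; first by rewrite ger0_norm.
  by rewrite mul1r.
have BS : blip (fun a _ => Sig (clampP P1 a)).
  apply: (@blip_clamp Sig P1 1 (Sig P1)) => // [a /andP[a0 aP]|a b a0 b0].
    by rewrite ger0_norm ?Sig_ge0//; exact: Sig_le.
  by rewrite mul1r Sig_lip.
have BD : blip (fun a _ => angmax (clampP P1 a)).
  apply: (@blip_comp R (fun a _ => clampP P1 a + Sig (clampP P1 a)) angmax_of tau^-1 1).
  - exact: blipD.
  - by rewrite invr_ge0 ltW.
  - exact: angmax_of_bound.
  - exact: angmax_of_lip.
have [L L0 kl] := cf_lip cf; have [M kM] := cf_up cf; have [m m0 km] := cf_low cf.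
split; first by apply: blipN; apply: blipM; [apply: blipM|exact: blip_sin].
apply: blipD; first by apply: blipM => //; exact: blip_cos.
apply: blipN; apply: blipM; first exact: blip_cst.
apply: (@blip_comp R (fun a b => sin b * angmax (clampP P1 a)) k L M) => //.
- by apply: blipM => //; exact: blip_sin.
- exact: ltW.
- by move=> x; rewrite ger0_norm ?kM// (le_trans (ltW m0)).
Qed.

Lemma cfield_lip P1 : 0 <= P1 -> exists L, [/\ 0 < L,
  forall a b a' b', `|cflowP P1 a b - cflowP P1 a' b'| <= L * (`|a - a'| + `|b - b'|) &
  forall a b a' b', `|cflowPhi P1 a b - cflowPhi P1 a' b'| <= L * (`|a - a'| + `|b - b'|)].
Proof.
move=> /cfield_blip[[M M0 [_ Ml]] [N N0 [_ Nl]]].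
exists (M + N + 1); split; first by rewrite ltr_wpDl// addr_ge0.
  move=> a b a' b'; apply: (le_trans (Ml _ _ _ _)); rewrite ler_wpM2r ?addr_ge0//; lra.
by move=> a b a' b'; apply: (le_trans (Nl _ _ _ _)); rewrite ler_wpM2r ?addr_ge0//; lra.
Qed.

End Field.

(** * Solutions of the planar system: symmetries, uniqueness, rotation rate *)

Section Dynamics.
Context {R : realType} (kappa tau : R) (k : R -> R).
Hypothesis kappa_le0 : kappa <= 0.
Hypothesis tau_gt0 : 0 < tau.
Hypothesis cf : curvature_fun kappa k.
Implicit Types (p phi : R -> R) (t s a b c e d l T C M N m x y : R) (J : set R).

Local Notation S := (Sig kappa).
Local Notation io := (angmax kappa tau).
Local Notation FP := (flowP kappa).
Local Notation FQ := (flowPhi kappa tau k).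

(** Positivity of [p] is part of the notion: it says that the corresponding radius lies inside the
    domain of the model. *)
Definition sol J p phi := forall t, J t -> [/\ 0 < p t,
  is_derive t 1 p (FP (p t) (phi t)) & is_derive t 1 phi (FQ (p t) (phi t))].

Lemma sol_sub J J' p phi : J' `<=` J -> sol J p phi -> sol J' p phi.
Proof. by move=> JJ s t /JJ /s. Qed.

(** Multiples of [2 pi] are encoded by [cos c = 1] and [sin c = 0], so that no integer has to be
    exhibited. *)
Lemma sol_lift J p phi c : cos c = 1 -> sin c = 0 ->
  sol J p phi -> sol J p (fun t => phi t + c).
Proof.
move=> c1 c0 s t /s[p0 pd phid]; split => //.
  by rewrite /flowP sinD c1 c0 mulr1 mulr0 addr0.
have D : is_derive t 1 (fun t => phi t + c) (FQ (p t) (phi t) + 0).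
  exact: (derD phid (der_cst _ _ _)).
notypeclasses refine (is_derive_eq D _).
by rewrite /flowPhi sinD cosD c1 c0 !mulr1 !mulr0 !addr0 subr0.
Qed.

Lemma sol_shift J p phi c : sol J p phi ->
  sol [set t | J (t + c)] (fun t => p (t + c)) (fun t => phi (t + c)).
Proof.
move=> s t /s[p0 pd phid].
have D : is_derive t 1 (fun t => t + c) 1 by der; ring.
by split => //; [rewrite -[FP _ _]mulr1|rewrite -[FQ _ _]mulr1];
  [exact: (derC1 (g := fun t => t + c) pd D)|exact: (derC1 (g := fun t => t + c) phid D)].
Qed.

Lemma cosB2 c x : cos c = 1 -> sin c = 0 -> cos (c - x) = cos x.
Proof. by move=> c1 c0; rewrite cosB c1 c0 mul1r mul0r addr0. Qed.
Lemma sinB2 c x : cos c = 1 -> sin c = 0 -> sin (c - x) = - sin x.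
Proof. by move=> c1 c0; rewrite sinB c1 c0 mul0r mul1r sub0r. Qed.

Lemma der_reflect (f : R -> R) t c df : is_derive (c - t) 1 f df ->
  is_derive t 1 (fun t => f (c - t)) (- df).
Proof.
move=> fd; have D : is_derive t 1 (fun t => c - t) (-1) by der; ring.
by rewrite -[- df]mulrN1; exact: (derC1 (g := fun t => c - t) fd D).
Qed.

Lemma FP_reflect a b c : cos c = 1 -> sin c = 0 -> FP a (c - b) = - FP a b.
Proof. by move=> c1 c0; rewrite /flowP sinB2// mulrN. Qed.
Lemma FQ_reflect a b c : cos c = 1 -> sin c = 0 -> FQ a (c - b) = FQ a b.
Proof. by move=> c1 c0; rewrite /flowPhi sinB2// cosB2// mulNr (cf_even cf). Qed.

(** Reversibility: under [phi -> c - phi] the first component of the field is odd and the second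
    even, the latter because [k] is even. *)
Lemma sol_reflect J p phi c T : cos c = 1 -> sin c = 0 -> sol J p phi ->
  sol [set t | J (T - t)] (fun t => p (T - t)) (fun t => c - phi (T - t)).
Proof.
move=> c1 c0 s t /s[p0 pd phid]; split => //.
  by rewrite FP_reflect//; exact: der_reflect.
rewrite FQ_reflect// -[FQ _ _]opprK -sub0r.
exact: (derB (der_cst _ _ _) (der_reflect phid)).
Qed.

Lemma sol_contp J p phi t : sol J p phi -> J t -> {for t, continuous p}.
Proof. by move=> s /s[_ pd _]; exact: der_cont pd. Qed.
Lemma sol_contphi J p phi t : sol J p phi -> J t -> {for t, continuous phi}.
Proof. by move=> s /s[_ _ pd]; exact: der_cont pd. Qed.
Lemma sol_contsin J p phi t : sol J p phi -> J t -> {for t, continuous (fun t => sin (phi t))}.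
Proof. by move=> s Jt; have c := sol_contphi s Jt; cont. Qed.
Lemma sol_contcos J p phi t : sol J p phi -> J t -> {for t, continuous (fun t => cos (phi t))}.
Proof. by move=> s Jt; have c := sol_contphi s Jt; cont. Qed.

Lemma cos_sin_eq a b : cos a = cos b -> sin a = sin b -> cos (a - b) = 1 /\ sin (a - b) = 0.
Proof.
move=> c s; rewrite cosB sinB c s -!expr2 cos2Dsin2.
by split => //; rewrite mulrC subrr.
Qed.

(** Angles are compared through cosine and sine. The second solution is lifted to agree with the
    first at [t0]; on the compact interval between [t0] and [t] both have [p] below a common [P1],
    so uniqueness for the clamped field applies. *)
Lemma sol_unique J p phi p' phi' t0 : is_interval J -> J t0 ->
  sol J p phi -> sol J p' phi' -> p t0 = p' t0 ->
  cos (phi t0) = cos (phi' t0) -> sin (phi t0) = sin (phi' t0) ->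
  forall t, J t -> [/\ p t = p' t, cos (phi t) = cos (phi' t) & sin (phi t) = sin (phi' t)].
Proof.
move=> iJ J0 s s' p0 c0 s0 t Jt.
have [cc ss] := cos_sin_eq c0 s0; set c := phi t0 - phi' t0 in cc ss.
have s2 := sol_lift cc ss s'.
pose a := Num.min t0 t; pose b := Num.max t0 t.
have ab : a <= b by rewrite /a /b ge_min !le_max lexx.
have JI x : a <= x <= b -> J x.
  move=> /andP[]; rewrite /a /b ge_min le_max => /orP[h|h] /orP[h'|h'].
  - by apply: (iJ t0 t0) => //; rewrite h.
  - by apply: (iJ t0 t) => //; rewrite h.
  - by apply: (iJ t t0) => //; rewrite h.
  - by apply: (iJ t t) => //; rewrite h.
have bd (q : R -> R) : (forall x, a <= x <= b -> {for x, continuous q}) -> exists M, forall x, a <= x <= b -> q x <= M.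
  move=> qc; have [m _ H] := EVT_max ab (cont_withinI qc).
  by exists (q m) => x xI; apply: H; rewrite in_itv.
have [M HM] := bd p (fun x xI => sol_contp s (JI x xI)).
have [M' HM'] := bd p' (fun x xI => sol_contp s' (JI x xI)).
pose P1 := Num.max 0 (Num.max M M').
have P0 : 0 <= P1 by rewrite le_max lexx.
have [L [L0 FL GL]] := cfield_lip kappa_le0 tau_gt0 cf P0.
have cl (q : R -> R) x : 0 < q x -> q x <= M \/ q x <= M' -> clampP P1 (q x) = q x.
  by move=> q0 qM; apply: clampP_id; rewrite ltW//= /P1 !le_max;
    case: qM => ->; rewrite ?orbT.
have ia : is_interval [set x | a <= x <= b].
  move=> x y /= /andP[ax xb] /andP[ay yb] z /andP[xz zy].
  by rewrite (le_trans ax xz) (le_trans zy yb).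
have It0 : a <= t0 <= b by rewrite /a /b ge_min le_max lexx.
have It : a <= t <= b by rewrite /a /b ge_min le_max lexx !orbT.
have e1 x : a <= x <= b -> is_derive x 1 p (cflowP kappa P1 (p x) (phi x)).
  move=> xI; have [px pd _] := s x (JI x xI).
  by rewrite /cflowP cl//; left; exact: HM.
have e2 x : a <= x <= b -> is_derive x 1 phi (cflowPhi kappa tau k P1 (p x) (phi x)).
  move=> xI; have [px _ pd] := s x (JI x xI).
  by rewrite /cflowPhi cl//; left; exact: HM.
have e3 x : a <= x <= b -> is_derive x 1 p' (cflowP kappa P1 (p' x) (phi' x + c)).
  move=> xI; have [px pd _] := s2 x (JI x xI).
  by rewrite /cflowP cl//; right; exact: HM'.
have e4 x : a <= x <= b ->
    is_derive x 1 (fun t => phi' t + c) (cflowPhi kappa tau k P1 (p' x) (phi' x + c)).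
  move=> xI; have [px _ pd] := s2 x (JI x xI).
  by rewrite /cflowPhi cl//; right; exact: HM'.
have q0 : phi t0 = phi' t0 + c by rewrite /c; ring.
have [h1 h2] := ode_unique L0 FL GL ia It0 e1 e2 e3 e4 p0 q0 It.
rewrite h1 h2; split => //; first by rewrite cosD cc ss mulr1 mulr0 subr0.
by rewrite sinD cc ss mulr1 mulr0 addr0.
Qed.

(** The substitute for a first integral: as [k > 0], the quotient is monotone wherever [sin phi]
    keeps its sign. For [kappa = 0] it is the radius times [cos phi]. *)
Lemma der_ratio J p phi t : sol J p phi -> J t ->
  is_derive t 1 (fun t => cos (phi t) / p t) (2 * k (sin (phi t) * io (p t)) * sin (phi t) / p t).
Proof.
move=> s /s[p0 pd phid].
have pn : p t != 0 by rewrite gt_eqF.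
der; rewrite /flowP /flowPhi; field; exact: pn.
Qed.

(** Far from the axis the angle turns at a definite negative rate. Put [X = S cos phi] and
    [y = k nu]. Since [nu^2 <= sin^2 phi], one has [X^2 <= (a^2 - kappa) (1 - nu^2)], and the
    curvature condition bounds this by [4 y^2 - d0 / 2] as soon as [a^2 <= d0 / 2]. Dividing
    [4 y^2 - X^2] by [2 y + X <= 4 M] bounds [2 y - X] below. *)
Lemma gap : exists P d, [/\ 0 < P, 0 < d &
  forall a b, 0 < a <= P -> FQ a b <= - d].
Proof.
have [d0 d0_gt0 H] := cf_gap cf; have [m m0 km] := cf_low cf; have [M kM] := cf_up cf.
have M0 : 0 < M by apply: lt_le_trans m0 (le_trans (km 0) (kM 0)).
(* The first bound serves when [X <= 0], the second when [X > 0]. *)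
pose d := Num.min (2 * m) (d0 / (8 * M)).
have d_gt0 : 0 < d by rewrite lt_min !mulr_gt0 ?invr_gt0 ?mulr_gt0.
have P0 : 0 < Num.sqrt (d0 / 2) by rewrite sqrtr_gt0 divr_gt0.
exists (Num.sqrt (d0 / 2)), d; split => // a b /andP[a0 aP].
have a2 : a ^+ 2 <= d0 / 2.
  have sq : Num.sqrt (d0 / 2) ^+ 2 = d0 / 2 by rewrite sqr_sqrtr// ltW// divr_gt0.
  by rewrite -sq ler_pXn2r// nnegrE ltW.
rewrite /flowPhi; set u := cos b; set v := sin b; set nu := v * io a.
have uv : u ^+ 2 + v ^+ 2 = 1 := cos2Dsin2 b.
have i0 := angmax_gt0 kappa tau_gt0 a0; have i1 := angmax_lt1 kappa tau_gt0 a0.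
have nv : nu ^+ 2 <= v ^+ 2.
  rewrite exprMn ler_piMr ?sqr_ge0//.
  by rewrite expr_le1// ltW.
have v1 : v ^+ 2 <= 1 by rewrite -uv lerDr sqr_ge0.
have nu1 := le_trans nv v1; have := H nu nu1; have := km nu; have := kM nu.
move: (k nu) => y yM my gapy.
have S2 := Sig_sq kappa_le0 a.
pose X := S a * u.
have X2 : X ^+ 2 <= 4 * y ^+ 2 - d0 / 2.
  rewrite /X exprMn S2.
  have -> : u ^+ 2 = 1 - v ^+ 2 by rewrite -uv; ring.
  apply: (@le_trans _ _ ((a ^+ 2 - kappa) * (1 - nu ^+ 2))).
    by apply: ler_wpM2l; [rewrite addr_ge0 ?sqr_ge0// oppr_ge0|rewrite lerD2l lerN2].
  have h : a ^+ 2 * (1 - nu ^+ 2) <= a ^+ 2.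
    by rewrite ler_piMr ?sqr_ge0// gerBl sqr_ge0.
  by move: gapy h a2; rewrite !mulrBl !mulrBr !mulr1 => ? ? ?; lra.
rewrite -/X.
have [X0|X0] := leP X 0.
  have : d <= 2 * m by rewrite ge_min lexx.
  lra.
have : d <= d0 / (8 * M) by rewrite ge_min lexx orbT.
rewrite ler_pdivlMr ?mulr_gt0// => dM.
have y0 : 0 < y by apply: lt_le_trans my.
have hX : X <= 2 * y.
  apply: le_sq; first by rewrite mulr_ge0 // ltW.
  have -> : (2 * y) ^+ 2 = 4 * y ^+ 2 by ring.
  by apply: (le_trans X2); lra.
suff : d * (4 * M) <= (2 * y - X) * (4 * M) by rewrite ler_pM2r ?mulr_gt0//; lra.
have h1 : (2 * y - X) * (2 * y + X) <= (2 * y - X) * (4 * M).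
  by apply: ler_wpM2l; [rewrite subr_ge0|lra].
apply: le_trans h1.
have -> : (2 * y - X) * (2 * y + X) = 4 * y ^+ 2 - X ^+ 2 by ring.
lra.
Qed.

Definition ray t1 : set R := [set t | t1 <= t].

(** While [sin phi] has no zero, the cotangent of [phi] is defined and has derivative
    [- phi' (1 + cot^2)]; rotation at a definite rate in either direction makes it, or its opposite,
    violate [riccati]. *)
Lemma no_fast p phi t1 d : 0 < d -> sol (ray t1) p phi ->
  (forall t, t1 <= t -> sin (phi t) != 0) ->
  (forall t, t1 <= t -> FQ (p t) (phi t) <= - d) \/
  (forall t, t1 <= t -> d <= FQ (p t) (phi t)) -> False.
Proof.
move=> d0 s sn F.
have D t : t1 <= t -> is_derive t 1 (fun t => cos (phi t) / sin (phi t))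
    (- FQ (p t) (phi t) * (1 + (cos (phi t) / sin (phi t)) ^+ 2)).
  move=> tt; have [p0 _ phid] := s t tt; have sn0 := sn t tt.
  der; field; exact: sn0.
case: F => F.
  apply: (riccati d0 D) => t tt; rewrite ler_wpM2r ?addr_ge0 ?sqr_ge0//.
  by rewrite lerNr F.
have D' t : t1 <= t -> is_derive t 1 (fun t => - (cos (phi t) / sin (phi t)))
    (FQ (p t) (phi t) * (1 + (- (cos (phi t) / sin (phi t))) ^+ 2)).
  by move=> tt; have := derN (D t tt); rewrite mulNr opprK sqrrN.
apply: (riccati d0 D') => t tt; rewrite ler_wpM2r ?addr_ge0 ?sqr_ge0//.
exact: F.
Qed.

Lemma decreasing_limit (f : R -> R) t1 b :
  (forall s t, t1 <= s -> s <= t -> f t <= f s) -> (forall t, t1 <= t -> b <= f t) ->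
  exists l, [/\ b <= l, forall t, t1 <= t -> l <= f t &
    forall e, 0 < e -> exists2 T, t1 <= T & forall t, T <= t -> f t <= l + e].
Proof.
move=> fd fb; pose A := [set y | exists2 t, t1 <= t & y = f t].
have A0 : A !=set0 by exists (f t1), t1.
have lA : has_lbound A by exists b => _ [t tt ->]; exact: fb.
exists (inf A); split.
- by apply: lb_le_inf => // _ [t tt ->]; exact: fb.
- by move=> t tt; apply: ge_inf => //; exists t.
- move=> e e0; have [_ [T tT ->] fT] := inf_adherent e0 (conj A0 lA).
  exists T => // t Tt; apply: ltW; apply: le_lt_trans fT; exact: fd.
Qed.

End Dynamics.

(** * No half-infinite orbit with [p] bounded and [sin phi] of constant sign *)

Section NoMonotoneRay.
Context {R : realType} (kappa tau : R) (k : R -> R).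
Hypothesis kappa_le0 : kappa <= 0.
Hypothesis tau_gt0 : 0 < tau.
Hypothesis cf : curvature_fun kappa k.
Implicit Types (p phi : R -> R) (t s a b c e d l T C M N m x y : R) (J : set R).

Local Notation S := (Sig kappa).
Local Notation io := (angmax kappa tau).
Local Notation FP := (flowP kappa).
Local Notation FQ := (flowPhi kappa tau k).
Local Notation sol := (sol kappa tau k).

Section Bounded.
Variables (p phi : R -> R) (t1 sg P0 P2 : R).
Hypothesis sg1 : sg = 1 \/ sg = -1.
Hypothesis s : sol (ray t1) p phi.
Hypothesis w_gt0 : forall t, t1 <= t -> 0 < sg * sin (phi t).
Hypothesis P0_gt0 : 0 < P0.
Hypothesis pP : forall t, t1 <= t -> P0 <= p t <= P2.

(** The sign [sg] treats both directions at once: [sg * p] decreases at rate [p S w]. *)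
Let w t := sg * sin (phi t).
Let sg2 : sg * sg = 1. Proof. by have [->|->] := sg1; rewrite ?mulr1 ?mulrNN ?mulr1. Qed.
Let sgn : `|sg| = 1. Proof. by have [->|->] := sg1; rewrite ?normrN normr1. Qed.
Let w2 t : w t ^+ 2 = sin (phi t) ^+ 2.
Proof. by rewrite exprMn expr2 sg2 mul1r. Qed.
Let absw t : `|w t| = `|sin (phi t)|. Proof. by rewrite normrM sgn mul1r. Qed.
Let w_le1 t : w t <= 1.
Proof. by apply: (le_trans (ler_norm _)); rewrite absw norm_sin_le1. Qed.
Let P2_gt0 : 0 < P2.
Proof. by have /andP[h1 h2] := pP (lexx t1); apply: lt_le_trans P0_gt0 (le_trans h1 h2). Qed.
Let Spos t : t1 <= t -> P0 <= S (p t) <= S P2.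
Proof.
move=> tt; have /andP[h1 h2] := pP tt; apply/andP; split.
  exact: le_trans h1 (Sig_ge kappa_le0 _).
by apply: Sig_le => //; exact: ltW (lt_le_trans P0_gt0 h1).
Qed.

Let dp t : t1 <= t -> is_derive t 1 (fun t => sg * p t) (- (p t * S (p t) * w t)).
Proof. by move=> /s[_ pd _]; der; rewrite /flowP /w; ring. Qed.

Let pSw t : t1 <= t -> 0 < p t * S (p t) * w t.
Proof.
move=> tt; have /andP[px _] := pP tt; have /andP[Sx _] := Spos tt.
apply: mulr_gt0; last exact: w_gt0.
by apply: mulr_gt0; [exact: lt_le_trans px|exact: lt_le_trans Sx].
Qed.

Let sp_decr a b : t1 <= a -> a <= b -> sg * p b <= sg * p a.
Proof.
move=> ta ab; rewrite -lerN2.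
have D x : a <= x <= b -> is_derive x 1 (fun t => - (sg * p t)) (p x * S (p x) * w x).
  by move=> /andP[ax _]; have := derN (dp (le_trans ta ax)); rewrite opprK.
apply: (derive_nondecr ab D) => x /andP[ax _].
by rewrite ltW// pSw// (le_trans ta)// ltW.
Qed.

Let sp_lt a b : t1 <= a -> a < b -> sg * p b < sg * p a.
Proof.
move=> ta ab; rewrite -ltrN2.
have D x : a <= x <= b -> is_derive x 1 (fun t => - (sg * p t)) (p x * S (p x) * w x).
  by move=> /andP[ax _]; have := derN (dp (le_trans ta ax)); rewrite opprK.
apply: (derive_incr ab D) => x /andP[ax _].
by rewrite pSw// (le_trans ta)// ltW.
Qed.

Let FQ_bound : exists2 N, 0 < N & forall t, t1 <= t -> `|FQ (p t) (phi t)| <= N.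
Proof.
have [M kM] := cf_up cf; have [m m0 km] := cf_low cf.
exists (S P2 + 2 * M + 1).
  by rewrite ltr_wpDl// addr_ge0 ?Sig_ge0// mulr_ge0// (le_trans _ (kM 0))// (le_trans (ltW m0)).
move=> t tt; rewrite /flowPhi.
apply: (@le_trans _ _ (S P2 + 2 * M)); last by rewrite lerDl.
apply: (le_trans (ler_normB _ _)); apply: lerD; rewrite normrM.
  rewrite ger0_norm ?Sig_ge0//; have /andP[_ h] := Spos tt.
  by rewrite -[leRHS]mulr1 ler_pM ?Sig_ge0// norm_cos_le1.
by rewrite normr_nat ler_pM2l// ger0_norm ?kM// (le_trans (ltW m0)).
Qed.

(* Barbalat's argument: p converges, so its derivative, which is Lipschitz, tends to 0. *)
Let w_small e : 0 < e -> exists2 T, t1 <= T & forall t, T <= t -> w t <= e.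
Proof.
move=> e0; have [N N0 HN] := FQ_bound.
have bd t : t1 <= t -> - (P2 + P2) <= sg * p t.
  move=> tt; have /andP[h1 h2] := pP tt; have p0 := lt_le_trans P0_gt0 h1.
  by have [->|->] := sg1; rewrite ?mul1r ?mulN1r; have := P2_gt0; lra.
have [l [_ lf L]] := decreasing_limit sp_decr bd.
(* If [w t > e], then [w >= e / 2] for a time [d], because [|w'| <= N]. As [p S >= c], this makes
   [sg * p] fall by at least [2 eta], while after [T] it is within [eta] of its limit. *)
pose c := P0 * P0; have c0 : 0 < c by rewrite mulr_gt0.
pose d := e / (2 * N); have d0 : 0 < d by rewrite divr_gt0// mulr_gt0.
pose eta := c * (e / 2) * d / 2.
have eta0 : 0 < eta by rewrite /eta divr_gt0// mulr_gt0// mulr_gt0// divr_gt0.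
have [T tT HT] := L _ eta0.
exists T => // t Tt; rewrite leNgt; apply/negP => wt.
have t1t := le_trans tT Tt.
have dw x : t1 <= x -> is_derive x 1 w (sg * (cos (phi x) * FQ (p x) (phi x))).
  by move=> /s[_ _ pd]; rewrite /w; der; ring.
have big x : t <= x <= t + d -> e / 2 <= w x.
  move=> /andP[tx xd].
  have E : `|w x - w t| <= N * x - N * t.
    have D1 y : t <= y <= x -> is_derive y 1 w (sg * (cos (phi y) * FQ (p y) (phi y))).
      by move=> /andP[ty _]; apply: dw; exact: le_trans t1t ty.
    have D2 y : t <= y <= x -> is_derive y 1 (fun y => N * y) N by move=> _; der; ring.
    apply: (derive_bound tx D1 D2) => y /andP[ty _].
    rewrite !normrM sgn mul1r -[leRHS]mul1r ler_pM ?norm_cos_le1//.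
    by apply: HN; exact: le_trans t1t (ltW ty).
  have : N * x - N * t <= e / 2.
    rewrite -mulrBr; apply: (@le_trans _ _ (N * d)); first by rewrite ler_pM2l//; lra.
    by rewrite /d le_eqVlt; apply/orP; left; apply/eqP; field; rewrite gt_eqF.
  by move: E; rewrite ler_norml => /andP[h _]; lra.
have td : t <= t + d by rewrite lerDl ltW.
have : c * (e / 2) * (t + d) - c * (e / 2) * t <= - (sg * p (t + d)) - - (sg * p t).
  have D1 x : t <= x <= t + d -> is_derive x 1 (fun x => - (sg * p x) - c * (e / 2) * x)
      (p x * S (p x) * w x - c * (e / 2)).
    move=> /andP[tx _]; have dpx := dp (le_trans t1t tx); der; ring.
  suff : - (sg * p t) - c * (e / 2) * t <= - (sg * p (t + d)) - c * (e / 2) * (t + d) by lra.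
  apply: (derive_nondecr td D1) => x /andP[tx xd].
  have t1x := le_trans t1t (ltW tx).
  have /andP[px _] := pP t1x; have /andP[Sx _] := Spos t1x.
  rewrite subr_ge0; apply: ler_pM.
  - exact: ltW.
  - by rewrite ltW// divr_gt0.
  - by rewrite /c; apply: ler_pM; rewrite ?(ltW P0_gt0).
  - by apply: big; rewrite !ltW.
have := HT t Tt; have := lf _ (le_trans t1t td).
have : c * (e / 2) * (t + d) - c * (e / 2) * t = 2 * eta by rewrite /eta; field.
by lra.
Qed.

Let k0 := k 0.

(** Three errors add up: [S] times [1 - cos phi <= w^2 <= d], the 1-Lipschitz [S], and twice the
    Lipschitz [k] at an angle of absolute value at most [w]. *)
Let FQ_near : exists2 C, 0 < C & forall t d l, t1 <= t -> 0 < d -> d <= 1 -> P0 <= l -> w t <= d ->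
  `|p t - l| <= d -> 0 < cos (phi t) -> `|FQ (p t) (phi t) - (S l - 2 * k0)| <= C * d.
Proof.
have [L L0 kL] := cf_lip cf.
exists (S P2 + 1 + 2 * L).
  by rewrite !addr_gt0 ?mulr_gt0// Sig_gt0.
move=> t d l tt d0 d1 lP wd pd u0.
have /andP[Pp pP2] := pP tt; have p0 : 0 < p t := lt_le_trans P0_gt0 Pp.
have l0 : 0 < l := lt_le_trans P0_gt0 lP.
have cs : cos (phi t) ^+ 2 + w t ^+ 2 = 1 by rewrite w2 cos2Dsin2.
have cle : 0 <= 1 - cos (phi t) <= d.
  have h : cos (phi t) <= 1 := cos_le1 _.
  have w0 := w_gt0 tt; rewrite -/(w t) in w0.
  have wd2 : w t ^+ 2 <= d.
    rewrite expr2; apply: (@le_trans _ _ (1 * w t)); last by rewrite mul1r.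
    by apply: ler_wpM2r; rewrite ?w_le1 ?ltW.
  rewrite subr_ge0 h /=; apply: le_trans wd2.
  rewrite (_ : w t ^+ 2 = 1 - cos (phi t) ^+ 2); last by rewrite -cs; ring.
  rewrite lerD2l lerN2 expr2; apply: ler_piMl => //; exact: ltW.
have -> : FQ (p t) (phi t) - (S l - 2 * k0) =
  - (S (p t) * (1 - cos (phi t))) + (S (p t) - S l) - 2 * (k (sin (phi t) * io (p t)) - k0).
  by rewrite /flowPhi; ring.
have -> : (S P2 + 1 + 2 * L) * d = S P2 * d + d + 2 * (L * d) by ring.
apply: (le_trans (ler_normB _ _)); apply: lerD.
  apply: (le_trans (ler_normD _ _)); apply: lerD.
    rewrite normrN normrM ger0_norm ?Sig_ge0// ger0_norm; last by case/andP: cle.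
    by case/andP: cle => c0 cd; apply: ler_pM; rewrite ?Sig_ge0// Sig_le// ltW.
  by apply: le_trans pd; apply: Sig_lip => //; exact: ltW.
rewrite normrM normr_nat ler_pM2l//; apply: (le_trans (kL _ _)).
rewrite subr0 ler_pM2l// normrM -absw (gtr0_norm (angmax_gt0 kappa tau_gt0 p0)).
have w0 := w_gt0 tt; rewrite -/(w t) in w0.
rewrite (gtr0_norm w0); apply: le_trans wd.
by rewrite ler_piMr ?ltW// angmax_lt1.
Qed.

(** As [p] converges to [l] and [w] to zero, [cos phi] is eventually bounded away from zero with a
    fixed sign. If it is negative, [phi'] is at most [- 2 m]; if positive, [phi'] tends to
    [S l - 2 k 0], and a nonzero limit contradicts [no_fast]. What remains is convergence to the
    equilibrium. *)
Lemma bounded_ray_contra : False.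
Proof.
have sn t : t1 <= t -> sin (phi t) != 0.
  by move=> tt; apply: contraTneq (w_gt0 tt) => ->; rewrite mulr0 ltxx.
have sub T : t1 <= T -> sol (ray T) p phi.
  by move=> tT; apply: sol_sub s => t; exact: le_trans.
have snT T : t1 <= T -> forall t, T <= t -> sin (phi t) != 0.
  by move=> tT t Tt; apply: sn; exact: le_trans Tt.
have bd t : t1 <= t -> - (P2 + P2) <= sg * p t.
  move=> tt; have /andP[h1 h2] := pP tt; have p0 := lt_le_trans P0_gt0 h1.
  by have [->|->] := sg1; rewrite ?mul1r ?mulN1r; have := P2_gt0; lra.
have [l' [_ lf Lf]] := decreasing_limit sp_decr bd.
pose l := sg * l'.
have l'E : l' = sg * l by rewrite /l mulrA sg2 mul1r.
have pl e : 0 < e -> exists2 T, t1 <= T & forall t, T <= t -> `|p t - l| <= e.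
  move=> e0; have [T tT HT] := Lf e e0; exists T => // t Tt.
  have -> : p t - l = sg * (sg * p t - l') by rewrite l'E -mulrBr mulrA sg2 mul1r.
  rewrite normrM sgn mul1r ger0_norm ?subr_ge0 ?lf ?(le_trans tT)//.
  by rewrite lerBlDl HT.
have lP : P0 <= l.
  apply/ler_addgt0Pl => e e0; have [T tT HT] := pl e e0.
  have := HT T (lexx T); rewrite ler_norml => /andP[_ h].
  by have /andP[h' _] := pP tT; lra.
have l0 : 0 < l := lt_le_trans P0_gt0 lP.
have [m m0 km] := cf_low cf.
have [T0 tT0 HT0] : exists2 T, t1 <= T & forall t, T <= t -> w t <= 2^-1 by exact: w_small.
have cos_big t : T0 <= t -> 2^-1 <= `|cos (phi t)|.
  move=> Tt; have wt := HT0 t Tt; have w0 := w_gt0 (le_trans tT0 Tt); rewrite -/(w t) in w0.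
  apply: le_sq => //; rewrite real_normK ?num_real//.
  have -> : cos (phi t) ^+ 2 = 1 - w t ^+ 2 by rewrite w2 -(cos2Dsin2 (phi t)); ring.
  have : w t ^+ 2 <= 2^-1 ^+ 2 by rewrite ler_pXn2r// nnegrE ltW.
  lra.
have [u0|u0] := leP (cos (phi T0)) 0.
  (* u stays negative: phi decreases at a definite rate *)
  apply: (@no_fast R kappa tau k p phi T0 (2 * m)) => //.
  - by rewrite mulr_gt0.
  - exact: sub.
  - exact: snT.
  left => t Tt.
  have ut : cos (phi t) <= 0.
    rewrite leNgt; apply/negP => ut.
    have cc y : T0 <= y <= t -> {for y, continuous (fun t => cos (phi t))}.
      by move=> /andP[Ty _]; apply: (sol_contcos s); exact: le_trans Ty.
    have [|y /andP[Ty _] cy] := ivt (v := 0) Tt cc; first by rewrite u0 ltW.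
    by have := cos_big y Ty; rewrite cy normr0; lra.
  have h : S (p t) * cos (phi t) <= 0 by rewrite mulr_ge0_le0 ?Sig_ge0.
  by rewrite /flowPhi; have := km (sin (phi t) * io (p t)); lra.
have up t : T0 <= t -> 0 < cos (phi t).
  move=> Tt; rewrite ltNge; apply/negP => ut.
  have cc y : T0 <= y <= t -> {for y, continuous (fun t => cos (phi t))}.
    by move=> /andP[Ty _]; apply: (sol_contcos s); exact: le_trans Ty.
  have [|y /andP[Ty _] cy] := ivt_decr (v := 0) Tt cc; first by rewrite ut ltW.
  by have := cos_big y Ty; rewrite cy normr0; lra.
have [C C0 HC] := FQ_near.
have near e : 0 < e -> exists2 T, T0 <= T & forall t, T <= t ->
    `|FQ (p t) (phi t) - (S l - 2 * k0)| <= e.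
  move=> e0; pose d := Num.min 1 (e / C).
  have d0 : 0 < d by rewrite lt_min ltr01 divr_gt0.
  have [T1 tT1 H1] := pl d d0; have [T2 tT2 H2] := w_small d0.
  exists (Num.max T0 (Num.max T1 T2)); first by rewrite le_max lexx.
  move=> t; rewrite !ge_max => /and3P[h0 h1 h2].
  apply: (@le_trans _ _ (C * d)).
    apply: HC => //; [exact: le_trans h0|by rewrite ge_min lexx|exact: H2|exact: H1|exact: up].
  by rewrite mulrC -ler_pdivlMr// ge_min lexx orbT.
have [Slt|Sgt|Seq] := ltgtP (S l) (2 * k0).
- pose d := (2 * k0 - S l) / 2; have d0 : 0 < d by rewrite divr_gt0// subr_gt0.
  have [T TT HT] := near d d0; have t1T := le_trans tT0 TT.
  apply: (no_fast d0 (sub T t1T) (snT T t1T)); left => t Tt.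
  by have := HT t Tt; rewrite ler_norml /d => /andP[_ h]; lra.
- pose d := (S l - 2 * k0) / 2; have d0 : 0 < d by rewrite divr_gt0// subr_gt0.
  have [T TT HT] := near d d0; have t1T := le_trans tT0 TT.
  apply: (no_fast d0 (sub T t1T) (snT T t1T)); right => t Tt.
  by have := HT t Tt; rewrite ler_norml /d => /andP[h _]; lra.
(* Convergence to the equilibrium is excluded by a Riccati inequality for |sin phi| / |p - l|,
   because k is flat at 0 to first order. *)
pose E t := sg * (p t - l).
have E0 t : t1 <= t -> 0 < E t.
  move=> tt; rewrite /E mulrBr -l'E subr_gt0.
  apply: le_lt_trans (sp_lt tt (_ : t < t + 1)); last by rewrite ltrDl.
  by apply: lf; rewrite (le_trans tt)// lerDl.
(* Constants of the linearized system: [a] bounds below the slope of [S] between [l] and [p t], and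
   [b] bounds below the product [p S]. *)
pose a := l / (S P2 + S l); pose b := P0 * P0.
have S20 : 0 < S P2 + S l by rewrite addr_gt0// Sig_gt0.
have a0 : 0 < a by rewrite divr_gt0.
have b0 : 0 < b by rewrite mulr_gt0.
(* With [9 e^2 <= a b / 2], completing the square absorbs the cross term [3 e psi] into half of
   [a / 2 + b psi^2]. *)
pose e := Num.min 1 (a * b / 18).
have e0 : 0 < e by rewrite lt_min ltr01 divr_gt0// mulr_gt0.
have e1 : e <= 1 by rewrite ge_min lexx.
have eab : 9 * e ^+ 2 <= a * b / 2.
  have : e <= a * b / 18 by rewrite ge_min lexx orbT.
  have : e ^+ 2 <= e by rewrite expr2 ler_piMr// ltW.
  lra.
have [d1 d10 flat] := cf_flat cf e0.
pose d2 := Num.min d1 (e / S P2).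
have SP2 : 0 < S P2 by rewrite Sig_gt0.
have d20 : 0 < d2 by rewrite lt_min d10 divr_gt0.
have [T1 tT1 HT1] := w_small d20.
pose T := Num.max T0 T1.
have tT : t1 <= T by rewrite le_max tT0.
have dE t : t1 <= t -> is_derive t 1 E (- (p t * S (p t) * w t)).
  move=> tt; have [_ pd _] := s tt.
  by rewrite /E; der; rewrite /flowP /w; ring.
have dw t : t1 <= t -> is_derive t 1 w (sg * (cos (phi t) * FQ (p t) (phi t))).
  by move=> /s[_ _ pd]; rewrite /w; der; ring.
pose psi t := w t / E t.
have dpsi t : T <= t -> is_derive t 1 psi
    (sg * (cos (phi t) * FQ (p t) (phi t)) / E t + p t * S (p t) * psi t ^+ 2).
  move=> Tt; have tt := le_trans tT Tt; have dEt := dE t tt; have dwt := dw t tt.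
  have En : E t != 0 by rewrite gt_eqF// E0.
  by rewrite /psi; der; field.
pose c := Num.min (a / 4) (b / 2).
have c0 : 0 < c by rewrite lt_min !divr_gt0.
apply: (riccati c0 dpsi) => t Tt.
have tt := le_trans tT Tt.
have T0t : T0 <= t by apply: le_trans Tt; rewrite le_max lexx.
have wt : w t <= d2 by apply: HT1; apply: le_trans Tt; rewrite le_max lexx orbT.
have w0 : 0 < w t := w_gt0 tt.
have Et := E0 t tt.
have /andP[pP0 pP2] := pP tt; have p0 : 0 < p t := lt_le_trans P0_gt0 pP0.
have utp := up t T0t.
have u1 : cos (phi t) <= 1 := cos_le1 _.
have u2 : 2^-1 <= cos (phi t) by have := cos_big t T0t; rewrite gtr0_norm.
have /andP[SP0 SpP2] := Spos tt.
have cs : cos (phi t) ^+ 2 + w t ^+ 2 = 1 by rewrite w2 cos2Dsin2.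
have wE : S (p t) * w t <= e.
  apply: (@le_trans _ _ (S P2 * (e / S P2))); last by rewrite mulrC divfK// gt_eqF.
  apply: ler_pM; [exact: Sig_ge0|exact: ltW|exact: SpP2|].
  by apply: (le_trans wt); rewrite ge_min lexx orbT.
have kf : `|k (sin (phi t) * io (p t)) - k0| <= e * w t.
  have iw : `|sin (phi t) * io (p t)| <= w t.
    rewrite normrM -absw (gtr0_norm w0) (gtr0_norm (angmax_gt0 kappa tau_gt0 p0)).
    by rewrite ler_piMr ?ltW// angmax_lt1.
  apply: (le_trans (flat _ _)).
    by apply: (le_trans iw); apply: (le_trans wt); rewrite ge_min lexx.
  by rewrite ler_pM2l.
have Sdiff : sg * (S (p t) - 2 * k0) >= a * E t.
  have Sn : S (p t) + S l != 0.
    by rewrite gt_eqF// addr_gt0// Sig_gt0.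
  have Sd : S (p t) - 2 * k0 = (p t - l) * ((p t + l) / (S (p t) + S l)).
    rewrite -Seq; apply: (mulIf Sn); rewrite mulrA divfK//.
    transitivity (S (p t) ^+ 2 - S l ^+ 2); first ring.
    by rewrite !Sig_sq//; ring.
  rewrite Sd mulrA -/(E t) mulrC ler_pM2l// /a.
  rewrite ler_pdivrMr// mulrAC ler_pdivlMr; last by rewrite addr_gt0// Sig_gt0.
  apply: ler_pM; [exact: ltW|by rewrite addr_ge0 ?Sig_ge0| |by rewrite lerD2r].
  by rewrite lerDr ltW.
have main : a / 2 * E t - 3 * e * w t <= sg * (cos (phi t) * FQ (p t) (phi t)).
  have -> : sg * (cos (phi t) * FQ (p t) (phi t)) = cos (phi t) *
    (sg * (S (p t) - 2 * k0) - sg * (S (p t) * (1 - cos (phi t)))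
     - 2 * (sg * (k (sin (phi t) * io (p t)) - k0))) by rewrite /flowPhi; ring.
  have h1 : sg * (S (p t) * (1 - cos (phi t))) <= e * w t.
    apply: (le_trans (ler_norm _)); rewrite normrM sgn mul1r normrM.
    rewrite (ger0_norm (Sig_ge0 _ _)) ger0_norm ?subr_ge0//.
    apply: (@le_trans _ _ (S (p t) * (w t * w t))); last first.
      by rewrite mulrA ler_wpM2r// ltW.
    apply: ler_wpM2l; rewrite ?Sig_ge0//.
    have -> : w t * w t = 1 - cos (phi t) ^+ 2 by rewrite -cs; ring.
    rewrite lerD2l lerN2 expr2; apply: ler_piMl => //; exact: ltW.
  have h2 : sg * (k (sin (phi t) * io (p t)) - k0) <= e * w t.
    by apply: (le_trans (ler_norm _)); rewrite normrM sgn mul1r.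
  have aE : 0 < a * E t by rewrite mulr_gt0.
  have ew : 0 < e * w t by rewrite mulr_gt0.
  apply: (@le_trans _ _ (cos (phi t) * (a * E t - 3 * (e * w t)))).
    rewrite mulrBr; apply: lerB.
      by rewrite mulrAC mulrC ler_wpM2r// ltW.
    by rewrite -[3 * e * w t]mulrA -[leRHS]mul1r ler_wpM2r// mulr_ge0 ?ltW.
  by rewrite ler_pM2l//; lra.
have psiE : w t = psi t * E t by rewrite /psi divfK// gt_eqF.
have psi0 : 0 < psi t by rewrite divr_gt0.
have h1 : a / 2 - 3 * e * psi t <= sg * (cos (phi t) * FQ (p t) (phi t)) / E t.
  rewrite ler_pdivlMr//; apply: le_trans main.
  by rewrite psiE le_eqVlt; apply/orP; left; apply/eqP; rewrite -psiE /psi; field; rewrite gt_eqF.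
have h2 : b * psi t ^+ 2 <= p t * S (p t) * psi t ^+ 2.
  by apply: ler_wpM2r; [exact: sqr_ge0|rewrite /b; apply: ler_pM => //; exact: ltW].
have h3 : 3 * e * psi t <= a / 4 + b / 2 * psi t ^+ 2.
  have A0 : a != 0 by rewrite gt_eqF.
  have : 0 <= (a / 2 - 3 * e * psi t) ^+ 2 by exact: sqr_ge0.
  have : 9 * e ^+ 2 * psi t ^+ 2 <= a * b / 2 * psi t ^+ 2 by rewrite ler_wpM2r ?sqr_ge0.
  have -> : (a / 2 - 3 * e * psi t) ^+ 2 = a ^+ 2 / 4 - a * (3 * e * psi t) + 9 * e ^+ 2 * psi t ^+ 2 by field.
  move=> g1 g2; rewrite -(ler_pM2l a0).
  have -> : a * (a / 4 + b / 2 * psi t ^+ 2) = a ^+ 2 / 4 + a * b / 2 * psi t ^+ 2 by field.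
  lra.
have c1 : c <= a / 4 by rewrite ge_min lexx.
have c2 : c * psi t ^+ 2 <= b / 2 * psi t ^+ 2.
  by apply: ler_wpM2r; [exact: sqr_ge0|rewrite ge_min lexx orbT].
rewrite mulrDr mulr1.
lra.
Qed.

End Bounded.

End NoMonotoneRay.

(** * Local signs from derivatives, and reduction modulo a period *)

Section PosRight.
Context {R : realType}.
Implicit Types (f : R -> R) (a d t c T : R).

Lemma pos_right f a d : is_derive a 1 f d -> f a = 0 -> 0 < d ->
  exists2 e, 0 < e & forall t, a < t < a + e -> 0 < f t.
Proof.
move=> /is_derive1_caratheodory[g [fE gc ga]] fa0 d0.
rewrite -ga in d0; have [e e0 H] := cont_near_gt gc d0.
exists e => // t /andP[at_ te]; have := fE t; rewrite fa0 subr0 => ->.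
rewrite mulr_gt0 ?subr_gt0//; apply: H.
by rewrite gtr0_norm ?subr_gt0// ltrBlDl.
Qed.

Lemma neg_left f a d : is_derive a 1 f d -> f a = 0 -> 0 < d ->
  exists2 e, 0 < e & forall t, a - e < t < a -> f t < 0.
Proof.
move=> /is_derive1_caratheodory[g [fE gc ga]] fa0 d0.
rewrite -ga in d0; have [e e0 H] := cont_near_gt gc d0.
exists e => // t /andP[at_ te]; have := fE t; rewrite fa0 subr0 => ->.
rewrite nmulr_llt0 ?subr_lt0//; apply: H.
by rewrite ltr0_norm ?subr_lt0// opprB ltrBlDr -ltrBlDl.
Qed.

Lemma periodic_int f T : periodic f T -> forall (n : int) t, f (t + n%:~R * T) = f t.
Proof.
move=> fT; have nat (n : nat) t : f (t + n%:R * T) = f t.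
  elim: n t => [|n IH] t; first by rewrite mul0r addr0.
  by rewrite -[RHS]IH -[RHS]fT -natr1 mulrDl mul1r addrA.
case=> n t; first exact: nat.
by rewrite -(nat n.+1 (t + _)) NegzE mulrNz mulNr subrK.
Qed.

Lemma periodic_reduce T : 0 < T -> forall t, exists n : int, 0 <= t + n%:~R * T < T.
Proof.
move=> T0 t; exists (- Num.floor (t / T)).
have := real_floor_itv (num_real (t / T)); rewrite intrD.
rewrite mulrNz mulNr; move: (Num.floor (t / T))%:~R => n /andP[h1 h2].
have -> : t - n * T = (t / T - n) * T by field; rewrite gt_eqF.
rewrite mulr_ge0 ?subr_ge0 ?(ltW T0)//= -[ltRHS]mul1r ltr_pM2r//.
by rewrite ltrBlDl.
Qed.

End PosRight.

(** * No half-infinite orbit without a zero of [sin phi] *)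

Section Canonical.
Context {R : realType} (kappa tau : R) (k : R -> R).
Hypothesis kappa_le0 : kappa <= 0.
Hypothesis tau_gt0 : 0 < tau.
Hypothesis cf : curvature_fun kappa k.
Implicit Types (p phi : R -> R) (t s a b c e d l T C M N m x y : R) (J : set R).

Local Notation S := (Sig kappa).
Local Notation io := (angmax kappa tau).
Local Notation FP := (flowP kappa).
Local Notation FQ := (flowPhi kappa tau k).
Local Notation sol := (sol kappa tau k).

Lemma sol_decr J p phi a b : sol J p phi -> a <= b -> (forall t, a <= t <= b -> J t) ->
  (forall t, a < t < b -> 0 <= sin (phi t)) -> p b <= p a.
Proof.
move=> s ab JI sn; rewrite -lerN2.
have D t : a <= t <= b -> is_derive t 1 (fun t => - p t) (- FP (p t) (phi t)).
  by move=> /JI/s[_ pd _]; exact: derN.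
apply: (derive_nondecr ab D) => t tI.
have [p0 _ _] := s t (JI t (ltac:(by case/andP: tI => ? ?; rewrite !ltW))).
by rewrite /flowP opprK mulr_ge0 ?sn// mulr_ge0 ?Sig_ge0// ltW.
Qed.

Lemma sol_sdecr J p phi a b : sol J p phi -> a < b -> (forall t, a <= t <= b -> J t) ->
  (forall t, a < t < b -> 0 < sin (phi t)) -> p b < p a.
Proof.
move=> s ab JI sn; rewrite -ltrN2.
have D t : a <= t <= b -> is_derive t 1 (fun t => - p t) (- FP (p t) (phi t)).
  by move=> /JI/s[_ pd _]; exact: derN.
apply: (derive_incr ab D) => t tI.
have [p0 _ _] := s t (JI t (ltac:(by case/andP: tI => ? ?; rewrite !ltW))).
by rewrite /flowP opprK mulr_gt0 ?sn// mulr_gt0 ?Sig_gt0.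
Qed.

Lemma sol_sincr J p phi a b : sol J p phi -> a < b -> (forall t, a <= t <= b -> J t) ->
  (forall t, a < t < b -> sin (phi t) < 0) -> p a < p b.
Proof.
move=> s ab JI sn.
have D t : a <= t <= b -> is_derive t 1 p (FP (p t) (phi t)) by move=> /JI/s[].
apply: (derive_incr ab D) => t tI.
have [p0 _ _] := s t (JI t (ltac:(by case/andP: tI => ? ?; rewrite !ltW))).
by rewrite /flowP -mulrN mulr_gt0 ?oppr_gt0 ?sn// mulr_gt0 ?Sig_gt0.
Qed.

Lemma FQ_cos_le0 m a b : (forall y, m <= k y) -> cos b <= 0 -> FQ a b <= - (2 * m).
Proof.
move=> km u; have h : S a * cos b <= 0 by rewrite mulr_ge0_le0 ?Sig_ge0.
by rewrite /flowPhi; have := km (sin b * io a); lra.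
Qed.

(** If [sin phi > 0], then [p] decreases: it stays above the threshold of [gap], hence is bounded
    away from zero, or drops below it, where the angle turns too fast. If [sin phi < 0], then [p]
    increases and only the unbounded case is new. There either [cos phi] is once nonpositive,
    remains so because [cos phi / p] decreases, and the angle turns too fast; or [cos phi] stays
    positive and tends to zero, and [p] blows up in finite time: the orbit runs into the axis. *)
Lemma no_ray p phi t1 sg : sg = 1 \/ sg = -1 -> sol (ray t1) p phi ->
  (forall t, t1 <= t -> 0 < sg * sin (phi t)) -> False.
Proof.
move=> sg1 s sn.
have snn t : t1 <= t -> sin (phi t) != 0.
  by move=> tt; apply: contraTneq (sn t tt) => ->; rewrite mulr0 ltxx.
have sub T : t1 <= T -> sol (ray T) p phi.
  by move=> tT; apply: sol_sub s => t; exact: le_trans.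
have p1 : 0 < p t1 by have [] := s t1 (lexx t1).
case: sg1 => sgE; subst sg.
  have sp t : t1 <= t -> 0 < sin (phi t) by move=> /sn; rewrite mul1r.
  have pd a b : t1 <= a -> a <= b -> p b <= p a.
    move=> ta ab; apply: (sol_decr s ab) => t /andP[/ltac:(idtac) at_ _].
      exact: le_trans ta at_.
    by rewrite ltW// sp// (le_trans ta)// ltW.
  have [P [d [P0 d0 H]]] := gap kappa_le0 tau_gt0 cf.
  have [[t2 t12 pt2]|nP] := pselect (exists2 t2, t1 <= t2 & p t2 <= P).
    apply: (no_fast d0 (sub _ t12)) => [t tt|]; first by apply: snn; exact: le_trans tt.
    left => t tt; apply: H; have [-> _ _] := s t (le_trans t12 tt).
    by rewrite (le_trans (pd _ _ t12 tt)).
  apply: (@bounded_ray_contra R kappa tau k kappa_le0 tau_gt0 cf p phi t1 1 P (p t1)) => //.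
    by left.
  move=> t tt; rewrite pd// andbT leNgt; apply/negP => pt; apply: nP.
  by exists t => //; exact: ltW.
have sp t : t1 <= t -> sin (phi t) < 0 by move=> /sn; rewrite mulN1r oppr_gt0.
have pd a b : t1 <= a -> a <= b -> p a <= p b.
  move=> ta; rewrite le_eqVlt => /predU1P[->//|ab]; apply/ltW.
  apply: (sol_sincr s ab) => t /andP[/ltac:(idtac) at_ _].
    exact: le_trans ta at_.
  by rewrite sp// (le_trans ta)// ltW.
have [[P2 HP2]|nB] := pselect (exists P2, forall t, t1 <= t -> p t <= P2).
  apply: (@bounded_ray_contra R kappa tau k kappa_le0 tau_gt0 cf p phi t1 (-1) (p t1) P2) => //.
    by right.
  by move=> t tt; rewrite pd//= HP2.
have unb N a : t1 <= a -> exists2 t, a <= t & N < p t.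
  move=> ta; apply: contrapT => nt; apply: nB; exists (Num.max N (p a)) => t tt.
  rewrite le_max; have [at_|/ltW at_] := leP a t; last by rewrite (pd t a tt at_) orbT.
  by apply/orP; left; rewrite leNgt; apply/negP => Nt; apply: nt; exists t.
have [m m0 km] := cf_low cf; have [M kM] := cf_up cf.
have M0 : 0 < M by apply: lt_le_trans m0 (le_trans (km 0) (kM 0)).
have [[t2 t12 ct2]|nC] := pselect (exists2 t2, t1 <= t2 & cos (phi t2) <= 0).
  have m20 : 0 < 2 * m by rewrite mulr_gt0.
  apply: (no_fast m20 (sub _ t12)) => [t tt|]; first by apply: snn; exact: le_trans tt.
  left => t tt; apply: FQ_cos_le0 => //.
  have D y : t2 <= y <= t -> is_derive y 1 (fun t => - (cos (phi t) / p t))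
      (- (2 * k (sin (phi y) * io (p y)) * sin (phi y) / p y)).
    move=> /andP[ty _]; apply: derN; apply: (der_ratio s); exact: le_trans t12 ty.
  have : - (cos (phi t2) / p t2) <= - (cos (phi t) / p t).
    apply: (derive_nondecr tt D) => y /andP[ty _].
    have t1y := le_trans t12 (ltW ty); have [py _ _] := s y t1y.
    rewrite -mulNr -mulrN divr_ge0 ?(ltW py)// mulr_ge0 ?oppr_ge0 ?(ltW (sp _ _))//.
    by rewrite mulr_ge0// (le_trans (ltW m0)).
  have [pt _ _] := s t (le_trans t12 tt); have [pt2 _ _] := s t2 t12.
  rewrite lerN2 => h; have : cos (phi t) / p t <= 0.
    by apply: (le_trans h); rewrite mulr_le0_ge0// invr_ge0 ltW.
  by rewrite pmulr_lle0 ?invr_gt0.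
have cpos t : t1 <= t -> 0 < cos (phi t).
  by move=> tt; rewrite ltNge; apply/negP => ct; apply: nC; exists t.
(* The correction [M / p^2] reverses the monotonicity of [cos phi / p], since [M S / p >= M >= k].
   As [f <= 1 / p] becomes arbitrarily small along the unbounded [p], the nondecreasing [f] is
   nonpositive, that is [cos phi <= M / p]. *)
pose f t := cos (phi t) / p t - M / p t ^+ 2.
have fd a b : t1 <= a -> a <= b -> f a <= f b.
  move=> ta ab.
  have D y : a <= y <= b -> is_derive y 1 f
    (- sin (phi y) * (2 * (M * (S (p y) / p y) - k (sin (phi y) * io (p y))) / p y)).
    move=> /andP[ay _]; have t1y := le_trans ta ay; have [py pdy _] := s y t1y.
    have rd := der_ratio s t1y; have pn : p y != 0 by rewrite gt_eqF.
    have pn2 : p y ^+ 2 != 0 by rewrite expf_neq0.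
    by rewrite /f; der; rewrite /flowP; field.
  apply: (derive_nondecr ab D) => y /andP[ay _].
  have t1y := le_trans ta (ltW ay); have [py _ _] := s y t1y.
  rewrite mulr_ge0 ?oppr_ge0 ?(ltW (sp _ _))// divr_ge0 ?(ltW py)// mulr_ge0// subr_ge0.
  apply: (le_trans (kM _)); rewrite -[leLHS]mulr1 ler_pM2l// ler_pdivlMr// mul1r.
  exact: Sig_ge.
have f0 t : t1 <= t -> f t <= 0.
  move=> tt; rewrite leNgt; apply/negP => ft.
  have [t2 t12 pt2] := unb (f t)^-1 t tt.
  have tt2 := le_trans tt t12; have [p2 _ _] := s t2 tt2.
  have := fd t t2 tt t12; rewrite {2}/f => h.
  have h2 : f t <= (p t2)^-1.
    apply: (le_trans h); apply: (@le_trans _ _ (cos (phi t2) / p t2)).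
      by rewrite gerBl divr_ge0 ?exprn_ge0 ?ltW.
    by rewrite ler_piMl ?cos_le1// invr_ge0 ltW.
  have : p t2 <= (f t)^-1 by rewrite -[leLHS]invrK lef_pV2 ?posrE ?invr_gt0.
  by rewrite leNgt pt2.
have [T tT pT] := unb (2 * M) t1 (lexx t1).
have pT0 : 0 < p T by have [] := s T tT.
(* From [T] on, [cos phi <= 1 / 2], so [sin phi <= - 1 / 2] and [1 / p] falls at rate at least
   [1 / 2]; after a time [4 / p T] it would be negative. *)
pose T2 := T + 4 / p T.
have TT2 : T <= T2 by rewrite lerDl divr_ge0// ltW.
have D y : T <= y <= T2 -> is_derive y 1 (fun t => - (p t)^-1 - t / 2)
    (- (S (p y) * sin (phi y) / p y) - 2^-1).
  move=> /andP[ty _]; have t1y := le_trans tT ty; have [py pdy _] := s y t1y.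
  have pn : p y != 0 by rewrite gt_eqF.
  by der; rewrite /flowP; field.
have : - (p T)^-1 - T / 2 <= - (p T2)^-1 - T2 / 2.
  apply: (derive_nondecr TT2 D) => y /andP[Ty _].
  have t1y := le_trans tT (ltW Ty); have [py _ _] := s y t1y.
  have pTy := pd T y tT (ltW Ty).
  have cy : cos (phi y) <= 2^-1.
    have := f0 y t1y; rewrite /f subr_le0 ler_pdivrMr// => h; apply: (le_trans h).
    rewrite expr2 invfM mulrA divfK ?gt_eqF// ler_pdivrMr// ler_pdivlMl//.
    exact: ltW (lt_le_trans pT pTy).
  have sy : 2^-1 <= - sin (phi y).
    apply: le_sq; first by rewrite oppr_ge0 ltW ?sp.
    have c0 := cpos y t1y; have c2 : cos (phi y) ^+ 2 <= 2^-1 ^+ 2.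
      by rewrite ler_pXn2r// nnegrE ltW.
    have -> : (- sin (phi y)) ^+ 2 = 1 - cos (phi y) ^+ 2.
      by rewrite sqrrN -(cos2Dsin2 (phi y)); ring.
    lra.
  rewrite subr_ge0 -mulrAC -mulrN; apply: (le_trans sy).
  rewrite -[leLHS]mul1r; apply: ler_wpM2r; first by rewrite oppr_ge0 ltW ?sp.
  by rewrite ler_pdivlMr// mul1r Sig_ge.
have [pT2 _ _] := s T2 (le_trans tT TT2).
have : 0 < (p T2)^-1 by rewrite invr_gt0.
have : T2 / 2 = T / 2 + 2 * (p T)^-1 by rewrite /T2; field; rewrite gt_eqF.
have : 0 < (p T)^-1 by rewrite invr_gt0.
by lra.
Qed.

End Canonical.

(** * Periodic orbits and half-periods *)

Section Periodic.
Context {R : realType} (kappa tau : R) (k : R -> R).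
Hypothesis kappa_le0 : kappa <= 0.
Hypothesis tau_gt0 : 0 < tau.
Hypothesis cf : curvature_fun kappa k.
Implicit Types (p phi : R -> R) (t s a b c e d l T C M N m x y : R) (J : set R).

Local Notation S := (Sig kappa).
Local Notation io := (angmax kappa tau).
Local Notation FP := (flowP kappa).
Local Notation FQ := (flowPhi kappa tau k).
Local Notation sol := (sol kappa tau k).

Lemma double_sin0 x : sin x = 0 -> cos (2 * x) = 1 /\ sin (2 * x) = 0.
Proof.
move=> s0; have -> : 2 * x = x + x by ring.
have := cos2Dsin2 x; rewrite s0 expr0n addr0 => c2.
by rewrite cosD sinD s0 !mulr0 !mul0r subr0 addr0 -expr2 c2.
Qed.

Lemma sin0_cos x : sin x = 0 -> cos x = 1 \/ cos x = -1.
Proof.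
move=> s0; have := cos2Dsin2 x; rewrite s0 expr0n addr0 => /eqP.
by rewrite sqrf_eq1 => /orP[]/eqP ->; [left|right].
Qed.

Lemma is_intervalT : is_interval [set: R]. Proof. by []. Qed.

Lemma sol_sym p phi T : sol setT p phi -> sin (phi T) = 0 -> forall t,
  [/\ p (2 * T - t) = p t, cos (phi (2 * T - t)) = cos (phi t) &
      sin (phi (2 * T - t)) = - sin (phi t)].
Proof.
move=> s s0 t; have [c1 c0] := double_sin0 s0.
have s' : sol setT (fun t => p (2 * T - t)) (fun t => 2 * phi T - phi (2 * T - t)).
  exact: (sol_reflect cf (T := 2 * T) c1 c0 s).
have TT : 2 * T - T = T by ring.
have i1 : p T = p (2 * T - T) by rewrite TT.
have i2 : cos (phi T) = cos (2 * phi T - phi (2 * T - T)) by rewrite TT cosB2.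
have i3 : sin (phi T) = sin (2 * phi T - phi (2 * T - T)) by rewrite TT sinB2// s0 oppr0.
have [] := sol_unique kappa_le0 tau_gt0 cf is_intervalT (I : setT T) s s' i1 i2 i3 (I : setT t).
by move=> -> -> ->; rewrite cosB2// sinB2// opprK.
Qed.

(** The reflections at [0] and at [T] compose to the translation by [2 T]. *)
Lemma sol_period p phi T : sol setT p phi -> sin (phi 0) = 0 -> sin (phi T) = 0 ->
  [/\ periodic p (2 * T), periodic (fun t => cos (phi t)) (2 * T) &
      periodic (fun t => sin (phi t)) (2 * T)].
Proof.
move=> s s0 sT.
have H t : [/\ p (t + 2 * T) = p t, cos (phi (t + 2 * T)) = cos (phi t) &
   sin (phi (t + 2 * T)) = sin (phi t)].
  have [e1 e2 e3] := sol_sym s sT (- t); rewrite opprK addrC in e1 e2 e3.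
  have [f1 f2 f3] := sol_sym s s0 t; rewrite mulr0 sub0r in f1 f2 f3.
  by rewrite e1 e2 e3 f1 f2 f3 opprK.
by split=> t; have [] := H t.
Qed.

(* The half-period from the largest value P1 of p (the smallest radius) to its smallest value. *)
Definition half_period (P1 c0 : R) p phi T := [/\ 0 < T, sol setT p phi,
  [/\ p 0 = P1, cos (phi 0) = c0 & sin (phi 0) = 0],
  cos (phi T) = 1 /\ sin (phi T) = 0 &
  forall t, 0 < t < T -> 0 < sin (phi t)].

(** A global solution of the clamped field, to be used as a solution of the original one wherever
    [Y <= P1] is known. The reflection at a zero of [sin] is established already here, before any
    such bound is available. *)
Lemma clamped_flow (P1 a0 phi0 : R) : 0 < a0 <= P1 -> sin phi0 = 0 ->
  exists Y Z : R -> R, [/\ [/\ Y 0 = a0, Z 0 = phi0 & forall t, 0 < Y t],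
    forall t, is_derive t 1 Y (cflowP kappa P1 (Y t) (Z t)),
    forall t, is_derive t 1 Z (cflowPhi kappa tau k P1 (Y t) (Z t)),
    forall J, (forall t, J t -> Y t <= P1) -> sol J Y Z &
    forall T, sin (Z T) = 0 -> forall t, Y (2 * T - t) = Y t /\ Z t = 2 * Z T - Z (2 * T - t)].
Proof.
move=> /andP[a0_gt0 a0P] sphi0; have P10 : 0 < P1 := lt_le_trans a0_gt0 a0P.
have [L [L0 FL GL]] := cfield_lip kappa_le0 tau_gt0 cf (ltW P10).
have [Y [Z [Y0 Z0 dY dZ]]] := ode_global L0 FL GL a0 phi0.
have symc T : sin (Z T) = 0 -> forall t, Y (2 * T - t) = Y t /\ Z t = 2 * Z T - Z (2 * T - t).
  move=> s0 t; have [c1 c00] := double_sin0 s0; set c := 2 * Z T in c1 c00 *.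
  have d1 x : is_derive x 1 (fun t => Y (2 * T - t))
      (cflowP kappa P1 (Y (2 * T - x)) (c - Z (2 * T - x))).
    by rewrite /cflowP FP_reflect//; exact: der_reflect.
  have d2 x : is_derive x 1 (fun t => c - Z (2 * T - t))
      (cflowPhi kappa tau k P1 (Y (2 * T - x)) (c - Z (2 * T - x))).
    rewrite /cflowPhi FQ_reflect//.
    have := derB (der_cst c x 1) (der_reflect (dZ (2 * T - x))).
    by rewrite sub0r opprK.
  have TT : 2 * T - T = T by ring.
  have i1 : Y T = Y (2 * T - T) by rewrite TT.
  have i2 : Z T = c - Z (2 * T - T) by rewrite TT /c; ring.
  have [h1 h2] := ode_unique L0 FL GL is_intervalT (I : setT T)
    (fun t _ => dY t) (fun t _ => dZ t) (fun t _ => d1 t) (fun t _ => d2 t) i1 i2 (I : setT t).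
  by rewrite -h1 {1}h2.
have cY t : {for t, continuous Y} by exact: der_cont (dY t).
have cZ t : {for t, continuous Z} by exact: der_cont (dZ t).
have cS t : {for t, continuous (fun t => sin (Z t))} by have c := cZ t; cont.
have Ypos0 t : 0 <= t -> 0 < Y t.
  move=> t0; rewrite ltNge; apply/negP => Yt.
  have Y00 : 0 < Y 0 by rewrite Y0.
  have [c [/andP[c_gt0 ct] Yc Yp]] := first_zero t0 (fun x _ => cY x) Y00 Yt.
  (* As long as [Y] is positive, [Y' >= - M Y], so [Y exp (M t)] does not decrease and [Y] cannot
     reach zero. *)
  pose M := S P1.
  have D x : 0 <= x <= c -> is_derive x 1 (fun t => Y t * expR (M * t))
      ((cflowP kappa P1 (Y x) (Z x) + M * Y x) * expR (M * x)).
    move=> _; have dYx := dY x.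
    have DL : is_derive x 1 (fun t => M * t) M by der; ring.
    have DE := derC1 (g := fun t => M * t) (is_derive_expR _) DL.
    by der; ring.
  have : Y 0 * expR (M * 0) <= Y c * expR (M * c).
    apply: (derive_nondecr (ltW c_gt0) D) => x /andP[x0 xc].
    rewrite mulr_ge0 ?expR_ge0// /cflowP /flowP addrC subr_ge0.
    have Yx : 0 < Y x by apply: Yp; rewrite ltW.
    have cl0 := clampP_ge0 P1 (Y x); have cl1 := clampP_le (Y x) (ltW P10).
    have cl2 := clampP_le_id P1 (ltW Yx).
    apply: (@le_trans _ _ (clampP P1 (Y x) * S (clampP P1 (Y x)) * 1)).
      by apply: ler_wpM2l; [rewrite mulr_ge0 ?Sig_ge0|exact: sin_le1].
    by rewrite mulr1 mulrC; apply: ler_pM; rewrite ?Sig_ge0// Sig_le.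
  by rewrite Yc mul0r mulr0 expR0 mulr1 Y0 leNgt a0_gt0.
have sZ0 : sin (Z 0) = 0 by rewrite Z0.
have Ypos t : 0 < Y t.
  have [t0|t0] := leP 0 t; first exact: Ypos0.
  have [<- _] := symc 0 sZ0 t; rewrite mulr0 sub0r Ypos0// oppr_ge0 ltW//.
have clE t : Y t <= P1 -> clampP P1 (Y t) = Y t.
  by move=> h; apply: clampP_id; rewrite ltW.
have solI J : (forall t, J t -> Y t <= P1) -> sol J Y Z.
  move=> JP t Jt; have h := clE t (JP t Jt); split; first exact: Ypos.
    by have := dY t; rewrite /cflowP h.
  by have := dZ t; rewrite /cflowPhi h.
exists Y, Z; split => //.
Qed.

(** The derivative of [sin phi] at [0] is [S P1 - 2 k 0] if [c0 = 1] and [S P1 + 2 k 0] if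
    [c0 = -1], positive in both cases, so [p] starts to decrease. By [no_ray] there is a next zero
    [T]; up to it [Y <= P1], and by reflection and periodicity always, so the clamping
    disappears. *)
Lemma half_period_exists (P1 c0 : R) : 0 < P1 ->
  (c0 = 1 /\ 2 * k 0 < S P1) \/ c0 = -1 -> exists p phi T, half_period P1 c0 p phi T.
Proof.
move=> P10 c0P.
have [phi0 [cphi0 sphi0]] : exists phi0 : R, cos phi0 = c0 /\ sin phi0 = 0.
  by case: c0P => [[-> _]|->]; [exists 0; rewrite cos0 sin0|exists pi; rewrite cospi sinpi].
have [|Y [Z [[Y0 Z0 Ypos] dY dZ solI symc]]] := @clamped_flow P1 P1 phi0 _ sphi0; first by rewrite P10 lexx.
have cY t : {for t, continuous Y} by exact: der_cont (dY t).
have cZ t : {for t, continuous Z} by exact: der_cont (dZ t).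
have cS t : {for t, continuous (fun t => sin (Z t))} by have c := cZ t; cont.
have sZ0 : sin (Z 0) = 0 by rewrite Z0.
have YleP t : (forall x, 0 < x < t -> 0 <= sin (Z x)) -> 0 <= t -> Y t <= P1.
  move=> sn t0; rewrite -Y0 -lerN2.
  have D x : 0 <= x <= t -> is_derive x 1 (fun t => - Y t) (- cflowP kappa P1 (Y x) (Z x)).
    by move=> _; exact: derN.
  apply: (derive_nondecr t0 D) => x xt; rewrite /cflowP /flowP opprK.
  by rewrite mulr_ge0 ?sn// mulr_ge0 ?Sig_ge0// clampP_ge0.
have [e e0 se] : exists2 e, 0 < e & forall t, 0 < t < 0 + e -> 0 < sin (Z t).
  have dZ0 := dZ 0; have D : is_derive (0 : R) 1 (fun t : R => sin (Z t))
    (cos (Z 0) * cflowPhi kappa tau k P1 (Y 0) (Z 0)) by der; ring.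
  apply: (pos_right D sZ0); rewrite /cflowPhi Y0 Z0 clampP_id ?lexx ?ltW//.
  rewrite /flowPhi cphi0 sphi0 mul0r.
  have [m m0 km] := cf_low cf.
  case: c0P => [[-> h]|->]; first by rewrite mul1r mulr1 subr_gt0.
  have := km 0; have := Sig_ge0 kappa P1; lra.
rewrite add0r in se.
have e20 : 0 < e / 2 by rewrite divr_gt0.
have e2e : e / 2 < e by rewrite ltr_pdivrMr// ltr_pMr// ltr1n.
have se2 : 0 < sin (Z (e / 2)) by apply: se; rewrite e20.
have [t2 t2e st2] : exists2 t2, e / 2 <= t2 & sin (Z t2) <= 0.
  apply: contrapT => nz.
  have sp t : 0 < t -> 0 < sin (Z t).
    move=> t0; have [te|et] := ltP t e; first by apply: se; rewrite t0.
    rewrite ltNge; apply/negP => st; apply: nz; exists t => //.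
    by rewrite (le_trans (ltW e2e)).
  apply: (@no_ray R kappa tau k kappa_le0 tau_gt0 cf Y Z (e / 2) 1) => [|t /= te|t te].
  - by left.
  - apply: (solI (ray (e / 2))) => // x /= xe; apply: YleP.
      by move=> y /andP[y0 _]; exact: ltW (sp y y0).
    exact: le_trans (ltW e20) xe.
  - by rewrite mul1r sp// (lt_le_trans e20).
have [T [/andP[eT Tt2] sT sp]] := first_zero t2e (fun x _ => cS x) se2 st2.
have T0 : 0 < T := lt_trans e20 eT.
have spT t : 0 < t < T -> 0 < sin (Z t).
  move=> /andP[t0 tT]; have [te|et] := ltP t e; first by apply: se; rewrite t0.
  by apply: sp; rewrite tT (le_trans (ltW e2e)).
have YT t : 0 <= t <= T -> Y t <= P1.
  move=> /andP[t0 tT]; apply: YleP => // x /andP[x0 xt].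
  by rewrite ltW// spT// x0 (lt_le_trans xt).
have Yper : periodic Y (2 * T).
  move=> t; have [e1 _] := symc T sT (- t); rewrite opprK addrC in e1.
  by have [f1 _] := symc 0 sZ0 t; rewrite mulr0 sub0r in f1; rewrite e1 f1.
have Yle t : Y t <= P1.
  have T20 : 0 < 2 * T by rewrite mulr_gt0.
  have [n] := periodic_reduce T20 t; rewrite -(periodic_int Yper n t).
  move: (t + _) => x /andP[x0 xT].
  have [xT'|Tx] := leP x T; first by apply: YT; rewrite x0.
  have [<- _] := symc T sT x; apply: YT; apply/andP; split; lra.
have s := solI setT (fun t _ => Yle t).
exists Y, Z, T; split => //; first by rewrite Z0.
split => //.
have D x : 0 <= x <= T -> is_derive x 1 (fun t => cos (Z t) / Y t)
  (2 * k (sin (Z x) * io (Y x)) * sin (Z x) / Y x) by move=> _; exact: (der_ratio s).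
have [m m0 km] := cf_low cf.
(* This rules out [cos = -1] at [T]: starting from [1 / P1] the increasing quotient stays positive,
   and starting from [- 1 / P1] it cannot end at [- 1 / Y T], which is no larger because
   [Y T <= P1]. *)
have inc : cos (Z 0) / Y 0 < cos (Z T) / Y T.
  apply: (derive_incr T0 D) => x xT; rewrite divr_gt0// mulr_gt0 ?spT//.
  by rewrite mulr_gt0// (lt_le_trans m0).
case: (sin0_cos sT) => // cT; exfalso.
move: inc; rewrite Z0 Y0 cphi0 cT ltNge => /negP; apply.
case: c0P => [[-> _]|->].
  apply: (@le_trans _ _ 0); first by rewrite mulN1r oppr_le0 invr_ge0 ltW.
  by rewrite mul1r invr_ge0 ltW.
by rewrite !mulN1r lerN2 lef_pV2 ?posrE.
Qed.

Section HalfPeriod.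
Variables (P1 c0 : R) (p phi : R -> R) (T : R).
Hypothesis hp : half_period P1 c0 p phi T.

Let T0 : 0 < T. Proof. by case: hp. Qed.
Let s : sol setT p phi. Proof. by case: hp. Qed.
Let s0 : sin (phi 0) = 0. Proof. by case: hp => _ _ []. Qed.
Let sT : sin (phi T) = 0. Proof. by case: hp => _ _ _ []. Qed.
Let sp t : 0 < t < T -> 0 < sin (phi t). Proof. by case: hp => _ _ _ _; apply. Qed.
Let p0 : p 0 = P1. Proof. by case: hp => _ _ []. Qed.

Lemma hp_sdecr a b : 0 <= a -> a < b -> b <= T -> p b < p a.
Proof.
move=> a0 ab bT; apply: (sol_sdecr kappa_le0 s ab) => // t /andP[at_ tb].
by rewrite sp// (le_lt_trans a0 at_) (lt_le_trans tb).
Qed.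

Lemma hp_fold t : exists2 x, 0 <= x <= T & [/\ p t = p x, cos (phi t) = cos (phi x) &
  sin (phi t) = sin (phi x) \/ sin (phi t) = - sin (phi x)].
Proof.
have T20 : 0 < 2 * T by rewrite mulr_gt0.
have [per1 per2 per3] := sol_period s s0 sT.
have [n] := periodic_reduce T20 t.
have := periodic_int per1 n t; have := periodic_int per2 n t; have := periodic_int per3 n t.
move: (t + _) => x /= e3 e2 e1 /andP[x0 xT].
have [xT'|Tx] := leP x T.
  by exists x; [rewrite x0|rewrite e1 e2 e3; split => //; left].
have [f1 f2 f3] := sol_sym s sT x.
exists (2 * T - x); first by apply/andP; split; lra.
by rewrite f1 f2 f3 e1 e2 e3 opprK; split => //; right.
Qed.

Lemma hp_bounds t : p T <= p t <= P1.
Proof.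
have [x /andP[x0 xT] [-> _ _]] := hp_fold t; rewrite -p0; apply/andP; split.
  by move: xT; rewrite le_eqVlt => /predU1P[->//|xT]; apply/ltW; exact: hp_sdecr.
by move: x0; rewrite le_eqVlt => /predU1P[<-//|x0]; apply/ltW; exact: hp_sdecr.
Qed.

Lemma hp_pT_gt0 : 0 < p T. Proof. by have [] := s (I : setT T). Qed.

Lemma hp_lt : p T < P1. Proof. by rewrite -p0; exact: hp_sdecr. Qed.

Lemma hp_strict t : 0 < t < 2 * T -> p t < P1.
Proof.
move=> /andP[t0 tT]; rewrite -p0; have [tT'|Tt] := leP t T; first exact: hp_sdecr.
have [<- _ _] := sol_sym s sT t; apply: hp_sdecr => //; lra.
Qed.

(** The quotient [cos phi / p] starts at [1 / P1 > 0] and does not decrease over the half-period;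
    the other times follow by folding. This is what makes the height of an unduloid monotone. *)
Lemma hp_cos_gt0 t : c0 = 1 -> 0 < cos (phi t).
Proof.
move=> c01; have [x /andP[x0 xT] [_ -> _]] := hp_fold t.
have D y : 0 <= y <= x -> is_derive y 1 (fun t => cos (phi t) / p t)
  (2 * k (sin (phi y) * io (p y)) * sin (phi y) / p y) by move=> _; exact: (der_ratio s).
have [m m0 km] := cf_low cf.
have inc : cos (phi 0) / p 0 <= cos (phi x) / p x.
  apply: (derive_nondecr x0 D) => y /andP[y0 yx]; have [py _ _] := s (I : setT y).
  rewrite divr_ge0 ?(ltW py)// mulr_ge0//.
    by rewrite mulr_ge0// (le_trans (ltW m0)).
  by rewrite ltW// sp// y0 (lt_le_trans yx).
have [px _ _] := s (I : setT x).
have : 0 < cos (phi x) / p x.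
  apply: lt_le_trans inc; case: hp => _ _ [-> -> _] _ _; rewrite c01 mul1r invr_gt0 -p0.
  by have [] := s (I : setT (0 : R)).
by rewrite pmulr_lgt0 ?invr_gt0.
Qed.

End HalfPeriod.

End Periodic.

(** * Complete orbits: zeros of [sin phi], symmetry of the domain, the sphere alternative *)

Section Classification.
Context {R : realType} (kappa tau : R) (k : R -> R).
Hypothesis kappa_le0 : kappa <= 0.
Hypothesis tau_gt0 : 0 < tau.
Hypothesis cf : curvature_fun kappa k.
Implicit Types (p phi : R -> R) (t s a b c e d l T C M N m x y : R) (J : set R).

Local Notation S := (Sig kappa).
Local Notation io := (angmax kappa tau).
Local Notation FP := (flowP kappa).
Local Notation FQ := (flowPhi kappa tau k).
Local Notation sol := (sol kappa tau k).

(** Only the right end is described; the left end is the right end of the reflected orbit. *)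
Definition blows_up J p := ((exists b, forall t, J t -> t <= b) ->
  forall M, exists2 x, J x & forall t, J t -> x <= t -> M < p t).
Definition reflected J c : set R := [set t | J (c - t)].

(* Completeness of the profile: an end at finite time is an end where the radius tends to 0. *)
Definition complete_sol J p phi := [/\ open J, is_interval J, sol J p phi,
  blows_up J p & blows_up (reflected J 0) (fun t => p (- t))].

Lemma reflected_open J c : open J -> open (reflected J c).
Proof.
move=> oJ; have : continuous (fun t => c - t : R).
  by move=> t; apply: contB; [exact: (@cont_cst R R)|exact: (@cont_id R)].
by move/continuousP; apply.
Qed.

Lemma reflected_itv J c : is_interval J -> is_interval (reflected J c).
Proof.
move=> iJ x y Jx Jy z /andP[xz zy]; apply: (iJ (c - y) (c - x)) => //.
by rewrite !lerD2l !lerN2 zy xz.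
Qed.

Lemma complete_reflect J p phi : complete_sol J p phi ->
  complete_sol (reflected J 0) (fun t => p (- t)) (fun t => - phi (- t)).
Proof.
move=> [oJ iJ s b1 b2]; split.
- exact: reflected_open.
- exact: reflected_itv.
- have := sol_reflect cf (T := 0) (@cos0 R) (@sin0 R) s.
  move=> H t /H; rewrite !sub0r => -[h1 h2 h3]; split => //.
    by have := der_near _ h2; apply; near=> x; rewrite sub0r.
  by have := der_near _ h3; apply; near=> x; rewrite !sub0r.
- exact: b2.
- have e : reflected (reflected J 0) 0 = J.
    by apply/funext => t; rewrite /reflected /= !sub0r opprK.
  by rewrite e; have -> : (fun t => p (- - t)) = p by apply/funext => t; rewrite opprK.
Unshelve. all: by end_near. Qed.

Lemma unbounded_ray J p phi t0 : complete_sol J p phi -> J t0 ->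
  (forall t, J t -> t0 <= t -> p t <= p t0) -> ray t0 `<=` J.
Proof.
move=> [oJ iJ s b1 b2] J0 pd t t0t; apply: contrapT => nJ.
have ub x : J x -> x <= t.
  by move=> Jx; rewrite leNgt; apply/negP => tx; apply: nJ; apply: (iJ t0 x) => //; rewrite t0t ltW.
have [x Jx H] := b1 (ex_intro _ t ub) (p t0).
have Jm : J (Num.max x t0) by have [_|_] := leP x t0.
have := H _ Jm; rewrite le_max lexx => /(_ isT).
by rewrite ltNge pd// le_max lexx orbT.
Qed.

(** With [sin phi > 0] the function [p] decreases, so the orbit has no finite right end, where [p]
    would blow up; the remaining ray is excluded by [no_ray]. *)
Lemma exists_zero_pos J p phi t0 : complete_sol J p phi -> J t0 ->
  ~ (forall t, J t -> 0 < sin (phi t)).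
Proof.
move=> cs J0 sp; have [oJ iJ s b1 b2] := cs.
have rJ : ray t0 `<=` J.
  apply: (unbounded_ray cs J0) => t Jt t0t; apply: (sol_decr s t0t).
    by move=> x xI; exact: iJ J0 Jt _ xI.
  by move=> x /andP[x0 xt]; apply/ltW/sp; apply: (iJ t0 t J0 Jt); rewrite !ltW.
apply: (@no_ray R kappa tau k kappa_le0 tau_gt0 cf p phi t0 1).
- by left.
- exact: sol_sub s.
- by move=> t tt; rewrite mul1r; apply: sp; exact: rJ.
Qed.

(** Without a zero [sin phi] keeps its sign; the negative sign becomes positive under reflection of
    time. *)
Lemma exists_zero J p phi t0 : complete_sol J p phi -> J t0 ->
  exists2 t1, J t1 & sin (phi t1) = 0.
Proof.
move=> cs J0; have [oJ iJ s b1 b2] := cs; apply: contrapT => nz.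
have cont_ a b : J a -> J b -> forall x, a <= x <= b -> {for x, continuous (fun t => sin (phi t))}.
  by move=> Ja Jb x xI; apply: (sol_contsin s); exact: (iJ a b).
have const a b : J a -> J b -> a <= b -> 0 < sin (phi a) * sin (phi b).
  move=> Ja Jb ab; rewrite ltNge; apply/negP => h; apply: nz.
  have [sa|sa|sa] := ltgtP (sin (phi a)) 0; last by exists a.
  - have sb : 0 <= sin (phi b).
      by rewrite leNgt; apply/negP => sb; have := nmulr_rgt0 (sin (phi b)) sa; rewrite sb ltNge h.
    have [|c cI <-] := ivt ab (cont_ a b Ja Jb) (v := 0); first by rewrite sb ltW.
    by exists c => //; exact: (iJ a b).
  - have sb : sin (phi b) <= 0.
      by rewrite leNgt; apply/negP => sb; have := pmulr_rgt0 (sin (phi b)) sa; rewrite sb ltNge h.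
    have [|c cI <-] := ivt_decr ab (cont_ a b Ja Jb) (v := 0); first by rewrite sb ltW.
    by exists c => //; exact: (iJ a b).
have same a : J a -> 0 < sin (phi t0) * sin (phi a).
  move=> Ja; have [h|/ltW h] := leP t0 a; first exact: const.
  by rewrite mulrC; exact: const.
have [sa|sa|sa] := ltgtP (sin (phi t0)) 0; last by apply: nz; exists t0.
  apply: (exists_zero_pos (complete_reflect cs) (t0 := - t0)).
    by rewrite /reflected /= sub0r opprK.
  move=> t; rewrite /reflected /= sub0r => Jt; rewrite sinN oppr_gt0.
  by have := same _ Jt; rewrite nmulr_rgt0.
apply: (exists_zero_pos cs J0) => t Jt.
by have := same _ Jt; rewrite pmulr_rgt0.
Qed.

Lemma sym_on J p phi t0 t : is_interval J -> sol J p phi -> sin (phi t0) = 0 -> J t0 ->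
  J t -> J (2 * t0 - t) ->
  [/\ p (2 * t0 - t) = p t, cos (phi (2 * t0 - t)) = cos (phi t) &
      sin (phi (2 * t0 - t)) = - sin (phi t)].
Proof.
move=> iJ s s0 J0 Jt Jt'; have [c1 c0] := double_sin0 s0.
pose J' := J `&` [set x | J (2 * t0 - x)].
have iJ' : is_interval J'.
  move=> x y [Jx Jx'] [Jy Jy'] z /andP[xz zy]; split; first by apply: (iJ x y) => //; rewrite xz.
  by apply: (iJ (2 * t0 - y) (2 * t0 - x)) => //; rewrite !lerD2l !lerN2 zy.
have TT : 2 * t0 - t0 = t0 by ring.
have J'0 : J' t0 by split; rewrite //= TT.
have s1 : sol J' p phi by apply: sol_sub s => x [].
have s2 : sol J' (fun t => p (2 * t0 - t)) (fun t => 2 * phi t0 - phi (2 * t0 - t)).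
  by apply: sol_sub (sol_reflect cf (T := 2 * t0) c1 c0 s) => x [].
have i1 : p t0 = p (2 * t0 - t0) by rewrite TT.
have i2 : cos (phi t0) = cos (2 * phi t0 - phi (2 * t0 - t0)) by rewrite TT cosB2.
have i3 : sin (phi t0) = sin (2 * phi t0 - phi (2 * t0 - t0)) by rewrite TT sinB2// s0 oppr0.
have Jtt : J' t by [].
have [] := sol_unique kappa_le0 tau_gt0 cf iJ' J'0 s1 s2 i1 i2 i3 Jtt.
by move=> -> -> ->; rewrite cosB2// sinB2// opprK.
Qed.

(** If the domain ended on the left before the mirror image of [t], then [p] would blow up there,
    whereas its values mirror those on [[t0, t]], where [p] is bounded. *)
Lemma sym_domain_right J p phi t0 t : complete_sol J p phi -> sin (phi t0) = 0 -> J t0 ->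
  J t -> t0 <= t -> J (2 * t0 - t).
Proof.
move=> cs s0 J0 Jt t0t; have [oJ iJ s b1 b2] := cs; apply: contrapT => nJ.
have lb x : J x -> 2 * t0 - t <= x.
  move=> Jx; rewrite leNgt; apply/negP => xt; apply: nJ; apply: (iJ x t0) => //.
  by rewrite (ltW xt) /=; lra.
have ub : exists b, forall x, reflected J 0 x -> x <= b.
  exists (- (2 * t0 - t)) => x; rewrite /reflected /= sub0r => Jx.
  by rewrite -[x]opprK lerN2 lb.
have [M HM] : exists M, forall x, t0 <= x <= t -> p x <= M.
  have [c _ H] := EVT_max t0t (cont_withinI (fun x xI => sol_contp s (iJ _ _ J0 Jt _ xI))).
  by exists (p c) => x xI; apply: H; rewrite in_itv.
have [y Jy H] := b2 ub M.
rewrite /reflected /= sub0r in Jy.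
pose x := Num.min (- y) t0.
have Jx : J x by rewrite /x; have [_|_] := leP (- y) t0.
have xt0 : x <= t0 by rewrite ge_min lexx orbT.
have xy : x <= - y by rewrite ge_min lexx.
have := H (- x); rewrite /reflected /= sub0r opprK => /(_ Jx).
rewrite -[y]opprK lerN2 => /(_ xy); rewrite ltNge => /negP; apply.
have rI : t0 <= 2 * t0 - x <= t by have := lb x Jx => ?; apply/andP; split; lra.
have Jr : J (2 * t0 - x) by exact: (iJ t0 t).
by have [<- _ _] := sym_on iJ s s0 J0 Jx Jr; exact: HM.
Qed.

Lemma sym_domain J p phi t0 t : complete_sol J p phi -> sin (phi t0) = 0 -> J t0 ->
  J t -> J (2 * t0 - t).
Proof.
move=> cs s0 J0 Jt; have [h|/ltW h] := leP t0 t; first exact: (sym_domain_right cs).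
have := @sym_domain_right _ _ _ (- t0) (- t) (complete_reflect cs).
rewrite /reflected /= !sub0r !opprK lerN2 sinN s0 oppr0 => /(_ erefl J0 Jt h).
by congr (J _); ring.
Qed.

Lemma complete_bounded J p phi t0 M : complete_sol J p phi -> J t0 ->
  (forall t, J t -> p t <= M) -> J = setT.
Proof.
move=> [oJ iJ s b1 b2] J0 pM; apply/funext => t; apply/propext; split => // _.
apply: contrapT => nJ; have [h|h] := leP t0 t.
  have ub x : J x -> x <= t.
    by move=> Jx; rewrite leNgt; apply/negP => tx; apply: nJ; apply: (iJ t0 x) => //; rewrite h ltW.
  have [x Jx H] := b1 (ex_intro _ t ub) M.
  by have := H x Jx (lexx x); rewrite ltNge pM.
have ub : exists b, forall x, reflected J 0 x -> x <= b.
  exists (- t) => x; rewrite /reflected /= sub0r => Jx; rewrite lerNr leNgt; apply/negP => tx.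
  by apply: nJ; apply: (iJ (- x) t0) => //; rewrite !ltW.
have [x Jx H] := b2 ub M.
by have := H x Jx (lexx x); rewrite ltNge pM// -sub0r.
Qed.

Lemma equilibrium J p phi t0 : is_interval J -> sol J p phi -> J t0 -> sin (phi t0) = 0 ->
  cos (phi t0) = 1 -> S (p t0) = 2 * k 0 -> forall t, J t -> p t = p t0 /\ sin (phi t) = 0 /\ cos (phi t) = 1.
Proof.
move=> iJ s J0 s0 c1 S0 t Jt.
have s' : sol J (fun=> p t0) (fun=> phi t0).
  move=> x _; have [p0 _ _] := s t0 J0; split => //.
    by rewrite /flowP s0 mulr0 oppr0; exact: der_cst.
  by rewrite /flowPhi s0 c1 mul0r mulr1 S0 subrr; exact: der_cst.
by have [-> -> ->] := sol_unique kappa_le0 tau_gt0 cf iJ J0 s s' erefl erefl erefl Jt.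
Qed.

Lemma der_sin J p phi t : sol J p phi -> J t ->
  is_derive t 1 (fun t => sin (phi t)) (cos (phi t) * FQ (p t) (phi t)).
Proof. by move=> s /s[_ _ pd]; der; ring. Qed.

Lemma FQ_zero p phi t : sin (phi t) = 0 -> cos (phi t) = 1 ->
  cos (phi t) * FQ (p t) (phi t) = S (p t) - 2 * k 0.
Proof. by move=> s0 c1; rewrite /flowPhi s0 c1 mul0r mulr1 mul1r. Qed.

(** The orbit of a sphere, with its equator at [t0]. The signs to the right of the equator follow
    from the symmetry. *)
Definition sphere_sol J p phi t0 r := [/\ 0 < r, forall t, J t <-> t0 - r < t < t0 + r,
  sin (phi t0) = 0, forall t, t0 - r < t < t0 -> 0 < sin (phi t) &
  forall t, J t -> 0 < cos (phi t)].

(** The condition [S < 2 k 0] makes [sin phi] positive just before [t0]. Going back in time,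
    consider the last zero of [sin phi] before [t0]: if [cos phi = 1] there, then [S < 2 k 0] would
    make [sin phi] negative just after it, and equality would make the orbit constant. Without such
    a zero the orbit has a finite left end by [no_ray], and symmetry about [t0] yields the
    sphere. *)
Lemma from_maximal_radius J p phi t0 : complete_sol J p phi -> J t0 ->
  sin (phi t0) = 0 -> cos (phi t0) = 1 -> S (p t0) < 2 * k 0 ->
  (exists t1, [/\ J t1, sin (phi t1) = 0 &
     cos (phi t1) = -1 \/ cos (phi t1) = 1 /\ 2 * k 0 < S (p t1)]) \/
  exists r, sphere_sol J p phi t0 r.
Proof.
move=> cs J0 s0 c1 S0; have [oJ iJ s b1 b2] := cs.
have [e e0 se] : exists2 e, 0 < e & forall t, t0 - e < t < t0 -> - sin (phi t) < 0.
  have D := derN (der_sin s J0); apply: (neg_left D); first by rewrite s0 oppr0.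
  by rewrite FQ_zero// oppr_gt0 subr_lt0.
have {}se t : t0 - e < t < t0 -> 0 < sin (phi t) by move=> /se; rewrite oppr_lt0.
have [[t2 [Jt2 t20 st2]]|np] := pselect (exists t2, [/\ J t2, t2 < t0 & sin (phi t2) <= 0]).
  left.
  (* Time is reversed so that [first_zero] finds the last zero before [t0]. *)
  pose f x := sin (phi (- x)).
  have t2e : t2 <= t0 - e by rewrite leNgt; apply/negP => h; have := se t2; rewrite h t20 => /(_ isT); rewrite ltNge st2.
  have h1 : - (t0 - e / 2) <= - t2 by rewrite lerN2; lra.
  have fc x : - (t0 - e / 2) <= x <= - t2 -> {for x, continuous f}.
    move=> /andP[h2 h3]; have Jx : J (- x).
      by apply: (iJ t2 t0) => //; apply/andP; split; lra.
    by apply: (contC (h := fun t => sin (phi t)) (f := fun x => - x) (sol_contsin s Jx)); apply: contN; exact: (@cont_id R).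
  have f1 : 0 < f (- (t0 - e / 2)) by rewrite /f opprK se//; apply/andP; split; lra.
  have f2 : f (- t2) <= 0 by rewrite /f opprK.
  have [x [/andP[x1 x2] fx fp]] := first_zero h1 fc f1 f2.
  have Jx : J (- x) by apply: (iJ t2 t0) => //; apply/andP; split; lra.
  have pos t : - x < t < t0 -> 0 < sin (phi t).
    move=> /andP[xt tt]; have [h|h] := ltP (t0 - e) t; first by rewrite se// h.
    by have := fp (- t); rewrite /f opprK; apply; apply/andP; split; lra.
  exists (- x); split => //.
  have [c1x|] := sin0_cos fx; last by left.
  right; split => //.
  have [//|Sx|Sx] := ltgtP (2 * k 0) (S (p (- x))).
    have D := derN (der_sin s Jx).
    have [d d0 sd] : exists2 d, 0 < d & forall t, - x < t < - x + d -> 0 < - sin (phi t).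
      apply: (pos_right D); first by move: fx; rewrite /f => ->; rewrite oppr0.
      by rewrite FQ_zero// oppr_gt0 subr_lt0.
    pose y := - x + Num.min (d / 2) ((t0 + x) / 2).
    have my : 0 < Num.min (d / 2) ((t0 + x) / 2) by rewrite lt_min divr_gt0// divr_gt0//; lra.
    have yd : Num.min (d / 2) ((t0 + x) / 2) < d by rewrite gt_min; apply/orP; left; lra.
    have yt : Num.min (d / 2) ((t0 + x) / 2) < t0 + x by rewrite gt_min; apply/orP; right; lra.
    have := sd y; have := pos y; rewrite /y => g1 g2.
    have := g1 (ltac:(apply/andP; split; lra)); have := g2 (ltac:(apply/andP; split; lra)).
    by move=> *; lra.
  have [e1 _] := equilibrium iJ s Jx fx c1x (esym Sx) J0.
  by move: S0; rewrite e1 Sx ltxx.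
right.
have sp t : J t -> t < t0 -> 0 < sin (phi t).
  by move=> Jt tt; rewrite ltNge; apply/negP => st; apply: np; exists t.
have [lb|nlb] := pselect (exists b, forall t, J t -> b <= t); last first.
  exfalso.
  have allJ t : t <= t0 -> J t.
    move=> tt; apply: contrapT => nJ; apply: nlb; exists t => x Jx.
    by rewrite leNgt; apply/negP => xt; apply: nJ; apply: (iJ x t0) => //; rewrite ltW.
  have [_ _ s' _ _] := complete_reflect cs.
  apply: (@no_ray R kappa tau k kappa_le0 tau_gt0 cf _ _ (- t0 + 1) (-1) _ (sol_sub _ s')).
  - by right.
  - move=> t tt; have {}tt : - t0 + 1 <= t := tt.
    by rewrite /reflected /= sub0r; apply: allJ; lra.
  - by move=> t tt; rewrite mulN1r sinN opprK; apply: sp; [apply: allJ|]; lra.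
have hJ : has_inf J by split; [exists t0|have [b hb] := lb; exists b].
pose a := inf J.
have nJa : ~ J a.
  move=> Ja; have /nbhs_ballP[d d0 H] := open_nbhs_nbhs (conj oJ Ja); have {}d0 : 0 < d := d0.
  have : J (a - d / 2).
    apply: H; rewrite /ball/= opprB addrC subrK gtr0_norm ?divr_gt0//; lra.
  by move/(ge_inf hJ.2) => h; have : a <= a - d / 2 by []; lra.
have aJ t : J t -> a < t.
  move=> Jt; rewrite lt_neqAle; apply/andP; split; last exact: ge_inf hJ.2 _ Jt.
  by apply/eqP => at_; apply: nJa; rewrite at_.
have Ja t : a < t -> t <= t0 -> J t.
  move=> at_ tt; have ta : 0 < t - a by rewrite subr_gt0.
  have [x Jx xt] := inf_adherent ta hJ.
  by apply: (iJ x t0) => //; rewrite tt andbT ltW//; apply: (lt_le_trans xt); rewrite addrC subrK.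
have a0 : a < t0 by exact: aJ.
pose r := t0 - a.
have ra : t0 - r = a by rewrite /r; ring.
have r0 : 0 < r by rewrite subr_gt0.
have JE t : J t <-> t0 - r < t < t0 + r.
  rewrite ra; split=> [Jt|/andP[at_ tr]].
    rewrite aJ//=; have := aJ _ (sym_domain cs s0 J0 Jt); rewrite /r; lra.
  have [h|h] := leP t t0; first exact: Ja.
  have : J (2 * t0 - t) by apply: Ja; move: tr; rewrite /r => ?; lra.
  move/(sym_domain cs s0 J0); congr (J _); ring.
exists r; split => // [t /andP[h1 h2]|].
  by apply: sp => //; apply/JE; rewrite h1 /=; lra.
have [m m0 km] := cf_low cf.
have ub : exists b, forall x, reflected J 0 x -> x <= b.
  exists (- a) => x; rewrite /reflected /= sub0r => /aJ; lra.
have inc x y : J x -> x < y -> y <= t0 -> cos (phi x) / p x < cos (phi y) / p y.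
  move=> Jx xy yt; have JI z : x <= z <= y -> J z.
    by move=> /andP[xz zy]; apply: (iJ x t0) => //; rewrite xz (le_trans zy).
  apply: (derive_incr xy (fun z zI => der_ratio s (JI z zI))) => z /andP[xz zy].
  have Jz : J z by apply: JI; rewrite !ltW.
  have [pz _ _] := s z Jz.
  rewrite divr_gt0// mulr_gt0 ?sp//; last exact: lt_le_trans yt.
  by rewrite mulr_gt0// (lt_le_trans m0).
(* The quotient [cos phi / p] increases up to [t0] and is at least [- 1 / p], which tends to zero at
   the left end; a nonpositive value would force values bounded away from zero by a negative
   constant nearer to the end. *)
have cpos t : J t -> t <= t0 -> 0 < cos (phi t).
  move=> Jt tt; have [pt _ _] := s t Jt.
  suff : 0 < cos (phi t) / p t by rewrite pmulr_lgt0 ?invr_gt0.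
  rewrite ltNge; apply/negP => gt.
  have at_ := aJ t Jt; pose t2 := (a + t) / 2.
  have t2t : t2 < t by rewrite /t2; lra.
  have Jt2 : J t2 by apply: Ja; rewrite /t2; lra.
  have [pt2 _ _] := s t2 Jt2.
  have g2 : cos (phi t2) / p t2 < 0 by apply: lt_le_trans gt; exact: inc.
  have [y Jy H] := b2 ub (- (cos (phi t2) / p t2))^-1.
  rewrite /reflected /= sub0r in Jy.
  pose x := Num.min (- y) ((a + t2) / 2).
  have at2 := aJ t2 Jt2.
  have Jx : J x by rewrite /x; have [_|_] := leP (- y) _ => //; apply: Ja; lra.
  have xt2 : x < t2 by rewrite gt_min; apply/orP; right; lra.
  have xy : y <= - x by rewrite lerNr ge_min lexx.
  have := H (- x); rewrite /reflected /= sub0r opprK => /(_ Jx xy) px.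
  have [px0 _ _] := s x Jx.
  have := inc x t2 Jx xt2 (ltW (lt_le_trans t2t tt)).
  apply/negP; rewrite -leNgt.
  apply: (@le_trans _ _ (- (p x)^-1)).
    rewrite lerNr -[leRHS]invrK lef_pV2 ?posrE ?invr_gt0 ?oppr_gt0//; exact: ltW.
  rewrite -mulN1r; apply: ler_wpM2r; [by rewrite invr_ge0 ltW|exact: cos_geN1].
move=> t Jt; have [h|h] := leP t t0; first exact: cpos.
have Jt' := sym_domain cs s0 J0 Jt.
by have [_ <- _] := sym_on iJ s s0 J0 Jt Jt'; apply: cpos => //; lra.
Qed.

End Classification.

(** * The radius as a function of [p] *)

Section Radius.
Context {R : realType} (kappa tau : R) (k : R -> R).
Hypothesis kappa_le0 : kappa <= 0.
Hypothesis tau_gt0 : 0 < tau.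
Hypothesis cf : curvature_fun kappa k.
Implicit Types (p phi : R -> R) (t s a b x y dp : R) (J : set R).

Local Notation S := (Sig kappa).
Local Notation io := (angmax kappa tau).
Local Notation sol := (sol kappa tau k).

(** The positive root of [kappa x^2 - 4 a x + 4 = 0], written in the form that also makes sense for
    [kappa = 0]. *)
Definition rad_of a : R := 2 / (a + S a).
Definition inv_rad x : R := x^-1 + kappa * x / 4.

Lemma rad_gt0 a : 0 < a -> 0 < rad_of a.
Proof. by move=> a0; rewrite divr_gt0// addr_gt0// Sig_gt0. Qed.

Lemma rad_sum a : 0 < a -> rad_of a * (a + S a) = 2.
Proof. by move=> a0; rewrite divfK// gt_eqF// addr_gt0// Sig_gt0. Qed.

Lemma rad_diff a : 0 < a -> 2 * (a - S a) = kappa * rad_of a.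
Proof.
move=> a0; have d0 : a + S a != 0 by rewrite gt_eqF// addr_gt0// Sig_gt0.
have e := Sig_sq kappa_le0 a; apply: (mulIf d0).
rewrite -[RHS]mulrA rad_sum//; have : (a - S a) * (a + S a) = kappa.
  by rewrite -subr_sqr e; ring.
by rewrite -mulrA => ->; ring.
Qed.

Lemma inv_radK a : 0 < a -> inv_rad (rad_of a) = a.
Proof.
move=> a0; have r0 := rad_gt0 a0; have e1 := rad_diff a0; have e2 := rad_sum a0.
rewrite /inv_rad -e1; have -> : (rad_of a)^-1 = (a + S a) / 2.
  by apply: (mulfI (lt0r_neq0 r0)); rewrite mulfV ?lt0r_neq0// mulrA e2 mulfV.
by field.
Qed.

Lemma Sig_rad a : 0 < a -> S a = (rad_of a)^-1 - kappa * rad_of a / 4.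
Proof.
move=> a0; have r0 := rad_gt0 a0; have e1 := rad_diff a0; have e2 := rad_sum a0.
have -> : (rad_of a)^-1 = (a + S a) / 2.
  by apply: (mulfI (lt0r_neq0 r0)); rewrite mulfV ?lt0r_neq0// mulrA e2 mulfV.
by rewrite -e1; field.
Qed.

Lemma inv_rad_gt0 x : 0 < x -> 0 < 4 + kappa * x ^+ 2 -> 0 < inv_rad x.
Proof.
move=> x0 h; have -> : inv_rad x = (4 + kappa * x ^+ 2) / (4 * x).
  by rewrite /inv_rad; field; rewrite lt0r_neq0.
by rewrite divr_gt0// mulr_gt0.
Qed.

Lemma Sig_inv_rad x : 0 < x -> S (inv_rad x) = x^-1 - kappa * x / 4.
Proof.
move=> x0; rewrite /Sig; have -> : inv_rad x ^+ 2 - kappa = (x^-1 - kappa * x / 4) ^+ 2.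
  by rewrite /inv_rad; field; rewrite lt0r_neq0.
rewrite sqrtr_sqr ger0_norm// subr_ge0; apply: (@le_trans _ _ 0); last by rewrite invr_ge0 ltW.
by rewrite pmulr_lle0// mulr_le0_ge0// ltW.
Qed.

Lemma radK x : 0 < x -> 0 < 4 + kappa * x ^+ 2 -> rad_of (inv_rad x) = x.
Proof.
move=> x0 h; rewrite /rad_of Sig_inv_rad// /inv_rad; field.
rewrite lt0r_neq0//=.
have -> : 4 + kappa * x * x + (4 + - (kappa * x) * x) = 8 by ring.
by rewrite pnatr_eq0.
Qed.

Lemma rad_ambient a : 0 < a -> 0 < 4 + kappa * rad_of a ^+ 2.
Proof.
move=> a0; have r0 := rad_gt0 a0.
have -> : 4 + kappa * rad_of a ^+ 2 = 4 * rad_of a * inv_rad (rad_of a).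
  by rewrite /inv_rad; field; rewrite lt0r_neq0.
by rewrite inv_radK// mulr_gt0// mulr_gt0// ltr0n.
Qed.

Lemma conf_rad a : 0 < a -> 4 / (4 + kappa * rad_of a ^+ 2) = (a * rad_of a)^-1.
Proof.
move=> a0; have r0 := rad_gt0 a0; have h := rad_ambient a0.
rewrite -{2}[a]inv_radK// /inv_rad; by field; rewrite !lt0r_neq0//= -mulrA -expr2.
Qed.

Lemma rad_le_inv a : 0 < a -> rad_of a <= a^-1.
Proof.
move=> a0; rewrite /rad_of ler_pdivrMr ?addr_gt0 ?Sig_gt0// ler_pdivlMl//.
by have := Sig_ge kappa_le0 a; lra.
Qed.

Lemma rad_lt a b : 0 < a -> a < b -> rad_of b < rad_of a.
Proof.
move=> a0 ab; have b0 := lt_trans a0 ab; have h := Sig_lt kappa_le0 (ltW a0) ab.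
rewrite /rad_of ltr_pM2l// ltf_pV2 ?posrE ?addr_gt0 ?Sig_gt0//; exact: ltrD.
Qed.

Lemma rad_inj a b : 0 < a -> 0 < b -> rad_of a = rad_of b -> a = b.
Proof. by move=> a0 b0 e; rewrite -[a]inv_radK// -[b]inv_radK// e. Qed.

Lemma angmax_rad a : 0 < a -> io a ^+ 2 * (1 + tau ^+ 2 * rad_of a ^+ 2) = 1.
Proof.
move=> a0; have d0 : 0 < a + S a by rewrite addr_gt0// Sig_gt0.
have w0 : 0 < (a + S a) ^+ 2 + 4 * tau ^+ 2 by rewrite addr_gt0// ?mulr_gt0// exprn_gt0.
rewrite /angmax /angmax_of /twice_inv_rad /rad_of expr_div_n sqr_sqrtr ?ltW//.
field; rewrite !lt0r_neq0//=.
Qed.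

Lemma angmaxE a : 0 < a -> io a = (Num.sqrt (1 + tau ^+ 2 * rad_of a ^+ 2))^-1.
Proof.
move=> a0; have e := angmax_rad a0; have i0 : 0 < io a := angmax_gt0 kappa tau_gt0 a0.
have q0 : 0 < 1 + tau ^+ 2 * rad_of a ^+ 2 by rewrite addr_gt0// mulr_gt0// exprn_gt0// rad_gt0.
rewrite -sqrtrV ?ltW//; have -> : (1 + tau ^+ 2 * rad_of a ^+ 2)^-1 = io a ^+ 2.
  by apply: (mulIf (lt0r_neq0 q0)); rewrite e mulVf// lt0r_neq0.
by rewrite sqrtr_sqr gtr0_norm.
Qed.

Lemma der_Sig p t dp : 0 < p t -> is_derive t 1 p dp ->
  is_derive t 1 (fun t => S (p t)) (p t * dp / S (p t)).
Proof.
move=> p0 D; have w0 : 0 < p t ^+ 2 - kappa by rewrite ltr_wpDr ?oppr_ge0// exprn_gt0.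
have S0 := Sig_gt0 kappa_le0 p0.
have := derC1 (is_derive1_sqrt w0) (g := fun t => p t ^+ 2 - kappa).
have E : is_derive t 1 (fun t => p t ^+ 2 - kappa) (2 * p t * dp) by der; ring.
move/(_ _ E) => {}E; notypeclasses refine (is_derive_eq E _).
by rewrite /Sig; field; rewrite lt0r_neq0.
Qed.

Lemma der_rad p t dp : 0 < p t -> is_derive t 1 p dp ->
  is_derive t 1 (fun t => rad_of (p t)) (- rad_of (p t) * dp / S (p t)).
Proof.
move=> p0 D; have DS := der_Sig p0 D; have S0 := Sig_gt0 kappa_le0 p0.
have n0 : p t + S (p t) != 0 by rewrite lt0r_neq0// addr_gt0.
rewrite /rad_of; der; field; rewrite n0 lt0r_neq0//.
Qed.

Lemma der_angmax p t dp : 0 < p t -> is_derive t 1 p dp ->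
  is_derive t 1 (fun t => io (p t))
    (tau ^+ 2 * rad_of (p t) ^+ 2 * io (p t) ^+ 3 * dp / S (p t)).
Proof.
move=> p0 D; have DS := der_Sig p0 D; have S0 := Sig_gt0 kappa_le0 p0.
have D2 : is_derive t 1 (fun t => p t + S (p t)) (dp + p t * dp / S (p t)) by der.
have n0 : 0 < p t + S (p t) by rewrite addr_gt0.
have E := derC1 (g := fun t => p t + S (p t)) (angmax_of_der tau_gt0 _) D2.
notypeclasses refine (is_derive_eq E _).
rewrite /rad_of /angmax /angmax_of /twice_inv_rad.
set w := Num.sqrt _; have w0 : 0 < w.
  by rewrite sqrtr_gt0 addr_gt0// ?mulr_gt0// exprn_gt0.
by field; rewrite !lt0r_neq0.
Qed.

End Radius.

(** * Strict monotonicity of the angle function on spheres *)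

Section SphereAngle.
Context {R : realType} (kappa tau : R) (k : R -> R).
Hypothesis kappa_le0 : kappa <= 0.
Hypothesis tau_gt0 : 0 < tau.
Hypothesis cf : curvature_fun kappa k.
Implicit Types (p phi : R -> R) (t s a b c e d l T C M N m x y : R) (J : set R).

Local Notation S := (Sig kappa).
Local Notation io := (angmax kappa tau).
Local Notation rad_of := (rad_of kappa).
Local Notation FP := (flowP kappa).
Local Notation FQ := (flowPhi kappa tau k).
Local Notation sol := (sol kappa tau k).

Definition flow_angle p phi t := sin (phi t) * io (p t).
Local Notation nu := flow_angle.

(** The value that [2 k] must take for the angle to be stationary: the angle has derivative
    [io cos phi (angle_force - 2 k nu)]. *)
Definition angle_force p phi t :=
  ((1 - nu p phi t ^+ 2) * S (p t) - 2 * tau ^+ 2 * rad_of (p t) * nu p phi t ^+ 2) / cos (phi t).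

Lemma angle_sq p phi t : 0 < p t ->
  cos (phi t) ^+ 2 = (1 - nu p phi t ^+ 2) - tau ^+ 2 * rad_of (p t) ^+ 2 * nu p phi t ^+ 2.
Proof.
move=> p0; have e := angmax_rad kappa_le0 tau_gt0 p0.
rewrite cos2sin2 /nu exprMn.
by rewrite -[X in 1 - X = _]mulr1 -e; ring.
Qed.

Lemma der_flow_angle J p phi t : sol J p phi -> J t -> cos (phi t) != 0 ->
  is_derive t 1 (nu p phi)
    (io (p t) * cos (phi t) * (angle_force p phi t - 2 * k (nu p phi t))).
Proof.
move=> s Jt c0; have [p0 Dp Dphi] := s t Jt.
have S0 := Sig_gt0 kappa_le0 p0.
have Dio := der_angmax kappa_le0 tau_gt0 p0 Dp.
have e2 := angle_sq phi p0; have e1 := rad_sum kappa_le0 p0.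
rewrite /flow_angle; der; rewrite -!/(nu p phi t) /angle_force /flowP /flowPhi -/(nu p phi t).
have -> : io (p t) * cos (phi t) *
  (((1 - nu p phi t ^+ 2) * S (p t) - 2 * tau ^+ 2 * rad_of (p t) * nu p phi t ^+ 2) / cos (phi t) -
   2 * k (nu p phi t)) = io (p t) * ((1 - nu p phi t ^+ 2) * S (p t)
   - rad_of (p t) * (p t + S (p t)) * tau ^+ 2 * rad_of (p t) * nu p phi t ^+ 2
   - 2 * k (nu p phi t) * cos (phi t)).
  by rewrite e1; field.
have -> : 1 - nu p phi t ^+ 2 = cos (phi t) ^+ 2 + tau ^+ 2 * rad_of (p t) ^+ 2 * nu p phi t ^+ 2.
  by rewrite e2; ring.
rewrite /nu; field; rewrite lt0r_neq0//.
Qed.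

(** At a stationary point of the angle both [nu] and [k nu] have zero derivative, so only the
    explicit dependence on [p] and [phi] contributes. The relations
    [cos^2 phi = 1 - nu^2 - tau^2 r^2 nu^2] and [r (p + S) = 2] collapse it to one term, of sign
    opposite to [sin phi] when [cos phi > 0]. *)
Lemma der_angle_force J p phi t k' : sol J p phi -> J t -> cos (phi t) != 0 ->
  is_derive (nu p phi t) 1 k k' ->
  angle_force p phi t = 2 * k (nu p phi t) ->
  is_derive t 1 (fun t => angle_force p phi t - 2 * k (nu p phi t))
    (- (p t ^+ 2 * sin (phi t) * (1 - nu p phi t ^+ 2) ^+ 2) / cos (phi t) ^+ 3).
Proof.
move=> s Jt c0 Dk B0; have [p0 Dp Dphi] := s t Jt.
have S0 := Sig_gt0 kappa_le0 p0.
have DS := der_Sig kappa_le0 p0 Dp; have Dr := der_rad kappa_le0 p0 Dp.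
have Dnu : is_derive t 1 (nu p phi) 0.
  notypeclasses refine (is_derive_eq (der_flow_angle s Jt c0) _).
  by rewrite B0 subrr mulr0.
have Dknu := derC1 (g := nu p phi) Dk Dnu.
have e2 := angle_sq phi p0; have e1 := rad_sum kappa_le0 p0.
have F : FQ (p t) (phi t) * cos (phi t) = tau ^+ 2 * rad_of (p t) ^+ 2 * p t * nu p phi t ^+ 2.
  rewrite /flowPhi -/(nu p phi t) -B0 /angle_force.
  transitivity (S (p t) * cos (phi t) ^+ 2 - (1 - nu p phi t ^+ 2) * S (p t)
    + rad_of (p t) * (p t + S (p t)) * tau ^+ 2 * rad_of (p t) * nu p phi t ^+ 2).
    by rewrite e1; field.
  by rewrite e2; ring.
rewrite /angle_force; der.
have F' : FQ (p t) (phi t) = tau ^+ 2 * rad_of (p t) ^+ 2 * p t * nu p phi t ^+ 2 / cos (phi t).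
  by rewrite -F mulfK.
rewrite {}F' /flowP; apply: (mulIf (expf_neq0 3 c0)); rewrite divfK ?expf_neq0//.
transitivity (- (p t * sin (phi t)) * ((p t * (1 - nu p phi t ^+ 2) + 2 * tau ^+ 2 * rad_of (p t) * nu p phi t ^+ 2) * cos (phi t) ^+ 2
  - ((1 - nu p phi t ^+ 2) * S (p t) - 2 * tau ^+ 2 * rad_of (p t) * nu p phi t ^+ 2)
    * (tau ^+ 2 * rad_of (p t) ^+ 2 * nu p phi t ^+ 2))).
  by field; rewrite c0 lt0r_neq0.
rewrite e2.
transitivity (- (p t * sin (phi t)) * (p t * (1 - nu p phi t ^+ 2) ^+ 2
  + tau ^+ 2 * rad_of (p t) * nu p phi t ^+ 2 * (1 - nu p phi t ^+ 2) * (2 - rad_of (p t) * (p t + S (p t))))).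
  by ring.
by rewrite e1; ring.
Qed.

Lemma flow_angle_lt1 p phi t : 0 < p t -> nu p phi t ^+ 2 < 1.
Proof.
move=> p0; have i0 := angmax_gt0 kappa tau_gt0 p0; have i1 := angmax_lt1 kappa tau_gt0 p0.
rewrite /nu exprMn; apply: (@le_lt_trans _ _ (io (p t) ^+ 2)).
  by rewrite ler_piMl ?sqr_ge0// -real_normK ?num_real// expr_le1// norm_sin_le1.
by rewrite expr_lt1// ltW.
Qed.

(** A barrier argument. The difference [B] is negative at the equator, and at each zero to its left
    it strictly decreases. A nonnegative value at [t1] would therefore give [B > 0] all the way down
    to the pole; the angle would be nondecreasing there, hence bounded by a value below [1] near the
    pole. But at the pole [cos phi] and the radius tend to zero, which forces [nu^2] to tend to
    [1]. *)
Lemma sphere_angle_force J p phi t0 r : complete_sol kappa tau k J p phi ->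
  sphere_sol J p phi t0 r -> S (p t0) < 2 * k 0 -> cos (phi t0) = 1 ->
  forall t, t0 - r < t <= t0 -> angle_force p phi t < 2 * k (nu p phi t).
Proof.
move=> cs [r0 JE s0 sp cp] S0 c1; have [oJ iJ s b1 b2] := cs.
have J0 : J t0 by apply/JE; lra.
have J_ t : t0 - r < t <= t0 -> J t by move=> /andP[? ?]; apply/JE; lra.
have c0 t : J t -> cos (phi t) != 0 by move=> /cp; exact: lt0r_neq0.
have [k' Dk] := cf_der cf.
have Dk' t : J t -> is_derive (nu p phi t) 1 k (k' (nu p phi t)).
  by move=> Jt; apply: Dk; apply: flow_angle_lt1; have [] := s t Jt.
pose B t := angle_force p phi t - 2 * k (nu p phi t).
have contB_ t : J t -> {for t, continuous B}.
  move=> Jt; have [pt Dp Dphi] := s t Jt.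
  have DS := der_Sig kappa_le0 pt Dp; have Dr := der_rad kappa_le0 pt Dp.
  have Dnu := der_flow_angle s Jt (c0 t Jt).
  have Dknu := derC1 (g := nu p phi) (Dk' t Jt) Dnu.
  have cc := c0 t Jt.
  rewrite /B /angle_force.
  have C1 := der_cont DS; have C2 := der_cont Dr; have C3 := der_cont Dnu.
  have C4 := der_cont Dknu; have C5 := sol_contcos s Jt.
  cont.
have Bt0 : B t0 < 0.
  by rewrite /B /angle_force /flow_angle s0 c1 !mul0r expr0n/= subr0 mul1r mulr0 subr0 divr1 subr_lt0.
move=> t1 /andP[h1 h2]; rewrite -subr_lt0 -/(B t1) ltNge; apply/negP => Bt1.
have Jt1 : J t1 by apply: J_; rewrite h1.
have t1t0 : t1 < t0.
  by rewrite lt_neqAle h2 andbT; apply/eqP => e; move: Bt1; rewrite e leNgt Bt0.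
have DB t : J t -> B t = 0 -> is_derive t 1 B
    (- (p t ^+ 2 * sin (phi t) * (1 - nu p phi t ^+ 2) ^+ 2) / cos (phi t) ^+ 3).
  by move=> Jt /eqP; rewrite subr_eq0 => /eqP; exact: (der_angle_force s Jt (c0 t Jt) (Dk' t Jt)).
have neg t : t0 - r < t < t0 -> - (p t ^+ 2 * sin (phi t) * (1 - nu p phi t ^+ 2) ^+ 2) / cos (phi t) ^+ 3 < 0.
  move=> /andP[? ?]; have Jt : J t by apply: J_; lra.
  have [pt _ _] := s t Jt.
  rewrite mulNr oppr_lt0 divr_gt0 ?exprn_gt0 ?cp// mulr_gt0 ?exprn_gt0// ?mulr_gt0 ?exprn_gt0 ?sp//; first by lra.
  by rewrite subr_gt0 flow_angle_lt1.
(* If [B] vanishes at [t1], its negative derivative makes it positive slightly to the left. *)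
have [t2 /andP[h3 h4] Bt2] : exists2 t2, t0 - r < t2 <= t1 & 0 < B t2.
  move: Bt1; rewrite le_eqVlt => /orP[/eqP e|?]; last by exists t1; rewrite ?h1 /=.
  have I1 : t0 - r < t1 < t0 by rewrite h1.
  have D := derN (DB t1 Jt1 (esym e)).
  have n1 : 0 < - (- (p t1 ^+ 2 * sin (phi t1) * (1 - nu p phi t1 ^+ 2) ^+ 2) / cos (phi t1) ^+ 3).
    by rewrite oppr_gt0 neg.
  have e' : - B t1 = 0 by rewrite -e oppr0.
  have [d d0 H] := neg_left D e' n1.
  pose m := Num.min (d / 2) ((t1 - (t0 - r)) / 2).
  have m0 : 0 < m by rewrite lt_min divr_gt0//= divr_gt0//; lra.
  have md : m < d by rewrite gt_min; apply/orP; left; lra.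
  have mt : m < t1 - (t0 - r) by rewrite gt_min; apply/orP; right; lra.
  exists (t1 - m); first by lra.
  by rewrite -oppr_lt0; apply: H; lra.
(* At the last zero before [t2] the derivative of [B] would be negative, contradicting [B > 0] just
   after it. *)
have Bpos t : t0 - r < t <= t2 -> 0 < B t.
  move=> /andP[h5 h6]; rewrite ltNge; apply/negP => Bt.
  have tt : t < t2 by rewrite lt_neqAle h6 andbT; apply/eqP => e; move: Bt; rewrite e leNgt Bt2.
  have h7 : - t2 <= - t by rewrite lerN2.
  pose f x := B (- x).
  have fc x : - t2 <= x <= - t -> {for x, continuous f}.
    move=> /andP[? ?]; have Jx : J (- x) by apply: J_; lra.
    by apply: (contC (h := B) (f := fun x => - x) (contB_ _ Jx)); apply: contN; exact: (@cont_id R).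
  have f1 : 0 < f (- t2) by rewrite /f opprK.
  have f2 : f (- t) <= 0 by rewrite /f opprK.
  have [x [/andP[x1 x2] fx fp]] := first_zero h7 fc f1 f2.
  have I1 : t0 - r < - x < t0 by lra.
  have Jx : J (- x) by apply: J_; lra.
  have n1 : 0 < - (- (p (- x) ^+ 2 * sin (phi (- x)) * (1 - nu p phi (- x) ^+ 2) ^+ 2) / cos (phi (- x)) ^+ 3).
    by rewrite oppr_gt0 neg.
  have e' : - B (- x) = 0 by move: fx; rewrite /f => ->; rewrite oppr0.
  have [d d0 H] := pos_right (derN (DB (- x) Jx fx)) e' n1.
  pose m := Num.min (d / 2) ((x + t2) / 2).
  have m0 : 0 < m by rewrite lt_min divr_gt0//= divr_gt0//; lra.
  have md : m < d by rewrite gt_min; apply/orP; left; lra.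
  have mt : m < x + t2 by rewrite gt_min; apply/orP; right; lra.
  have := H (- x + m); have := fp (x - m); rewrite /f opprB => g1 g2.
  have : 0 < B (m - x) by apply: g1; lra.
  have : 0 < - B (- x + m) by apply: g2; lra.
  by rewrite [m - x]addrC; lra.
have Jt2 : J t2 by apply: J_; lra.
have inc t : t0 - r < t <= t2 -> nu p phi t <= nu p phi t2.
  move=> /andP[h5 h6].
  have J' x : t <= x <= t2 -> J x by move=> /andP[? ?]; apply: J_; lra.
  apply: (derive_nondecr h6 (fun x xI => der_flow_angle s (J' x xI) (c0 _ (J' x xI)))) => x /andP[? ?].
  have Jx : J x by apply: J_; lra.
  have [px _ _] := s x Jx.
  apply: mulr_ge0; last by apply/ltW; apply: Bpos; lra.
  by apply: mulr_ge0; apply/ltW; [exact: angmax_gt0|exact: cp].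
have [K HK] := cf_up cf.
have [m m0 Hm] := cf_low cf.
have K0 : 0 < K := lt_le_trans m0 (le_trans (Hm 0) (HK 0)).
(* The corrected quotient as in [no_ray]: it is nondecreasing because [K S / p >= K >= k], and it
   yields [cos phi <= K / p] up to the equator. *)
have Dg t : J t -> is_derive t 1 (fun t => K / p t ^+ 2 - cos (phi t) / p t)
   (2 * sin (phi t) / p t * (K * S (p t) / p t - k (nu p phi t))).
  move=> Jt; have [pt Dp Dphi] := s t Jt.
  have pn : p t != 0 by exact: lt0r_neq0.
  have pn2 : p t ^+ 2 != 0 by exact: expf_neq0.
  have Dr := der_ratio s Jt.
  notypeclasses refine (is_derive_eq _ _); [notypeclasses refine (derB _ Dr)|]; first by repeat der_step.
  by rewrite /= /flowP -/(nu p phi t); field.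
have gmono x y : t0 - r < x -> x <= y -> y <= t0 ->
    K / p x ^+ 2 - cos (phi x) / p x <= K / p y ^+ 2 - cos (phi y) / p y.
  move=> h5 h6 h7; have J' z : x <= z <= y -> J z by move=> /andP[? ?]; apply: J_; lra.
  apply: (derive_nondecr h6 (fun z zI => Dg z (J' z zI))) => z /andP[? ?].
  have Jz : J z by apply: J_; lra.
  have [pz _ _] := s z Jz.
  apply: mulr_ge0.
    by rewrite divr_ge0 ?(ltW pz)// mulr_ge0// ltW// sp//; lra.
  rewrite subr_ge0; apply: (le_trans (HK _)); rewrite -mulrA; apply: ler_peMr; first exact: ltW.
  by rewrite ler_pdivlMr// mul1r Sig_ge.
have far M a : t0 - r < a <= t0 -> exists2 x, t0 - r < x <= a & M < p x.
  move=> /andP[h5 h6].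
  have ub : exists b, forall x, reflected J 0 x -> x <= b.
    by exists (r - t0) => x; rewrite /reflected /= sub0r => /JE; lra.
  have [y Jy H] := b2 ub M; rewrite /reflected /= sub0r in Jy.
  have [y1 y2] : t0 - r < - y /\ - y < t0 + r by have := proj1 (JE _) Jy; lra.
  pose x := Num.min (- y) a.
  have xy : x <= - y by rewrite ge_min lexx.
  have xa : x <= a by rewrite ge_min lexx orbT.
  have x0 : t0 - r < x by rewrite lt_min y1 h5.
  exists x; first by rewrite x0.
  have := H (- x); rewrite /reflected /= sub0r opprK; apply; first by apply: J_; lra.
  by lra.
have cK t : t0 - r < t <= t0 -> cos (phi t) <= K / p t.
  move=> /andP[h5 h6]; have Jt : J t by apply: J_; lra.
  have [pt _ _] := s t Jt.
  suff : cos (phi t) / p t <= K / p t ^+ 2.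
    by rewrite ler_pdivrMr// => /le_trans; apply; rewrite expr2 invfM mulrA mulfVK ?lt0r_neq0.
  rewrite leNgt; apply/negP; rewrite -subr_gt0.
  set e := cos _ / _ - _ => e0.
  have [x /andP[h8 h9] px] := far e^-1 t (ltac:(lra)).
  have := gmono x t h8 h9 h6.
  have [px0 _ _] := s x (J_ x (ltac:(lra))).
  have : cos (phi x) / p x <= (p x)^-1 by rewrite ler_pdivrMr// mulVf ?lt0r_neq0// cos_le1.
  have : (p x)^-1 < e by rewrite -[e]invrK ltf_pV2 ?posrE ?invr_gt0.
  have : 0 < K / p x ^+ 2 by rewrite divr_gt0// exprn_gt0.
  by rewrite /e; lra.
have [pt2 _ _] := s t2 Jt2.
have n2 : nu p phi t2 < 1.
  by apply: lt_sq; rewrite ?ler01// expr1n flow_angle_lt1.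
(* For [p > M] one has [cos^2 phi + tau^2 r^2 nu^2 <= (K^2 + tau^2) / p < 1 - nu t2], while the left
   side equals [1 - nu^2 >= 1 - nu t2]. The bound [1] allows [1 / p^2 <= 1 / p]. *)
pose M := Num.max 1 ((K ^+ 2 + tau ^+ 2) / (1 - nu p phi t2)).
have [t /andP[h5 h6] pt] := far M t2 (ltac:(lra)).
have Jt : J t by apply: J_; lra.
have [pt0 _ _] := s t Jt.
have [p1 pM] : 1 < p t /\ (K ^+ 2 + tau ^+ 2) / (1 - nu p phi t2) < p t.
  by move: pt; rewrite gt_max => /andP[].
have nt := inc t (ltac:(lra)).
have nt0 : 0 <= nu p phi t by rewrite mulr_ge0 ?ltW ?angmax_gt0// sp//; lra.
have ct := cK t (ltac:(lra)).
have X0 : 0 < (p t)^-1 by rewrite invr_gt0.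
have X1 : (p t)^-1 < 1 by rewrite invf_lt1.
have rX := rad_le_inv kappa_le0 pt0.
have r_0 := rad_gt0 kappa_le0 pt0.
have c_0 := cp t Jt.
have e := angle_sq phi pt0.
have nsq : nu p phi t ^+ 2 <= nu p phi t by rewrite expr2 ler_piMl//; lra.
have cX : cos (phi t) ^+ 2 <= K ^+ 2 * (p t)^-1.
  apply: (@le_trans _ _ ((K / p t) ^+ 2)); first by rewrite lerXn2r// nnegrE ltW// mulr_gt0.
  by rewrite exprMn ler_wpM2l ?sqr_ge0// expr2 ler_piMl// ltW.
have rX2 : rad_of (p t) ^+ 2 <= (p t)^-1.
  apply: (@le_trans _ _ ((p t)^-1 ^+ 2)); first by rewrite lerXn2r// nnegrE ltW.
  by rewrite expr2 ler_piMl// ltW.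
have tX : tau ^+ 2 * rad_of (p t) ^+ 2 * nu p phi t ^+ 2 <= tau ^+ 2 * (p t)^-1.
  rewrite -mulrA ler_wpM2l ?sqr_ge0//; apply: le_trans rX2.
  by rewrite ler_piMr ?sqr_ge0//; lra.
have : (K ^+ 2 + tau ^+ 2) * (p t)^-1 < 1 - nu p phi t2.
  by move: pM; rewrite ltr_pdivrMr ?subr_gt0// mulrC -ltr_pdivrMr.
by lra.
Qed.

(** The force inequality settles the part before the equator; the angle is odd under the reflection
    at [t0], which settles the other part. *)
Lemma sphere_angle_decr J p phi t0 r : complete_sol kappa tau k J p phi ->
  sphere_sol J p phi t0 r -> S (p t0) < 2 * k 0 -> cos (phi t0) = 1 ->
  strictly_decreasing_on J (nu p phi).
Proof.
move=> cs sph S0 c1; have [oJ iJ s b1 b2] := cs; have [r0 JE s0 sp cp] := sph.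
have F := sphere_angle_force cs sph S0 c1.
have J0 : J t0 by apply/JE; lra.
have left_ x y : J x -> x < y -> y <= t0 -> nu p phi y < nu p phi x.
  move=> /JE/andP[h1 h2] xy yt; rewrite -ltrN2.
  have J' z : x <= z <= y -> J z by move=> /andP[? ?]; apply/JE; lra.
  apply: (derive_incr xy (fun z zI => derN (der_flow_angle s (J' z zI) (lt0r_neq0 (cp _ (J' z zI)))))).
  move=> z /andP[h3 h4]; have Jz : J z by apply: J'; lra.
  have [pz _ _] := s z Jz.
  rewrite -mulrN; apply: mulr_gt0; first by rewrite mulr_gt0 ?angmax_gt0 ?cp.
  by rewrite oppr_gt0 subr_lt0 F//; lra.
have sym t : J t -> nu p phi t = - nu p phi (2 * t0 - t).
  move=> Jt; have Jt' := sym_domain kappa_le0 tau_gt0 cf cs s0 J0 Jt.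
  have [e1 _ e2] := sym_on kappa_le0 tau_gt0 cf iJ s s0 J0 Jt Jt'.
  by rewrite /nu e1 e2 mulNr opprK.
have right_ x y : J y -> x < y -> t0 <= x -> nu p phi y < nu p phi x.
  move=> Jy xy tx; have Jx : J x by have := proj1 (JE _) Jy => h; apply/JE; lra.
  rewrite (sym x)// (sym y)// ltrN2; apply: left_; [exact: (sym_domain kappa_le0 tau_gt0 cf cs s0 J0)| |]; lra.
move=> x y Jx Jy xy.
have [h|h] := leP y t0; first exact: left_.
have [h'|h'] := leP t0 x; first exact: right_.
by apply: (lt_trans (right_ t0 y _ _ _)) => //; exact: left_.
Qed.
End SphereAngle.

(** * The largest radii of nodoids are closed upwards *)

Section NodoidFamily.
Context {R : realType} (kappa tau : R) (k : R -> R).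
Hypothesis kappa_le0 : kappa <= 0.
Hypothesis tau_gt0 : 0 < tau.
Hypothesis cf : curvature_fun kappa k.
Implicit Types (p phi Y Z : R -> R) (t s a b c e d l T C M N m x y P Q : R) (J : set R).

Local Notation S := (Sig kappa).
Local Notation io := (angmax kappa tau).
Local Notation FP := (flowP kappa).
Local Notation FQ := (flowPhi kappa tau k).
Local Notation sol := (sol kappa tau k).
Local Notation half_period := (half_period kappa tau k).

Lemma der_sin_phi J p phi t : sol J p phi -> J t ->
  is_derive t 1 (fun t => sin (phi t)) (cos (phi t) * FQ (p t) (phi t)).
Proof. by move=> s /s[_ _ pd]; der; ring. Qed.

(** At [T] the function [sin phi] comes down to zero, so its derivative [S - 2 k 0] there cannot be
    positive. *)
Lemma hp_end_Sig P c0 p phi T : half_period P c0 p phi T -> S (p T) <= 2 * k 0.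
Proof.
move=> [T0 s _ [cT sT] sp]; rewrite leNgt; apply/negP => h.
have D : 0 < cos (phi T) * FQ (p T) (phi T).
  by rewrite /flowPhi sT cT mul0r mulr1 mul1r subr_gt0.
have [e e0 H] := neg_left (der_sin_phi s (I : setT T)) sT D.
have m0 : 0 < Num.min (e / 2) (T / 2) by rewrite lt_min !divr_gt0.
have me : Num.min (e / 2) (T / 2) < e by rewrite gt_min; apply/orP; left; lra.
have mT : Num.min (e / 2) (T / 2) < T by rewrite gt_min; apply/orP; right; lra.
have := H (T - Num.min (e / 2) (T / 2)) (ltac:(lra)).
by have := sp (T - Num.min (e / 2) (T / 2)) (ltac:(lra)); lra.
Qed.

(** An orbit from [cos = 1] to [cos = -1] with [sin < 0] is a nodoid half-period run backwards: its
    reflection and the half-period started at [Y t] coincide by uniqueness, and so do their next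
    zeros. *)
Lemma half_period_start Y Z t : 0 < t -> sol `[0, t]%classic Y Z ->
  cos (Z 0) = 1 -> sin (Z 0) = 0 -> cos (Z t) = -1 -> sin (Z t) = 0 ->
  (forall x, 0 < x < t -> sin (Z x) < 0) ->
  exists p phi, half_period (Y t) (-1) p phi t /\ p t = Y 0.
Proof.
move=> t0 s c0 s0 ct st sn.
have Jt : `[0, t]%classic t by rewrite /= in_itv/= lexx ltW.
have [Yt _ _] := s t Jt.
have [p [phi [T hp]]] := half_period_exists kappa_le0 tau_gt0 cf Yt (or_intror erefl).
have [T0 sg [p0 cp0 sp0] [cT sT] sp] := hp.
have s' := sol_reflect cf (T := t) (@cos0 R) (@sin0 R) s.
pose J : set R := `[0, t]%classic.
have sJ : sol J (fun x => Y (t - x)) (fun x => 0 - Z (t - x)).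
  by apply: sol_sub s' => x; rewrite /J /= !in_itv/= => /andP[? ?]; lra.
have J0 : J 0 by rewrite /J /= in_itv/= lexx ltW.
have i1 : p 0 = Y (t - 0) by rewrite subr0.
have i2 : cos (phi 0) = cos (0 - Z (t - 0)) by rewrite subr0 sub0r cosN ct.
have i3 : sin (phi 0) = sin (0 - Z (t - 0)) by rewrite subr0 sub0r sinN st oppr0.
have sg' : sol J p phi by apply: sol_sub sg.
have iJ : is_interval J by exact: interval_is_interval.
have U := sol_unique kappa_le0 tau_gt0 cf iJ J0 sg' sJ i1 i2 i3.
have Tt : T = t.
  have [h|h|//] := ltgtP T t.
    have JT : J T by rewrite /J /= in_itv/= !ltW.
    have [_ _] := U T JT; rewrite sT sub0r sinN => e; have := sn (t - T) (ltac:(lra)); lra.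
  have [_ _] := U t Jt; rewrite subrr sub0r sinN s0 oppr0 => e.
  by have := sp t; rewrite t0 h e ltxx => /(_ isT).
rewrite Tt in hp; exists p, phi; split => //.
by have [-> _ _] := U t Jt; rewrite subrr.
Qed.

(** At a meeting point the reflected second orbit has the same cosine and sine as the first.
    Uniqueness would then place the value [Y 0] on the nodoid orbit, along which [p] never falls
    below [p T]. *)
Lemma no_crossing P p phi T Y Z t x : half_period P (-1) p phi T -> 0 <= t ->
  sol `[0, t]%classic Y Z -> Y 0 < p T -> 0 <= x <= T -> Y t = p x ->
  cos (Z t) = cos (phi x) -> sin (Z t) <= 0 -> False.
Proof.
move=> hp t0 s Y0 xT Yt ct st; have [T0 sg [p0 cp0 sp0] [cT sT] sp] := hp.
have sx : 0 <= sin (phi x).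
  case/andP: xT; rewrite le_eqVlt => /orP[/eqP <-|x0]; first by rewrite sp0.
  by rewrite le_eqVlt => /orP[/eqP ->|xT]; [rewrite sT|rewrite ltW// sp// x0].
have e : sin (- Z t) = sin (phi x).
  apply/eqP; rewrite sinN -(eqrXn2 (n := 2))// ?oppr_ge0//.
  by rewrite sqrrN !sin2cos2 ct.
have s' := sol_reflect cf (T := t) (@cos0 R) (@sin0 R) s.
pose J : set R := `[0, t]%classic.
have sJ : sol J (fun x => Y (t - x)) (fun x => 0 - Z (t - x)).
  by apply: sol_sub s' => y; rewrite /J /= !in_itv/= => /andP[? ?]; lra.
have J0 : J 0 by rewrite /J /= in_itv/= lexx t0.
have Jt : J t by rewrite /J /= in_itv/= lexx t0.
have sh := sol_sub (J' := setT) (fun _ _ => I : [set t | setT (t + x)] _) (sol_shift (c := x) sg).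
have i1 : p (0 + x) = Y (t - 0) by rewrite subr0 add0r Yt.
have i2 : cos (phi (0 + x)) = cos (0 - Z (t - 0)) by rewrite subr0 add0r sub0r cosN ct.
have i3 : sin (phi (0 + x)) = sin (0 - Z (t - 0)) by rewrite subr0 add0r sub0r e.
have sg' : sol J (fun t => p (t + x)) (fun t => phi (t + x)) by apply: sol_sub sh.
have iJ : is_interval J by exact: interval_is_interval.
have [] := sol_unique kappa_le0 tau_gt0 cf iJ J0 sg' sJ i1 i2 i3 Jt.
rewrite subrr => e1 _ _; move: Y0; rewrite -e1 ltNge.
by have [/andP[->]] := (hp_bounds kappa_le0 tau_gt0 cf hp (t + x), I).
Qed.

(* The reversed orbit from p = Q, phi = 0 cannot cross that of the given nodoid, so phi reaches -pi before p exceeds P. *)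
Lemma nodoid_up P p phi T Q : half_period P (-1) p phi T -> 0 < Q < p T ->
  exists P' p' phi' T', half_period P' (-1) p' phi' T' /\ p' T' = Q.
Proof.
move=> hp /andP[Q0 QT]; have [T0 sg [p0 cp0 sp0] [cT sT] sp] := hp.
have pTP : p T < P := hp_lt kappa_le0 hp.
have QP : 0 < Q <= P by rewrite Q0 /=; apply/ltW/(lt_trans QT).
have [Y [Z [[Y0 Z0 Ypos] dY dZ solI _]]] := clamped_flow kappa_le0 tau_gt0 cf QP (@sin0 R).
have cY t : {for t, continuous Y} by exact: der_cont (dY t).
have cZ t : {for t, continuous Z} by exact: der_cont (dZ t).
have cS t : {for t, continuous (fun t => sin (Z t))} by have c := cZ t; cont.
have cC t : {for t, continuous (fun t => cos (Z t))} by have c := cZ t; cont.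
have SQ : S Q < 2 * k 0.
  by apply: (lt_le_trans (Sig_lt kappa_le0 (ltW Q0) QT)); exact: hp_end_Sig hp.
have s0 : sol [set 0] Y Z by apply: solI => t ->; rewrite Y0; case/andP: QP.
have D0 := derN (der_sin_phi s0 (erefl : [set 0] 0)).
have n0 : 0 < - (cos (Z 0) * FQ (Y 0) (Z 0)).
  by rewrite Z0 Y0 cos0 mul1r /flowPhi sin0 cos0 mul0r mulr1 oppr_gt0 subr_lt0.
have sZ0 : sin (Z 0) = 0 by rewrite Z0 sin0.
have z0 : - sin (Z 0) = 0 by rewrite sZ0 oppr0.
have [e e0 se] := pos_right D0 z0 n0.
have Y0P : Y 0 < P by rewrite Y0; exact: lt_trans pTP.
have [d d0 Yd] := cont_near_lt (cY 0) Y0P.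
pose m := Num.min (e / 2) (d / 2).
have m0 : 0 < m by rewrite lt_min !divr_gt0.
have me : m < e by rewrite gt_min; apply/orP; left; lra.
have md : m < d by rewrite gt_min; apply/orP; right; lra.
(* The first zero of [g] is the first time at which [sin] returns to zero or [Y] reaches [P]. Before
   it the clamping is invisible, and [no_ray] guarantees that it occurs. *)
pose g t := Num.min (- sin (Z t)) (P - Y t).
have cg t : {for t, continuous g}.
  have h1 : {for t, continuous (fun t => - sin (Z t))} by have c := cS t; cont.
  have h2 : {for t, continuous (fun t => P - Y t)} by have c := cY t; cont.
  exact: (continuous_min h1 h2).
have gpos t : 0 < t <= m -> 0 < g t.
  move=> /andP[h1 h2]; rewrite lt_min; apply/andP; split; first by apply: se; lra.
  by rewrite subr_gt0; apply: Yd; rewrite subr0 gtr0_norm//; lra.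
have [t1 mt1 gt1] : exists2 t1, m <= t1 & g t1 <= 0.
  apply: contrapT => ng.
  have gp t : m <= t -> 0 < g t.
    by move=> mt; rewrite ltNge; apply/negP => gt; apply: ng; exists t.
  apply: (@no_ray R kappa tau k kappa_le0 tau_gt0 cf Y Z m (-1)).
  - by right.
  - by apply: solI => t mt; have := gp t mt; rewrite lt_min subr_gt0 => /andP[_ /ltW].
  - by move=> t mt; rewrite mulN1r; have := gp t mt; rewrite lt_min => /andP[].
have gm : 0 < g m by apply: gpos; rewrite m0 lexx.
have [t2 [/andP[mt2 t2t1] gt2 gp]] := first_zero mt1 (fun t _ => cg t) gm gt1.
have t20 : 0 < t2 by exact: lt_trans mt2.
have gp2 t : 0 < t < t2 -> 0 < g t.
  move=> /andP[h1 h2]; have [h|h] := leP m t; first by apply: gp; rewrite h.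
  by apply: gpos; rewrite h1 ltW.
have sn t : 0 < t < t2 -> sin (Z t) < 0.
  by move=> /gp2; rewrite lt_min oppr_gt0 => /andP[].
have YP t : 0 <= t <= t2 -> Y t <= P.
  move=> /andP[]; rewrite le_eqVlt => /orP[/eqP <- _|h1]; first exact: ltW.
  rewrite le_eqVlt => /orP[/eqP ->|h2].
    have : 0 <= g t2 by rewrite gt2.
    by rewrite le_min subr_ge0 => /andP[].
  by have := gp2 t; rewrite h1 h2 => /(_ isT); rewrite lt_min subr_gt0 => /andP[_ /ltW].
have s : sol `[0, t2]%classic Y Z by apply: solI => t; rewrite /= in_itv/=; exact: YP.
have st2 : sin (Z t2) <= 0.
  have : 0 <= g t2 by rewrite gt2.
  by rewrite le_min oppr_ge0 => /andP[].
have J2 : `[0, t2]%classic t2 by rewrite /= in_itv/= lexx ltW.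
have [[c2 s2]|nend] := pselect (cos (Z t2) = -1 /\ sin (Z t2) = 0).
  have cZ0 : cos (Z 0) = 1 by rewrite Z0 cos0.
  have [p' [phi' [hp' e']]] := half_period_start t20 s cZ0 sZ0 c2 s2 sn.
  by exists (Y t2), p', phi', t2; rewrite e' Y0.
exfalso.
have [YT c1] : p T <= Y t2 /\ (Y t2 = P \/ cos (Z t2) = 1).
  move: gt2; rewrite /g /Num.min; case: ifP => _ h; last first.
    have -> : Y t2 = P by lra.
    by split; [exact: ltW|left].
  have s2 : sin (Z t2) = 0 by lra.
  have c2 : cos (Z t2) = 1 by have [//|c2] := sin0_cos s2; case: nend.
  split; last by right.
  rewrite leNgt; apply/negP => YT.
  have SY : S (Y t2) < 2 * k 0.
    have h' := Sig_lt kappa_le0 (ltW (Ypos t2)) YT.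
    by apply: (lt_le_trans h'); exact: hp_end_Sig hp.
  have n2 : 0 < - (cos (Z t2) * FQ (Y t2) (Z t2)).
    by rewrite c2 mul1r /flowPhi s2 c2 mul0r mulr1 oppr_gt0 subr_lt0.
  have z2 : - sin (Z t2) = 0 by rewrite s2 oppr0.
  have [e2 e20 H] := neg_left (derN (der_sin_phi s J2)) z2 n2.
  pose m2 := Num.min (e2 / 2) (t2 / 2).
  have m20 : 0 < m2 by rewrite lt_min !divr_gt0.
  have m2e : m2 < e2 by rewrite gt_min; apply/orP; left; lra.
  have m2d : m2 < t2 by rewrite gt_min; apply/orP; right; lra.
  by have := H (t2 - m2) (ltac:(lra)); have := sn (t2 - m2) (ltac:(lra)); lra.
have np x : 0 <= x <= T -> {for x, continuous (fun x => - p x)}.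
  by move=> _; have c := sol_contp sg (I : setT x); cont.
have mono x y : 0 <= x -> x < y -> y <= T -> - p x < - p y.
  by move=> h1 h2 h3; rewrite ltrN2; exact: (hp_sdecr kappa_le0 hp).
have [i [iK i0 Ki ci]] := inverse_segment (ltW T0) np mono.
(* The difference of the cosines of the two orbits at equal values of [p], with [i] recovering the
   time on the half-period. It is nonpositive when [Y] passes [p T] and nonnegative at [t2], so a
   zero in between is a crossing. *)
pose f t := cos (Z t) - cos (phi (i (- Y t))).
have cf_ t : {for t, continuous f}.
  have h1 := cC t; have h2 := contN (cY t).
  have h3 : {for t, continuous (fun t => i (- Y t))} by exact: (contC (ci _) h2).
  have h4 : {for t, continuous (fun t => phi (i (- Y t)))}.
    by apply: (contC _ h3); exact: (sol_contphi sg (I : setT _)).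
  by rewrite /f; cont.
have [ta taI Ya] : exists2 ta, 0 <= ta <= t2 & Y ta = p T.
  by apply: ivt => //; [exact: ltW|rewrite Y0 YT andbT ltW].
case/andP: taI => ta0 ta2.
have iT : i (- p T) = T by apply: iK; rewrite lexx ltW.
have f1 : f ta <= 0 by rewrite /f Ya iT cT subr_le0 cos_le1.
have f2 : 0 <= f t2.
  rewrite /f; case: c1 => [->|->]; last by rewrite subr_ge0 cos_le1.
  have -> : i (- P) = 0 by rewrite -p0 iK// lexx ltW.
  by rewrite cp0 opprK -lerBlDr sub0r cos_geN1.
have [c /andP[cta ct2] fc] := ivt ta2 (fun t _ => cf_ t) (v := 0) (ltac:(by rewrite f1 f2)).
have c0 : 0 <= c by exact: le_trans cta.
have sc : sol `[0, c]%classic Y Z.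
  by apply: sol_sub s => t; rewrite /= !in_itv/= => /andP[-> /le_trans]; exact.
have Yc : p T <= Y c <= P.
  rewrite YP ?c0// andbT -Ya; move: cta; rewrite le_eqVlt => /orP[/eqP ->//|cta].
  apply/ltW/(sol_sincr kappa_le0 s cta) => t /andP[h1 h2].
    by rewrite /= in_itv/=; lra.
  by apply: sn; lra.
have st : sin (Z c) <= 0.
  move: c0; rewrite le_eqVlt => /orP[/eqP <-|c0]; first by rewrite sZ0.
  by move: ct2; rewrite le_eqVlt => /orP[/eqP ->//|c2]; rewrite ltW// sn// c0.
apply: (no_crossing hp c0 sc (x := i (- Y c))) => //; first by rewrite Y0.
  by have := Ki (- Y c); rewrite p0 !lerN2 andbC => /(_ Yc) /oppr_inj.
by apply/eqP; rewrite -subr_eq0; apply/eqP.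
Qed.

End NodoidFamily.

(** * Coordinates of row vectors and their derivatives *)

Section Coordinates.
Context {R : realType}.
Implicit Types (p v : 'rV[R]_3) (w : 'rV[R]_2).

Lemma px_vec3 (a b c : R) : px (vec3 a b c) = a.
Proof. by rewrite /px mxE inordK. Qed.
Lemma py_vec3 (a b c : R) : py (vec3 a b c) = b.
Proof. by rewrite /py mxE inordK. Qed.
Lemma pz_vec3 (a b c : R) : pz (vec3 a b c) = c.
Proof. by rewrite /pz mxE inordK. Qed.
Definition vec3E := (px_vec3, py_vec3, pz_vec3).

Lemma vec3_eta v : vec3 (px v) (py v) (pz v) = v.
Proof.
apply/rowP => i; rewrite mxE /px /py /pz.
by case: i => -[|[|[|//]]] Hi /=; congr (v _ _); apply: val_inj; rewrite /= inordK.
Qed.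

Lemma scale_vec3 (k a b c : R) : k *: vec3 a b c = vec3 (k * a) (k * b) (k * c).
Proof. by rewrite -[LHS]vec3_eta /px /py /pz !mxE !inordK. Qed.

Lemma add_vec3 (a b c a' b' c' : R) :
  vec3 a b c + vec3 a' b' c' = vec3 (a + a') (b + b') (c + c').
Proof. by rewrite -[LHS]vec3_eta /px /py /pz !mxE !inordK. Qed.

Lemma w0_vec2 (a b : R) : vec2 a b ord0 (inord 0) = a.
Proof. by rewrite mxE inordK. Qed.
Lemma w1_vec2 (a b : R) : vec2 a b ord0 (inord 1) = b.
Proof. by rewrite mxE inordK. Qed.
Definition vec2E := (w0_vec2, w1_vec2).

Lemma vec2_eta w : vec2 (w ord0 (inord 0)) (w ord0 (inord 1)) = w.
Proof.
apply/rowP => i; rewrite mxE.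
by case: i => -[|[|//]] Hi /=; congr (w _ _); apply: val_inj; rewrite /= inordK.
Qed.

Lemma I2P (P : 'I_2 -> Prop) : P (inord 0) -> P (inord 1) -> forall a, P a.
Proof.
move=> P0 P1; case=> -[|[|//]] Ha.
  by rewrite (_ : Ordinal Ha = inord 0)//; apply: val_inj; rewrite /= inordK.
by rewrite (_ : Ordinal Ha = inord 1)//; apply: val_inj; rewrite /= inordK.
Qed.

Lemma inord01 : (inord 0 == inord 1 :> 'I_2) = false.
Proof. by rewrite -val_eqE /= !inordK. Qed.
Lemma inord10 : (inord 1 == inord 0 :> 'I_2) = false.
Proof. by rewrite -val_eqE /= !inordK. Qed.

Lemma delta0 : delta_mx ord0 (inord 0) = vec2 1 0 :> 'rV[R]_2.
Proof. by rewrite -[LHS]vec2_eta !mxE !eqxx inord10. Qed.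
Lemma delta1 : delta_mx ord0 (inord 1) = vec2 0 1 :> 'rV[R]_2.
Proof. by rewrite -[LHS]vec2_eta !mxE !eqxx inord01. Qed.

Lemma is_derive_coord m n (i : 'I_m) (j : 'I_n) (p v : 'M[R]_(m, n)) :
  is_derive p v (fun q => q i j) (v i j).
Proof.
have H : (fun h : R => h^-1 *: ((h *: v + p) i j - p i j)) @ 0^' --> v i j.
  apply: (@cvg_trans _ ((fun=> v i j) @ (0 : R)^')); last exact: cvg_cst.
  apply: near_eq_cvg; near=> h.
  by rewrite !mxE addrK scalerA mulVf ?scale1r//; near: h; exact: nbhs_dnbhs_neq.
by split; [apply: cvgP H | apply: cvg_lim H].
Unshelve. all: by end_near. Qed.

Context {V : normedModType R}.

Lemma is_derive_vec3 (f g k : V -> R) (x v : V) (a b c : R) :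
  is_derive x v f a -> is_derive x v g b -> is_derive x v k c ->
  is_derive x v (fun y => vec3 (f y) (g y) (k y)) (vec3 a b c).
Proof.
move=> [f1 f2] [g1 g2] [k1 k2].
have D : derivable (fun y => vec3 (f y) (g y) (k y)) x v.
  apply/derivable_mxP => i j; rewrite ord1.
  have -> : (fun y => vec3 (f y) (g y) (k y) ord0 j) = [:: f; g; k]`_j.
    by apply/funext => y; rewrite mxE; case: j => -[|[|[|]]].
  case: j => -[Hj|[Hj|[Hj|? Hj]]]; [exact: f1 | exact: g1 | exact: k1 | by case: (notF Hj)].
split=> //; rewrite derive_mx//; apply/rowP => j; rewrite mxE [RHS]mxE.
have -> : (fun y => vec3 (f y) (g y) (k y) ord0 j) = [:: f; g; k]`_j.
  by apply/funext => y; rewrite mxE; case: j => -[|[|[|]]].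
case: j => -[|[|[|//]]] /= _; [exact: f2 | exact: g2 | exact: k2].
Qed.

Lemma derivable_vec3P (f g k : V -> R) (x v : V) :
  derivable (fun y => vec3 (f y) (g y) (k y)) x v <->
  [/\ derivable f x v, derivable g x v & derivable k x v].
Proof.
split=> [/derivable_mxP D|[/derivableP f1 /derivableP g1 /derivableP k1]].
  have H j := D ord0 j.
  split; [have := H (inord 0)|have := H (inord 1)|have := H (inord 2)];
    by under eq_fun do rewrite mxE inordK//=.
by have [] := is_derive_vec3 f1 g1 k1.
Qed.

Lemma continuous_vec3 {T : topologicalType} (f g k : T -> R) (x : T) :
  {for x, continuous f} -> {for x, continuous g} -> {for x, continuous k} ->
  {for x, continuous (fun y => vec3 (f y) (g y) (k y))}.
Proof.
move=> f1 g1 k1.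
have -> : (fun y => vec3 (f y) (g y) (k y)) =
    (fun y => f y *: vec3 1 0 0 + g y *: vec3 0 1 0 + k y *: vec3 0 0 1).
  by apply/funext => y; rewrite !scale_vec3 !add_vec3; congr vec3; ring.
by apply: cvgD; [apply: cvgD|]; apply: cvgZr_tmp.
Qed.

End Coordinates.

(** * Directional derivatives of the metric in closed form *)

Section MetricDerivative.
Context {R : realType} (kappa tau : R).
Implicit Types (p u v w : 'rV[R]_3).

Let lam := conf kappa.

Lemma is_derive_px p v : is_derive p v px (px v).
Proof. exact: is_derive_coord. Qed.
Lemma is_derive_py p v : is_derive p v py (py v).
Proof. exact: is_derive_coord. Qed.

Lemma is_derive_conf p u : 4 + kappa * (px p ^+ 2 + py p ^+ 2) != 0 ->
  is_derive p u lam (- (kappa / 2) * lam p ^+ 2 * (px p * px u + py p * py u)).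
Proof.
move=> p0; have dx := is_derive_px p u; have dy := is_derive_py p u.
rewrite /lam /conf; der.
by field.
Qed.

Definition vform_der p u v : R :=
  - (kappa / 2) * lam p ^+ 2 * (px p * px u + py p * py u) * tau *
    (py p * px v - px p * py v) + lam p * tau * (py u * px v - px u * py v).

Lemma is_derive_vform p u v : 4 + kappa * (px p ^+ 2 + py p ^+ 2) != 0 ->
  is_derive p u (fun q => vform kappa tau q v) (vform_der p u v).
Proof.
move=> p0; have dx := is_derive_px p u; have dy := is_derive_py p u.
have dl := is_derive_conf u p0.
rewrite /vform /vform_der -/lam; der.
by rewrite -/lam; ring.
Qed.

Definition metric_der p u v w : R :=
  - kappa * lam p ^+ 3 * (px p * px u + py p * py u) * (px v * px w + py v * py w)
  + vform_der p u v * vform kappa tau p w + vform kappa tau p v * vform_der p u w.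

Lemma is_derive_metric p u v w : 4 + kappa * (px p ^+ 2 + py p ^+ 2) != 0 ->
  is_derive p u (fun q => metric kappa tau q v w) (metric_der p u v w).
Proof.
move=> p0; have dl := is_derive_conf u p0.
have dv := is_derive_vform u v p0; have dw := is_derive_vform u w p0.
rewrite /metric /metric_der -/lam; der.
by rewrite -/lam; field.
Qed.

Lemma christoffelE p u v w : 4 + kappa * (px p ^+ 2 + py p ^+ 2) != 0 ->
  christoffel kappa tau p u v w =
  2^-1 * (metric_der p u v w + metric_der p v u w - metric_der p w u v).
Proof.
by move=> p0; rewrite /christoffel !(derive_val (is_derive := is_derive_metric _ _ _ p0)).
Qed.

End MetricDerivative.

(** * Unit normal and mean curvature of a rotational patch at one point *)

Section RotationalPatch.
Context {R : realType} (kappa tau : R).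
Variables (P : profile R) (s th x1 z1 x2 z2 eps : R).
Let x := cx P s.
Let c := cos th.
Let n := sin th.
Let lam := 4 / (4 + kappa * x ^+ 2).
Let q2 := 1 + tau ^+ 2 * x ^+ 2.
Let p := vec3 (x * c) (x * n) (cz P s).
Let T0 := vec3 (x1 * c) (x1 * n) z1.
Let T1 := vec3 (- (x * n)) (x * c) 0.
Let T00 := vec3 (x2 * c) (x2 * n) z2.
Let T01 := vec3 (- (x1 * n)) (x1 * c) 0.
Let T11 := vec3 (- (x * c)) (- (x * n)) 0.
Hypothesis x_gt0 : 0 < x.
Hypothesis amb : 0 < 4 + kappa * x ^+ 2.

Let cn : c ^+ 2 = 1 - n ^+ 2.
Proof. by rewrite -[1](cos2Dsin2 th) addrK. Qed.

Let norm_p : px p ^+ 2 + py p ^+ 2 = x ^+ 2.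
Proof. by rewrite !vec3E; ring: cn. Qed.

Let conf_p : conf kappa p = lam.
Proof. by rewrite /conf norm_p. Qed.

Let amb_p : 4 + kappa * (px p ^+ 2 + py p ^+ 2) != 0.
Proof. by rewrite norm_p gt_eqF. Qed.

Let lam_gt0 : 0 < lam. Proof. by rewrite divr_gt0. Qed.

(** Radial, tangential and vertical components in the frame rotated by [th]; in them the metric and
    its derivatives no longer depend on [th]. *)
Let a_ r t e := vec3 (r * c - t * n) (r * n + t * c) e.

Let vecP v : exists r t e, v = a_ r t e.
Proof.
exists (c * px v + n * py v), (c * py v - n * px v), (pz v).
by rewrite -[LHS]vec3_eta /a_; congr vec3; ring: cn.
Qed.

Let vform_a r t e : vform kappa tau p (a_ r t e) = e - lam * tau * x * t.
Proof. by rewrite /vform conf_p /a_ !vec3E; ring: cn. Qed.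

Let metric_a r t e r' t' e' : metric kappa tau p (a_ r t e) (a_ r' t' e') =
  lam ^+ 2 * (r * r' + t * t') + (e - lam * tau * x * t) * (e' - lam * tau * x * t').
Proof. by rewrite /metric !vform_a conf_p /a_ !vec3E; ring: cn. Qed.

Let vform_der_a r t e r' t' e' : vform_der kappa tau p (a_ r t e) (a_ r' t' e') =
  (kappa / 2) * lam ^+ 2 * x ^+ 2 * r * tau * t' + lam * tau * (t * r' - r * t').
Proof. by rewrite /vform_der conf_p /a_ !vec3E; ring: cn. Qed.

Let metric_der_a r t e r' t' e' r'' t'' e'' :
  metric_der kappa tau p (a_ r t e) (a_ r' t' e') (a_ r'' t'' e'') =
  - kappa * lam ^+ 3 * x * r * (r' * r'' + t' * t'')
  + ((kappa / 2) * lam ^+ 2 * x ^+ 2 * r * tau * t' + lam * tau * (t * r' - r * t')) *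
    (e'' - lam * tau * x * t'')
  + (e' - lam * tau * x * t') *
   ((kappa / 2) * lam ^+ 2 * x ^+ 2 * r * tau * t'' + lam * tau * (t * r'' - r * t'')).
Proof. by rewrite /metric_der !vform_der_a !vform_a conf_p /a_ !vec3E; ring: cn. Qed.

Let T0E : T0 = a_ x1 0 z1. Proof. by rewrite /T0 /a_; congr vec3; ring. Qed.
Let T1E : T1 = a_ 0 x 0. Proof. by rewrite /T1 /a_; congr vec3; ring. Qed.
Let T00E : T00 = a_ x2 0 z2. Proof. by rewrite /T00 /a_; congr vec3; ring. Qed.
Let T01E : T01 = a_ 0 x1 0. Proof. by rewrite /T01 /a_; congr vec3; ring. Qed.
Let T11E : T11 = a_ (- x) 0 0. Proof. by rewrite /T11 /a_; congr vec3; ring. Qed.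

Let W2 := lam ^+ 2 * q2 * x1 ^+ 2 + z1 ^+ 2.
Let W := Num.sqrt W2.
Let nu := eps * lam * x1 / W.
(** Orthogonality to the parallel ties the tangential component to the vertical one through the
    twist [lam tau x], whence the factor [q2]; orthogonality to the meridian gives the radial
    one. *)
Definition rot_normal := a_ (- eps * z1 / (lam * W)) (tau * x * nu / lam) (q2 * nu).

Hypothesis imm : x1 != 0 \/ z1 != 0.
Hypothesis eps1 : eps = 1 \/ eps = -1.

Let q2_gt0 : 0 < q2. Proof. by rewrite ltr_pwDl// -exprMn sqr_ge0. Qed.

Let W2_gt0 : 0 < W2.
Proof.
have [h|h] := imm.
  rewrite ltr_pwDl ?sqr_ge0// mulr_gt0//; first by rewrite mulr_gt0// exprn_gt0.
  by rewrite lt0r sqrf_eq0 h sqr_ge0.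
rewrite ltr_wpDl//; last by rewrite lt0r sqrf_eq0 h sqr_ge0.
by rewrite mulr_ge0 ?sqr_ge0// mulr_ge0 ?sqr_ge0// ltW.
Qed.

Let W_gt0 : 0 < W. Proof. by rewrite sqrtr_gt0. Qed.
Let W_sq : W ^+ 2 = W2. Proof. by rewrite sqr_sqrtr// ltW. Qed.
Let eps_sq : eps ^+ 2 = 1. Proof. by have [->|->] := eps1; rewrite ?sqrrN expr1n. Qed.
Let lam0 : lam != 0. Proof. by rewrite gt_eqF. Qed.
Let W0 : W != 0. Proof. by rewrite gt_eqF. Qed.
Let x0 : x != 0. Proof. by rewrite gt_eqF. Qed.

Let tri (u v w : 'rV[R]_3) : R :=
  px u * (py v * pz w - pz v * py w) - py u * (px v * pz w - pz v * px w)
  + pz u * (px v * py w - py v * px w).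

Let tri_a r t e : tri T0 T1 (a_ r t e) = x * (x1 * e - z1 * r).
Proof. by rewrite /tri /a_ !vec3E; ring: cn. Qed.

Lemma rot_normalP : [/\ metric kappa tau p rot_normal rot_normal = 1,
   metric kappa tau p T0 rot_normal = 0, metric kappa tau p T1 rot_normal = 0 &
   0 < eps * tri T0 T1 rot_normal].
Proof.
rewrite /rot_normal T0E T1E !metric_a; split.
- rewrite /nu.
  have -> : q2 * (eps * lam * x1 / W) - lam * tau * x * (tau * x * (eps * lam * x1 / W) / lam) = eps * lam * x1 / W.
    by rewrite /q2; field; rewrite lam0 W0.
  transitivity ((eps ^+ 2) * W2 / W ^+ 2); last by rewrite eps_sq W_sq mul1r divff// gt_eqF.
  by rewrite /W2 /q2; field; rewrite lam0 W0.
- by rewrite /nu /q2; field; rewrite lam0 W0.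
- by rewrite /nu /q2; field; rewrite lam0 W0.
- rewrite -T0E -T1E tri_a.
  have -> : eps * (x * (x1 * (q2 * nu) - z1 * (- eps * z1 / (lam * W)))) =
    eps ^+ 2 * x * W2 / (lam * W) by rewrite /nu /W2; field; rewrite lam0 W0.
  by rewrite eps_sq mul1r divr_gt0// mulr_gt0.
Qed.

(** Here [m] is the product with [xi]. Orthogonality to the parallel expresses [t] and [e] by [m];
    orthogonality to the meridian makes [r] and [m] proportional to [d], the orientation
    determinant, whose square is fixed by the unit length and whose sign by the orientation. *)
Lemma rot_normal_unique eta : metric kappa tau p eta eta = 1 ->
   metric kappa tau p T0 eta = 0 -> metric kappa tau p T1 eta = 0 ->
   0 < eps * tri T0 T1 eta -> eta = rot_normal.
Proof.
have [r [t [e ->]]] := vecP eta.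
rewrite T0E T1E !metric_a -T0E -T1E tri_a.
pose m := e - lam * tau * x * t; rewrite -/m => e1 e2 e3 e4.
have tE : t = tau * x * m / lam.
  apply: (mulfI (mulf_neq0 x0 (expf_neq0 2 lam0))).
  transitivity (tau * x ^+ 2 * lam * m); last by field; rewrite lam0.
  by apply/eqP; rewrite -subr_eq0; apply/eqP; rewrite -[RHS]e3; ring.
have eE : e = q2 * m.
  have -> : e = m + lam * tau * x * t by rewrite /m; ring.
  by rewrite tE /q2; field.
have e2' : lam ^+ 2 * x1 * r = - (z1 * m).
  by apply/eqP; rewrite -subr_eq0; apply/eqP; rewrite -[RHS]e2; ring.
have e1' : lam ^+ 2 * r ^+ 2 + q2 * m ^+ 2 = 1.
  by rewrite -[RHS]e1 [in RHS]tE /q2; field.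
pose d := x1 * q2 * m - z1 * r.
have d_gt0 : 0 < eps * d.
  have : 0 < x * (eps * d).
    by congr (0 < _): e4; rewrite /d [in LHS]eE; ring.
  by rewrite pmulr_rgt0.
have mW : m * W2 = lam ^+ 2 * x1 * d.
  rewrite /W2 /d.
  transitivity (lam ^+ 2 * q2 * x1 ^+ 2 * m - z1 * - (z1 * m)); first ring.
  by rewrite -e2'; ring.
have rW : r * W2 = - (z1 * d).
  rewrite /W2 /d.
  transitivity (q2 * x1 * (lam ^+ 2 * x1 * r) + z1 ^+ 2 * r); first ring.
  by rewrite e2'; ring.
have dE : d = eps * W / lam.
  have d2 : lam ^+ 2 * d ^+ 2 = W2.
    apply: (mulfI (lt0r_neq0 W2_gt0)).
    transitivity (lam ^+ 2 * (z1 * d) ^+ 2 + q2 * (lam ^+ 2 * x1 * d) ^+ 2).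
      by rewrite /W2; ring.
    rewrite -mW -[(z1 * d) ^+ 2]sqrrN -rW.
    by transitivity (W2 ^+ 2 * (lam ^+ 2 * r ^+ 2 + q2 * m ^+ 2)); [ring|rewrite e1'; ring].
  have : lam * (eps * d) = W.
    apply/eqP; rewrite -(eqrXn2 (n := 2))//; last 2 first.
    - by rewrite ltW// mulr_gt0.
    - by rewrite ltW.
    apply/eqP; rewrite W_sq -d2.
    by transitivity (lam ^+ 2 * eps ^+ 2 * d ^+ 2); [ring|rewrite eps_sq; ring].
  by move=> <-; transitivity (eps ^+ 2 * d); [rewrite eps_sq mul1r | field].
have mE : m = nu.
  apply: (mulIf (lt0r_neq0 W2_gt0)); rewrite mW dE /nu -W_sq.
  by field; rewrite lam0 W0.
rewrite /rot_normal eE mE tE mE; congr a_.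
apply: (mulIf (lt0r_neq0 W2_gt0)); rewrite rW dE -W_sq.
by field; rewrite lam0 W0.
Qed.

Lemma metric_rot_normal_xi : metric kappa tau p rot_normal xi = nu.
Proof.
have -> : xi = a_ 0 0 1 by rewrite /xi /a_; congr vec3; ring.
by rewrite metric_a /nu /q2; field; rewrite lam0 W0.
Qed.

Let Gam u v := metric kappa tau p u rot_normal + christoffel kappa tau p v.1 v.2 rot_normal.

Definition rot_H : R :=
  2^-1 * ((Gam T00 (T0, T0) * metric kappa tau p T1 T1
   - Gam T01 (T0, T1) * metric kappa tau p T1 T0
   - Gam T01 (T1, T0) * metric kappa tau p T0 T1
   + Gam T11 (T1, T1) * metric kappa tau p T0 T0) /
  (metric kappa tau p T0 T0 * metric kappa tau p T1 T1
   - metric kappa tau p T0 T1 * metric kappa tau p T1 T0)).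

Let gram : metric kappa tau p T0 T0 * metric kappa tau p T1 T1
   - metric kappa tau p T0 T1 * metric kappa tau p T1 T0 = lam ^+ 2 * x ^+ 2 * W2.
Proof. by rewrite T0E T1E !metric_a /W2 /q2; ring. Qed.

Lemma rot_gram_neq0 : metric kappa tau p T0 T0 * metric kappa tau p T1 T1
   - metric kappa tau p T0 T1 * metric kappa tau p T1 T0 != 0.
Proof. by rewrite gram; apply: lt0r_neq0; rewrite mulr_gt0// mulr_gt0// exprn_gt0. Qed.

(** The mean curvature equation solved for the combination of second derivatives that enters the
    rotation of the tangent of the profile. *)
Lemma rot_HE :
  z1 * ((- (kappa / 2) * lam ^+ 2 * x * q2 + lam * tau ^+ 2 * x) * x1 ^+ 2 + lam * q2 * x2)
   - lam * q2 * x1 * z2 = W2 * (z1 * (x^-1 - kappa * x / 4) - 2 * eps * W * rot_H).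
Proof.
rewrite /rot_H gram /Gam /= !christoffelE //.
rewrite T0E T1E T00E T01E T11E !metric_a /rot_normal !metric_der_a.
(* Treating [eps / W] as one variable removes the square root: as [eps] is a sign,
   [2 eps W = 2 / k]. *)
pose k := eps / W.
have k0 : k != 0.
  by rewrite mulf_neq0 ?invr_eq0//; have [->|->] := eps1; rewrite ?oppr_eq0 oner_eq0.
have -> : - eps * z1 / (lam * W) = - k * z1 / lam by rewrite /k; field; rewrite lam0 W0.
have -> : nu = k * lam * x1 by rewrite /nu /k; field.
have -> : 2 * eps * W = 2 / k.
  rewrite /k invf_div; have -> : W / eps = eps * W; last by ring.
  by have [->|->] := eps1; field.
(* Eliminating [kappa] in favour of [lam] leaves a rational identity between independent
   variables. *)
have kE : kappa = (4 / lam - 4) / x ^+ 2.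
  have a0 : 4 + kappa * x ^+ 2 != 0 by rewrite gt_eqF.
  by rewrite /lam; field; rewrite a0 x0.
have W2n0 : W2 != 0 by rewrite gt_eqF.
rewrite kE; move: W2n0; rewrite /W2 /q2 => Wn0.
field; rewrite k0 lam0 x0 /=.
rewrite ?andbT; have -> : (tau * x) ^+ 2 = tau ^+ 2 * x ^+ 2 by rewrite exprMn.
by [].
Qed.

End RotationalPatch.

(** * Partial derivatives of rotational patches and the regularity of their profiles *)

Section PatchDerivatives.
Context {R : realType}.
Implicit Types (f g : R -> R) (w : 'rV[R]_2).

(** With [rotG] these maps form a family closed under both partial derivatives, so that every
    derivative of a rotational patch keeps this shape. *)
Definition rotF f g w : 'rV[R]_3 :=
  vec3 (f (w ord0 (inord 0)) * cos (w ord0 (inord 1)))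
       (f (w ord0 (inord 0)) * sin (w ord0 (inord 1))) (g (w ord0 (inord 0))).
Definition rotG f w : 'rV[R]_3 :=
  vec3 (- (f (w ord0 (inord 0)) * sin (w ord0 (inord 1))))
       (f (w ord0 (inord 0)) * cos (w ord0 (inord 1))) 0.

Let e0 : 'rV[R]_2 := delta_mx ord0 (inord 0).
Let e1 : 'rV[R]_2 := delta_mx ord0 (inord 1).

Lemma diff_coord2 (i : 'I_2) w : differentiable (fun w : 'rV[R]_2 => w ord0 i) w.
Proof. exact: differentiable_coord. Qed.

Lemma der_coord w (i : 'I_2) f (df : R) (v : 'rV[R]_2) : is_derive (w ord0 i) 1 f df ->
  is_derive w v (fun w : 'rV[R]_2 => f (w ord0 i)) (df * v ord0 i).
Proof.
move=> fd; apply: (derC fd); first exact: diff_coord2.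
exact: is_derive_coord.
Qed.

Lemma derivable_der1 f (x : R) : derivable f x 1 -> is_derive x 1 f (derive1 f x).
Proof. by move=> /derivableP; rewrite derive1E. Qed.

Lemma rotF_der0 f g w : derivable f (w ord0 (inord 0)) 1 ->
  derivable g (w ord0 (inord 0)) 1 ->
  is_derive w e0 (rotF f g) (rotF (derive1 f) (derive1 g) w).
Proof.
move=> /derivable_der1 f1 /derivable_der1 g1.
have df := der_coord e0 f1; have dg := der_coord e0 g1.
have dc := der_coord e0 (is_derive_cos (w ord0 (inord 1))).
have ds := der_coord e0 (is_derive_sin (w ord0 (inord 1))).
move: df dg dc ds; rewrite /e0 !delta0 !vec2E !mulr0 !mulr1 => df dg dc ds.
by apply: is_derive_vec3 => //; der; ring.
Qed.

Lemma rotF_der1 f g w :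
  derivable f (w ord0 (inord 0)) 1 -> derivable g (w ord0 (inord 0)) 1 ->
  is_derive w e1 (rotF f g) (rotG f w).
Proof.
move=> /derivable_der1 f1 /derivable_der1 g1.
have df := der_coord e1 f1; have dg := der_coord e1 g1.
have dc := der_coord e1 (is_derive_cos (w ord0 (inord 1))).
have ds := der_coord e1 (is_derive_sin (w ord0 (inord 1))).
move: df dg dc ds; rewrite /e1 !delta1 !vec2E !mulr0 !mulr1 => df dg dc ds.
by apply: is_derive_vec3 => //; der; ring.
Qed.

Lemma rotG_der0 f w : derivable f (w ord0 (inord 0)) 1 ->
  is_derive w e0 (rotG f) (rotG (derive1 f) w).
Proof.
move=> /derivable_der1 f1; have df := der_coord e0 f1.
have dc := der_coord e0 (is_derive_cos (w ord0 (inord 1))).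
have ds := der_coord e0 (is_derive_sin (w ord0 (inord 1))).
move: df dc ds; rewrite /e0 !delta0 !vec2E !mulr0 !mulr1 => df dc ds.
by apply: is_derive_vec3; der; ring.
Qed.

Lemma rotG_der1 f w : derivable f (w ord0 (inord 0)) 1 ->
  is_derive w e1 (rotG f) (rotF (fun t => - f t) (fun=> 0) w).
Proof.
move=> /derivable_der1 f1; have df := der_coord e1 f1.
have dc := der_coord e1 (is_derive_cos (w ord0 (inord 1))).
have ds := der_coord e1 (is_derive_sin (w ord0 (inord 1))).
move: df dc ds; rewrite /e1 !delta1 !vec2E !mulr0 !mulr1 => df dc ds.
by apply: is_derive_vec3; der; ring.
Qed.

Lemma cont_coord (i : 'I_2) f w : {for w ord0 i, continuous f} ->
  {for w, continuous (fun w : 'rV[R]_2 => f (w ord0 i))}.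
Proof.
move=> fc; apply: (@continuous_comp _ _ _ (fun w : 'rV[R]_2 => w ord0 i) f) => //.
exact: coord_continuous.
Qed.

Lemma cont_rotF f g w : {for w ord0 (inord 0), continuous f} ->
  {for w ord0 (inord 0), continuous g} -> {for w, continuous (rotF f g)}.
Proof.
move=> fc gc; have cc := cont_coord (continuous_cos (x := w ord0 (inord 1))).
have sc := cont_coord (continuous_sin (x := w ord0 (inord 1))).
have fc' := cont_coord fc; have gc' := cont_coord gc.
by apply: continuous_vec3; [apply: continuousM|apply: continuousM|].
Qed.

Lemma cont_rotG f w : {for w ord0 (inord 0), continuous f} ->
  {for w, continuous (rotG f)}.
Proof.
move=> fc; have cc := cont_coord (continuous_cos (x := w ord0 (inord 1))).
have sc := cont_coord (continuous_sin (x := w ord0 (inord 1))).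
have fc' := cont_coord fc.
apply: continuous_vec3; last exact: cont_cst.
  by cont.
by apply: continuousM.
Qed.

Lemma derivable_coord0 f w : derivable (fun w : 'rV[R]_2 => f (w ord0 (inord 0))) w e0 <->
  derivable f (w ord0 (inord 0)) 1.
Proof.
rewrite derivable1P [X in _ <-> X]derivable1P.
rewrite (_ : (fun h : R => _) = (fun h => f (h *: 1 + w ord0 (inord 0))))//.
by apply/funext => h; rewrite /e0 delta0 !mxE/= inordK.
Qed.

Lemma rotF_der0_inv f g s : derivable (rotF f g) (vec2 s 0) e0 ->
  derivable f s 1 /\ derivable g s 1.
Proof.
move=> /derivable_vec3P[fd _ gd].
split; last by move/derivable_coord0 : gd; rewrite vec2E.
have : derivable (fun w => f (w ord0 (inord 0))) (vec2 s 0) e0.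
  move: fd; rewrite derivable1P => fd; rewrite derivable1P.
  rewrite (_ : (fun h : R => _) = (fun h => f (((h *: e0 + vec2 s 0) : 'rV[R]_2) ord0 (inord 0)) *
    cos (((h *: e0 + vec2 s 0) : 'rV[R]_2) ord0 (inord 1))))//.
  apply/funext => h; rewrite /e0 delta0 [X in cos X]mxE [X in cos (X + _)]mxE !vec2E.
  by rewrite mulr0 addr0 cos0 mulr1.
by move/derivable_coord0; rewrite vec2E.
Qed.

Lemma cont_vec2 (th s : R) : {for s, continuous (fun t : R => vec2 t th : 'rV[R]_2)}.
Proof.
have -> : (fun t => vec2 t th) = (fun t : R => t *: vec2 1 0 + vec2 0 th) :> (R -> 'rV[R]_2).
  apply/funext => t; rewrite -[RHS]vec2_eta; congr vec2; rewrite !mxE !inordK//=; ring.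
by apply: cvgD; [apply: cvgZr_tmp; exact: cvg_id | exact: cvg_cst].
Qed.

Lemma cont_rotF_inv f g s : {for vec2 s 0, continuous (rotF f g)} ->
  {for s, continuous f} /\ {for s, continuous g}.
Proof.
move=> Fc.
have comp (i : 'I_3) : {for s, continuous (fun t => rotF f g (vec2 t 0) ord0 i)}.
  apply: (@continuous_comp _ _ _ (fun t : R => rotF f g (vec2 t 0)) (fun v : 'rV[R]_3 => v ord0 i)).
    by apply: continuous_comp; [exact: cont_vec2 | exact: Fc].
  exact: coord_continuous.
split; [have := comp (inord 0) | have := comp (inord 2)].
  by apply: cont_ext => y; rewrite mxE inordK//= !vec2E cos0 mulr1.
by apply: cont_ext => y; rewrite mxE inordK//= !vec2E.
Qed.

Definition C2_profile_at (P : profile R) (s : R) : Prop :=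
  [/\ derivable (cx P) s 1, derivable (cz P) s 1,
      derivable (derive1 (cx P)) s 1, derivable (derive1 (cz P)) s 1 &
      {for s, continuous (derive1 (derive1 (cx P)))} /\ {for s, continuous (derive1 (derive1 (cz P)))}].

Lemma near_vec2 (s th : R) (A : set 'rV[R]_2) : (\forall w \near vec2 s th, A w) ->
  \forall t \near s, A (vec2 t th).
Proof. by move=> wA; exact: (cont_vec2 (th := th) wA). Qed.

Lemma near_coord0 (w : 'rV[R]_2) (A : set R) :
  (\forall t \near w ord0 (inord 0), A t) -> \forall w' \near w, A ((w' : 'rV[R]_2) ord0 (inord 0)).
Proof. by move=> wA; exact: (coord_continuous (x := w) wA). Qed.

Lemma pd_rotF0 f g w : derivable f (w ord0 (inord 0)) 1 ->
  derivable g (w ord0 (inord 0)) 1 ->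
  pd (inord 0) (rotF f g) w = rotF (derive1 f) (derive1 g) w.
Proof. by move=> f1 g1; rewrite /pd; exact: (derive_val (is_derive := rotF_der0 f1 g1)). Qed.
Lemma pd_rotF1 f g w : derivable f (w ord0 (inord 0)) 1 ->
  derivable g (w ord0 (inord 0)) 1 -> pd (inord 1) (rotF f g) w = rotG f w.
Proof. by move=> f1 g1; rewrite /pd; exact: (derive_val (is_derive := rotF_der1 f1 g1)). Qed.
Lemma pd_rotG0 f w : derivable f (w ord0 (inord 0)) 1 ->
  pd (inord 0) (rotG f) w = rotG (derive1 f) w.
Proof. by move=> f1; rewrite /pd; exact: (derive_val (is_derive := rotG_der0 f1)). Qed.
Lemma pd_rotG1 f w : derivable f (w ord0 (inord 0)) 1 ->
  pd (inord 1) (rotG f) w = rotF (fun t => - f t) (fun=> 0) w.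
Proof. by move=> f1; rewrite /pd; exact: (derive_val (is_derive := rotG_der1 f1)). Qed.

Lemma pd_near (F G : 'rV[R]_2 -> 'rV[R]_3) a w : (\forall w' \near w, F w' = G w') ->
  [/\ pd a F w = pd a G w, pderivable a F w <-> pderivable a G w &
     \forall w' \near w, pd a F w' = pd a G w'].
Proof.
move=> FG; split; first exact: near_eq_derive.
  split; apply: near_eq_derivable => //.
  by near do apply/esym.
have FG2 := near_join FG.
near=> w'; apply: near_eq_derive.
by near: w'; exact: FG2.
Unshelve. all: by end_near. Qed.

Lemma contV_near (F G : 'rV[R]_2 -> 'rV[R]_3) w : (\forall w' \near w, F w' = G w') ->
  {for w, continuous F} -> {for w, continuous G}.
Proof.
move=> FG Fw; rewrite /prop_for/= /continuous_at -(nbhs_singleton FG).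
apply: cvg_trans Fw; have H := near_eq_cvg (F := nbhs w) FG; exact: H.
Qed.

Section Profile.
Variable P : profile R.
Let x := cx P.
Let z := cz P.
Let Psi := rot_patch P.

Lemma pd_rot w : (\forall t \near w ord0 (inord 0), derivable x t 1 /\ derivable z t 1) ->
  [/\ \forall w' \near w, rotF (derive1 x) (derive1 z) w' = pd (inord 0) Psi w' &
      \forall w' \near w, rotG x w' = pd (inord 1) Psi w'].
Proof.
move=> /near_coord0 D; split; apply: filterS D => w' [d1 d2]; apply/esym.
  exact: (pd_rotF0 d1 d2).
exact: (pd_rotF1 d1 d2).
Qed.

Lemma pd2_rot w : (\forall t \near w ord0 (inord 0), C2_profile_at P t) ->
  [/\ pd (inord 0) (pd (inord 0) Psi) w = rotF (derive1 (derive1 x)) (derive1 (derive1 z)) w,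
      pd (inord 0) (pd (inord 1) Psi) w = rotG (derive1 x) w,
      pd (inord 1) (pd (inord 0) Psi) w = rotG (derive1 x) w &
      pd (inord 1) (pd (inord 1) Psi) w = rotF (fun t => - x t) (fun=> 0) w].
Proof.
move=> D; have [x1 z1 x2 z2 _] := nbhs_singleton D.
have [n0 n1] : [/\ \forall w' \near w, rotF (derive1 x) (derive1 z) w' = pd (inord 0) Psi w' &
      \forall w' \near w, rotG x w' = pd (inord 1) Psi w'].
  by apply: pd_rot; apply: filterS D => t [xt zt _ _ _]; exact: (conj xt zt).
have [e00 _ _] := pd_near (inord 0) n0; have [e10 _ _] := pd_near (inord 1) n0.
have [e01 _ _] := pd_near (inord 0) n1; have [e11 _ _] := pd_near (inord 1) n1.
split.
- exact: (etrans (esym e00) (pd_rotF0 x2 z2)).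
- exact: (etrans (esym e01) (pd_rotG0 x1)).
- exact: (etrans (esym e10) (pd_rotF1 x2 z2)).
- exact: (etrans (esym e11) (pd_rotG1 x1)).
Qed.

Lemma C2_near_rot w : (\forall t \near w ord0 (inord 0), C2_profile_at P t) ->
  C2_near Psi w.
Proof.
move=> /near_join /near_coord0; apply: filterS => {}w D.
have [x1 z1 x2 z2 [x3 z3]] := nbhs_singleton D.
have [n0 n1] : [/\ \forall w' \near w, rotF (derive1 x) (derive1 z) w' = pd (inord 0) Psi w' &
      \forall w' \near w, rotG x w' = pd (inord 1) Psi w'].
  by apply: pd_rot; apply: filterS D => t [xt zt _ _ _]; exact: (conj xt zt).
have D2 : \forall w' \near w, C2_profile_at P ((w' : 'rV[R]_2) ord0 (inord 0)).
  exact: near_coord0.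
have [_ d00 n00] := pd_near (inord 0) n0; have [_ d01 n01] := pd_near (inord 1) n0.
have [_ d10 n10] := pd_near (inord 0) n1; have [_ d11 n11] := pd_near (inord 1) n1.
split.
- exact: (cont_rotF (derivable_cont x1) (derivable_cont z1)).
- apply: I2P; split.
  + exact: (@ex_derive _ _ _ _ _ _ _ (rotF_der0 x1 z1)).
  + exact: (contV_near n0 (cont_rotF (derivable_cont x2) (derivable_cont z2))).
  + exact: (@ex_derive _ _ _ _ _ _ _ (rotF_der1 x1 z1)).
  + exact: (contV_near n1 (cont_rotG (derivable_cont x1))).
- apply: I2P; apply: I2P; split.
  + exact: (d00.1 (@ex_derive _ _ _ _ _ _ _ (rotF_der0 x2 z2))).
  + apply: (contV_near n00); apply: (contV_near _ (cont_rotF x3 z3)).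
    by apply: filterS D2 => w' [_ _ xw zw _]; exact: (esym (pd_rotF0 xw zw)).
  + exact: (d01.1 (@ex_derive _ _ _ _ _ _ _ (rotF_der1 x2 z2))).
  + apply: (contV_near n01); apply: (contV_near _ (cont_rotG (derivable_cont x2))).
    by apply: filterS D2 => w' [_ _ xw zw _]; exact: (esym (pd_rotF1 xw zw)).
  + exact: (d10.1 (@ex_derive _ _ _ _ _ _ _ (rotG_der0 x1))).
  + apply: (contV_near n10); apply: (contV_near _ (cont_rotG (derivable_cont x2))).
    by apply: filterS D2 => w' [xw _ _ _ _]; exact: (esym (pd_rotG0 xw)).
  + exact: (d11.1 (@ex_derive _ _ _ _ _ _ _ (rotG_der1 x1))).
  + have xn : {for w ord0 (inord 0), continuous (fun t => - x t)}.
      exact: (contN (derivable_cont x1)).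
    have zn : {for w ord0 (inord 0), continuous (fun=> 0 : R)}.
      exact: (@cont_cst R R).
    apply: (contV_near n11); apply: (contV_near _ (cont_rotF xn zn)).
    by apply: filterS D2 => w' [xw _ _ _ _]; exact: (esym (pd_rotG1 xw)).
Qed.

(** At angle zero the first and third components of the patch, and of its derivatives in [s], are
    those of the profile; regularity of the surface is thus inherited by the profile. *)
Lemma C2_near_rot_inv s : C2_near Psi (vec2 s 0) -> \forall t \near s, C2_profile_at P t.
Proof.
move=> /near_vec2 D; apply: filterS (near_join D) => {D}t D.
have D1 : \forall t' \near t, derivable x t' 1 /\ derivable z t' 1.
  apply: filterS D => t' [_ Dt _]; have [Dt0 _] := Dt (inord 0).
  exact: (rotF_der0_inv Dt0).
have [n0 n1] : [/\ \forall w' \near (vec2 t 0), rotF (derive1 x) (derive1 z) w' = pd (inord 0) Psi w' &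
      \forall w' \near (vec2 t 0), rotG x w' = pd (inord 1) Psi w'].
  by apply: pd_rot; rewrite vec2E.
have [_ d00 n00] := pd_near (inord 0) n0.
have [_ _ D00] := nbhs_singleton D.
have [b0 c1] := D00 (inord 0) (inord 0).
have b1 := d00.2 b0.
have [x1 z1] := nbhs_singleton D1.
have [x2 z2] := rotF_der0_inv b1.
split; [exact: x1|exact: z1|exact: x2|exact: z2|apply: cont_rotF_inv].
apply: (contV_near _ c1).
have DD : \forall t' \near t, derivable (derive1 x) t' 1 /\ derivable (derive1 z) t' 1.
  have DJ := near_join D; have DJ1 := near_join D1.
  near=> t'.
  have D1' : \forall t'' \near t', derivable x t'' 1 /\ derivable z t'' 1.
    by near: t'; exact: DJ1.
  have [n0' _] : [/\ \forall w' \near (vec2 t' 0), rotF (derive1 x) (derive1 z) w' = pd (inord 0) Psi w' &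
      \forall w' \near (vec2 t' 0), rotG x w' = pd (inord 1) Psi w'].
    by apply: pd_rot; rewrite vec2E; exact: D1'.
  have [_ d00' _] := pd_near (inord 0) n0'.
  have b1' : pderivable (inord 0) (pd (inord 0) Psi) (vec2 t' 0).
    by near: t'; apply: filterS D => t' [_ _ D00']; have [] := D00' (inord 0) (inord 0).
  exact: (rotF_der0_inv (d00'.2 b1')).
have DD2 := near_coord0 (w := vec2 t 0).
rewrite vec2E in DD2; have {}DD2 := DD2 _ DD.
near=> w'.
have <- : pd (inord 0) (rotF (derive1 x) (derive1 z)) w' = pd (inord 0) (pd (inord 0) Psi) w'.
  by near: w'; exact: n00.
have [xw zw] : derivable (derive1 x) (w' ord0 (inord 0)) 1 /\ derivable (derive1 z) (w' ord0 (inord 0)) 1.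
  by near: w'; exact: DD2.
exact: (pd_rotF0 xw zw).
Unshelve. all: by end_near. Qed.

End Profile.

Lemma det3 (F : nat -> nat -> R) : \det (\matrix_(i < 3, j < 3) F i j) =
  F 0 0 * (F 1 1 * F 2 2 - F 1 2 * F 2 1) - F 0 1 * (F 1 0 * F 2 2 - F 1 2 * F 2 0)
  + F 0 2 * (F 1 0 * F 2 1 - F 1 1 * F 2 0).
Proof.
rewrite (expand_det_row _ ord0) !big_ord_recl big_ord0 /cofactor.
rewrite !(expand_det_row _ ord0) !big_ord_recl !big_ord0 /cofactor !det_mx11 !mxE /=.
rewrite /bump /= !addn0 !addn1 !add0n ?add1n !expr0 ?expr1 ?expr2.
ring.
Qed.

Lemma det_frame (T : 'M[R]_(2, 3)) (a b v : 'rV[R]_3) :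
  row (inord 0) T = a -> row (inord 1) T = b ->
  \det (col_mx T v : 'M[R]_3) =
  px a * (py b * pz v - pz b * py v) - py a * (px b * pz v - pz b * px v)
  + pz a * (px b * py v - py b * px v).
Proof.
move=> <- <-; rewrite /px /py /pz !mxE.
set M := col_mx T v.
transitivity (\det (\matrix_(i < 3, j < 3) (fun i j : nat => (M : 'M[R]_3) (inord i) (inord j)) i j)).
  by congr (\det _); apply/matrixP => i j; rewrite [RHS]mxE !inord_val.
rewrite (det3 (fun i j : nat => (M : 'M[R]_3) (inord i) (inord j))) /=.
have M0 j : (M : 'M[R]_3) (inord 0) j = T (inord 0) j.
  have -> : (inord 0 : 'I_3) = lshift 1 (inord 0 : 'I_2) by apply: val_inj; rewrite /= !inordK.
  exact: col_mxEu.
have M1 j : (M : 'M[R]_3) (inord 1) j = T (inord 1) j.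
  have -> : (inord 1 : 'I_3) = lshift 1 (inord 1 : 'I_2) by apply: val_inj; rewrite /= !inordK.
  exact: col_mxEu.
have M2 j : (M : 'M[R]_3) (inord 2) j = v ord0 j.
  have -> : (inord 2 : 'I_3) = rshift 2 (ord0 : 'I_1) by apply: val_inj; rewrite /= !inordK.
  exact: col_mxEd.
by rewrite !M0 !M1 !M2.
Qed.

Lemma sum2 (U : nmodType) (F : 'I_2 -> U) : \sum_i F i = F (inord 0) + F (inord 1).
Proof.
rewrite !big_ord_recl big_ord0 addr0; congr (F _ + F _); apply: val_inj; rewrite /= ?inordK//.
Qed.

Lemma mx2P (A B : 'M[R]_2) : (forall i j : 'I_2, A i j = B i j) -> A = B.
Proof. by move=> AB; apply/matrixP. Qed.

Lemma trace_invmx2 (S A : 'M[R]_2) :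
  let i := inord 0 in let j := inord 1 in
  A i i * A j j - A i j * A j i != 0 ->
  \tr (S *m invmx A) =
   (S i i * A j j - S i j * A j i - S j i * A i j + S j j * A i i) /
   (A i i * A j j - A i j * A j i).
Proof.
move=> i j; set d := _ - _ => d0.
pose B : 'M[R]_2 := \matrix_(a, b) ((if a == b then A (if a == i then j else i) (if a == i then j else i)
  else - A a b) / d).
have ij : (i == j) = false := inord01; have ji : (j == i) = false := inord10.
have BA : B *m A = 1%:M.
  apply: mx2P; apply: I2P; apply: I2P; rewrite !mxE sum2 !mxE -/i -/j ?eqxx ?ij ?ji /=.
  - by rewrite mulr1n /d; field.
  - by rewrite mulr0n /d; field.
  - by rewrite mulr0n /d; field.
  - by rewrite mulr1n /d; field.
have -> : invmx A = B.
  have Au : A \in unitmx by case: (mulmx1_unit BA).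
  by rewrite -[LHS]mul1mx -BA -mulmxA mulmxV// mulmx1.
rewrite /mxtrace sum2 !mxE !sum2 !mxE -/i -/j ?eqxx ?ij ?ji /=.
by rewrite /d; field.
Qed.

End PatchDerivatives.

(** * Regular points of a rotational surface *)

Section RotationalGeometry.
Context {R : realType} (kappa tau : R).
Hypothesis kappa_le0 : kappa <= 0.
Implicit Types (P : profile R) (s th eps : R).

Lemma ambientP P s th : ambient kappa (rotated P s th) <-> 0 < 4 + kappa * cx P s ^+ 2.
Proof.
rewrite /ambient /= /rotated !vec3E !exprMn -mulrDr cos2Dsin2 mulr1.
have [k0|k0|->] := ltgtP kappa 0; last first.
- by split=> // _; rewrite mul0r addr0.
- by move: kappa_le0; rewrite leNgt k0.
split=> [/(_ isT)|h _]; rewrite ltr_pdivlMr ?oppr_gt0//; nra.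
Qed.

Definition immersed_at P s := derive1 (cx P) s != 0 \/ derive1 (cz P) s != 0.

Definition regular_at P s := [/\ \forall t \near s, C2_profile_at P t,
  0 < cx P s, 0 < 4 + kappa * cx P s ^+ 2 & immersed_at P s].

Lemma tangents_rot P s th : C2_profile_at P s ->
  let x1 := derive1 (cx P) s in
  row (inord 0) (tangents (rot_patch P) (vec2 s th)) =
    vec3 (x1 * cos th) (x1 * sin th) (derive1 (cz P) s) /\
  row (inord 1) (tangents (rot_patch P) (vec2 s th)) =
    vec3 (- (cx P s * sin th)) (cx P s * cos th) 0.
Proof.
move=> [x1 z1 _ _ _]; rewrite !rowK.
have e0 : vec2 s th ord0 (inord 0) = s by rewrite vec2E.
rewrite -e0 in x1 z1.
split; first by rewrite (pd_rotF0 x1 z1) /rotF !vec2E.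
by rewrite (pd_rotF1 x1 z1) /rotG !vec2E.
Qed.

Lemma row_free_rot P s th : C2_profile_at P s ->
  row_free (tangents (rot_patch P) (vec2 s th)) <-> cx P s != 0 /\ immersed_at P s.
Proof.
move=> c2; have [r0 r1] := tangents_rot th c2; set T := tangents _ _ in r0 r1 *.
split=> [fT|[x0 imm]].
  have nz (i : 'I_2) : row i T != 0.
    apply/eqP => ri; have : delta_mx ord0 i = 0 :> 'rV[R]_2.
      by apply: (row_free_inj fT); rewrite mul0mx -rowE.
    by move=> /matrixP/(_ ord0 i); rewrite !mxE !eqxx => /eqP; rewrite oner_eq0.
  have z3 : vec3 0 0 0 = 0 :> 'rV[R]_3 by apply/rowP => i; rewrite !mxE; case: i => -[|[|[|]]].
  split.
    by apply: contraNneq (nz (inord 1)) => x0; rewrite r1 x0 !mul0r oppr0 z3.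
  apply: contrapT => /not_orP[/negP/negPn/eqP x1 /negP/negPn/eqP z1].
  by move: (nz (inord 0)); rewrite r0 x1 z1 !mul0r z3 eqxx.
apply: inj_row_free => v vT.
have : v ord0 (inord 0) *: row (inord 0) T + v ord0 (inord 1) *: row (inord 1) T = 0.
  by rewrite -[RHS]vT [RHS]mulmx_sum_row sum2.
rewrite r0 r1 !scale_vec3 add_vec3 => e.
have e1 := congr1 px e; have e2 := congr1 py e; have e3 := congr1 pz e.
move: e1 e2 e3; rewrite !vec3E /px /py /pz !mxE.
set a := v _ _; set b := v _ _; set c := cos th; set n := sin th => e1 e2 e3.
have cn : c ^+ 2 + n ^+ 2 = 1 := cos2Dsin2 th.
have b0 : b = 0.
  apply: (mulIf x0); rewrite mul0r.
  transitivity (b * cx P s * (c ^+ 2 + n ^+ 2)); first by rewrite cn mulr1.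
  transitivity (c * (a * (derive1 (cx P) s * n) + b * (cx P s * c)) -
    n * (a * (derive1 (cx P) s * c) + b * - (cx P s * n))); first ring.
  by rewrite e1 e2; ring.
have a0 : a = 0.
  move: e1 e2 e3; rewrite b0 !mul0r !addr0 => e1 e2 e3.
  case: imm => i0; apply: (mulIf i0); rewrite mul0r; last by rewrite e3.
  transitivity (c * (a * (derive1 (cx P) s * c)) + n * (a * (derive1 (cx P) s * n))).
    by transitivity (a * derive1 (cx P) s * (c ^+ 2 + n ^+ 2)); [rewrite cn mulr1|ring].
  by rewrite e1 e2; ring.
by rewrite -[v]vec2_eta -/a -/b a0 b0; apply/rowP => i; rewrite !mxE; case: i => -[|[|]].
Qed.

Lemma C2_immersion_rot P s th : regular_at P s ->
  C2_immersion_at (rot_patch P) (vec2 s th).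
Proof.
move=> [c2 x0 amb imm]; split; first by apply: C2_near_rot; rewrite vec2E.
by apply/row_free_rot; [exact: nbhs_singleton c2|rewrite gt_eqF].
Qed.

Lemma regular_interior P s : rotational_surface kappa P -> (cdom P)^° s -> regular_at P s.
Proof.
move=> [_ xge0 _ amb imm] si.
have [C2 free] := imm _ _ _ _ _ (chart_regular 0 si).
have c2 := C2_near_rot_inv C2.
have sP : cdom P s := interior_subset si.
have [x0 im] := (row_free_rot 0 (nbhs_singleton c2)).1 free.
split => //; last by apply/ambientP; exact: (amb s 0).
by rewrite lt0r x0 xge0.
Qed.

Section Normal.
Variables (P : profile R) (s th eps : R).
Hypothesis reg : regular_at P s.
Hypothesis eps1 : eps = 1 \/ eps = -1.
Let x := cx P s.
Let x1 := derive1 (cx P) s.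
Let z1 := derive1 (cz P) s.
Let x2 := derive1 (derive1 (cx P)) s.
Let z2 := derive1 (derive1 (cz P)) s.
Let lam := 4 / (4 + kappa * x ^+ 2).
Let q2 := 1 + tau ^+ 2 * x ^+ 2.
Let W2 := lam ^+ 2 * q2 * x1 ^+ 2 + z1 ^+ 2.
Let W := Num.sqrt W2.
Let eta0 := rot_normal kappa tau P s th x1 z1 eps.

Let c2 : C2_profile_at P s. Proof. by case: reg => /nbhs_singleton. Qed.
Let x0 : 0 < x. Proof. by case: reg. Qed.
Let amb : 0 < 4 + kappa * x ^+ 2. Proof. by case: reg. Qed.
Let imm : x1 != 0 \/ z1 != 0. Proof. by case: reg. Qed.

Let PsiE : rot_patch P (vec2 s th) = vec3 (x * cos th) (x * sin th) (cz P s).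
Proof. by rewrite /rot_patch /rotated !vec2E. Qed.

Let pd0 : pd (inord 0) (rot_patch P) (vec2 s th) = vec3 (x1 * cos th) (x1 * sin th) z1.
Proof. by have [+ _] := tangents_rot th c2; rewrite rowK. Qed.
Let pd1 : pd (inord 1) (rot_patch P) (vec2 s th) = vec3 (- (x * sin th)) (x * cos th) 0.
Proof. by have [_] := tangents_rot th c2; rewrite rowK. Qed.

Lemma unit_normal_rotP eta :
  unit_normal kappa tau eps (rot_patch P) (vec2 s th) eta <-> eta = eta0.
Proof.
have [r0 r1] := tangents_rot th c2.
split=> [[e1 e2 e3]|->].
  have := e2 (inord 0); have := e2 (inord 1); rewrite pd0 pd1 PsiE => m1 m0.
  rewrite PsiE in e1; rewrite (det_frame _ r0 r1) in e3.
  exact: (rot_normal_unique x0 amb imm eps1 e1 m0 m1 e3).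
have [m m0 m1 d] := rot_normalP tau th x0 amb imm eps1.
split; [by rewrite PsiE|by apply: I2P; rewrite PsiE ?pd0 ?pd1|].
by rewrite (det_frame _ r0 r1).
Qed.

Lemma angle_rot : angle kappa tau (rot_patch P) (vec2 s th) eta0 = eps * lam * x1 / W.
Proof. by rewrite /angle PsiE metric_rot_normal_xi. Qed.

Lemma mean_curvature_rot :
  z1 * ((- (kappa / 2) * lam ^+ 2 * x * q2 + lam * tau ^+ 2 * x) * x1 ^+ 2 + lam * q2 * x2)
   - lam * q2 * x1 * z2 = W2 * (z1 * (x^-1 - kappa * x / 4)
     - 2 * eps * W * mean_curvature kappa tau (rot_patch P) (vec2 s th) eta0).
Proof.
rewrite /W2 /W /lam /q2 /x (rot_HE tau th x2 z2 x0 amb imm eps1).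
congr (_ * (_ - _ * _)).
have c2n : \forall t \near vec2 s th ord0 (inord 0), C2_profile_at P t.
  by rewrite vec2E; case: reg.
have [p00 p01 p10 p11] := pd2_rot c2n.
have g0 := rot_gram_neq0 tau th x0 amb imm.
rewrite /mean_curvature trace_invmx2; last first.
  by rewrite !mxE pd0 pd1 PsiE.
have pd0' := pd0; have pd1' := pd1.
(* [inord 0] and [inord 1] are generalized to keep unification from unfolding them. *)
move: p00 p01 p10 p11 pd0' pd1'; rewrite !mxE.
move: (inord 0 : 'I_2) (inord 1 : 'I_2) => i j p00 p01 p10 p11 p0 p1.
by rewrite p00 p01 p10 p11 p0 p1 PsiE /rotF /rotG !vec2E mulNr mulNr.
Qed.

End Normal.

End RotationalGeometry.

(** * Sequences, products and periodic functions *)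

Section Topology.
Context {R : realType}.
Implicit Types (f g : R -> R) (u : nat -> R) (s t l e T : R).

Lemma integral_primitive g : (forall t, {for t, continuous g}) ->
  exists F, (forall t, is_derive t 1 F (g t)) /\
    \int[lebesgue_measure]_(t in `[0, 1]) g t = F 1 - F 0.
Proof.
move=> cg; have [F [_ D]] := primitive openT (@is_intervalT R) (fun t _ => cg t) (I : setT 0).
have {}D t : is_derive t 1 F (g t) by exact: D.
exists F; split=> //; rewrite /Rintegral (@continuous_FTC2 _ g F 0 1)//.
- by apply: continuous_subspaceT => t; exact: cg.
- split => [t _||]; first by have [] := D t.
  + by apply: cvg_at_right_filter; exact: der_cont (D 0).
  + by apply: cvg_at_left_filter; exact: der_cont (D 1).
- by move=> t _; rewrite derive1E; have Dt := D t; exact: derive_val.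
Qed.

Lemma seq_cvgP u l : (forall e, 0 < e -> exists N, forall n, (N <= n)%N -> `|u n - l| < e) ->
  u @ \oo --> l.
Proof.
move=> H; apply/cvgrPdist_lt => e e0; have [N HN] := H e e0.
by exists N => // n /= Nn; rewrite distrC; exact: HN.
Qed.

Lemma cvg_seqP u l : u @ \oo --> l ->
  forall e, 0 < e -> exists N, forall n, (N <= n)%N -> `|u n - l| < e.
Proof.
move=> /cvgrPdist_lt H e e0; have [N _ HN] := H e e0.
by exists N => n Nn; rewrite distrC; exact: HN.
Qed.

Lemma real_cauchy u :
  (forall e, 0 < e -> exists N, forall m n, (N <= m)%N -> (N <= n)%N -> `|u m - u n| < e) ->
  exists l, u @ \oo --> l.
Proof.
move=> H; suff : cvg (u @ \oo) by move=> h; exists (lim (u @ \oo)).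
apply: cauchy_cvg; apply/cauchy_ballP => e e0.
have [N HN] := H e e0.
exists ([set x | exists2 n, (N <= n)%N & u n = x], [set x | exists2 n, (N <= n)%N & u n = x]).
  by split; exists N => // n /= Nn; exists n.
by move=> [_ _] [/= [m Nm <-] [n Nn <-]]; rewrite /ball/=; exact: HN.
Qed.

Lemma cvg_first {T U : topologicalType} (f : nat -> T * U) (l : T * U) :
  f @ \oo --> l -> (fun n => (f n).1) @ \oo --> l.1.
Proof. by case: l => a b h; apply: (cvg_comp _ _ h); exact: cvg_fst. Qed.

Lemma cont_pair {T U V : topologicalType} (f : T -> U) (g : T -> V) x :
  {for x, continuous f} -> {for x, continuous g} -> {for x, continuous (fun y => (f y, g y))}.
Proof. by move=> cf cg; exact: cvg_pair. Qed.

Lemma cont_comp {T U V : topologicalType} (f : T -> U) (g : U -> V) x :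
  {for x, continuous f} -> {for f x, continuous g} -> {for x, continuous (fun y => g (f y))}.
Proof. by move=> cf cg; exact: (continuous_comp cf cg). Qed.

Lemma cont_fst {T U : topologicalType} (x : T * U) : {for x, continuous fst}.
Proof. by case: x => a b; exact: cvg_fst. Qed.

Lemma cont_snd {T U : topologicalType} (x : T * U) : {for x, continuous snd}.
Proof. by case: x => a b; exact: cvg_snd. Qed.

Lemma derive1_periodic f T : periodic f T -> periodic (derive1 f) T.
Proof.
move=> H s; suff e : (fun h : R => h^-1 *: (f (h + (s + T)) - f (s + T))) =
    (fun h : R => h^-1 *: (f (h + s) - f s)) by rewrite /derive1 e.
by apply/funext => h; rewrite addrA !H.
Qed.

Lemma periodic_ge f T : 0 < T -> periodic f T -> (forall t, {for t, continuous f}) ->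
  exists c, forall t, f c <= f t.
Proof.
move=> T0 pf cf; have [c _ H] := EVT_min (ltW T0) (cont_withinI (fun x (_ : 0 <= x <= T) => cf x)).
exists c => t; have [n /andP[n0 nT]] := periodic_reduce T0 t.
by rewrite -(periodic_int pf n t); apply: H; rewrite in_itv/= n0 ltW.
Qed.

End Topology.

(** * The one-dimensional base of the abstract surface *)

Section BasePoint.
Context {R : realType}.
Implicit Types (P : profile R) (s t T : R).

Lemma base_pointP P :
  (exists T, closes_up P T /\
     forall s, base_point P s = (cos (2 * pi * s / T), sin (2 * pi * s / T))) \/
  ((forall T, ~ closes_up P T) /\ forall s, base_point P s = (s, 0)).
Proof.
rewrite /base_point; case: pselect => [e|ne]; last first.
  by right; split => // T cT; apply: ne; exists T.
by left; exists (projT1 (cid e)); split => //; exact: projT2 (cid e).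
Qed.

Lemma cont_base_point P s : {for s, continuous (base_point P)}.
Proof.
have [[T [_ H]]|[_ H]] := base_pointP P.
  have -> : base_point P = (fun s => (cos (2 * pi * s / T), sin (2 * pi * s / T))).
    by apply/funext => x; rewrite H.
  apply: cont_pair; first by cont.
  by cont.
have -> : base_point P = (fun s => (s, 0)) by apply/funext => x; rewrite H.
by apply: cont_pair; [exact: cont_id|exact: cst_continuous].
Qed.

Lemma cont_surf_point {T : topologicalType} P (s theta : T -> R) x :
  {for x, continuous s} -> {for x, continuous (fun y => cx P (s y))} ->
  {for x, continuous theta} -> {for x, continuous (fun y => surf_point P (s y) (theta y))}.
Proof.
move=> cs cc ct.
have c1 : {for x, continuous (fun y => base_point P (s y))}.
  by apply: continuous_comp; [exact: cs|exact: cont_base_point].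
have c2 : {for x, continuous (fun y => (cx P (s y) * cos (theta y), cx P (s y) * sin (theta y)))}.
  by apply: cont_pair; cont.
by rewrite /surf_point; exact: (cont_pair c1 c2).
Qed.

End BasePoint.

(** * Change of parameter on an open interval and lifting of an angle *)

Section InverseOpen.
Context {R : realType}.
Implicit Types (I J : set R) (F G f u v w : R -> R) (s t a b : R).

(** The interval [J] is the image of [F]; outside it the inverse takes arbitrary values. *)
Lemma open_inverse I F f : open I -> is_interval I ->
  (forall s, I s -> is_derive s 1 F (f s)) -> (forall s, I s -> 0 < f s) ->
  exists J G, [/\ open J, is_interval J,
    forall s, I s -> [/\ J (F s), G (F s) = s & is_derive (F s) 1 G (f s)^-1],
    forall t, J t -> I (G t) /\ F (G t) = t &
    forall s s', I s -> I s' -> s < s' -> F s < F s'].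
Proof.
move=> oI iI D f0.
have incr s s' : I s -> I s' -> s < s' -> F s < F s'.
  move=> Is Is' ss; have I' t : s <= t <= s' -> I t by move=> tI; exact: (iI s s').
  by apply: (derive_incr ss (fun t tI => D t (I' t tI))) => t /andP[h1 h2]; apply/f0/I'; rewrite !ltW.
have inj s s' : I s -> I s' -> F s = F s' -> s = s'.
  move=> Is Is' e; have [h|h|//] := ltgtP s s'.
    by have := incr s s' Is Is' h; rewrite e ltxx.
  by have := incr s' s Is' Is h; rewrite e ltxx.
pose J := [set t | exists2 s, I s & F s = t].
have exG t : exists s, J t -> I s /\ F s = t.
  by have [[s Is e]|n] := pselect (J t); [exists s|exists 0].
pose G t := projT1 (cid (exG t)).
have GP t : J t -> I (G t) /\ F (G t) = t by exact: projT2 (cid (exG t)).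
have GF s : I s -> G (F s) = s.
  by move=> Is; have [h1 h2] := GP (F s) (ex_intro2 _ _ s Is erefl); exact: inj.
have iJ : is_interval J.
  move=> _ _ [s Is <-] [s' Is' <-] t /andP[h1 h2].
  have [h|h] := leP s s'.
    have I' x : s <= x <= s' -> I x by move=> xI; exact: (iI s s').
    have [|c cI <-] := ivt (v := t) h (fun x xI => der_cont (D x (I' x xI))); first by rewrite h1.
    by exists c => //; exact: I'.
  by have := incr s' s Is' Is h; lra.
have ball_ s : I s -> exists2 d, 0 < d & forall x, `|x - s| < d -> I x.
  move=> Is; have /nbhs_ballP[d d0 H] := open_nbhs_nbhs (conj oI Is).
  by exists d => // x xs; apply: H; rewrite /ball/= distrC.
have oJ : open J.
  rewrite openE => _ [s Is <-]; have [d d0 H] := ball_ s Is.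
  have d2 : `|s - d / 2 - s| < d by rewrite addrAC subrr sub0r normrN gtr0_norm ?divr_gt0//; lra.
  have d3 : `|s + d / 2 - s| < d by rewrite addrAC subrr add0r gtr0_norm ?divr_gt0//; lra.
  have I1 := H _ d2; have I2 := H _ d3.
  have F1 : F (s - d / 2) < F s by apply: incr => //; lra.
  have F2 : F s < F (s + d / 2) by apply: incr => //; lra.
  have := @near_in_itvoo R (F (s - d / 2)) (F (s + d / 2)) (F s).
  rewrite in_itv/= F1 F2 => /(_ isT) near_; apply: filterS near_ => t.
  rewrite in_itv/= => /andP[t1 t2].
  apply: (iJ (F (s - d / 2)) (F (s + d / 2))); [by exists (s - d / 2)|by exists (s + d / 2)|].
  by rewrite !ltW.
exists J, G; split => // s Is; split; [by exists s|exact: GF|].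
apply: is_derive_inverse.
- by apply: filterS (open_nbhs_nbhs (conj oI Is)) => x; exact: GF.
- by apply: filterS (open_nbhs_nbhs (conj oI Is)) => x Ix; exact: der_cont (D x Ix).
- exact: D.
- exact: lt0r_neq0 (f0 s Is).
Qed.

Lemma unit_angle a b : a ^+ 2 + b ^+ 2 = 1 -> exists t, cos t = a /\ sin t = b.
Proof.
move=> e; have a1 : -1 <= a <= 1.
  by rewrite -ler_norml -(expr_le1 (n := 2))// real_normK ?num_real//; have := sqr_ge0 b; lra.
have sb : Num.sqrt (1 - a ^+ 2) = `|b| by rewrite -sqrtr_sqr; congr Num.sqrt; lra.
have [b0|b0] := leP 0 b.
  by exists (acos a); rewrite acosK ?in_itv//= sin_acos// sb ger0_norm.
by exists (- acos a); rewrite cosN acosK ?in_itv//= sinN sin_acos// sb ltr0_norm// opprK.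
Qed.

(* The angle is the primitive of u v' - v u'; both cos(angle) u + sin(angle) v and its conjugate are then constant. *)
Lemma angle_lift I u v w s0 : open I -> is_interval I -> I s0 ->
  u s0 ^+ 2 + v s0 ^+ 2 = 1 -> (forall s, I s -> {for s, continuous w}) ->
  (forall s, I s -> is_derive s 1 u (- (v s * w s))) ->
  (forall s, I s -> is_derive s 1 v (u s * w s)) ->
  exists phi, forall s, I s ->
    [/\ is_derive s 1 phi (w s), cos (phi s) = u s & sin (phi s) = v s].
Proof.
move=> oI iI I0 e cw Du Dv; have [a [ca sa]] := unit_angle e.
have [Fw [F0 DF]] := primitive oI iI cw I0.
pose phi s := a + Fw s.
have Dphi s : I s -> is_derive s 1 phi (w s).
  by move=> Is; have h := DF s Is; rewrite /phi; der; ring.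
exists phi => s Is; split; first exact: Dphi.
  all: have const (f : R -> R) : (forall s, I s -> is_derive s 1 f 0) -> f s = f s0;
    [move=> Df; have [h|/ltW h] := leP s s0;
      [apply: (derive0_const h) => x xI; apply: Df; exact: (iI s s0)
      |apply/esym; apply: (derive0_const h) => x xI; apply: Df; exact: (iI s0 s)]|].
  all: have D1 x : I x -> is_derive x 1 (fun s => u s * cos (phi s) + v s * sin (phi s)) 0;
    [move=> Ix; have h1 := Du x Ix; have h2 := Dv x Ix; have h3 := Dphi x Ix; der; ring|].
  all: have D2 x : I x -> is_derive x 1 (fun s => v s * cos (phi s) - u s * sin (phi s)) 0;
    [move=> Ix; have h1 := Du x Ix; have h2 := Dv x Ix; have h3 := Dphi x Ix; der; ring|].
  all: have := const _ D1; have := const _ D2; rewrite /= {3 4 5 6 7 8}/phi F0 addr0 ca sa.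
  all: move=> e2 e1.
  all: have {}e2 : v s * cos (phi s) - u s * sin (phi s) = 0 by rewrite e2 mulrC subrr.
  all: have {}e1 : u s * cos (phi s) + v s * sin (phi s) = 1 by rewrite -e !expr2; exact: e1.
  all: have cs := cos2Dsin2 (phi s).
- transitivity (cos (phi s) * (u s * cos (phi s) + v s * sin (phi s))
    - sin (phi s) * (v s * cos (phi s) - u s * sin (phi s))); first by rewrite e1 e2; ring.
  by rewrite -[RHS]mulr1 -cs; ring.
- transitivity (sin (phi s) * (u s * cos (phi s) + v s * sin (phi s))
    + cos (phi s) * (v s * cos (phi s) - u s * sin (phi s))); first by rewrite e1 e2; ring.
  by rewrite -[RHS]mulr1 -cs; ring.
Qed.

End InverseOpen.

(** * From an h-surface to an orbit of the planar system *)

Section FlowOfProfile.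
Context {R : realType} (kappa tau : R) (h : R -> R).
Hypothesis kappa_le0 : kappa <= 0.
Hypothesis tau_gt0 : 0 < tau.
Let k y := h (clamp1 y).
Hypothesis cf : curvature_fun kappa k.
Implicit Types (P : profile R) (s t eps : R).

Local Notation S := (Sig kappa).
Local Notation io := (angmax kappa tau).

(** Dictionary between a profile and an orbit. It covers the interior of the parameter domain only,
    so that poles appear as ends of [J]. The time runs along or against the profile according to
    [eps], which makes the equation independent of the orientation. [fc_speed] keeps the periodicity
    of the speed for profiles that close up. *)
Record flow_chart P (eps : R) (J : set R) (p phi T G : R -> R) : Prop := FlowChart {
  fc_eps : eps = 1 \/ eps = -1;
  fc_open : open J;
  fc_itv : is_interval J;
  fc_sol : sol kappa tau k J p phi;
  fc_T : forall s, (cdom P)^° s -> J (T s) /\ G (T s) = s;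
  fc_G : forall t, J t -> (cdom P)^° (G t) /\ T (G t) = t;
  fc_contT : forall s, (cdom P)^° s -> {for s, continuous T};
  fc_contG : forall t, J t -> {for t, continuous G};
  fc_mono : forall s s', (cdom P)^° s -> (cdom P)^° s' -> s < s' -> eps * T s < eps * T s';
  fc_cx : forall t, J t -> cx P (G t) = rad_of kappa (p t);
  fc_cz : forall t, J t -> is_derive t 1 (fun t => cz P (G t)) (cos (phi t) / io (p t));
  fc_angle : forall s th eta, (cdom P)^° s ->
    unit_normal kappa tau eps (rot_patch P) (vec2 s th) eta ->
    angle kappa tau (rot_patch P) (vec2 s th) eta = flow_angle kappa tau p phi (T s);
  fc_speed : exists W : R -> R, forall s, [/\ (cdom P)^° s -> [/\ 0 < W s, {for s, continuous W} &
      is_derive s 1 T (eps * W s)] &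
    forall T', periodic (cx P) T' -> periodic (cz P) T' -> periodic W T'] }.

Lemma curvature_fun_cont (y : R) : {for y, continuous k}.
Proof.
have [L L0 H] := cf_lip cf; apply/cvgrPdist_le => e e0.
near=> x; apply: (le_trans (H _ _)); rewrite -ler_pdivlMl//.
near: x; apply/nbhs_ballP; exists (L^-1 * e); first by rewrite /= mulr_gt0// invr_gt0.
by move=> x /=; rewrite /ball/= => /ltW.
Unshelve. all: by end_near. Qed.

Section AtRegular.
Variables (P : profile R) (eps : R).
Hypothesis eps1 : eps = 1 \/ eps = -1.
Let x := cx P. Let z := cz P.
Let x1 := derive1 x. Let z1 := derive1 z.
Let x2 := derive1 x1. Let z2 := derive1 z1.
(** In the plane orthogonal to the rotation field the profile has metric [lam^2 dx^2 + dz^2 / q^2].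
    Hence [W / q] is its speed, [u] and [v] are the cosine and sine of its tangent angle up to the
    sign [eps], and [w] is the derivative of that angle in [s]. *)
Let lam s := 4 / (4 + kappa * x s ^+ 2).
Let q s := Num.sqrt (1 + tau ^+ 2 * x s ^+ 2).
Let B s := lam s * q s * x1 s.
Let W s := Num.sqrt (B s ^+ 2 + z1 s ^+ 2).
Let p s := inv_rad kappa (x s).
Let u s := eps * z1 s / W s.
Let v s := eps * B s / W s.
Let w s := eps * (W s / q s) * (u s * ((x s)^-1 - kappa * x s / 4) - 2 * k (v s / q s)).

Let eps_sq : eps * eps = 1. Proof. by case: eps1 => ->; rewrite ?mulrNN mulr1. Qed.

Section Pointwise.
Variable s : R.
Hypothesis reg : regular_at kappa P s.
Let c2 : C2_profile_at P s. Proof. by case: reg => /nbhs_singleton. Qed.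
Let Dx : is_derive s 1 x (x1 s). Proof. by case: c2 => d _ _ _ _; exact: derivable_der1. Qed.
Let Dz : is_derive s 1 z (z1 s). Proof. by case: c2 => _ d _ _ _; exact: derivable_der1. Qed.
Let Dx1 : is_derive s 1 x1 (x2 s). Proof. by case: c2 => _ _ d _ _; exact: derivable_der1. Qed.
Let Dz1 : is_derive s 1 z1 (z2 s). Proof. by case: c2 => _ _ _ d _; exact: derivable_der1. Qed.
Let x0 : 0 < x s. Proof. by case: reg. Qed.
Let amb : 0 < 4 + kappa * x s ^+ 2. Proof. by case: reg. Qed.
Let imm : x1 s != 0 \/ z1 s != 0. Proof. by case: reg. Qed.
Let lam0 : 0 < lam s. Proof. exact: divr_gt0. Qed.
Let q2_gt0 : 0 < 1 + tau ^+ 2 * x s ^+ 2.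
Proof. by rewrite addr_gt0// mulr_gt0// exprn_gt0. Qed.
Let q0 : 0 < q s. Proof. by rewrite sqrtr_gt0. Qed.
Let q_sq : q s ^+ 2 = 1 + tau ^+ 2 * x s ^+ 2. Proof. by rewrite sqr_sqrtr// ltW. Qed.
Let W2_gt0 : 0 < B s ^+ 2 + z1 s ^+ 2.
Proof.
rewrite lt0r addr_ge0 ?sqr_ge0// andbT paddr_eq0 ?sqr_ge0// !sqrf_eq0 negb_and.
by case: imm => h'; rewrite ?h' ?orbT// mulf_neq0// mulf_neq0// lt0r_neq0.
Qed.
Let W0 : 0 < W s. Proof. by rewrite sqrtr_gt0. Qed.
Let W_sq : W s ^+ 2 = B s ^+ 2 + z1 s ^+ 2. Proof. by rewrite sqr_sqrtr// ltW. Qed.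
Let p0 : 0 < p s. Proof. exact: inv_rad_gt0. Qed.
Let Sp : S (p s) = (x s)^-1 - kappa * x s / 4. Proof. exact: Sig_inv_rad. Qed.
Let rp : rad_of kappa (p s) = x s. Proof. exact: radK. Qed.
Let iop : io (p s) = (q s)^-1. Proof. by rewrite angmaxE// rp. Qed.
Let lamp : lam s = (p s * x s)^-1. Proof. by have := conf_rad kappa_le0 p0; rewrite rp. Qed.

Let Dlam : is_derive s 1 lam (- (kappa / 2) * lam s ^+ 2 * x s * x1 s).
Proof.
have n0 : 4 + kappa * x s ^+ 2 != 0 by exact: lt0r_neq0.
by rewrite /lam; der; field.
Qed.
Let Dq : is_derive s 1 q (tau ^+ 2 * x s * x1 s / q s).
Proof.
have E : is_derive s 1 (fun s => 1 + tau ^+ 2 * x s ^+ 2) (2 * tau ^+ 2 * x s * x1 s) by der; ring.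
have D := derC1 (is_derive1_sqrt q2_gt0) (g := fun s => 1 + tau ^+ 2 * x s ^+ 2) E.
by notypeclasses refine (is_derive_eq D _); rewrite -/(q s); field; rewrite lt0r_neq0.
Qed.
Let B1 := (- (kappa / 2) * lam s ^+ 2 * x s * x1 s) * q s * x1 s
  + lam s * (tau ^+ 2 * x s * x1 s / q s) * x1 s + lam s * q s * x2 s.
Let DB : is_derive s 1 B B1. Proof. by rewrite /B; der; rewrite /B1; ring. Qed.
Let DW : is_derive s 1 W ((B s * B1 + z1 s * z2 s) / W s).
Proof.
have E : is_derive s 1 (fun s => B s ^+ 2 + z1 s ^+ 2) (2 * (B s * B1 + z1 s * z2 s)) by der; ring.
have D := derC1 (is_derive1_sqrt W2_gt0) (g := fun s => B s ^+ 2 + z1 s ^+ 2) E.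
by notypeclasses refine (is_derive_eq D _); rewrite -/(W s); field; rewrite lt0r_neq0.
Qed.
Let Du : is_derive s 1 u (- (v s * ((z1 s * B1 - B s * z2 s) / W s ^+ 2))).
Proof.
have n0 : W s != 0 by exact: lt0r_neq0.
rewrite /u; der; rewrite /v.
transitivity (eps * (z2 s * W s ^+ 2 - z1 s * (B s * B1 + z1 s * z2 s)) / W s ^+ 3).
  by field.
have -> : z2 s * W s ^+ 2 - z1 s * (B s * B1 + z1 s * z2 s) = B s * (z2 s * B s - z1 s * B1).
  by rewrite W_sq; ring.
by field.
Qed.
Let Dv : is_derive s 1 v (u s * ((z1 s * B1 - B s * z2 s) / W s ^+ 2)).
Proof.
have n0 : W s != 0 by exact: lt0r_neq0.
rewrite /v; der; rewrite /u.
transitivity (eps * (B1 * W s ^+ 2 - B s * (B s * B1 + z1 s * z2 s)) / W s ^+ 3).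
  by field.
have -> : B1 * W s ^+ 2 - B s * (B s * B1 + z1 s * z2 s) = z1 s * (z1 s * B1 - B s * z2 s).
  by rewrite W_sq; ring.
by field.
Qed.

Lemma profile_uv : u s ^+ 2 + v s ^+ 2 = 1.
Proof.
have n0 : W s != 0 by exact: lt0r_neq0.
rewrite /u /v; transitivity ((eps * eps) * (B s ^+ 2 + z1 s ^+ 2) / W s ^+ 2); first by field.
by rewrite eps_sq -W_sq mul1r divff// expf_neq0.
Qed.

Let W2E : lam s ^+ 2 * (1 + tau ^+ 2 * x s ^+ 2) * x1 s ^+ 2 + z1 s ^+ 2 = W s ^+ 2.
Proof. by rewrite W_sq -q_sq /B; ring. Qed.

Let WE : Num.sqrt (lam s ^+ 2 * (1 + tau ^+ 2 * x s ^+ 2) * x1 s ^+ 2 + z1 s ^+ 2) = W s.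
Proof. by rewrite W2E sqrtr_sqr gtr0_norm. Qed.

Lemma profile_angle th eta : unit_normal kappa tau eps (rot_patch P) (vec2 s th) eta ->
  angle kappa tau (rot_patch P) (vec2 s th) eta = v s / q s.
Proof.
move/(unit_normal_rotP tau th reg eps1) => ->.
rewrite (angle_rot tau th eps reg) -/x -/x1 -/z1 -/(lam s) WE /v /B.
by field; rewrite !lt0r_neq0.
Qed.

Lemma profile_angle_le1 : -1 <= v s / q s <= 1.
Proof.
rewrite -ler_norml -(expr_le1 (n := 2))// real_normK ?num_real// expr_div_n ler_pdivrMr ?exprn_gt0//.
rewrite mul1r q_sq; have := profile_uv; have := sqr_ge0 (u s).
by have : 0 <= tau ^+ 2 * x s ^+ 2; [rewrite mulr_ge0 ?sqr_ge0|lra].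
Qed.

Hypothesis H : oriented_h_surface kappa tau h P eps.
Hypothesis Is : (cdom P)^° s.

(** The mean curvature equation says exactly that the unit vector [(u, v)] turns at speed [w]. The
    clamping of [h] is invisible because the angle lies in [[-1, 1]]. *)
Let hE : (z1 s * B1 - B s * z2 s) / W s ^+ 2 = w s.
Proof.
have [eta etaP] : exists eta, unit_normal kappa tau eps (rot_patch P) (vec2 s 0) eta.
  by eexists; apply/(unit_normal_rotP tau 0 reg eps1).
have [_ /(_ s 0 _ _ _ eta (chart_regular 0 Is))] := H.
rewrite mulr1 => /(_ etaP) mc; have an := profile_angle etaP.
have etaE := proj1 (unit_normal_rotP tau 0 reg eps1 eta) etaP.
have := mean_curvature_rot tau 0 reg eps1.
rewrite -etaE mc an -/x -/x1 -/z1 -/x2 -/z2 -/(lam s) WE W2E.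
have -> : h (v s / q s) = k (v s / q s) by rewrite /k clamp1_id// profile_angle_le1.
rewrite -q_sq => E; have n0 : W s != 0 by exact: lt0r_neq0.
have m0 : q s != 0 by exact: lt0r_neq0.
apply: (mulIf (expf_neq0 2 n0)); rewrite divfK ?expf_neq0//; apply: (mulfI m0).
transitivity (W s ^+ 2 * (z1 s * ((x s)^-1 - kappa * x s / 4) - 2 * eps * W s * k (v s / q s))).
  by rewrite -E /B1 /B; field.
rewrite /w /u; transitivity (W s ^+ 2 * ((eps * eps) * z1 s * ((x s)^-1 - kappa * x s / 4)
   - 2 * eps * W s * k (v s / q s))); first by rewrite eps_sq; ring.
by field; rewrite m0 n0 lt0r_neq0.
Qed.

Lemma profile_der_u : is_derive s 1 u (- (v s * w s)). Proof. by have := Du; rewrite hE. Qed.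
Lemma profile_der_v : is_derive s 1 v (u s * w s). Proof. by have := Dv; rewrite hE. Qed.
Lemma profile_cont_w : {for s, continuous w}.
Proof.
have cx_ := der_cont Dx; have cW := der_cont DW; have cq := der_cont Dq.
have cu := der_cont profile_der_u; have cv := der_cont profile_der_v.
have n0 : x s != 0 by exact: lt0r_neq0.
have m0 : q s != 0 by exact: lt0r_neq0.
have cvq : {for s, continuous (fun s => v s / q s)} by cont.
have ck := contC (h := k) (@curvature_fun_cont _) cvq.
rewrite /w; cont.
Qed.
Lemma profile_speed_gt0 : 0 < W s / q s. Proof. exact: divr_gt0. Qed.
Lemma profile_speed_cont : {for s, continuous (fun s => W s / q s)}.
Proof.
have cW := der_cont DW; have cq := der_cont Dq.
have m0 : q s != 0 by exact: lt0r_neq0.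
cont.
Qed.
Lemma profile_p : [/\ 0 < p s, rad_of kappa (p s) = x s, S (p s) = (x s)^-1 - kappa * x s / 4 &
  io (p s) = (q s)^-1].
Proof. by []. Qed.
Lemma profile_der_p : is_derive s 1 p (- (p s * S (p s) * v s) * (eps * (W s / q s))).
Proof.
have n0 : x s != 0 by exact: lt0r_neq0.
have m0 : q s != 0 by exact: lt0r_neq0.
have l0 : W s != 0 by exact: lt0r_neq0.
have D : is_derive s 1 p (- S (p s) / x s * x1 s).
  by rewrite Sp /p /inv_rad; der; field.
notypeclasses refine (is_derive_eq D _); rewrite /v /B lamp.
transitivity (- S (p s) / x s * x1 s * (eps * eps)); first by rewrite eps_sq mulr1.
by field; rewrite n0 m0 l0 lt0r_neq0.
Qed.
Lemma profile_der_z : is_derive s 1 z (u s * q s * (eps * (W s / q s))).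
Proof.
have m0 : q s != 0 by exact: lt0r_neq0.
have l0 : W s != 0 by exact: lt0r_neq0.
notypeclasses refine (is_derive_eq Dz _); rewrite /u.
transitivity (z1 s * (eps * eps)); first by rewrite eps_sq mulr1.
by field; rewrite m0 l0.
Qed.

End Pointwise.

Theorem flow_chart_exists : rotational_surface kappa P ->
  oriented_h_surface kappa tau h P eps -> exists J p phi T G, flow_chart P eps J p phi T G.
Proof.
move=> rs H; pose I := (cdom P)^°.
have reg s (Is : I s) := regular_interior kappa_le0 rs Is.
have oI : open I by exact: open_interior.
have [[iD [a [b [Da Db ab]]]] _ _ _ _] := rs.
have iI : is_interval I.
  move=> s s' Is Is' t /andP[]; rewrite le_eqVlt => /orP[/eqP <-//|st].
  rewrite le_eqVlt => /orP[/eqP ->//|ts].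
  have /nbhs_singleton Ds := Is; have /nbhs_singleton Ds' := Is'.
  have := @near_in_itvoo R s s' t; rewrite in_itv/= st ts => /(_ isT).
  apply: filterS => y; rewrite in_itv/= => /andP[h1 h2]; apply: (iD s s') => //.
  by rewrite !ltW.
have I0 : I ((a + b) / 2).
  have := @near_in_itvoo R a b ((a + b) / 2); rewrite in_itv/=.
  have -> : a < (a + b) / 2 < b by lra.
  move=> /(_ isT); apply: filterS => y; rewrite in_itv/= => /andP[h1 h2]; apply: (iD a b) => //.
  by rewrite !ltW.
have [phi Hphi] := angle_lift oI iI I0 (profile_uv (reg _ I0))
  (fun s Is => profile_cont_w (reg s Is) H Is) (fun s Is => profile_der_u (reg s Is) H Is)
  (fun s Is => profile_der_v (reg s Is) H Is).
have [F [_ DF]] := primitive oI iI (fun s Is => profile_speed_cont (reg s Is)) I0.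
have [J [G [oJ iJ FG GF mono]]] := open_inverse oI iI DF (fun s Is => profile_speed_gt0 (reg s Is)).
(* The arc length [F] always increases with the parameter; multiplication by [eps] turns it into the
   time of the orbit. *)
pose J' := [set t | J (eps * t)].
pose T s := eps * F s.
have eT s : eps * T s = F s by rewrite /T mulrA eps_sq mul1r.
have DG t : J' t -> is_derive t 1 (fun t => G (eps * t)) (eps * (W (G (eps * t)) / q (G (eps * t)))^-1).
  move=> Jt; have [Is e] := GF _ Jt; have [_ _] := FG _ Is; rewrite e => D.
  have DE : is_derive t 1 (fun t => eps * t) eps by der; ring.
  have E := derC1 (g := fun t => eps * t) D DE.
  by notypeclasses refine (is_derive_eq E _); rewrite mulrC.
exists J', (fun t => p (G (eps * t))), (fun t => phi (G (eps * t))), T, (fun t => G (eps * t)).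
split.
- exact: eps1.
- have : continuous (fun t => eps * t : R).
    by move=> t; apply: contM; [exact: (@cont_cst R R)|exact: (@cont_id R)].
  by move/continuousP; apply.
- move=> s s' Js Js' t /andP[h1 h2].
  case: eps1 => e; rewrite /J' /= e in Js Js' *.
    by apply: (iJ (1 * s) (1 * s')); rewrite // !mul1r h1.
  by apply: (iJ (-1 * s') (-1 * s)); rewrite // !mulN1r !lerN2 h2.
- move=> t Jt; have [Is e] := GF _ Jt; have D := DG t Jt; have r := reg _ Is.
  have [p0 rp Sp iop] := profile_p r; have [Dphi cphi sphi] := Hphi _ Is.
  have n0 := lt0r_neq0 (profile_speed_gt0 r).
  split => //.
    have E := derC1 (g := fun t => G (eps * t)) (profile_der_p r) D.
    notypeclasses refine (is_derive_eq E _); rewrite /flowP sphi.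
    set y := W _ / q _ in n0 *; set m := - (_ * _ * v _).
    transitivity (m * (eps * eps)); first by field.
    by rewrite eps_sq mulr1.
  have E := derC1 (g := fun t => G (eps * t)) Dphi D.
  notypeclasses refine (is_derive_eq E _); rewrite /flowPhi sphi cphi iop Sp /w.
  set y := W _ / q _ in n0 *; set m := _ - _ * k _.
  transitivity (m * (eps * eps)); first by field.
  by rewrite eps_sq mulr1 /m; ring.
- by move=> s Is; have [Js e _] := FG s Is; rewrite /J' /= eT e.
- by move=> t Jt; have [Is e] := GF _ Jt; rewrite /T e mulrA eps_sq mul1r.
- move=> s Is; have c := der_cont (DF s Is).
  by rewrite /T; cont.
- by move=> t Jt; exact: der_cont (DG t Jt).
- by move=> s s' Is Is' ss; rewrite !eT; exact: mono.
- by move=> t Jt; have [Is e] := GF _ Jt; have [] := profile_p (reg _ Is).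
- move=> t Jt; have [Is e] := GF _ Jt; have D := DG t Jt; have r := reg _ Is.
  have [p0 rp Sp iop] := profile_p r; have [Dphi cphi sphi] := Hphi _ Is.
  have n0 := lt0r_neq0 (profile_speed_gt0 r).
  have E := derC1 (g := fun t => G (eps * t)) (profile_der_z r) D.
  notypeclasses refine (is_derive_eq E _); rewrite cphi iop invrK.
  set y := W _ / q _ in n0 *; set m := u _ * q _.
  transitivity (m * (eps * eps)); first by field.
  by rewrite eps_sq mulr1.
- move=> s th eta Is un; rewrite (profile_angle (reg s Is) un) /flow_angle eT.
  have [_ -> _] := FG s Is; have [_ _ ->] := Hphi s Is.
  by have [_ _ _ ->] := profile_p (reg s Is).
- exists (fun s => W s / q s) => s; split=> [Is|T' px pz y].
    split; [exact: profile_speed_gt0 (reg s Is)|exact: profile_speed_cont (reg s Is)|].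
    have D := DF s Is; rewrite /T; der; ring.
  rewrite /W /q /B /lam /q /x1 /z1 (derive1_periodic px) (derive1_periodic pz).
  by rewrite /x px.
Qed.

End AtRegular.
End FlowOfProfile.

(** * Ends of the profile of a complete surface *)

Section ProfileEnds.
Context {R : realType} (kappa tau : R).
Hypothesis kappa_le0 : kappa <= 0.
Hypothesis tau_gt0 : 0 < tau.
Implicit Types (P : profile R) (J : set R) (T G : R -> R) (s t b d e r sg eps : R).

Lemma interior_between P s a b : is_interval (cdom P) -> cdom P a -> cdom P b -> a < s < b ->
  (cdom P)^° s.
Proof.
move=> iD Da Db ab; have := @near_in_itvoo R a b s; rewrite in_itv/= => /(_ ab).
by apply: filterS => y; rewrite in_itv/= => /andP[h1 h2]; apply: (iD a b); rewrite // !ltW.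
Qed.

Lemma cdom_end P s : nondegenerate_interval (cdom P) -> cdom P s -> exists sg, inward P s sg.
Proof.
move=> [iD [a [b [Da Db ab]]]] Ds.
have H c : cdom P c -> s < c -> inward P s 1.
  move=> Dc sc; split; first by left.
  near=> r; rewrite mul1r; apply: (iD s c) => //.
  have r0 : 0 < r by near: r; exact: nbhs_right_gt.
  have rc : r < c - s by near: r; apply: nbhs_right_lt; rewrite subr_gt0.
  by lra.
have H' c : cdom P c -> c < s -> inward P s (-1).
  move=> Dc sc; split; first by right.
  near=> r; rewrite mulN1r; apply: (iD c s) => //.
  have r0 : 0 < r by near: r; exact: nbhs_right_gt.
  have rc : r < s - c by near: r; apply: nbhs_right_lt; rewrite subr_gt0.
  by lra.
have [h|h] := ltP s b; first by exists 1; exact: H h.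
by exists (-1); apply: (H' a) => //; exact: lt_le_trans h.
Unshelve. all: by end_near. Qed.

Lemma der_line (F : 'rV[R]_2 -> 'rV[R]_3) v : derivable F 0 v ->
  is_derive (0 : R) 1 (fun r : R => F (r *: v)) ('D_v F 0).
Proof.
have e : (fun h : R => h^-1 *: (((fun r : R => F (r *: v)) \o shift 0) (h *: 1) - F (0 *: v))) =
    (fun h : R => h^-1 *: ((F \o shift 0) (h *: v) - F 0)).
  by apply/funext => h; rewrite /= !addr0 scale0r /GRing.scale/= mulr1.
by move=> D; split; rewrite /derivable /derive e.
Qed.

Lemma is_derive_comp3 (f : R -> 'rV[R]_3) (x : R) v : is_derive x 1 f v ->
  [/\ is_derive x 1 (fun r => px (f r)) (px v), is_derive x 1 (fun r => py (f r)) (py v) &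
      is_derive x 1 (fun r => pz (f r)) (pz v)].
Proof.
move=> D; have fE : f = (fun r => vec3 (px (f r)) (py (f r)) (pz (f r))).
  by apply/funext => r; rewrite vec3_eta.
have [d _] := D; rewrite fE in d.
have [/derivable_der1 d1 /derivable_der1 d2 /derivable_der1 d3] := proj1 (derivable_vec3P _ _ _ _ _) d.
have D' := is_derive_vec3 d1 d2 d3; rewrite -fE in D'.
have -> : v = vec3 (derive1 (fun r => px (f r)) x) (derive1 (fun r => py (f r)) x)
    (derive1 (fun r => pz (f r)) x).
  by rewrite -(@derive_val _ _ _ _ _ _ _ D) -(@derive_val _ _ _ _ _ _ _ D').
by rewrite !vec3E.
Qed.

Section Pole.
Variables (P : profile R) (b sg : R).
Hypothesis rs : rotational_surface kappa P.
Hypothesis Db : cdom P b.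
Hypothesis cb : cx P b = 0.
Hypothesis ib : inward P b sg.
Let Psi := pole_patch P b sg.

Let C2I : C2_immersion_at Psi 0.
Proof. by have [_ _ _ _ H] := rs; apply: (H b 0 _ _ _ (chart_pole 0 Db cb ib)). Qed.

Let enorm_e0 r : enorm2 (vec2 r 0) = `|r|.
Proof. by rewrite /enorm2 !vec2E expr0n addr0 sqrtr_sqr. Qed.
Let enorm_e1 r : enorm2 (vec2 0 r) = `|r|.
Proof. by rewrite /enorm2 !vec2E expr0n add0r sqrtr_sqr. Qed.
Let vec00 : vec2 0 0 = 0 :> 'rV[R]_2.
Proof. by apply/rowP => i; rewrite !mxE; case: i => [[|[|]]]. Qed.

Let X r : R := cx P (b + sg * `|r|) * (r / `|r|).
Let Z r : R := cz P (b + sg * `|r|).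
Let Psi0 r : Psi (vec2 r 0) = vec3 (X r) 0 (Z r).
Proof. by rewrite /Psi /pole_patch enorm_e0 !vec2E mul0r mulr0. Qed.
Let Psi1 r : Psi (vec2 0 r) = vec3 0 (X r) (Z r).
Proof. by rewrite /Psi /pole_patch enorm_e1 !vec2E mul0r mulr0. Qed.
Let PsiO : Psi 0 = vec3 0 0 (cz P b).
Proof. by rewrite -vec00 Psi0 /X /Z normr0 mulr0 addr0 mul0r mulr0. Qed.

Lemma pole_cont e : 0 < e -> exists2 d, 0 < d & forall r, 0 < r < d ->
  cx P (b + sg * r) < e /\ `|cz P (b + sg * r) - cz P b| < e.
Proof.
move=> e0; have [/nbhs_singleton [cP _ _] _] := C2I.
have cv : {for 0 : R, continuous (fun r : R => Psi (vec2 r 0))}.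
  apply: cont_comp; first exact: cont_vec2.
  by rewrite vec00.
have H (i : 'I_3) : {for 0 : R, continuous (fun r : R => Psi (vec2 r 0) ord0 i)}.
  exact: (cont_comp (g := fun v : 'rV[R]_3 => v ord0 i) cv (@coord_continuous R 1 3 ord0 i _)).
have cX : {for 0 : R, continuous (fun r : R => X r)}.
  by apply: (cont_ext _ (H (inord 0))) => r; rewrite Psi0; exact: px_vec3.
have cZ : {for 0 : R, continuous (fun r : R => Z r)}.
  by apply: (cont_ext _ (H (inord 2))) => r; rewrite Psi0; exact: pz_vec3.
have X0 : X 0 < e by rewrite /X mul0r mulr0.
have [d1 d10 H1] := cont_near_lt cX X0.
have e2 : 0 < e / 2 by rewrite divr_gt0.
have [d2 d20 H2] := cont_eps cZ e2.
exists (Num.min d1 d2); first by rewrite lt_min d10.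
move=> r /andP[r0]; rewrite lt_min => /andP[rd1 rd2].
have nr : `|r - 0| = r by rewrite subr0 gtr0_norm.
split.
  by have := H1 r; rewrite nr /X gtr0_norm// divff ?lt0r_neq0// mulr1; apply.
have nr' : `|r| = r by rewrite gtr0_norm.
have := H2 r; rewrite nr /Z nr' normr0 mulr0 addr0 => /(_ rd2).
by move/le_lt_trans; apply; lra.
Qed.

(** The tangent plane at a pole is horizontal: along either coordinate axis of the patch the height
    is even, so its derivative vanishes, and the radial function is the same along both axes. The
    metric on the axis is Euclidean, so the unit normal is vertical and the orientation fixes its
    sign. *)
Lemma pole_normal eps eta : unit_normal kappa tau eps Psi 0 eta ->
  (eps = 1 \/ eps = -1) -> angle kappa tau Psi 0 eta = eps.
Proof.
move=> [n1 n2 n3] eps1; have [/nbhs_singleton [_ dP _] _] := C2I.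
pose pd0 := pd (inord 0) Psi 0; pose pd1 := pd (inord 1) Psi 0.
have D0 : is_derive (0 : R) 1 (fun r : R => Psi (vec2 r 0)) pd0.
  have [D _] := dP (inord 0); have := der_line D.
  have -> : (fun r : R => Psi (r *: delta_mx ord0 (inord 0))) = (fun r => Psi (vec2 r 0)).
    apply/funext => r; congr Psi; rewrite delta0; apply/rowP => i; rewrite !mxE.
    by case: i => [[|[|//]] ?] /=; rewrite ?mulr1 ?mulr0.
  by [].
have D1 : is_derive (0 : R) 1 (fun r : R => Psi (vec2 0 r)) pd1.
  have [D _] := dP (inord 1); have := der_line D.
  have -> : (fun r : R => Psi (r *: delta_mx ord0 (inord 1))) = (fun r => Psi (vec2 0 r)).
    apply/funext => r; congr Psi; rewrite delta1; apply/rowP => i; rewrite !mxE.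
    by case: i => [[|[|//]] ?] /=; rewrite ?mulr1 ?mulr0.
  by [].
have uniq (f : R -> R) a a' : is_derive (0 : R) 1 f a -> is_derive (0 : R) 1 f a' -> a = a'.
  by move=> h1 h2; rewrite -(@derive_val _ _ _ _ _ _ _ h1) -(@derive_val _ _ _ _ _ _ _ h2).
have [c00 c01 c02] := is_derive_comp3 D0.
have [c10 c11 c12] := is_derive_comp3 D1.
have ext (f g : R -> R) a : (forall r, f r = g r) -> is_derive (0 : R) 1 f a -> is_derive (0 : R) 1 g a.
  by move=> /funext ->.
have z0 : py pd0 = 0.
  have h := ext _ (fun=> 0) _ (fun r => etrans (congr1 (@py R) (Psi0 r)) (py_vec3 _ _ _)) c01.
  have h0 : is_derive (0 : R) 1 (fun=> 0 : R) 0 by notypeclasses refine (der_cst _ _ _).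
  exact: (uniq _ _ _ h h0).
have z1 : px pd1 = 0.
  have h := ext _ (fun=> 0) _ (fun r => etrans (congr1 (@px R) (Psi1 r)) (px_vec3 _ _ _)) c10.
  have h0 : is_derive (0 : R) 1 (fun=> 0 : R) 0 by notypeclasses refine (der_cst _ _ _).
  exact: (uniq _ _ _ h h0).
have X0 := ext _ X _ (fun r => etrans (congr1 (@px R) (Psi0 r)) (px_vec3 _ _ _)) c00.
have X1 := ext _ X _ (fun r => etrans (congr1 (@py R) (Psi1 r)) (py_vec3 _ _ _)) c11.
have Z0 := ext _ Z _ (fun r => etrans (congr1 (@pz R) (Psi0 r)) (pz_vec3 _ _ _)) c02.
have Z1 := ext _ Z _ (fun r => etrans (congr1 (@pz R) (Psi1 r)) (pz_vec3 _ _ _)) c12.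
(* The patch depends on the distance to the origin only, so [Z] is even and its derivative equals
   its own opposite. *)
have even a : is_derive (0 : R) 1 Z a -> a = 0.
  move=> Za; have Zr : is_derive (0 : R) 1 (fun r => Z (0 - r)) (- a).
    by apply: der_reflect; rewrite subr0.
  have Zs r : Z (0 - r) = Z r by rewrite /Z sub0r normrN.
  by have := uniq _ _ _ Za (ext _ _ _ Zs Zr); lra.
have aa : px pd0 = py pd1 := uniq _ _ _ X0 X1.
have {}Z0 : pz pd0 = 0 := even _ Z0.
have {}Z1 : pz pd1 = 0 := even _ Z1.
have conf1 : conf kappa (Psi 0) = 1.
  by rewrite PsiO /conf !vec3E expr0n/= addr0 mulr0 addr0 divff// pnatr_eq0.
have mE u v : metric kappa tau (Psi 0) u v = px u * px v + py u * py v + pz u * pz v.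
  by rewrite /metric /vform conf1 PsiO !vec3E; ring.
have [T0 T1] : row (inord 0) (tangents Psi 0) = pd0 /\ row (inord 1) (tangents Psi 0) = pd1.
  by split; exact: rowK.
have n20 : metric kappa tau (Psi 0) pd0 eta = 0 := n2 (inord 0).
have n21 : metric kappa tau (Psi 0) pd1 eta = 0 := n2 (inord 1).
rewrite (mE eta eta) in n1; rewrite (mE pd0 eta) in n20; rewrite (mE pd1 eta) in n21.
have := n3; rewrite (det_frame eta T0 T1).
clear - n1 n20 n21 z0 z1 Z0 Z1 aa eps1 mE.
move: n20 n21; rewrite /angle (mE eta xi) /xi !vec3E.
clearbody pd0 pd1; rewrite z0 z1 Z0 Z1 -aa => n20 n21 n3.
have n3' : 0 < eps * (px pd0 ^+ 2 * pz eta).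
  by move: n3; congr (0 < _); ring.
have a0 : px pd0 != 0 by apply/eqP => a0; move: n3'; rewrite a0 expr0n/= mul0r mulr0 ltxx.
move: n20 n21; rewrite !mul0r !addr0 !add0r => /eqP; rewrite mulf_eq0 (negPf a0)/= => /eqP ex /eqP.
rewrite mulf_eq0 (negPf a0)/= => /eqP ey.
move: n1; rewrite ex ey !mul0r !add0r => nz; rewrite mulr1.
have : 0 < eps * pz eta.
  move: n3'; rewrite mulrCA pmulr_rgt0// lt0r sqrf_eq0 a0 sqr_ge0//.
have /eqP : (pz eta - 1) * (pz eta + 1) = 0.
  have -> : (pz eta - 1) * (pz eta + 1) = pz eta * pz eta - 1 by ring.
  by rewrite nz subrr.
rewrite mulf_eq0 => /orP[|] /eqP h; case: eps1 => ->; lra.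
Qed.

End Pole.

(** What remains of [flow_chart] once the curvature equation is forgotten, in a form that survives
    reversal of time, which exchanges the two ends. The bounds in [tc_curve] say that the radius is
    1-Lipschitz in time and that the ambient speed of the meridian is at most the square root of
    [1 + tau^2 x^2]. *)
Record time_chart P e J T G : Prop := TimeChart {
  tc_sign : e = 1 \/ e = -1;
  tc_open : open J;
  tc_itv : is_interval J;
  tc_T : forall s, (cdom P)^° s -> J (T s) /\ G (T s) = s;
  tc_G : forall t, J t -> (cdom P)^° (G t) /\ T (G t) = t;
  tc_contG : forall t, J t -> {for t, continuous G};
  tc_mono : forall s s', (cdom P)^° s -> (cdom P)^° s' -> s < s' -> e * T s < e * T s';
  tc_curve : exists dX dZ : R -> R, forall t, J t ->
    [/\ is_derive t 1 (fun t => cx P (G t)) (dX t), is_derive t 1 (fun t => cz P (G t)) (dZ t),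
      {for t, continuous dX}, {for t, continuous dZ} &
      `|dX t| <= 1 /\ (4 / (4 + kappa * cx P (G t) ^+ 2)) ^+ 2 * dX t ^+ 2 + dZ t ^+ 2
         <= 1 + tau ^+ 2 * cx P (G t) ^+ 2];
  tc_speed : exists W : R -> R, forall s, [/\ (cdom P)^° s -> [/\ 0 < W s, {for s, continuous W} &
      is_derive s 1 T (e * W s)] &
    forall L : R, periodic (cx P) L -> periodic (cz P) L -> periodic W L] }.

Lemma tc_reflect P e J T G : time_chart P e J T G ->
  time_chart P (- e) (reflected J 0) (fun s => - T s) (fun t => G (0 - t)).
Proof.
move=> tc; split.
- by case: (tc_sign tc) => ->; [right|left; rewrite opprK].
- exact: reflected_open (tc_open tc).
- exact: reflected_itv (tc_itv tc).
- by move=> s /(tc_T tc); rewrite /reflected /= !sub0r opprK.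
- by move=> t /(tc_G tc); rewrite sub0r => -[? ->]; rewrite opprK.
- move=> t Jt; apply: (contC (h := G) (f := fun t => 0 - t)); first exact: tc_contG tc _ Jt.
  by cont.
- by move=> s s' Is Is' ss; rewrite !mulrNN (tc_mono tc).
- have [dX [dZ H]] := tc_curve tc.
  exists (fun t => - dX (0 - t)), (fun t => - dZ (0 - t)) => t Jt.
  have [D1 D2 c1 c2 [b1 b2]] := H _ Jt; split.
  + exact: (der_reflect (f := fun t => cx P (G t)) D1).
  + exact: (der_reflect (f := fun t => cz P (G t)) D2).
  + by apply: contN; apply: (contC (h := dX) (f := fun t => 0 - t) c1); cont.
  + by apply: contN; apply: (contC (h := dZ) (f := fun t => 0 - t) c2); cont.
  + by rewrite normrN !sqrrN.
- have [W H] := tc_speed tc; exists W => s; have [h1 h2] := H s; split => // Is.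
  have [W0 cW D] := h1 Is; split => //; der; ring.
Qed.

(** On a closed profile the periodic speed has a positive minimum, so the time grows at least
    linearly in both directions. *)
Lemma closing_unbounded P e J T G (T0 t0 : R) : time_chart P e J T G -> closes_up P T0 -> J t0 ->
  ~ exists b, forall t, J t -> t <= b.
Proof.
move=> tc [DT T00 [px pz] _] _ [b Hb].
have Is s : (cdom P)^° s by rewrite DT interiorT.
have [W H] := tc_speed tc.
have pW : periodic W T0 by have [_] := H 0; apply.
have cW s : {for s, continuous W} by have [h _] := H s; have [] := h (Is s).
have W0 s : 0 < W s by have [h _] := H s; have [] := h (Is s).
have DT' s : is_derive s 1 T (e * W s) by have [h _] := H s; have [] := h (Is s).
have [c Hc] := periodic_ge T00 pW cW.
have grow s : 0 <= s -> e * T 0 + W c * s <= e * T s.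
  move=> s0; have D x : 0 <= x <= s -> is_derive x 1 (fun s => e * T s - W c * s) (W x - W c).
    move=> _; have h := DT' x; der.
    have ee : e * e = 1 by case: (tc_sign tc) => ->; ring.
    by transitivity (e * e * W x - W c); [ring|rewrite ee mul1r].
  have := derive_nondecr s0 D (fun x _ => _); rewrite mulr0 subr0 => h.
  by have := h (ltac:(move=> x; rewrite subr_ge0; exact: Hc)); lra.
have shrink s : s <= 0 -> e * T s <= e * T 0 + W c * s.
  move=> s0; have D x : s <= x <= 0 -> is_derive x 1 (fun s => e * T s - W c * s) (W x - W c).
    move=> _; have h := DT' x; der.
    have ee : e * e = 1 by case: (tc_sign tc) => ->; ring.
    by transitivity (e * e * W x - W c); [ring|rewrite ee mul1r].
  have := derive_nondecr s0 D (fun x _ => _); rewrite mulr0 subr0 => h.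
  by have := h (ltac:(move=> x; rewrite subr_ge0; exact: Hc)); lra.
pose M := (`|b| + `|T 0| + 1) / W c.
have M0 : 0 <= M by rewrite divr_ge0// ltW.
have WM : W c * M = `|b| + `|T 0| + 1 by rewrite mulrC divfK// lt0r_neq0.
have n1 := ler_norm b; have n2 := ler_norm (- T 0); rewrite normrN in n2.
case: (tc_sign tc) => e1.
  have := grow M M0; have [/Hb h _] := tc_T tc (Is M); rewrite e1 WM; lra.
have M0' : - M <= 0 by rewrite oppr_le0.
by have := shrink (- M) M0'; have [/Hb h _] := tc_T tc (Is (- M)); rewrite e1 mulrN WM; lra.
Qed.

(** The meridian arc itself is the short curve. On the strip its ambient speed is at most [Q], since
    the radius is at most [M] there. *)
Lemma meridian_close P e J T G lo hi : rotational_surface kappa P -> time_chart P e J T G ->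
  J lo -> exists2 C, 0 < C & forall t1 t2 d, J t1 -> J t2 -> lo <= t1 <= hi -> lo <= t2 <= hi ->
    C * `|t1 - t2| < d -> intrinsically_close kappa tau P (G t1, 0) (G t2, 0) d.
Proof.
move=> rs tc Jlo; have [dX [dZ H]] := tc_curve tc.
pose M := cx P (G lo) + (hi - lo).
pose Q := 1 + tau * `|M|.
have Q0 : 0 < Q by rewrite ltr_wpDr// mulr_ge0// ltW.
have amb t : J t -> 0 < 4 + kappa * cx P (G t) ^+ 2.
  move=> Jt; have [It _] := tc_G tc Jt; have [_ _ _ am _] := rs.
  by apply/(ambientP kappa_le0 P (G t) 0)/am; exact: nbhs_singleton It.
have XM t : J t -> lo <= t <= hi -> 0 <= cx P (G t) <= M.
  move=> Jt /andP[t1 t2]; have [It _] := tc_G tc Jt; have [_ ge0 _ _ _] := rs.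
  rewrite ge0; last exact: nbhs_singleton It.
  have J' x : lo <= x <= t -> J x by move=> xI; exact: (tc_itv tc) xI.
  have := derive_bound t1 (fun x xI => let: And5 D _ _ _ _ := H x (J' x xI) in D)
    (fun x _ => der_id x).
  have bd x : lo < x < t -> `|dX x| <= 1.
    move=> /andP[h1 h2]; have Jx : J x by apply: J'; rewrite !ltW.
    by have [_ _ _ _ []] := H x Jx.
  by move=> /(_ bd); rewrite ler_norml /M => /andP[_ h]; lra.
exists (Q * pi); first by rewrite mulr_gt0// pi_gt0.
move=> t1 t2 d J1 J2 I1 I2 small.
(* The competing curves are defined for all real times; with the cosine this one stays between [t1]
   and [t2] even outside [[0, 1]], and is smooth at the ends. *)
pose y0 t := t1 + (t2 - t1) * (1 - cos (pi * t)) / 2.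
have yI t : Num.min t1 t2 <= y0 t <= Num.max t1 t2.
  have h1 := cos_le1 (pi * t); have h2 := cos_geN1 (pi * t).
  have w0 : 0 <= (1 - cos (pi * t)) / 2 by lra.
  have w1 : 0 <= 1 - (1 - cos (pi * t)) / 2 by lra.
  rewrite /y0 -mulrA; move: w0 w1; set w := _ / 2 => w0 w1; case: (leP t1 t2) => h.
    have := mulr_ge0 (ltac:(lra) : 0 <= t2 - t1) w0; have := mulr_ge0 (ltac:(lra) : 0 <= t2 - t1) w1; lra.
  have := mulr_ge0 (ltac:(lra) : 0 <= t1 - t2) w0; have := mulr_ge0 (ltac:(lra) : 0 <= t1 - t2) w1; lra.
have Jy t : J (y0 t).
  have [h|/ltW h] := leP t1 t2; have := yI t; [rewrite (min_idPl h) (max_idPr h)|rewrite (min_idPr h) (max_idPl h)].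
    by apply: (tc_itv tc).
  by apply: (tc_itv tc).
have yB t : lo <= y0 t <= hi.
  by have := yI t; case: (leP t1 t2) => _; lra.
pose dy t := (t2 - t1) * (pi * sin (pi * t)) / 2.
have Dy t : is_derive t 1 y0 (dy t).
  have Dp : is_derive t 1 (fun t => pi * t) pi by der; ring.
  have Dc := derC1 (g := fun t => pi * t) (is_derive_cos _) Dp.
  rewrite /y0; der; rewrite /dy; ring.
have cy t := der_cont (Dy t).
have cdy t : {for t, continuous dy} by rewrite /dy; cont.
have dyB t : `|dy t| <= `|t1 - t2| * pi / 2.
  rewrite /dy !normrM distrC -!mulrA ler_wpM2l// [`|2^-1|]gtr0_norm ?invr_gt0//.
  rewrite mulrA ler_wpM2r ?invr_ge0// [`|pi|]gtr0_norm ?pi_gt0// ler_piMr ?pi_ge0//.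
  exact: norm_sin_le1.
exists (fun t => G (y0 t)), (fun=> 0).
set c := fun t => _.
have cE : c = (fun t => vec3 (cx P (G (y0 t))) 0 (cz P (G (y0 t)))).
  by apply/funext => t; rewrite /c /rotated cos0 sin0 mulr1 mulr0.
pose v t := vec3 (dX (y0 t) * dy t) 0 (dZ (y0 t) * dy t).
have Dc t : is_derive t 1 c (v t).
  have [D1 D2 _ _ _] := H _ (Jy t); have dt := Dy t.
  rewrite cE; apply: is_derive_vec3.
  + exact: (derC1 (f := fun t => cx P (G t)) (g := y0) D1 dt).
  + exact: (derC1 (f := fun t => cz P (G t)) (g := y0) D2 dt).
have DcE : 'D_1 c = v by apply/funext => t; exact: (@derive_val _ _ _ _ _ _ _ (Dc t)).
have cX t : {for t, continuous (fun t => cx P (G (y0 t)))}.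
  have [D1 _ _ _ _] := H _ (Jy t); exact: (contC (h := fun t => cx P (G t)) (f := y0) (der_cont D1) (cy t)).
have cdX t : {for t, continuous (fun t => dX (y0 t))}.
  by have [_ _ c1 _ _] := H _ (Jy t); exact: (contC c1 (cy t)).
have cdZ t : {for t, continuous (fun t => dZ (y0 t))}.
  by have [_ _ _ c1 _] := H _ (Jy t); exact: (contC c1 (cy t)).
split.
- by move=> t; have [It _] := tc_G tc (Jy t); exact: nbhs_singleton It.
- move=> t; apply: (cont_surf_point (s := fun t => G (y0 t)) (theta := fun=> 0)).
  + exact: (contC (tc_contG tc (Jy t)) (cy t)).
  + exact: cX.
  + exact: cont_cst.
- by rewrite /y0 mulr0 cos0 subrr mulr0 mul0r addr0 mulr1 cospi opprK; split => //=; congr surf_point; congr G; field.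
- split=> [t|t]; first by have [] := Dc t.
  have e1 := cdy t; have e2 := cdX t; have e3 := cdZ t.
  have v1 : {for t, continuous (fun t => dX (y0 t) * dy t)} by cont.
  have v3 : {for t, continuous (fun t => dZ (y0 t) * dy t)} by cont.
  have v2 : {for t, continuous (fun=> 0 : R)} by exact: cont_cst.
  by have := continuous_vec3 v1 v2 v3; rewrite DcE.
pose lam t := 4 / (4 + kappa * cx P (G (y0 t)) ^+ 2).
pose g t := Num.sqrt (lam t ^+ 2 * (dX (y0 t) * dy t) ^+ 2 + (dZ (y0 t) * dy t) ^+ 2).
have gE : (fun t => Num.sqrt (metric kappa tau (c t) ('D_1 c t) ('D_1 c t))) = g.
  apply/funext => t; have e1 : 'D_1 c t = v t := @derive_val _ _ _ _ _ _ _ (Dc t).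
  transitivity (Num.sqrt (metric kappa tau (c t) (v t) (v t))).
    exact: (congr1 (fun w => Num.sqrt (metric kappa tau (c t) w w)) e1).
  rewrite cE /g /lam /v; congr Num.sqrt.
  by rewrite /metric /vform /conf !vec3E expr0n/= addr0; ring.
have cg t : {for t, continuous g}.
  have a1 := cX t; have a2 := cdX t; have a3 := cdZ t; have a4 := cdy t.
  have n0 : 4 + kappa * cx P (G (y0 t)) ^+ 2 != 0 by apply: lt0r_neq0; exact: amb.
  rewrite /g /lam; cont.
rewrite gE; have [F [DF ->]] := integral_primitive cg.
pose B := Q * (`|t1 - t2| * pi / 2).
have gB t : `|g t| <= B.
  have [_ _ _ _ [_ b2]] := H _ (Jy t); have /andP[X0 X1] := XM _ (Jy t) (yB t).
  rewrite ger0_norm ?sqrtr_ge0//.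
  apply: (@le_trans _ _ (Q * `|dy t|)); last by rewrite ler_wpM2l// ltW.
  have q1 : 0 <= Q * `|dy t| by rewrite mulr_ge0// ltW.
  rewrite /g -[leRHS]ger0_norm// -sqrtr_sqr; apply: ler_wsqrtr.
  have -> : (Q * `|dy t|) ^+ 2 = Q ^+ 2 * dy t ^+ 2 by rewrite exprMn real_normK// num_real.
  have -> : lam t ^+ 2 * (dX (y0 t) * dy t) ^+ 2 + (dZ (y0 t) * dy t) ^+ 2 =
    (lam t ^+ 2 * dX (y0 t) ^+ 2 + dZ (y0 t) ^+ 2) * dy t ^+ 2 by ring.
  rewrite ler_wpM2r ?sqr_ge0//; apply: (le_trans b2).
  have MM : cx P (G (y0 t)) <= `|M| by apply: (le_trans X1); exact: ler_norm.
  have : tau ^+ 2 * cx P (G (y0 t)) ^+ 2 <= tau ^+ 2 * `|M| ^+ 2.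
    by rewrite ler_wpM2l ?sqr_ge0// lerXn2r// nnegrE.
  have : 0 <= tau * `|M| by rewrite mulr_ge0// ltW.
  by rewrite /Q sqrrD expr1n mul1r exprMn; lra.
have DB (t : R) : is_derive t 1 (fun t : R => B * t) B by der; ring.
have := derive_bound (ler01 : (0 : R) <= 1) (fun t _ => DF t) (fun t _ => DB t) (fun t _ => gB t).
rewrite mulr1 mulr0 subr0 => h; apply: (le_lt_trans (le_trans (ler_norm _) h)).
apply: (le_lt_trans _ small); rewrite /B -[leRHS]mulrA; apply: ler_wpM2l; first exact: ltW.
rewrite [leRHS]mulrC ler_pdivrMr ?ltr0n//; apply: ler_peMr; last by rewrite ler1n.
by rewrite mulr_ge0// pi_ge0.
Qed.

(** The times approaching the finite end give an intrinsic Cauchy sequence along a meridian, which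
    converges in the surface by completeness. The limit parameter cannot be interior, so it is an
    end of the profile, lying on the axis. *)
Lemma pole_end P e J T G t0 b0 : rotational_surface kappa P -> complete_surface kappa tau P ->
  time_chart P e J T G -> J t0 -> (forall t, J t -> t <= b0) ->
  exists b, [/\ cdom P b /\ cx P b = 0, inward P b (- e),
    forall s, cdom P s -> e * s <= e * b, forall t, J t -> e * G t < e * b &
    forall d, 0 < d -> exists2 x, J x & forall t, J t -> x <= t -> `|G t - b| < d].
Proof.
move=> rs comp tc J0 ub; have [nd ge0 ends _ _] := rs; have iD := nd.1.
have ee : e * e = 1 by case: (tc_sign tc) => ->; ring.
have en : `|e| = 1 by case: (tc_sign tc) => ->; rewrite ?normrN normr1.
have monoG t t' : J t -> J t' -> t < t' -> e * G t < e * G t'.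
  move=> Jt Jt' tt; have [It e1] := tc_G tc Jt; have [It' e2] := tc_G tc Jt'.
  have [h|h|h] := ltgtP (G t) (G t').
  - have := tc_mono tc It It' h; rewrite e1 e2; case: (tc_sign tc) => ->; lra.
  - have := tc_mono tc It' It h; rewrite e1 e2; case: (tc_sign tc) => ->; lra.
  - by move: tt; rewrite -e1 -e2 h ltxx.
have monoG' t t' : J t -> J t' -> t <= t' -> e * G t <= e * G t'.
  by move=> Jt Jt'; rewrite le_eqVlt => /orP[/eqP ->//|tt]; exact/ltW/monoG.
have hJ : has_sup J by split; [exists t0|exists b0].
pose be := sup J.
have Jbe t : J t -> t <= be by move=> Jt; exact: (sup_upper_bound hJ).
have right_ t : J t -> exists2 t', J t' & t < t'.
  move=> Jt; have /nbhs_ballP[d d0 Hd] := open_nbhs_nbhs (conj (tc_open tc) Jt).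
  have {}d0 : 0 < d := d0.
  exists (t + d / 2); last by rewrite ltrDl divr_gt0.
  by apply: Hd; rewrite /ball/= opprD addrA subrr sub0r normrN gtr0_norm ?divr_gt0//; lra.
have Jlt t : J t -> t < be.
  by move=> /right_[t' Jt' tt]; exact: lt_le_trans (Jbe _ Jt').
have t0be := Jlt t0 J0.
have Jin t : t0 <= t -> t < be -> J t.
  move=> tt tb; have h : 0 < be - t by rewrite subr_gt0.
  have [x Jx xt] := sup_adherent h hJ.
  by apply: (tc_itv tc) J0 Jx _ _; rewrite tt/= ltW//; apply: le_lt_trans xt; rewrite /be; lra.
(* A sequence of times tending to the end of [J] and contained in [J] from its first term. *)
pose u (n : nat) := be - (be - t0) / n.+1%:R.
have u1 n : t0 <= u n.
  have : (be - t0) / n.+1%:R <= be - t0.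
    by rewrite ler_pdivrMr ?ltr0n//; apply: ler_peMr; [lra|rewrite ler1n].
  by rewrite /u; set y := _ / _; lra.
have u2 n : u n < be by rewrite /u ltrBlDr ltrDl divr_gt0// subr_gt0.
have Ju n : J (u n) by exact: Jin.
have uclose d : 0 < d -> exists N, forall n, (N <= n)%N -> be - d < u n.
  move=> d0; have [N HN] : exists N : nat, (be - t0) / d < N.+1%:R.
    exists (Num.Def.archi_bound ((be - t0) / d)).
    apply: (lt_trans (archi_boundP _)); rewrite ?ltr_nat//.
    by apply: divr_ge0; apply/ltW; rewrite ?subr_gt0.
  exists N => n Nn; rewrite /u ltrD2l ltrN2 ltr_pdivrMr//.
  move: HN; rewrite ltr_pdivrMr// => /lt_le_trans; apply; rewrite mulrC.
  by apply: ler_wpM2l; [exact: ltW|rewrite ler_nat].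
have [C C0 close] := meridian_close be rs tc J0.
have [|d d0|b [Db cvb]] := comp (fun n => (G (u n), 0)).
- by move=> n /=; have [It _] := tc_G tc (Ju n); exact: nbhs_singleton It.
- have [N HN] := uclose (d / C) (divr_gt0 d0 C0).
  exists N => m n Nm Nn; apply: close => //.
  + by rewrite u1 ltW.
  + by rewrite u1 ltW.
  + rewrite mulrC -ltr_pdivlMr//.
    have h1 := HN m Nm; have h2 := HN n Nn; have h3 := u2 m; have h4 := u2 n.
    by rewrite ltr_norml; lra.
(* A profile that closes up has unbounded time; hence the base point is the parameter itself and
   convergence in the surface is convergence of parameters. *)
have [[L [cl _]]|[_ bpE]] := base_pointP P.
  by case: (closing_unbounded tc cl J0); exists b0.
have Gb : (fun n => G (u n)) @ \oo --> b.1.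
  have := cvg_first (cvg_first cvb).
  rewrite /surf_point /= bpE /=.
  have -> : (fun n => (base_point P (G (u n))).1) = (fun n => G (u n)).
    by apply/funext => n; rewrite bpE.
  by [].
pose L := b.1.
have GL := cvg_seqP Gb.
have below t : J t -> e * G t < e * L.
  move=> Jt; have [t' Jt' tt] := right_ t Jt.
  apply: (lt_le_trans (monoG _ _ Jt Jt' tt)); rewrite leNgt; apply/negP => h.
  have d0 : 0 < e * G t' - e * L by rewrite subr_gt0.
  have [N1 H1] := GL _ d0.
  have [N2 H2] := uclose (be - t') (ltac:(by rewrite subr_gt0 Jlt)).
  have h1 := H1 (maxn N1 N2) (leq_maxl _ _); have h2 := H2 (maxn N1 N2) (leq_maxr _ _).
  have h3 := monoG t' _ Jt' (Ju (maxn N1 N2)) (ltac:(lra)).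
  have : `|e * (G (u (maxn N1 N2)) - L)| < e * G t' - e * L by rewrite normrM en mul1r.
  by rewrite ltr_norml mulrBr; lra.
(* An interior limit would have its own time in [J], and would then lie strictly before itself. *)
have nI : ~ (cdom P)^° L.
  by move=> IL; have [JL e1] := tc_T tc IL; have := below _ JL; rewrite e1 ltxx.
have cL : cx P L = 0 by case: (ends L Db).
have DG t : J t -> cdom P (G t) by move=> Jt; have [It _] := tc_G tc Jt; exact: nbhs_singleton It.
exists L; split => //.
- split; first by case: (tc_sign tc) => ->; [right|left; rewrite opprK].
  have h0 := below _ J0.
  near=> r.
  have r0 : 0 < r by near: r; exact: nbhs_right_gt.
  have r1 : r < e * L - e * G t0 by near: r; apply: nbhs_right_lt; rewrite subr_gt0.
  case: (tc_sign tc) => e1; move: r1; rewrite e1 => r1.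
    by apply: (iD (G t0) L) => //; [exact: DG|lra].
  by apply: (iD L (G t0)) => //; [exact: DG|lra].
- move=> s Ds; rewrite leNgt; apply/negP => h; apply: nI; have h0 := below _ J0.
  case: (tc_sign tc) => e1; rewrite e1 in h h0.
    by apply: (interior_between iD (DG _ J0) Ds); lra.
  by apply: (interior_between iD Ds (DG _ J0)); lra.
- move=> d d0; have [N HN] := GL d d0; exists (u N); first exact: Ju.
  move=> t Jt ut; have h1 := monoG' _ _ (Ju N) Jt ut; have h2 := below t Jt.
  have h3 := HN N (leqnn N).
  have : `|e * (G (u N) - L)| < d by rewrite normrM en mul1r.
  have -> : `|G t - L| = `|e * (G t - L)| by rewrite normrM en mul1r.
  by rewrite !ltr_norml !mulrBr; lra.
Unshelve. all: by end_near. Qed.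

End ProfileEnds.

(** * Completeness of the surface gives completeness of the orbit *)

Section CompleteFlow.
Context {R : realType} (kappa tau : R) (h : R -> R).
Hypothesis kappa_le0 : kappa <= 0.
Hypothesis tau_gt0 : 0 < tau.
Let k (y : R) := h (clamp1 y).
Hypothesis cf : curvature_fun kappa k.
Implicit Types (P : profile R) (J : set R) (T G p phi : R -> R) (s t b d e r sg eps : R).

Local Notation S := (Sig kappa).
Local Notation io := (angmax kappa tau).

Lemma time_of_flow P eps J p phi T G : flow_chart kappa tau h P eps J p phi T G ->
  time_chart kappa tau P eps J T G.
Proof.
move=> fc; split.
- exact: fc_eps fc.
- exact: fc_open fc.
- exact: fc_itv fc.
- exact: fc_T fc.
- exact: fc_G fc.
- exact: fc_contG fc.
- exact: fc_mono fc.
- exists (fun t => rad_of kappa (p t) * p t * sin (phi t)), (fun t => cos (phi t) / io (p t)) => t Jt.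
  have [p0 Dp Dphi] := fc_sol fc Jt; have S0 := Sig_gt0 kappa_le0 p0.
  have Dr := der_rad kappa_le0 p0 Dp; have Di := der_angmax kappa_le0 tau_gt0 p0 Dp.
  have i0 := angmax_gt0 kappa tau_gt0 p0; have i0' := lt0r_neq0 i0.
  have cp := der_cont Dp; have cphi := der_cont Dphi; have cr := der_cont Dr; have ci := der_cont Di.
  have r0 := rad_gt0 kappa_le0 p0; have pn := lt0r_neq0 p0; have rn := lt0r_neq0 r0.
  have amb := rad_ambient kappa_le0 p0.
  have near_ : \forall x \near t, rad_of kappa (p x) = cx P (G x).
    by apply: filterS (open_nbhs_nbhs (conj (fc_open fc) Jt)) => x Jx; rewrite (fc_cx fc).
  have rp : rad_of kappa (p t) * p t = (4 + kappa * rad_of kappa (p t) ^+ 2) / 4.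
    by rewrite [LHS]mulrC -[LHS]invrK -conf_rad// invf_div.
  split.
  + apply: (der_near near_); notypeclasses refine (is_derive_eq Dr _).
    by rewrite /flowP; field; exact: lt0r_neq0.
  + exact: fc_cz fc _ Jt.
  + by cont.
  + by cont.
  + split.
      rewrite normrM rp -[leRHS]mulr1; apply: ler_pM; rewrite ?normr_ge0 ?norm_sin_le1//.
      rewrite ger0_norm; last by apply: divr_ge0; apply/ltW.
      by rewrite ler_pdivrMr ?ltr0n// mul1r gerDl pmulr_lle0// exprn_gt0.
    rewrite (fc_cx fc)// conf_rad//.
    have q2 := angmax_rad kappa_le0 tau_gt0 p0.
    have -> : (p t * rad_of kappa (p t))^-1 ^+ 2 * (rad_of kappa (p t) * p t * sin (phi t)) ^+ 2
      + (cos (phi t) / io (p t)) ^+ 2 = sin (phi t) ^+ 2 + cos (phi t) ^+ 2 * (1 + tau ^+ 2 * rad_of kappa (p t) ^+ 2).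
      have -> : 1 + tau ^+ 2 * rad_of kappa (p t) ^+ 2 = (io (p t) ^+ 2)^-1.
        by apply: (mulfI (expf_neq0 2 i0')); rewrite q2 mulfV// expf_neq0.
      by field; rewrite i0' pn rn.
    have := cos2Dsin2 (phi t); have : 0 <= tau ^+ 2 * rad_of kappa (p t) ^+ 2 by rewrite mulr_ge0 ?sqr_ge0.
    by have := sqr_ge0 (sin (phi t)); nra.
- have [W H] := fc_speed fc; exists W => s; have [h1 h2] := H s; split => //.
Qed.

(** A finite end lies on the axis by [pole_end], so the radius tends to zero, that is [p] tends to
    infinity. The same argument applied to the reflected chart gives the left end. *)
Lemma flow_blows_up P eps J p phi T G : rotational_surface kappa P ->
  complete_surface kappa tau P -> flow_chart kappa tau h P eps J p phi T G ->
  (exists t, J t) -> blows_up J p /\ blows_up (reflected J 0) (fun t => p (- t)).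
Proof.
move=> rs comp fc [t0 J0].
have key e J' T' G' q t1 : time_chart kappa tau P e J' T' G' -> J' t1 ->
    (forall t, J' t -> 0 < q t /\ cx P (G' t) = rad_of kappa (q t)) -> blows_up J' q.
  move=> tc J1 qP [b0 ub] M.
  have [b [[Db cb] ib _ below near_]] := pole_end kappa_le0 tau_gt0 rs comp tc J1 ub.
  pose M1 := Num.max M 1; have M10 : 0 < M1 by rewrite lt_max ltr01 orbT.
  have [d d0 Hd] := pole_cont rs Db cb ib (rad_gt0 kappa_le0 M10).
  have [x Jx Hx] := near_ d d0; exists x => // t Jt xt.
  have := Hx t Jt xt; have lt := below t Jt => ltd.
  have [q0 cq] := qP t Jt.
  have en : `|e| = 1 by case: (tc_sign tc) => ->; rewrite ?normrN normr1.
  have [|] := Hd (e * b - e * G' t).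
    rewrite subr_gt0 lt/=; apply: le_lt_trans ltd.
    by rewrite -mulrBr; apply: (le_trans (ler_norm _)); rewrite normrM en mul1r distrC.
  have -> : b + - e * (e * b - e * G' t) = G' t.
    by case: (tc_sign tc) => ->; ring.
  rewrite cq => h1 _; rewrite ltNge; apply/negP => qM.
  have : q t <= M1 by rewrite le_max qM.
  rewrite le_eqVlt => /orP[/eqP qe|qlt]; first by move: h1; rewrite qe ltxx.
  by have := rad_lt kappa_le0 q0 qlt; lra.
have tc := time_of_flow fc; split.
  apply: (key _ _ _ _ _ t0 tc J0) => t Jt; rewrite (fc_cx fc)//.
  by have [p0 _ _] := fc_sol fc Jt.
apply: (key _ _ _ _ _ (- t0) (tc_reflect tc)); first by rewrite /reflected /= sub0r opprK.
move=> t; rewrite /reflected /= sub0r => Jt; rewrite (fc_cx fc)//.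
by have [p0 _ _] := fc_sol fc Jt.
Qed.

Theorem complete_flow P eps : rotational_surface kappa P -> complete_surface kappa tau P ->
  oriented_h_surface kappa tau h P eps -> exists J p phi T G,
  [/\ flow_chart kappa tau h P eps J p phi T G, complete_sol kappa tau k J p phi & exists t, J t].
Proof.
move=> rs comp H; have [J [p [phi [T [G fc]]]]] := flow_chart_exists kappa_le0 tau_gt0 cf H.1 rs H.
have [nd _ _ _ _] := rs; have [iD [a [b [Da Db ab]]]] := nd.
have Im : (cdom P)^° ((a + b) / 2) by apply: (interior_between iD Da Db); lra.
have [Jm _] := fc_T fc Im.
have ne : exists t, J t by exists (T ((a + b) / 2)).
have [b1 b2] := flow_blows_up rs comp fc ne.
exists J, p, phi, T, G; split => //; split => //.
- exact: fc_open fc.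
- exact: fc_itv fc.
- exact: fc_sol fc.
Qed.

End CompleteFlow.

(** * From a global solution to an h-surface *)

Section SolutionSurface.
Context {R : realType} (kappa tau : R) (h : R -> R).
Hypothesis kappa_le0 : kappa <= 0.
Hypothesis tau_gt0 : 0 < tau.
Let k (y : R) := h (clamp1 y).
Hypothesis cf : curvature_fun kappa k.
Local Notation S := (Sig kappa).
Local Notation io := (angmax kappa tau).
Local Notation FQ := (flowPhi kappa tau k).
Variables (p phi z : R -> R).
Hypothesis sl : sol kappa tau k setT p phi.
Hypothesis Dz : forall t : R, is_derive t 1 z (cos (phi t) / io (p t)).
Implicit Types (t s : R).

Definition sol_profile : profile R := Profile setT (fun t => rad_of kappa (p t)) z.
Local Notation Q := sol_profile.

Let x1 t := rad_of kappa (p t) * p t * sin (phi t).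
Let z1 t := cos (phi t) / io (p t).
Let x2 t := rad_of kappa (p t) * p t *
  ((p t - S (p t)) * sin (phi t) ^+ 2 + cos (phi t) * FQ (p t) (phi t)).
Let z2 t := - (sin (phi t) * FQ (p t) (phi t) / io (p t))
  + cos (phi t) * tau ^+ 2 * rad_of kappa (p t) ^+ 2 * io (p t) * p t * sin (phi t).

Let p0 t : 0 < p t. Proof. by have [] := sl (I : setT t). Qed.
Let Dp t : is_derive t 1 p (flowP kappa (p t) (phi t)). Proof. by have [] := sl (I : setT t). Qed.
Let Dphi t : is_derive t 1 phi (FQ (p t) (phi t)). Proof. by have [] := sl (I : setT t). Qed.
Let S0 t : 0 < S (p t). Proof. exact: Sig_gt0. Qed.
Let i0 t : 0 < io (p t). Proof. exact: angmax_gt0. Qed.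
Let r0 t : 0 < rad_of kappa (p t). Proof. exact: rad_gt0. Qed.

Let Dr t : is_derive t 1 (fun t => rad_of kappa (p t)) (x1 t).
Proof.
notypeclasses refine (is_derive_eq (der_rad kappa_le0 (p0 t) (Dp t)) _).
by rewrite /x1 /flowP; field; exact: lt0r_neq0.
Qed.
Let Di t : is_derive t 1 (fun t => io (p t)) (- (tau ^+ 2 * rad_of kappa (p t) ^+ 2 * io (p t) ^+ 3 * p t * sin (phi t))).
Proof.
notypeclasses refine (is_derive_eq (der_angmax kappa_le0 tau_gt0 (p0 t) (Dp t)) _).
by rewrite /flowP; field; exact: lt0r_neq0.
Qed.
Let Dx1 t : is_derive t 1 x1 (x2 t).
Proof. have a := Dr t; have b := Dp t; have c := Dphi t; rewrite /x1; der; rewrite /x2 /x1 /flowP; ring. Qed.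
Let Dz1 t : is_derive t 1 z1 (z2 t).
Proof.
have a := Di t; have c := Dphi t; have n := lt0r_neq0 (i0 t).
by rewrite /z1; der; rewrite /z2; field.
Qed.
Let derive1_eq (f f' : R -> R) : (forall t, is_derive t 1 f (f' t)) -> derive1 f = f'.
Proof. by move=> D; apply/funext => t; have Dt := D t; rewrite derive1E; exact: derive_val. Qed.
Let E1 : derive1 (cx Q) = x1. Proof. exact: derive1_eq Dr. Qed.
Let E2 : derive1 x1 = x2. Proof. exact: derive1_eq Dx1. Qed.
Let E3 : derive1 (cz Q) = z1. Proof. exact: derive1_eq Dz. Qed.
Let E4 : derive1 z1 = z2. Proof. exact: derive1_eq Dz1. Qed.

Lemma derive1_sol_z : derive1 z = (fun t => cos (phi t) / io (p t)).
Proof. exact: E3. Qed.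

Let cosc t : {for t, continuous (fun t => FQ (p t) (phi t))}.
Proof.
have a := der_cont (Dphi t); have b := der_cont (Di t); have c := der_cont (der_Sig kappa_le0 (p0 t) (Dp t)).
have d : {for t, continuous (fun t => sin (phi t) * io (p t))} by cont.
have e := contC (h := k) (@curvature_fun_cont _ _ _ cf _) d.
rewrite /flowPhi; cont.
Qed.

Let C2Q t : C2_profile_at Q t.
Proof.
have a := der_cont (Dphi t); have b := der_cont (Di t); have c := der_cont (der_Sig kappa_le0 (p0 t) (Dp t)).
have d := der_cont (Dr t); have e := der_cont (Dp t); have f := @cosc t.
have n := lt0r_neq0 (i0 t).
split; rewrite ?E1 ?E3 ?E2 ?E4.
- by have [] := Dr t.
- by have [] := Dz t.
- by have [] := Dx1 t.
- by have [] := Dz1 t.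
- by split; [rewrite /x2; cont|rewrite /z2; cont].
Qed.

Let x1E t : (4 / (4 + kappa * rad_of kappa (p t) ^+ 2)) ^+ 2 * (1 + tau ^+ 2 * rad_of kappa (p t) ^+ 2)
  * x1 t ^+ 2 + z1 t ^+ 2 = (io (p t))^-1 ^+ 2.
Proof.
have q2 := angmax_rad kappa_le0 tau_gt0 (p0 t).
have a := lt0r_neq0 (i0 t); have b := lt0r_neq0 (p0 t); have c := lt0r_neq0 (r0 t).
have -> : 1 + tau ^+ 2 * rad_of kappa (p t) ^+ 2 = (io (p t))^-1 ^+ 2.
  by apply: (mulfI (expf_neq0 2 a)); rewrite q2 exprVn mulfV// expf_neq0.
rewrite conf_rad// /x1 /z1 -[RHS]mulr1 -(cos2Dsin2 (phi t)); field.
by rewrite a b c.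
Qed.

Let imm t : x1 t != 0 \/ z1 t != 0.
Proof.
have [e1|?] := eqVneq (x1 t) 0; last by left.
right; apply/eqP => e2; have := x1E t; rewrite e1 e2 expr0n/= mulr0 addr0 => /esym/eqP.
by rewrite sqrf_eq0 invr_eq0 (gt_eqF (i0 t)).
Qed.

Lemma sol_regular t : regular_at kappa Q t.
Proof.
split; [exists 1; [exact: ltr01|by move=> y _; exact: C2Q]|exact: r0|exact: rad_ambient|].
by rewrite /immersed_at E1 E3; exact: imm.
Qed.

Lemma sol_rotational : rotational_surface kappa Q.
Proof.
split.
- by split; [move=> ? ? _ _ ? _|exists 0, 1; split => //; exact: ltr01].
- by move=> t _; exact/ltW/r0.
- by move=> t _; left; rewrite interiorT.
- by move=> t th _; apply/(ambientP kappa_le0); exact: rad_ambient.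
- move=> t th _ _ _ [_|sg _ e _]; first exact: C2_immersion_rot (sol_regular t).
  by have := r0 t; rewrite -[X in _ < X]/(cx Q t) e ltxx.
Qed.

(** The converse of the passage from a surface to an orbit: in this parametrization [W = 1 / io],
    and the curvature equation reduces to comparing [S cos phi - 2 k] with [S cos phi - 2 H]. *)
Let H_eq t th eta : eta = rot_normal kappa tau Q t th (derive1 (cx Q) t) (derive1 (cz Q) t) 1 ->
  mean_curvature kappa tau (rot_patch Q) (vec2 t th) eta =
  h (angle kappa tau (rot_patch Q) (vec2 t th) eta).
Proof.
move=> ->; rewrite (angle_rot tau th 1 (sol_regular t)).
have := mean_curvature_rot tau th (sol_regular t) (or_introl erefl).
rewrite E1 E3 E2 E4 /= x1E sqrtr_sqr ger0_norm ?invr_ge0 ?ltW//.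
set Hm := mean_curvature _ _ _ _ _.
have a := lt0r_neq0 (i0 t); have b := lt0r_neq0 (p0 t); have c := lt0r_neq0 (r0 t).
rewrite conf_rad// mul1r.
have -> : (p t * rad_of kappa (p t))^-1 * x1 t / (io (p t))^-1 = sin (phi t) * io (p t).
  by rewrite /x1; field; rewrite a b c.
have [i1 ln] : io (p t) < 1 /\ `|sin (phi t)| <= 1 by split; [exact: angmax_lt1|exact: norm_sin_le1].
have -> : h (sin (phi t) * io (p t)) = k (sin (phi t) * io (p t)).
  rewrite /k clamp1_id// -ler_norml normrM (gtr0_norm (i0 t)).
  by rewrite -[leRHS]mulr1; apply: ler_pM; rewrite // ltW.
have q2 := angmax_rad kappa_le0 tau_gt0 (p0 t).
have -> : 1 + tau ^+ 2 * rad_of kappa (p t) ^+ 2 = (io (p t))^-1 ^+ 2.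
  by apply: (mulfI (expf_neq0 2 a)); rewrite q2 exprVn mulfV// expf_neq0.
rewrite -Sig_rad// => E.
have kr := rad_diff kappa_le0 (p0 t).
(* With [lam = 1 / (p r)] and [kappa r = 2 (p - S)] the second-order expression collapses to the
   rotation rate divided by [io^3]. *)
have F : z1 t * ((- (kappa / 2) * (p t * rad_of kappa (p t))^-1 ^+ 2 * rad_of kappa (p t) * (io (p t))^-1 ^+ 2
     + (p t * rad_of kappa (p t))^-1 * tau ^+ 2 * rad_of kappa (p t)) * x1 t ^+ 2
     + (p t * rad_of kappa (p t))^-1 * (io (p t))^-1 ^+ 2 * x2 t)
   - (p t * rad_of kappa (p t))^-1 * (io (p t))^-1 ^+ 2 * x1 t * z2 t = FQ (p t) (phi t) / io (p t) ^+ 3.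
  transitivity (cos (phi t) / io (p t) ^+ 3 * (- (kappa * rad_of kappa (p t)) / 2 + (p t - S (p t))) * sin (phi t) ^+ 2
    + FQ (p t) (phi t) / io (p t) ^+ 3 * (cos (phi t) ^+ 2 + sin (phi t) ^+ 2)).
    by rewrite /z1 /z2 /x1 /x2; field; rewrite a b c.
  by rewrite cos2Dsin2 -kr; field.
rewrite F /z1 /flowPhi in E.
have : (io (p t))^-1 ^+ 3 * (2 * (k (sin (phi t) * io (p t)) - Hm)) = 0.
  transitivity ((io (p t))^-1 ^+ 2 * (cos (phi t) / io (p t) * S (p t) - 2 * 1 * (io (p t))^-1 * Hm)
    - (S (p t) * cos (phi t) - 2 * k (sin (phi t) * io (p t))) / io (p t) ^+ 3); first by field.
  by rewrite E subrr.
move/eqP; rewrite mulf_eq0 expf_eq0/= invr_eq0 (negPf a) /= mulf_eq0 pnatr_eq0/= subr_eq0.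
by move/eqP.
Qed.

Lemma sol_oriented : oriented_h_surface kappa tau h Q 1.
Proof.
split; first by left.
move=> t th _ _ _ eta [_|sg _ e _]; last by have := r0 t; rewrite -[X in _ < X]/(cx Q t) e ltxx.
rewrite mulr1 => /(unit_normal_rotP tau th (sol_regular t) (or_introl erefl)).
exact: H_eq.
Qed.

Lemma sol_h_surface : h_surface kappa tau h Q.
Proof. by split; [exact: sol_rotational|exists 1; exact: sol_oriented]. Qed.

Lemma sol_cont_x t : {for t, continuous (fun t => rad_of kappa (p t))}.
Proof. exact: der_cont (Dr t). Qed.
Lemma sol_cont_z t : {for t, continuous z}.
Proof. exact: der_cont (Dz t). Qed.
Lemma sol_der_x t : is_derive t 1 (fun t => rad_of kappa (p t)) (rad_of kappa (p t) * p t * sin (phi t)).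
Proof. exact: Dr. Qed.
Lemma sol_cont_FQ t : {for t, continuous (fun t => FQ (p t) (phi t))}.
Proof. exact: @cosc t. Qed.

End SolutionSurface.

(** * Distances in the base line or circle *)

Section BaseArc.
Context {R : realType}.
Implicit Types (P : profile R) (s t d e x y : R) (b c : R * R).

Lemma cos_sdecr x y : 0 <= x -> x < y -> y <= pi -> cos y < cos x.
Proof.
move=> x0 xy yp; rewrite -ltrN2.
have D t : x <= t <= y -> is_derive t 1 (fun t => - cos t) (sin t) by move=> _; der; ring.
by apply: (derive_incr xy D) => t /andP[? ?]; apply: sin_gt0_pi; lra.
Qed.

Definition dist2 b c : R := (b.1 - c.1) ^+ 2 + (b.2 - c.2) ^+ 2.

Lemma base_point_shift P T : closes_up P T ->
  (forall s, base_point P s = (cos (2 * pi * s / T), sin (2 * pi * s / T))) ->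
  forall (n : int) s, [/\ base_point P (s + n%:~R * T) = base_point P s,
    cx P (s + n%:~R * T) = cx P s & cz P (s + n%:~R * T) = cz P s].
Proof.
move=> [_ T0 [px pz] _] bE n s; split; [|exact: (periodic_int px)|exact: (periodic_int pz)].
have [c2 s2] := double_sin0 (@sinpi R).
have e y : 2 * pi * (y + T) / T = 2 * pi * y / T + 2 * pi by field; exact: lt0r_neq0.
have pc : periodic (fun y => cos (2 * pi * y / T)) T.
  by move=> y; rewrite /= e cosD c2 s2 mulr1 mulr0 subr0.
have ps : periodic (fun y => sin (2 * pi * y / T)) T.
  by move=> y; rewrite /= e sinD c2 s2 mulr1 mulr0 addr0.
by rewrite !bE (periodic_int pc n s) (periodic_int ps n s).
Qed.

(* rho gives the chordal distance of two base points in terms of the shortest parameter difference. *)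
Lemma base_arc P : exists (rho : R -> R) (dom : set R) (D : R),
  [/\ 0 < D /\ (forall x, 0 <= x <= D -> dom x), rho 0 = 0 /\ {for 0, continuous rho},
      forall x y, 0 <= x -> dom x -> dom y -> x < y -> rho x < rho y &
      forall s s', exists s'', [/\ base_point P s'' = base_point P s',
         cx P s'' = cx P s' /\ cz P s'' = cz P s', dom `|s'' - s| &
         dist2 (base_point P s') (base_point P s) = rho `|s'' - s|]].
Proof.
have [[T [cl bE]]|[_ bE]] := base_pointP P; last first.
  exists (fun x => x ^+ 2), setT, 1; split.
  - by split => //; exact: ltr01.
  - by split; [rewrite expr0n|cont].
  - by move=> x y x0 _ _ xy; rewrite ltrXn2r// nnegrE ltW// (le_lt_trans x0).
  - move=> s s'; exists s'; split => //.
    by rewrite /dist2 !bE /= subrr expr0n addr0 real_normK// num_real.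
have sh := base_point_shift cl bE; have [_ T0 _ _] := cl.
exists (fun x => 2 - 2 * cos (2 * pi * x / T)), [set x | x <= T / 2], (T / 2); split.
- by split; [rewrite divr_gt0|move=> x /andP[]].
- by split; [rewrite mulr0 mul0r cos0 mulr1 subrr|cont].
- move=> x y x0 _ yT xy; rewrite ltrD2l ltrN2 ltr_pM2l//.
  have c0 : 0 < 2 * pi / T by rewrite divr_gt0// mulr_gt0// pi_gt0.
  have E a : 2 * pi * a / T = 2 * pi / T * a by ring.
  rewrite !E; apply: cos_sdecr; [by rewrite mulr_ge0// ltW|by rewrite ltr_pM2l|].
  apply: (@le_trans _ _ (2 * pi / T * (T / 2))); first by rewrite ler_pM2l.
  by rewrite le_eqVlt; apply/orP; left; apply/eqP; field; exact: lt0r_neq0.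
(* The shift by [T / 2] before reducing selects the representative at distance at most [T / 2] from
   [s]. *)
- move=> s s'; have [n /andP[n0 nT]] := periodic_reduce T0 (s' - s + T / 2).
  have [e1 e2 e3] := sh n s'; exists (s' + n%:~R * T); split => //.
    by rewrite /= ler_norml; apply/andP; split; lra.
  have ce y : cos (2 * pi * `|y| / T) = cos (2 * pi * y / T).
    by have [h|h] := leP 0 y; [rewrite ger0_norm|rewrite ltr0_norm// mulrN mulNr cosN].
  rewrite ce -e1 /dist2 !bE /=.
  have -> : 2 * pi * (s' + n%:~R * T - s) / T = 2 * pi * (s' + n%:~R * T) / T - 2 * pi * s / T by ring.
  rewrite cosB; set a := _ / T; set b := 2 * pi * s / T.
  have ca := cos2Dsin2 a; have cb := cos2Dsin2 b.
  transitivity ((cos a ^+ 2 + sin a ^+ 2) + (cos b ^+ 2 + sin b ^+ 2) - 2 * (cos a * cos b + sin a * sin b)).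
    by ring.
  by rewrite ca cb; ring.
Qed.

Lemma cont_first {T U V : topologicalType} (f : T -> U * V) (x : T) :
  {for x, continuous f} -> {for x, continuous (fun a : T => (f a).1)}.
Proof. by move=> c; apply: (cvg_comp _ _ c); exact: cont_fst. Qed.

Lemma cont_second {T U V : topologicalType} (f : T -> U * V) (x : T) :
  {for x, continuous f} -> {for x, continuous (fun a : T => (f a).2)}.
Proof. by move=> c; apply: (cvg_comp _ _ c); exact: cont_snd. Qed.

Lemma cvg_sqsum (u v w : nat -> R) (l m W : R) : u @ \oo --> l -> v @ \oo --> m ->
  w @ \oo --> W -> (forall n, u n ^+ 2 + v n ^+ 2 = w n) -> l ^+ 2 + m ^+ 2 = W.
Proof.
move=> H1 H2 H3 e; rewrite !expr2; apply: (cvg_unique (@norm_hausdorff _ R) _ H3).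
have -> : w = (fun n => u n * u n + v n * v n) by apply/funext => n; rewrite -e !expr2.
exact: (cvgD (cvgM H1 H1) (cvgM H2 H2)).
Qed.

Lemma base_near P s0 d : 0 < d -> exists2 e, 0 < e &
  forall s, dist2 (base_point P s) (base_point P s0) < e -> exists s',
   [/\ base_point P s' = base_point P s, cx P s' = cx P s, cz P s' = cz P s & `|s' - s0| < d].
Proof.
move=> d0; have [rho [dom [D [[D0 HD] [r0 cr] mono arc]]]] := base_arc P.
pose m := Num.min d D; have m0 : 0 < m by rewrite lt_min d0.
have dm : dom m by apply: HD; rewrite ltW// ge_min lexx orbT.
have d00 : dom 0 by apply: HD; rewrite lexx ltW.
exists (rho m); first by rewrite -r0; exact: mono.
move=> s; have [s' [e1 [e2 e3] ds ->]] := arc s0 s => lt.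
exists s'; split => //; rewrite ltNge; apply/negP => h.
have : m <= `|s' - s0| by rewrite ge_min h.
rewrite le_eqVlt => /orP[/eqP e|h']; first by move: lt; rewrite -e ltxx.
by have := mono _ _ (ltW m0) dm ds h'; lra.
Qed.

End BaseArc.

(** * Periodic solutions: properness, embeddedness, completeness *)

Section PeriodicSurface.
Context {R : realType} (kappa tau : R) (h : R -> R).
Hypothesis kappa_le0 : kappa <= 0.
Hypothesis tau_gt0 : 0 < tau.
Let k (y : R) := h (clamp1 y).
Hypothesis cf : curvature_fun kappa k.
Local Notation S := (Sig kappa).
Local Notation io := (angmax kappa tau).
Local Notation FQ := (flowPhi kappa tau k).
Variables (p phi z : R -> R) (L : R).
Hypothesis sl : sol kappa tau k setT p phi.
Hypothesis Dz : forall t : R, is_derive t 1 z (cos (phi t) / io (p t)).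
Hypothesis L_gt0 : 0 < L.
Hypothesis pp : periodic p L.
Hypothesis pc : periodic (fun t => cos (phi t)) L.
Hypothesis ps : periodic (fun t => sin (phi t)) L.
Implicit Types (t s d e x y th : R).
Local Notation Q := (sol_profile kappa p z).
Let X t := rad_of kappa (p t).
Let cX t : {for t, continuous X}. Proof. exact: (sol_cont_x kappa_le0 sl). Qed.
Let cZ t : {for t, continuous z}. Proof. exact: (sol_cont_z Dz). Qed.
Let p0 t : 0 < p t. Proof. by have [] := sl (I : setT t). Qed.
Let X0 t : 0 < X t. Proof. exact: rad_gt0. Qed.
Let pX : periodic X L. Proof. by move=> t; rewrite /X pp. Qed.

Lemma z_shift t : z (t + L) = z t + (z L - z 0).
Proof.
have D s : is_derive s 1 (fun t => z (t + L) - z t) 0.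
  have a := Dz s; have b := Dz (s + L).
  have c : is_derive s 1 (fun t => t + L) 1 by der; ring.
  have d := derC1 (g := fun t => t + L) b c.
  by der; rewrite pp pc; ring.
have : z (t + L) - z t = z (0 + L) - z 0.
  have [t0|/ltW t0] := leP t 0; first exact: (derive0_const t0 (fun s _ => D s)).
  exact/esym/(derive0_const t0 (fun s _ => D s)).
by rewrite add0r => <-; ring.
Qed.

Lemma z_shift_int (n : int) t : z (t + n%:~R * L) = z t + n%:~R * (z L - z 0).
Proof.
pose f t := z t - t / L * (z L - z 0).
have pf : periodic f L by move=> s; rewrite /f z_shift; field; exact: lt0r_neq0.
have := periodic_int pf n t; rewrite /f => e.
have -> : z (t + n%:~R * L) = z t - t / L * (z L - z 0) + (t + n%:~R * L) / L * (z L - z 0).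
  by rewrite -e; ring.
by field; exact: lt0r_neq0.
Qed.

Lemma sol_z_strict s t : (forall x, 0 < cos (phi x)) -> s < t -> z s < z t.
Proof.
move=> c0 st; apply: (derive_incr st (fun x _ => Dz x)) => x _.
by rewrite divr_gt0// angmax_gt0.
Qed.

Lemma rotated_cont : continuous (fun w : R * R => rotated Q w.1 w.2).
Proof.
move=> w.
have c1 : {for w, continuous (fun w : R * R => X w.1)}.
  apply: (contC (h := X) (f := fun w : R * R => w.1)); [exact: cX|exact: cont_fst].
have c2 : {for w, continuous (fun w : R * R => w.2)} by exact: cont_snd.
have c3 : {for w, continuous (fun w : R * R => z w.1)}.
  apply: (contC (h := z) (f := fun w : R * R => w.1)); [exact: cZ|exact: cont_fst].
have d1 : {for w, continuous (fun w : R * R => X w.1 * cos w.2)} by cont.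
have d2 : {for w, continuous (fun w : R * R => X w.1 * sin w.2)} by cont.
exact: (continuous_vec3 d1 d2 c3).
Qed.

Lemma surf_point_cont : continuous (fun w : R * R => surf_point Q w.1 w.2).
Proof.
move=> w; apply: (cont_surf_point (s := fst) (theta := snd)).
- exact: cont_fst.
- apply: (contC (h := X) (f := fun w : R * R => w.1)); [exact: cX|exact: cont_fst].
- exact: cont_snd.
Qed.

(** The preimage of a compact set is the image of a compact set of parameters. Angles reduce to one
    turn; the parameter reduces to one period if the profile closes up, and otherwise is bounded by
    the height, which advances by [z L - z 0] in each period. *)
Lemma sol_proper : z L != z 0 \/ closes_up Q L -> proper_surface kappa Q.
Proof.
move=> ZL K _ cK.
have [M HM] : exists M : R, forall v, K v -> `|pz v| <= M.
  have cpz : compact ((@pz R) @` K).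
    apply: continuous_compact => //; apply: continuous_subspaceT => v.
    exact: (@coord_continuous R 1 3 ord0 (inord 2) v).
  have [M [_ HM]] := compact_bounded cpz.
  by exists (M + 1) => v Kv; apply: (HM (M + 1)); [rewrite ltrDl|exists v].
(* The number of periods between [s] and the basic one is at most [(M + C) / D]: the heights at both
   parameters are bounded by [M] and [C], and each period contributes [D]. *)
have [lo [hi red]] : exists lo hi : R, forall s th, K (rotated Q s th) -> exists s',
   [/\ lo <= s' <= hi, base_point Q s' = base_point Q s, X s' = X s & z s' = z s].
  have [[T [cl bE]]|[ncl _]] := base_pointP Q.
    have [_ T0 _ _] := cl; exists 0, T => s th _.
    have [n /andP[n0 nT]] := periodic_reduce T0 s.
    have [e1 e2 e3] := base_point_shift cl bE n s.
    by exists (s + n%:~R * T); split => //; rewrite n0 ltW.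
  have {}ZL : z L != z 0 by case: ZL => // cl; case: (ncl L cl).
  pose D := `|z L - z 0|; have D0 : 0 < D by rewrite normr_gt0 subr_eq0.
  have [C HC] : exists C, forall s, 0 <= s <= L -> `|z s| <= C.
    have cn : {within `[0, L], continuous (fun s => `|z s|)}.
      apply: cont_withinI => t _.
      by apply: (contC (h := fun x => `|x|)); [exact: norm_continuous|exact: cZ].
    have [c _ H] := EVT_max (ltW L_gt0) cn.
    by exists `|z c| => s sI; apply: H; rewrite in_itv.
  pose N := (M + C) / D.
  exists (- (N * L)), (L + N * L) => s th Ks.
  exists s; split => //.
  have [n /andP[n0 nT]] := periodic_reduce L_gt0 s.
  have zn := z_shift_int n s; have zM : `|z s| <= M.
    by have := HM _ Ks; rewrite /rotated pz_vec3.
  have zC := HC (s + n%:~R * L); rewrite n0 (ltW nT) in zC; have {}zC := zC isT.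
  have : `|n%:~R| * D <= M + C.
    rewrite -normrM; have -> : n%:~R * (z L - z 0) = z (s + n%:~R * L) - z s by rewrite zn; ring.
    by apply: (le_trans (ler_normB _ _)); rewrite addrC; exact: lerD.
  rewrite -ler_pdivlMr// -/N => nN.
  have : `|n%:~R * L| <= N * L by rewrite normrM (gtr0_norm L_gt0) ler_wpM2r// ltW.
  by rewrite ler_norml; lra.
pose B := [set w : R * R | [/\ lo <= w.1 <= hi, 0 <= w.2 <= 2 * pi & K (rotated Q w.1 w.2)]].
have -> : [set q | exists s theta, [/\ cdom Q s, K (rotated Q s theta) & q = surf_point Q s theta]]
    = (fun w : R * R => surf_point Q w.1 w.2) @` B.
  apply/seteqP; split => q /=; last first.
    by move=> [[s th] [/= _ _ Ks] <-]; exists s, th.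
  move=> [s [th [_ Ks ->]]]; have [s' [sI e1 e2 e3]] := red s th Ks.
  have P0 : 0 < 2 * pi :> R by rewrite mulr_gt0// pi_gt0.
  have [n /andP[n0 nT]] := periodic_reduce P0 th.
  have [c2 s2] := double_sin0 (@sinpi R).
  have q1 : periodic (@cos R) (2 * pi) by move=> y; rewrite cosD c2 s2 mulr1 mulr0 subr0.
  have q2 : periodic (@sin R) (2 * pi) by move=> y; rewrite sinD c2 s2 mulr1 mulr0 addr0.
  have tc := periodic_int q1 n th; have ts := periodic_int q2 n th.
  have E2 : cx Q s' = cx Q s by exact: e2.
  have E3 : cz Q s' = cz Q s by exact: e3.
  exists (s', th + n%:~R * (2 * pi)); last by rewrite /surf_point /= e1 tc ts -/(X s') -/(X s) e2.
  split => //=; first by rewrite n0 ltW.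
  by move: Ks; rewrite /rotated tc ts E2 E3.
apply: continuous_compact; first by apply: continuous_subspaceT; exact: surf_point_cont.
have cR : compact (`[lo, hi]%classic `*` `[0, 2 * pi]%classic : set (R * R)).
  by apply: compact_setX; exact: segment_compact.
apply: (subclosed_compact _ cR); last first.
  by move=> [a b] [/= h1 h2 _]; split; rewrite /= in_itv.
have -> : B = (`[lo, hi]%classic `*` `[0, 2 * pi]%classic) `&` ((fun w : R * R => rotated Q w.1 w.2) @^-1` K).
  apply/seteqP; split => -[a b] /=; rewrite !in_itv/=; first by move=> [? ? ?].
  by move=> [[? ?] ?].
apply: closedI.
  by apply: compact_closed cR; exact: norm_hausdorff.
apply: preimage_closed; first by move=> w _; exact: rotated_cont.
by apply: compact_closed cK; exact: norm_hausdorff.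
Qed.

(** The height increases strictly from minus to plus infinity, so it determines the parameter
    continuously; in particular the profile cannot close up. *)
Lemma sol_embedded : (forall t, 0 < cos (phi t)) -> embedded Q.
Proof.
move=> c0.
have ZL : 0 < z L - z 0 by rewrite subr_gt0; apply: sol_z_strict.
have big M : exists n : nat, M < n%:R * (z L - z 0).
  exists (Num.Def.archi_bound (`|M| / (z L - z 0))).
  rewrite -ltr_pdivrMr//; apply: le_lt_trans (archi_boundP _); last by rewrite divr_ge0// ltW.
  by rewrite ler_pM2r ?invr_gt0// ler_norm.
have up y : exists t, y <= z t.
  have [n hn] := big (y - z 0); exists (0 + (n : int)%:~R * L).
  by rewrite z_shift_int; apply/ltW; move: hn; rewrite ltrBlDl.
have down y : exists t, z t <= y.
  have [n hn] := big (z 0 - y); exists (0 + (- (n : int))%:~R * L).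
  have {}hn : z 0 - y < (n : int)%:~R * (z L - z 0) := hn.
  by rewrite z_shift_int mulrNz mulNr; move: hn; set b := _ * _ => hn; lra.
have [g [gK _ cg]] := inverse_line (fun t => @cZ t) (fun s t => sol_z_strict c0 (s := s) (t := t)) up down.
have ncl T : ~ closes_up Q T.
  move=> [_ T0 [_ pz] _]; have := pz 0; rewrite /= add0r => e.
  by have := sol_z_strict c0 T0; rewrite e ltxx.
have bE s : base_point Q s = (s, 0).
  by have [[T [cl _]]|[_ ->//]] := base_pointP Q; case: (ncl T).
exists (fun v => ((g (pz v), 0), (px v, py v))); split.
  apply: continuous_subspaceT => v.
  have c1 : {for v, continuous (fun v => g (pz v))}.
    exact: (cont_comp (g := g) (@coord_continuous R 1 3 ord0 (inord 2) v) (cg _)).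
  have c2 : {for v, continuous (@px R)} := @coord_continuous R 1 3 ord0 (inord 0) v.
  have c3 : {for v, continuous (@py R)} := @coord_continuous R 1 3 ord0 (inord 1) v.
  have c4 : {for v, continuous (fun=> 0 : R)} by exact: cont_cst.
  exact: (cont_pair (cont_pair c1 c4) (cont_pair c2 c3)).
by move=> s th _; rewrite /rotated !vec3E /surf_point bE gK.
Qed.

(** Norm of the vector [(a, b, c)] at a point with horizontal coordinates [(x, y)] and conformal
    factor [la]. *)
Let gspeed a b c x y la := Num.sqrt (la ^+ 2 * (a ^+ 2 + b ^+ 2) + (la * tau * (y * a - x * b) + c) ^+ 2).

Let cont_gspeed (a b c x y la : R -> R) (t : R) : {for t, continuous a} -> {for t, continuous b} ->
  {for t, continuous c} -> {for t, continuous x} -> {for t, continuous y} ->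
  {for t, continuous la} ->
  {for t, continuous (fun t => gspeed (a t) (b t) (c t) (x t) (y t) (la t))}.
Proof. move=> ca cb cc cx_ cy cl; rewrite /gspeed; cont. Qed.

(* The first bound holds as the conformal factor la is at least 1; Cauchy-Schwarz bounds the twisting term of the metric. *)
Lemma speed_bounds a b c x y la M : 1 <= la -> 0 <= M -> x ^+ 2 + y ^+ 2 <= M ^+ 2 ->
  [/\ `|a| <= gspeed a b c x y la, `|b| <= gspeed a b c x y la &
      `|c| <= (1 + tau * M) * gspeed a b c x y la].
Proof.
move=> la1 M0 xM; set g := gspeed _ _ _ _ _ _.
have g0 : 0 <= g by exact: sqrtr_ge0.
have la0 : 0 <= la by exact: le_trans ler01 la1.
have g2 : g ^+ 2 = la ^+ 2 * (a ^+ 2 + b ^+ 2) + (la * tau * (y * a - x * b) + c) ^+ 2.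
  by rewrite sqr_sqrtr// addr_ge0 ?sqr_ge0// mulr_ge0 ?sqr_ge0// addr_ge0 ?sqr_ge0.
have h1 : la ^+ 2 * (a ^+ 2 + b ^+ 2) <= g ^+ 2 by rewrite g2 lerDl sqr_ge0.
have h2 : a ^+ 2 + b ^+ 2 <= la ^+ 2 * (a ^+ 2 + b ^+ 2).
  by rewrite ler_peMl ?addr_ge0 ?sqr_ge0// exprn_ege1.
have a2 := sqr_ge0 a; have b2 := sqr_ge0 b.
have h3 : (la * tau * (y * a - x * b) + c) ^+ 2 <= g ^+ 2.
  by rewrite g2 lerDr mulr_ge0 ?sqr_ge0// addr_ge0.
have h4 : (y * a - x * b) ^+ 2 <= (x ^+ 2 + y ^+ 2) * (a ^+ 2 + b ^+ 2).
  rewrite -subr_ge0.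
  have -> : (x ^+ 2 + y ^+ 2) * (a ^+ 2 + b ^+ 2) - (y * a - x * b) ^+ 2 = (x * a + y * b) ^+ 2 by ring.
  exact: sqr_ge0.
have h5 : (la * (y * a - x * b)) ^+ 2 <= (M * g) ^+ 2.
  rewrite !exprMn; apply: (@le_trans _ _ (la ^+ 2 * (M ^+ 2 * (a ^+ 2 + b ^+ 2)))).
    apply: ler_wpM2l; first exact: sqr_ge0.
    by apply: (le_trans h4); apply: ler_wpM2r => //; rewrite addr_ge0.
  by rewrite mulrCA; apply: ler_wpM2l => //; exact: sqr_ge0.
have sq_norm (u v : R) : 0 <= v -> u ^+ 2 <= v ^+ 2 -> `|u| <= v.
  by move=> v0 uv; apply: le_sq => //; rewrite real_normK ?num_real.
split; [by apply: sq_norm => //; lra|by apply: sq_norm => //; lra|].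
have n1 := sq_norm _ _ g0 h3.
have n2 := sq_norm _ _ (mulr_ge0 M0 g0) h5.
have -> : c = (la * tau * (y * a - x * b) + c) - tau * (la * (y * a - x * b)) by ring.
apply: (le_trans (ler_normB _ _)); rewrite mulrDl mul1r; apply: lerD => //.
by rewrite normrM (gtr0_norm tau_gt0) -mulrA; apply: ler_wpM2l => //; exact: ltW.
Qed.

Let Xmax : exists2 M, 0 < M & forall t, X t <= M.
Proof.
have pN : periodic (fun t => - X t) L by move=> t; rewrite pX.
have [c Hc] := periodic_ge L_gt0 pN (fun t => contN (@cX t)).
by exists (X c) => // t; have := Hc t; rewrite lerN2.
Qed.

(** Each coordinate moves by at most [C] times the length, by [speed_bounds] and since the radius is
    bounded by [M]. The bound is kept at every intermediate time, because the next comparison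
    follows the curve continuously. *)
Lemma close_displacement : exists2 C, 0 < C & forall a b e,
  intrinsically_close kappa tau Q a b e -> exists s th : R -> R,
  [/\ continuous (fun t => base_point Q (s t)), surf_point Q (s 0) (th 0) = surf_point Q a.1 a.2,
    surf_point Q (s 1) (th 1) = surf_point Q b.1 b.2 &
    forall t, 0 <= t <= 1 -> [/\ `|X (s t) * cos (th t) - X (s 0) * cos (th 0)| < C * e,
      `|X (s t) * sin (th t) - X (s 0) * sin (th 0)| < C * e & `|z (s t) - z (s 0)| < C * e]].
Proof.
have [M M0 HM] := Xmax; pose C := 1 + tau * M.
have C1 : 1 <= C by rewrite lerDl mulr_ge0// ltW.
have C0 : 0 < C by exact: lt_le_trans C1.
exists C => // a b e [s [th /= [_ cs [e0 e1] [Dc cDc] len]]].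
exists s, th; split => //.
  by move=> t; exact: cont_first (cs t).
set c := fun t => rotated Q (s t) (th t) in Dc cDc len.
pose v : R -> 'rV[R]_3 := 'D_1 c.
have Dv t : is_derive t 1 c (v t) by split; [exact: Dc|].
pose A t := X (s t) * cos (th t); pose B t := X (s t) * sin (th t); pose Z t := z (s t).
have cA t : is_derive t 1 A (px (v t)).
  have [d _ _] := is_derive_comp3 (Dv t).
  by have -> : A = (fun t => px (c t)) by apply/funext => y; rewrite /c /rotated px_vec3.
have cB t : is_derive t 1 B (py (v t)).
  have [_ d _] := is_derive_comp3 (Dv t).
  by have -> : B = (fun t => py (c t)) by apply/funext => y; rewrite /c /rotated py_vec3.
have cZ' t : is_derive t 1 Z (pz (v t)).
  have [_ _ d] := is_derive_comp3 (Dv t).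
  by have -> : Z = (fun t => pz (c t)) by apply/funext => y; rewrite /c /rotated pz_vec3.
have AB t : A t ^+ 2 + B t ^+ 2 = X (s t) ^+ 2.
  by rewrite /A /B !exprMn -mulrDr cos2Dsin2 mulr1.
have amb t : 0 < 4 + kappa * (A t ^+ 2 + B t ^+ 2) by rewrite AB; exact: rad_ambient.
pose la t := 4 / (4 + kappa * (A t ^+ 2 + B t ^+ 2)).
have la1 t : 1 <= la t.
  rewrite /la ler_pdivlMr// mul1r gerDl; apply: mulr_le0_ge0 => //.
  by rewrite addr_ge0 ?sqr_ge0.
pose g t := gspeed (px (v t)) (py (v t)) (pz (v t)) (A t) (B t) (la t).
have gE t : Num.sqrt (metric kappa tau (c t) (v t) (v t)) = g t.
  rewrite /g /gspeed /la; congr Num.sqrt; rewrite /metric /vform /conf.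
  by rewrite /c /rotated !vec3E -/(A t) -/(B t); ring.
have cv t (i : 'I_3) : {for t, continuous (fun t => v t ord0 i)}.
  exact: (cont_comp (g := fun w : 'rV[R]_3 => w ord0 i) (cDc t) (@coord_continuous R 1 3 ord0 i _)).
have cg t : {for t, continuous g}.
  have c1 := der_cont (cA t); have c2 := der_cont (cB t).
  have c3 : {for t, continuous (fun t => px (v t))} := cv t (inord 0).
  have c4 : {for t, continuous (fun t => py (v t))} := cv t (inord 1).
  have c5 : {for t, continuous (fun t => pz (v t))} := cv t (inord 2).
  have n0 : 4 + kappa * (A t ^+ 2 + B t ^+ 2) != 0 by exact: lt0r_neq0.
  have c6 : {for t, continuous la} by rewrite /la; clear - c1 c2 n0; cont.
  exact: (cont_gspeed c3 c4 c5 c1 c2 c6).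
have [F [DF FE]] := integral_primitive cg.
have len' : F 1 - F 0 < e.
  rewrite -FE; apply: le_lt_trans len.
  rewrite le_eqVlt; apply/orP; left; apply/eqP; congr Rintegral.
  by apply/funext => t; rewrite -gE.
have Fmono x y : x <= y -> F x <= F y.
  by move=> xy; apply: (derive_nondecr xy (fun t _ => DF t)) => t _; exact: sqrtr_ge0.
have bound (f df : R -> R) t : 0 <= t <= 1 -> (forall t, is_derive t 1 f (df t)) ->
    (forall t, `|df t| <= C * g t) -> `|f t - f 0| < C * e.
  move=> /andP[t0 t1] Df bd.
  have DC x : is_derive x 1 (fun x => C * F x) (C * g x) by have d := DF x; der; ring.
  have := derive_bound t0 (fun x _ => Df x) (fun x _ => DC x) (fun x _ => bd x).
  move/le_lt_trans; apply; rewrite -mulrBr ltr_pM2l//; apply: le_lt_trans len'.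
  by rewrite lerD2r; exact: Fmono.
have sb t := @speed_bounds (px (v t)) (py (v t)) (pz (v t)) (A t) (B t) (la t) M (la1 t) (ltW M0)
  (ltac:(by rewrite AB lerXn2r// nnegrE ltW)).
have gC t : g t <= C * g t by rewrite ler_peMl// sqrtr_ge0.
move=> t tI; split.
- by apply: (bound A _ t tI cA) => x; have [h1 _ _] := sb x; exact: le_trans h1 (gC x).
- by apply: (bound B _ t tI cB) => x; have [_ h1 _] := sb x; exact: le_trans h1 (gC x).
- by apply: (bound Z _ t tI cZ') => x; have [_ _] := sb x.
Qed.

(* Two points whose parameters differ by a small d cannot coincide: by Rolle x' and z' would vanish at nearby parameters, where the angles differ by a quarter turn. *)
Lemma short_chord : exists2 K, 0 < K & forall d, 0 < d -> K * d < 1 ->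
  exists2 m, 0 < m & forall s, m <= (X (s + d) - X s) ^+ 2 + (z (s + d) - z s) ^+ 2.
Proof.
pose f t := cos (phi t) * FQ (p t) (phi t).
have cf_ t : {for t, continuous f}.
  have a := sol_cont_FQ kappa_le0 tau_gt0 cf sl (t := t); have b := sol_contcos sl (I : setT t).
  by rewrite /f; cont.
have pf : periodic f L by move=> t; rewrite /f /flowPhi pp pc ps.
have pf1 : periodic (fun t => - `|f t|) L by move=> t; rewrite /= pf.
have cf1 t : {for t, continuous (fun t => - `|f t|)}.
  by apply: contN; apply: (contC (h := fun x => `|x|)); [exact: norm_continuous|exact: cf_].
have [c Hc] := periodic_ge L_gt0 pf1 cf1.
pose K := `|f c| + 1; have K0 : 0 < K by rewrite ltr_wpDl.
have fK t : `|f t| <= K by have := Hc t; rewrite lerN2 /K; lra.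
exists K => // d d0 Kd.
pose E s := (X (s + d) - X s) ^+ 2 + (z (s + d) - z s) ^+ 2.
have pE : periodic E L.
  by move=> s; rewrite /E [s + L + d]addrAC !pX !z_shift; congr (_ + _ ^+ 2); ring.
have cE s : {for s, continuous E}.
  have a := @cX s; have b := @cZ s.
  have sh : {for s, continuous (fun s => s + d)} by cont.
  have a' := contC (h := X) (f := fun s => s + d) (@cX (s + d)) sh.
  have b' := contC (h := z) (f := fun s => s + d) (@cZ (s + d)) sh.
  by rewrite /E; cont.
have [s0 Hs0] := periodic_ge L_gt0 pE cE.
exists (E s0) => //; rewrite lt0r addr_ge0 ?sqr_ge0// andbT; apply/negP.
rewrite paddr_eq0 ?sqr_ge0// !sqrf_eq0 !subr_eq0 => /andP[/eqP eX /eqP eZ].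
have sd : s0 < s0 + d by rewrite ltrDl.
have [c1 /andP[c11 c12]] := mean_value_open sd (fun t _ => @cX t) (fun t _ => sol_der_x kappa_le0 sl t).
rewrite eX subrr => e1.
have {e1} /eqP : X c1 * (p c1 * (sin (phi c1) * d)) = 0 by rewrite [RHS]e1 /X; ring.
rewrite mulf_eq0 (gt_eqF (X0 c1)) mulf_eq0 (gt_eqF (p0 c1)) mulf_eq0 (gt_eqF d0) !orFb orbF => /eqP sin0.
have [c2 /andP[c21 c22]] := mean_value_open sd (fun t _ => @cZ t) (fun t _ => Dz t).
rewrite eZ subrr => e2.
have {e2} /eqP : (io (p c2))^-1 * (d * cos (phi c2)) = 0 by rewrite [RHS]e2; ring.
rewrite mulf_eq0 invr_eq0 (gt_eqF (angmax_gt0 kappa tau_gt0 (p0 c2))) mulf_eq0 (gt_eqF d0) !orFb => /eqP cos0.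
have Dsin t : is_derive t 1 (fun t => sin (phi t)) (f t).
  by have [_ _ pd] := sl (I : setT t); rewrite /f; der; ring.
have Dlin t : is_derive t 1 (fun t : R => K * t) K by der; ring.
have s1 : `|sin (phi c2)| = 1.
  have := cos2Dsin2 (phi c2); rewrite cos0 expr0n/= add0r => e.
  by apply/eqP; rewrite -(@pexpr_eq1 _ _ 2)// real_normK ?num_real// e.
have key x y : x <= y -> y - x < d -> `|sin (phi y) - sin (phi x)| < 1.
  move=> xy yd; have := derive_bound xy (fun t _ => Dsin t) (fun t _ => Dlin t) (fun t _ => fK t).
  move/le_lt_trans; apply; rewrite -mulrBr; apply: (le_lt_trans _ Kd).
  by rewrite ler_pM2l// ltW.
have [h'|h'] := leP c1 c2.
  by have := key c1 c2 h' (ltac:(lra)); rewrite sin0 subr0 s1 ltxx.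
by have := key c2 c1 (ltW h') (ltac:(lra)); rewrite sin0 sub0r normrN s1 ltxx.
Qed.

(** Small displacement in space does not bound the base distance directly, because a nodoid may meet
    itself. Following the curve instead: if the base distance reached [rho d], the parameters would
    at some moment differ by exactly [d] modulo the period, and [short_chord] would then give a
    definite displacement in space. *)
Lemma close_base e1 : 0 < e1 -> exists2 e, 0 < e & forall a b,
  intrinsically_close kappa tau Q a b e ->
  [/\ dist2 (base_point Q b.1) (base_point Q a.1) < e1,
    `|X b.1 * cos b.2 - X a.1 * cos a.2| < e1 & `|X b.1 * sin b.2 - X a.1 * sin a.2| < e1].
Proof.
move=> e10; have [C C0 disp] := close_displacement; have [K K0 chord] := short_chord.
have [rho [dom [D [[D0 HD] [r0 cr] mono arc]]]] := base_arc Q.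
have [d1 d10 Hd1] := cont_near_lt cr (ltac:(by rewrite r0)) (c := e1).
pose d := Num.min (d1 / 2) (Num.min D (K^-1 / 2)).
have d0 : 0 < d by rewrite !lt_min D0 !divr_gt0 ?invr_gt0.
have dd1 : d < d1 by rewrite gt_min; apply/orP; left; lra.
have dD : d <= D by rewrite !ge_min lexx orbT.
have Kd : K * d < 1.
  rewrite mulrC -ltr_pdivlMr// mul1r !gt_min; apply/orP; right; apply/orP; right.
  by have : 0 < K^-1; [rewrite invr_gt0|lra].
have dom_d : dom d by apply: HD; rewrite dD ltW.
have dom0 : dom 0 by apply: HD; rewrite lexx ltW.
have rd0 : 0 < rho d by rewrite -r0; exact: mono.
have rde : rho d < e1 by apply: Hd1; rewrite subr0 gtr0_norm.
have [m m0 Hm] := chord d d0 Kd.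
(* Three squares, each below [y], must add up to less than [m]; [y <= 1] makes the square of a
   number below [y] again smaller than [y]. *)
pose y := Num.min e1 (Num.min 1 (m / 6)).
have y0 : 0 < y by rewrite !lt_min e10 ltr01 divr_gt0.
have ye : y <= e1 by rewrite ge_min lexx.
have y1 : y <= 1 by rewrite !ge_min lexx orbT.
have ym : y <= m / 6 by rewrite !ge_min lexx !orbT.
exists (y / C); first by rewrite divr_gt0.
move=> a b /disp[s [th [cb sa sb H]]].
have Cy : C * (y / C) = y by rewrite mulrCA mulfV ?mulr1// lt0r_neq0.
rewrite {}Cy in H.
have [ba xa ya] : [/\ base_point Q (s 0) = base_point Q a.1, X (s 0) * cos (th 0) = X a.1 * cos a.2 &
    X (s 0) * sin (th 0) = X a.1 * sin a.2] by case: sa.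
have [bb xb yb] : [/\ base_point Q (s 1) = base_point Q b.1, X (s 1) * cos (th 1) = X b.1 * cos b.2 &
    X (s 1) * sin (th 1) = X b.1 * sin b.2] by case: sb.
have I1 : 0 <= (1 : R) <= 1 by rewrite ler01 lexx.
have [h1 h2 _] := H 1 I1; rewrite -xa -xb -ya -yb -ba -bb.
split; [|exact: lt_le_trans ye|exact: lt_le_trans ye].
pose q t := dist2 (base_point Q (s t)) (base_point Q (s 0)).
have cq t : {for t, continuous q}.
  have c1 : {for t, continuous (fun t => (base_point Q (s t)).1)}.
    exact: cont_first (cb t).
  have c2 : {for t, continuous (fun t => (base_point Q (s t)).2)}.
    exact: cont_second (cb t).
  by rewrite /q /dist2; cont.
rewrite -/(q 1); apply: (lt_trans _ rde); rewrite ltNge; apply/negP => qr.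
have q0 : q 0 = 0 by rewrite /q /dist2 !subrr expr0n addr0.
have [t tI qt] := ivt ler01 (fun t _ => cq t) (ltac:(by rewrite q0 qr (ltW rd0)) : q 0 <= rho d <= q 1).
have [s' [_ [eX eZ] ds qE]] := arc (s 0) (s t).
rewrite -/(q t) qt in qE.
have sd : `|s' - s 0| = d.
  have [h'|h'|//] := ltgtP `|s' - s 0| d.
    by have := mono _ _ (normr_ge0 _) ds dom_d h'; rewrite qE ltxx.
  by have := mono _ _ (ltW d0) dom_d ds h'; rewrite qE ltxx.
have [g1 g2 g3] := H t tI.
have XX : (X (s t) - X (s 0)) ^+ 2 <= (X (s t) * cos (th t) - X (s 0) * cos (th 0)) ^+ 2
    + (X (s t) * sin (th t) - X (s 0) * sin (th 0)) ^+ 2.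
  have ca := cos2Dsin2 (th t); have cb' := cos2Dsin2 (th 0).
  have cc : cos (th t - th 0) <= 1 by exact: cos_le1.
  rewrite cosB in cc; rewrite -subr_ge0.
  have -> : (X (s t) * cos (th t) - X (s 0) * cos (th 0)) ^+ 2
    + (X (s t) * sin (th t) - X (s 0) * sin (th 0)) ^+ 2 - (X (s t) - X (s 0)) ^+ 2
    = X (s t) ^+ 2 * ((cos (th t) ^+ 2 + sin (th t) ^+ 2) - 1) + X (s 0) ^+ 2 * ((cos (th 0) ^+ 2 + sin (th 0) ^+ 2) - 1)
     + 2 * (X (s t) * X (s 0)) * (1 - (cos (th t) * cos (th 0) + sin (th t) * sin (th 0))) by ring.
  rewrite ca cb' subrr !mulr0 !add0r mulr_ge0 ?subr_ge0// mulr_ge0// mulr_ge0 ?ltW//.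
have sq (u : R) : `|u| < y -> u ^+ 2 < y.
  move=> uy; apply: (@lt_le_trans _ _ (y ^+ 2)); last by rewrite expr2 ler_piMl// ltW.
  by rewrite -real_normK ?num_real// ltrXn2r// nnegrE ltW.
have := sq _ g1; have := sq _ g2; have := sq _ g3.
have eX' : X s' = X (s t) by exact: eX.
have eZ' : z s' = z (s t) by exact: eZ.
have Em : m <= (X (s t) - X (s 0)) ^+ 2 + (z (s t) - z (s 0)) ^+ 2.
  rewrite -eX' -eZ'; have [h'|h'] := leP 0 (s' - s 0).
    have -> : s' = s 0 + d by rewrite -sd ger0_norm//; ring.
    exact: Hm.
  have -> : s 0 = s' + d by rewrite -sd ltr0_norm//; ring.
  by rewrite -[X s' - _]opprB -[z s' - _]opprB !sqrrN; exact: Hm.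
by move=> *; lra.
Qed.

(** By [close_base] an intrinsic Cauchy sequence has Cauchy components in the model of the surface
    in four-space. The limit lies on the surface: its first pair is a base point, and since the
    radius stays positive its second pair determines an angle. *)
Lemma sol_complete : complete_surface kappa tau Q.
Proof.
move=> a _ cau.
have cau' e1 : 0 < e1 -> exists N, forall m n, (N <= m)%N -> (N <= n)%N ->
    [/\ dist2 (base_point Q (a n).1) (base_point Q (a m).1) < e1,
    `|X (a n).1 * cos (a n).2 - X (a m).1 * cos (a m).2| < e1 &
    `|X (a n).1 * sin (a n).2 - X (a m).1 * sin (a m).2| < e1].
  move=> e10; have [e e0 He] := close_base e10; have [N HN] := cau e e0.
  by exists N => m n Nm Nn; apply: He; exact: HN.
have sqlt (u e : R) : 0 < e -> u ^+ 2 < e ^+ 2 -> `|u| < e.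
  by move=> e0 ue; apply: lt_sq; rewrite ?ltW// real_normK ?num_real.
have [|l1 H1] := @real_cauchy R (fun n => (base_point Q (a n).1).1).
  move=> e e0; have [N HN] := cau' _ (exprn_gt0 2 e0).
  exists N => m n Nm Nn; have [h1 _ _] := HN n m Nn Nm; apply: sqlt => //.
  by apply: le_lt_trans h1; rewrite /dist2 lerDl sqr_ge0.
have [|l2 H2] := @real_cauchy R (fun n => (base_point Q (a n).1).2).
  move=> e e0; have [N HN] := cau' _ (exprn_gt0 2 e0).
  exists N => m n Nm Nn; have [h1 _ _] := HN n m Nn Nm; apply: sqlt => //.
  by apply: le_lt_trans h1; rewrite /dist2 lerDr sqr_ge0.
have [|l3 H3] := @real_cauchy R (fun n => X (a n).1 * cos (a n).2).
  move=> e e0; have [N HN] := cau' _ e0.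
  by exists N => m n Nm Nn; have [_ h1 _] := HN n m Nn Nm.
have [|l4 H4] := @real_cauchy R (fun n => X (a n).1 * sin (a n).2).
  move=> e e0; have [N HN] := cau' _ e0.
  by exists N => m n Nm Nn; have [_ _ h1] := HN n m Nn Nm.
have [s bs] : exists s, base_point Q s = (l1, l2).
  have [[T [[_ T0 _ _] bE]]|[_ bE]] := base_pointP Q; last first.
    exists l1; rewrite bE; congr (_, _).
    apply: (cvg_unique (@norm_hausdorff _ R) _ H2).
    have -> : (fun n => (base_point Q (a n).1).2) = (fun=> 0) by apply/funext => n; rewrite bE.
    exact: cvg_cst.
  have e : l1 ^+ 2 + l2 ^+ 2 = 1.
    have w1 : (fun n : nat => 1 : R) @ \oo --> (1 : R) by exact: cvg_cst.
    by apply: (cvg_sqsum H1 H2 w1) => n; rewrite bE cos2Dsin2.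
  have [al [cal sal]] := unit_angle e; exists (al * T / (2 * pi)).
  have pn : pi != 0 :> R by exact: lt0r_neq0 (pi_gt0 R).
  have ae (c : R) : c != 0 -> 2 * c * (al * T / (2 * c)) / T = al.
    by move=> c0; field; rewrite c0 lt0r_neq0.
  by rewrite bE ae// cal sal.
have Xs : (fun n => X (a n).1) @ \oo --> X s.
  apply: seq_cvgP => e e0; have e2 : 0 < e / 2 by rewrite divr_gt0.
  have [d d0 Hd] := cont_eps (@cX s) e2.
  have [e3 e30 He3] := base_near Q s d0.
  pose y := Num.min 1 (e3 / 3).
  have y0 : 0 < y by rewrite lt_min ltr01 divr_gt0.
  have y1 : y <= 1 by rewrite ge_min lexx.
  have ye : y <= e3 / 3 by rewrite ge_min lexx orbT.
  have [N1 HN1] := cvg_seqP H1 y0; have [N2 HN2] := cvg_seqP H2 y0.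
  exists (maxn N1 N2) => n; rewrite geq_max => /andP[n1 n2].
  have sq (u : R) : `|u| < y -> u ^+ 2 < y.
    move=> uy; apply: (@lt_le_trans _ _ (y ^+ 2)); last by rewrite expr2 ler_piMl// ltW.
    by rewrite -real_normK ?num_real// ltrXn2r// nnegrE ltW.
  have [|s' [_ eX _ ds]] := He3 (a n).1.
    by rewrite /dist2 bs /=; have := sq _ (HN1 n n1); have := sq _ (HN2 n n2); lra.
  have <- : X s' = X (a n).1 by exact: eX.
  by apply: (le_lt_trans (Hd s' ds)); lra.
have l34 : l3 ^+ 2 + l4 ^+ 2 = X s ^+ 2.
  apply: (cvg_sqsum H3 H4 (w := fun n => X (a n).1 * X (a n).1)); first exact: (cvgM Xs Xs).
  move=> n; transitivity (X (a n).1 * X (a n).1 * (cos (a n).2 ^+ 2 + sin (a n).2 ^+ 2)); first by ring.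
  by rewrite cos2Dsin2 mulr1.
have Xn := lt0r_neq0 (X0 s).
have nrm : (l3 / X s) ^+ 2 + (l4 / X s) ^+ 2 = 1.
  transitivity ((l3 ^+ 2 + l4 ^+ 2) / X s ^+ 2); first by field.
  by rewrite l34 mulfV// expf_neq0.
have [th [cth sth]] := unit_angle nrm.
exists (s, th); split => //.
have -> : surf_point Q (s, th).1 (s, th).2 = ((l1, l2), (l3, l4)).
  rewrite /surf_point /= bs cth sth -/(X s); congr (_, (_, _)); field; exact: Xn.
have -> : (fun n => surf_point Q (a n).1 (a n).2) = (fun n => (((base_point Q (a n).1).1,
    (base_point Q (a n).1).2), (X (a n).1 * cos (a n).2, X (a n).1 * sin (a n).2))).
  by apply/funext => n; rewrite -surjective_pairing.
exact: (cvg_pair (cvg_pair H1 H2) (cvg_pair H3 H4)).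
Qed.

End PeriodicSurface.

(** * Quotients that stay continuous at the axis *)

Section ClampedQuotient.
Context {R : realType}.
Implicit Types (m u c x y a b d e : R).

(** Quotients by the radius have no continuous value on the axis. Clamped to a bound that vanishes
    there, they become continuous, and the clamping changes nothing on the values that occur. *)
Definition clamp m u : R := Num.max (- m) (Num.min m u).

Lemma clamp_bound m u : 0 <= m -> `|clamp m u| <= m.
Proof.
move=> m0; rewrite ler_norml /clamp le_max lexx /= ge_max ge_min lexx /= andbT.
by rewrite (le_trans _ m0)// oppr_le0.
Qed.

Lemma clamp_id m u : `|u| <= m -> clamp m u = u.
Proof.
rewrite ler_norml => /andP[h1 h2]; rewrite /clamp (min_idPr h2).
by apply/max_idPr.
Qed.

Lemma clamp_quot x m c : 0 <= m -> (0 < x \/ m = 0) -> `|c| <= 1 -> clamp m (x * c * m / x) = m * c.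
Proof.
move=> m0 xm c1; case: xm => [x0|->]; last first.
  by have := clamp_bound (x * c * 0 / x) (lexx 0); rewrite normr_le0 mul0r => /eqP.
have -> : x * c * m / x = m * c by field; exact: lt0r_neq0.
by apply: clamp_id; rewrite normrM (ger0_norm m0) ler_piMr.
Qed.

Lemma cont_clamp {T : topologicalType} (m u : T -> R) (q : T) : (forall w : T, 0 <= m w) ->
  {for q, continuous m} -> (m q = 0 \/ {for q, continuous u}) ->
  {for q, continuous (fun w : T => clamp (m w) (u w))}.
Proof.
move=> m0 cm [mq|cu]; last first.
  have h1 : {for q, continuous (fun w : T => Num.min (m w) (u w))} by exact: (continuous_min cm cu).
  exact: (continuous_max (contN cm) h1).
apply/cvgrPdist_le => e e0; have /cvgrPdist_le /(_ e e0) := cm.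
apply: filterS => y; rewrite mq sub0r normrN => h.
have -> : clamp 0 (u q) = 0 by have := clamp_bound (u q) (lexx 0); rewrite normr_le0 => /eqP.
rewrite sub0r normrN; apply: (le_trans (clamp_bound _ (m0 y))).
exact: le_trans (ler_norm _) h.
Qed.

(** Values of a profile outside its domain are arbitrary; after clamping the parameter, one-sided
    continuity at the two ends suffices. *)
Lemma cont_clampI_end (f : R -> R) a b : a < b ->
  (forall s, a < s < b -> {for s, continuous f}) ->
  (forall e, 0 < e -> exists2 d, 0 < d & forall r, 0 < r < d -> `|f (a + r) - f a| < e) ->
  (forall e, 0 < e -> exists2 d, 0 < d & forall r, 0 < r < d -> `|f (b - r) - f b| < e) ->
  forall s, {for s, continuous (fun s => f (Num.max a (Num.min b s)))}.
Proof.
move=> ab ci ca cb s; have cc := @cont_clampI R a b s.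
have I t := clampI t (ltW ab).
pose c t := Num.max a (Num.min b t).
have [ac|ca'] := ltP a (c s); last first.
  have cs : c s = a by apply/le_anti; rewrite ca' andTb; case/andP: (I s).
  apply/cvgrPdist_le => e e0; have [d d0 Hd] := ca e e0.
  have /cvgrPdist_lt /(_ d d0) := cc; apply: filterS => t; rewrite -/(c t) -/(c s) cs => h.
  have /andP[a1 _] := I t; rewrite -/(c t) in a1.
  move: a1; rewrite le_eqVlt => /orP[/eqP <-|a1]; first by rewrite subrr normr0 ltW.
  rewrite distrC; have := Hd (c t - a); rewrite [a + _]addrC subrK => /(_ _)/ltW; apply.
  by rewrite subr_gt0 a1 /=; apply: le_lt_trans h; rewrite distrC ler_norm.
have [cb'|bc] := ltP (c s) b; last first.
  have cs : c s = b by apply/le_anti; rewrite bc andbT; case/andP: (I s).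
  apply/cvgrPdist_le => e e0; have [d d0 Hd] := cb e e0.
  have /cvgrPdist_lt /(_ d d0) := cc; apply: filterS => t; rewrite -/(c t) -/(c s) cs => h.
  have /andP[_ a1] := I t; rewrite -/(c t) in a1.
  move: a1; rewrite le_eqVlt => /orP[/eqP ->|a1]; first by rewrite subrr normr0 ltW.
  rewrite distrC; have := Hd (b - c t).
  have -> : b - (b - c t) = c t by ring.
  move=> /(_ _)/ltW; apply.
  by rewrite subr_gt0 a1 /=; apply: le_lt_trans h; exact: ler_norm.
by apply: (contC (h := f) (f := c)); [apply: ci; rewrite ac|exact: cc].
Qed.

Lemma incr_closed (f : R -> R) a b : (forall s, {for s, continuous f}) ->
  (forall x y, a < x -> x < y -> y < b -> f x < f y) ->
  forall x y, a <= x -> x < y -> y <= b -> f x < f y.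
Proof.
move=> cf incr x y ax xy yb.
pose m1 := x + (y - x) / 3; pose m2 := x + 2 * (y - x) / 3.
have [x1 [x2 x3]] : x < m1 /\ m1 < m2 /\ m2 < y by rewrite /m1 /m2; split; [|split]; lra.
have h1 : f x <= f m1.
  rewrite leNgt; apply/negP => h; have [d d0 H] := cont_near_gt (cf x) h.
  pose e := Num.min (d / 2) ((m1 - x) / 2).
  have e0 : 0 < e by rewrite lt_min !divr_gt0// subr_gt0.
  have ed : e < d by rewrite gt_min; apply/orP; left; lra.
  have em : e < m1 - x by rewrite gt_min; apply/orP; right; lra.
  have := H (x + e); rewrite [x + e]addrC addrK gtr0_norm// => /(_ ed).
  by have := incr (e + x) m1 (ltac:(lra)) (ltac:(lra)) (ltac:(lra)); lra.
have h2 : f m2 <= f y.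
  rewrite leNgt; apply/negP => h; have [d d0 H] := cont_near_lt (cf y) h.
  pose e := Num.min (d / 2) ((y - m2) / 2).
  have e0 : 0 < e by rewrite lt_min !divr_gt0// subr_gt0.
  have ed : e < d by rewrite gt_min; apply/orP; left; lra.
  have em : e < y - m2 by rewrite gt_min; apply/orP; right; lra.
  have := H (y - e); rewrite addrAC subrr sub0r normrN gtr0_norm// => /(_ ed).
  by have := incr m2 (y - e) (ltac:(lra)) (ltac:(lra)) (ltac:(lra)); lra.
by have := incr m1 m2 (ltac:(lra)) x2 (ltac:(lra)); lra.
Qed.

End ClampedQuotient.

(** * The surface of a profile with two ends on the axis is a sphere *)

Section SphereTopology.
Context {R : realType}.
Variables (P : profile R) (a b : R) (X : R -> R).
Hypothesis ab : a < b.
Hypothesis DE : forall s, cdom P s <-> a <= s <= b.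
Hypothesis cX : forall s, {for s, continuous X}.
Hypothesis XE : forall s, a <= s <= b -> X s = cx P s.
Hypothesis X_ge0 : forall s, 0 <= X s.
Hypothesis X_gt0 : forall s, a < s < b -> 0 < X s.
Hypothesis Xa : X a = 0.
Hypothesis Xb : X b = 0.

Lemma segment_base_point s : base_point P s = (s, 0).
Proof.
have [[T [[DT _ _ _] _]]|[_ ->//]] := base_pointP P.
have : cdom P (b + 1) by rewrite DT.
by move=> /DE/andP[_]; rewrite gerDl ler10.
Qed.

Let zeta s : R := (2 * s - a - b) / (b - a).
Let param (y : R) : R := (y * (b - a) + a + b) / 2.
Let m (y : R) : R := Num.sqrt (1 - y ^+ 2).
(** Height [zeta] on the unit sphere, where the parallel has radius [m]: the horizontal pair is
    rescaled from radius [X] to radius [m]. At the poles both radii vanish and the clamp yields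
    zero. [ofS] exchanges the roles of [X] and [m]. *)
Let toS (q : (R * R) * (R * R)) : 'rV[R]_3 :=
  vec3 (clamp (m (zeta q.1.1)) (q.2.1 * m (zeta q.1.1) / X q.1.1))
       (clamp (m (zeta q.1.1)) (q.2.2 * m (zeta q.1.1) / X q.1.1)) (zeta q.1.1).
Let ofS (v : 'rV[R]_3) : (R * R) * (R * R) :=
  ((param (pz v), 0), (clamp (X (param (pz v))) (px v * X (param (pz v)) / m (pz v)),
     clamp (X (param (pz v))) (py v * X (param (pz v)) / m (pz v)))).

Let ba0 : b - a != 0. Proof. by rewrite subr_eq0 gt_eqF. Qed.
Let zetaK s : param (zeta s) = s. Proof. by rewrite /param /zeta; field. Qed.
Let paramK y : zeta (param y) = y. Proof. by rewrite /param /zeta; field. Qed.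
Let zeta_itv s : a <= s <= b -> -1 <= zeta s <= 1.
Proof.
move=> sI; have b0 : 0 < b - a by rewrite subr_gt0.
by rewrite /zeta ler_pdivrMr// ler_pdivlMr//; lra.
Qed.
Let zeta_oo s : a < s < b -> -1 < zeta s < 1.
Proof.
move=> sI; have b0 : 0 < b - a by rewrite subr_gt0.
by rewrite /zeta ltr_pdivrMr// ltr_pdivlMr//; lra.
Qed.
Let m_sq y : -1 <= y <= 1 -> m y ^+ 2 = 1 - y ^+ 2.
Proof.
move=> yI; rewrite sqr_sqrtr// subr_ge0 -real_normK ?num_real// expr_le1//.
by rewrite ler_norml.
Qed.
Let m_ge0 y : 0 <= m y. Proof. exact: sqrtr_ge0. Qed.
Let zeta_ends s : a <= s <= b -> (a < s < b) \/ (m (zeta s) = 0 /\ X s = 0).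
Proof.
case/andP; rewrite le_eqVlt => /orP[/eqP <- _|sa].
  right; split => //; have -> : zeta a = -1 by rewrite /zeta; field.
  by rewrite /m sqrrN expr1n subrr sqrtr0.
rewrite le_eqVlt => /orP[/eqP ->|sb]; last by left; rewrite sa.
right; split => //; have -> : zeta b = 1 by rewrite /zeta; field.
by rewrite /m expr1n subrr sqrtr0.
Qed.
Let mz_gt0 s : a < s < b -> 0 < m (zeta s).
Proof.
move=> /zeta_oo z; rewrite sqrtr_gt0 subr_gt0 -real_normK ?num_real// expr_lt1//.
by rewrite ltr_norml.
Qed.
Let Xz s : a <= s <= b -> 0 < X s \/ m (zeta s) = 0.
Proof. by move=> /zeta_ends[/X_gt0|[]]; [left|right]. Qed.
Let zX s : a <= s <= b -> 0 < m (zeta s) \/ X s = 0.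
Proof. by move=> /zeta_ends[/mz_gt0|[]]; [left|right]. Qed.

Let toSE s th : a <= s <= b -> toS (surf_point P s th) =
  vec3 (m (zeta s) * cos th) (m (zeta s) * sin th) (zeta s).
Proof.
move=> sI; rewrite /toS /surf_point segment_base_point /= -XE//.
by rewrite !clamp_quot ?norm_sin_le1 ?norm_cos_le1//; exact: Xz.
Qed.
Let ofSE s th : a <= s <= b -> ofS (vec3 (m (zeta s) * cos th) (m (zeta s) * sin th) (zeta s))
  = surf_point P s th.
Proof.
move=> sI; rewrite /ofS !vec3E zetaK /surf_point segment_base_point -XE//.
by rewrite !clamp_quot ?norm_sin_le1 ?norm_cos_le1//; exact: zX.
Qed.
Let sphereE v : sphere2 v -> exists s th, a <= s <= b /\
  v = vec3 (m (zeta s) * cos th) (m (zeta s) * sin th) (zeta s).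
Proof.
rewrite /sphere2 /= => e; have yI : -1 <= pz v <= 1.
  rewrite -ler_norml -(expr_le1 (n := 2))// real_normK ?num_real//.
  by have := sqr_ge0 (px v); have := sqr_ge0 (py v); lra.
have msq := m_sq yI.
have [th [e1 e2]] : exists th, px v = m (pz v) * cos th /\ py v = m (pz v) * sin th.
  have [m0|m0] := eqVneq (m (pz v)) 0.
    exists 0; rewrite m0 !mul0r; move: msq; rewrite m0 expr0n/= => msq.
    have := sqr_ge0 (px v); have := sqr_ge0 (py v) => h1 h2.
    by split; apply/eqP; rewrite -sqrf_eq0; apply/eqP; lra.
  have nrm : (px v / m (pz v)) ^+ 2 + (py v / m (pz v)) ^+ 2 = 1.
    transitivity ((px v ^+ 2 + py v ^+ 2) / m (pz v) ^+ 2); first by field.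
    have -> : px v ^+ 2 + py v ^+ 2 = m (pz v) ^+ 2 by rewrite msq; lra.
    by rewrite mulfV// expf_neq0.
  have [th [c1 c2]] := unit_angle nrm; exists th.
  by rewrite c1 c2; split; field.
exists (param (pz v)), th; rewrite !paramK -e1 -e2 vec3_eta; split => //.
rewrite /param; have b0 : 0 < b - a by rewrite subr_gt0.
have h1 := mulr_ge0 (ltac:(lra) : 0 <= pz v + 1) (ltW b0).
have h2 := mulr_ge0 (ltac:(lra) : 0 <= 1 - pz v) (ltW b0).
rewrite ler_pdivlMr// ler_pdivrMr//; lra.
Qed.

Lemma carrier_sphere : homeomorphic (carrier P) (@sphere2 R).
Proof.
have czeta s : {for s, continuous zeta} by rewrite /zeta; cont.
have cm y : {for y, continuous m} by rewrite /m; cont.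
have cpar y : {for y, continuous param} by rewrite /param; cont.
exists toS, ofS; split.
- apply: continuous_in_subspaceT => q; rewrite inE => -[s [th [/DE sI ->]]].
  set q0 := surf_point P s th.
  have q1 : q0.1.1 = s by rewrite /q0 /surf_point segment_base_point.
  have c1 : {for q0, continuous (fun q : (R * R) * (R * R) => q.1.1)}.
    by apply: (cvg_comp _ _ (@cont_fst _ _ q0)); exact: cont_fst.
  have c2 : {for q0, continuous (fun q : (R * R) * (R * R) => q.2.1)}.
    by apply: (cvg_comp _ _ (@cont_snd _ _ q0)); exact: cont_fst.
  have c3 : {for q0, continuous (fun q : (R * R) * (R * R) => q.2.2)}.
    by apply: (cvg_comp _ _ (@cont_snd _ _ q0)); exact: cont_snd.
  have c4 : {for q0, continuous (fun q : (R * R) * (R * R) => zeta q.1.1)} by exact: contC (czeta _) c1.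
  have c5 : {for q0, continuous (fun q : (R * R) * (R * R) => m (zeta q.1.1))} by exact: contC (cm _) c4.
  have c6 : {for q0, continuous (fun q : (R * R) * (R * R) => X q.1.1)} by exact: contC (@cX _) c1.
  have key (f : (R * R) * (R * R) -> R) : {for q0, continuous f} ->
      m (zeta q0.1.1) = 0 \/ {for q0, continuous (fun q => f q * m (zeta q.1.1) / X q.1.1)}.
    move=> cf; rewrite q1; case: (Xz sI) => [x0|]; last by left.
    right; have n0 : X q0.1.1 != 0 by rewrite q1; exact: lt0r_neq0.
    exact: contM (contM cf c5) (contV n0 c6).
  have k1 := cont_clamp (fun q : (R * R) * (R * R) => m_ge0 (zeta q.1.1)) c5 (key _ c2).
  have k2 := cont_clamp (fun q : (R * R) * (R * R) => m_ge0 (zeta q.1.1)) c5 (key _ c3).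
  exact: (continuous_vec3 k1 k2 c4).
- apply: continuous_in_subspaceT => v; rewrite inE => /sphereE[s [th [sI ve]]].
  have c1 : {for v, continuous (@px R)} := @coord_continuous R 1 3 ord0 (inord 0) v.
  have c2 : {for v, continuous (@py R)} := @coord_continuous R 1 3 ord0 (inord 1) v.
  have c3 : {for v, continuous (@pz R)} := @coord_continuous R 1 3 ord0 (inord 2) v.
  have c4 : {for v, continuous (fun v => param (pz v))} by exact: contC (cpar _) c3.
  have c5 : {for v, continuous (fun v => X (param (pz v)))} by exact: contC (@cX _) c4.
  have c6 : {for v, continuous (fun v => m (pz v))} by exact: contC (cm _) c3.
  have zv : pz v = zeta s by rewrite ve vec3E.
  have key (f : 'rV[R]_3 -> R) : {for v, continuous f} ->
      X (param (pz v)) = 0 \/ {for v, continuous (fun v => f v * X (param (pz v)) / m (pz v))}.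
    move=> cf; rewrite zv zetaK; case: (zX sI) => [x0|]; last by left.
    right; have n0 : m (pz v) != 0 by rewrite zv; exact: lt0r_neq0.
    exact: contM (contM cf c5) (contV (f := fun v : 'rV[R]_3 => m (pz v)) n0 c6).
  have c7 : {for v, continuous (fun=> 0 : R)} by exact: cont_cst.
  have k1 := cont_clamp (fun y => X_ge0 (param (pz y))) c5 (key _ c1).
  have k2 := cont_clamp (fun y => X_ge0 (param (pz y))) c5 (key _ c2).
  exact: (cont_pair (cont_pair c4 c7) (cont_pair k1 k2)).
- move=> q [s [th [/DE sI ->]]]; rewrite toSE// ofSE//; split => //.
  rewrite /sphere2 /= !vec3E; move: (zeta s) (zeta_itv sI) => y yI.
  by rewrite !exprMn -mulrDr cos2Dsin2 mulr1 m_sq// subrK.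
- move=> v /sphereE[s [th [sI ->]]]; rewrite ofSE// toSE//; split => //.
  by exists s, th; split => //; apply/DE.
Qed.

End SphereTopology.

(** * The sphere: topology, embeddedness, monotone angle *)

Section SphereCase.
Context {R : realType} (kappa tau : R) (h : R -> R).
Hypothesis kappa_le0 : kappa <= 0.
Hypothesis tau_gt0 : 0 < tau.
Let k (y : R) := h (clamp1 y).
Hypothesis cf : curvature_fun kappa k.
Variables (P : profile R) (eps : R) (J : set R) (p phi T G : R -> R) (t0 r : R).
Hypothesis rs : rotational_surface kappa P.
Hypothesis comp : complete_surface kappa tau P.
Hypothesis H : oriented_h_surface kappa tau h P eps.
Hypothesis fc : flow_chart kappa tau h P eps J p phi T G.
Hypothesis cs : complete_sol kappa tau k J p phi.
Hypothesis sph : sphere_sol J p phi t0 r.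
Implicit Types (s t x y a b e d : R).

(** The orbit is bounded in time on both sides, so [pole_end] applies to it and to its reflection;
    the sign [eps] decides which pole comes first. *)
Lemma sphere_ends : exists a b, [/\ a < b, forall s, cdom P s <-> a <= s <= b,
  cx P a = 0 /\ cx P b = 0, inward P a 1 & inward P b (-1)].
Proof.
have [r0 JE _ _ _] := sph; have J0 : J t0 by apply/JE; lra.
have tc := time_of_flow kappa_le0 tau_gt0 fc.
have ub t : J t -> t <= t0 + r by move=> /JE; lra.
have [b [[Db cb] ib Hb lb _]] := pole_end kappa_le0 tau_gt0 rs comp tc J0 ub.
have J0' : reflected J 0 (- t0) by rewrite /reflected /= sub0r opprK.
have ub' t : reflected J 0 t -> t <= - (t0 - r) by rewrite /reflected /= sub0r => /JE; lra.
have [a [[Da ca] ia Ha la _]] := pole_end kappa_le0 tau_gt0 rs comp (tc_reflect tc) J0' ub'.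
rewrite opprK in ia; have h1 := lb _ J0; have h2 := la _ J0'; rewrite sub0r opprK in h2.
have [[iD _] _ _ _ _] := rs.
case: (fc_eps fc) => e; rewrite e in ib Hb h1 ia Ha h2.
  exists a, b; split => //; first by lra.
  move=> s; split=> [Ds|sI]; last by exact: (iD a b).
  by have := Hb s Ds; have := Ha s Ds; lra.
exists b, a; rewrite opprK in ib; split => //; first by lra.
move=> s; split=> [Ds|sI]; last by exact: (iD b a).
by have := Hb s Ds; have := Ha s Ds; lra.
Qed.

Local Notation nu := (flow_angle kappa tau p phi).

(** Since [cos phi > 0], the height is strictly monotone up to the poles and determines the
    parameter, which gives the embedding. The angle is strictly between [-1] and [1] inside and
    equals [eps] and [- eps] at the two poles, so strict monotonicity extends to the closed
    profile. *)
Theorem sphere_conclusion : Sig kappa (p t0) < 2 * k 0 -> cos (phi t0) = 1 ->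
  [/\ h_sphere kappa tau h P, embedded P & monotone_angle kappa tau h P].
Proof.
move=> S0 c1; have [a [b [ab DE [ca cb] ia ib]]] := sphere_ends.
have [nd ge0 _ _ _] := rs; have [iD _] := nd.
have Da : cdom P a by apply/DE; rewrite lexx ltW.
have Db : cdom P b by apply/DE; rewrite lexx ltW.
have In s : a < s < b -> (cdom P)^° s by exact: interior_between.
have In' s : (cdom P)^° s -> a < s < b.
  move=> Is; have reg := regular_interior kappa_le0 rs Is.
  have /DE/andP[h1 h2] := nbhs_singleton Is; have [_ x0 _ _] := reg.
  apply/andP; split; rewrite lt_neqAle ?h1 ?h2 andbT; apply/eqP => e; move: x0.
    by rewrite -e ca ltxx.
  by rewrite e cb ltxx.
have reg s : a < s < b -> regular_at kappa P s by move=> /In; exact: regular_interior.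
have cont_int s : a < s < b -> {for s, continuous (cx P)} /\ {for s, continuous (cz P)}.
  move=> /reg[/nbhs_singleton[d1 d2 _ _ _] _ _ _].
  by split; exact: derivable_cont.
(* Outside [[a, b]] the functions of the profile carry no information; composed with [cl] they
   become continuous on the whole line. *)
pose cl s := Num.max a (Num.min b s).
have clI s : a <= s <= b -> cl s = s := @clampI_id R a b s.
have ab0 : 0 < b - a by rewrite subr_gt0.
have cX : forall s, {for s, continuous (fun s => cx P (cl s))}.
  apply: (cont_clampI_end ab) => [s /cont_int[]//|e e0|e e0].
    have [d d0 Hd] := pole_cont rs Da ca ia e0; exists (Num.min d (b - a)); first by rewrite lt_min d0.
    move=> x /andP[x0]; rewrite lt_min => /andP[xd xb].
    have [hx _] := Hd x (ltac:(lra)); move: hx.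
    by rewrite mul1r ca subr0 ger0_norm// ge0//; apply/DE; lra.
  have [d d0 Hd] := pole_cont rs Db cb ib e0; exists (Num.min d (b - a)); first by rewrite lt_min d0.
  move=> x /andP[x0]; rewrite lt_min => /andP[xd xb].
  have [hx _] := Hd x (ltac:(lra)); move: hx.
  by rewrite mulN1r cb subr0 ger0_norm// ge0//; apply/DE; lra.
have cZ : forall s, {for s, continuous (fun s => cz P (cl s))}.
  apply: (cont_clampI_end ab) => [s /cont_int[]//|e e0|e e0].
    have [d d0 Hd] := pole_cont rs Da ca ia e0; exists d => // x /Hd[_].
    by rewrite mul1r.
  have [d d0 Hd] := pole_cont rs Db cb ib e0; exists d => // x /Hd[_].
  by rewrite mulN1r.
have Icl s : a <= cl s <= b by exact: clampI (ltW ab).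
have XE s : a <= s <= b -> cx P (cl s) = cx P s by move=> /clI ->.
have X_ge0 s : 0 <= cx P (cl s) by apply: ge0; apply/DE.
have X_gt0 s : a < s < b -> 0 < cx P (cl s).
  by move=> sI; rewrite XE; [case: (reg s sI)|lra].
have cla : cl a = a by apply: clI; rewrite lexx ltW.
have clb : cl b = b by apply: clI; rewrite lexx ltW.
have Xa : cx P (cl a) = 0 by rewrite cla.
have Xb : cx P (cl b) = 0 by rewrite clb.
have [r0 JE s0 sp cp] := sph.
have sl := fc_sol fc.
have Jm t1 t2 t : J t1 -> J t2 -> t1 <= t <= t2 -> J t by move=> /JE ? /JE ? ?; apply/JE; lra.
have wz t1 t2 : J t1 -> J t2 -> t1 < t2 -> cz P (G t1) < cz P (G t2).
  move=> J1 J2 tt; apply: (derive_incr tt (fun t tI => fc_cz fc (Jm _ _ _ J1 J2 tI))) => t /andP[h1 h2].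
  have Jt : J t by apply: (Jm t1 t2) => //; rewrite !ltW.
  by have [pt _ _] := sl t Jt; rewrite divr_gt0 ?cp// angmax_gt0.
have incZ x y : a < x -> x < y -> y < b -> eps * cz P (cl x) < eps * cz P (cl y).
  move=> ax xy yb; rewrite !clI; try lra.
  have Ix := In x (ltac:(lra)); have Iy := In y (ltac:(lra)).
  have [Jx Gx] := fc_T fc Ix; have [Jy Gy] := fc_T fc Iy.
  have := fc_mono fc Ix Iy xy; rewrite -[in cz P x]Gx -[in cz P y]Gy.
  case: (fc_eps fc) => ->; rewrite ?mul1r ?mulN1r ?ltrN2; exact: wz.
have incZ' := incr_closed (fun s => contM (@cont_cst R R eps s) (@cZ s)) incZ.
split.
- split; first by split => //; exists eps.
  exact: (carrier_sphere ab DE cX XE X_ge0 X_gt0 Xa Xb).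
- have [g [gK _ _ cg]] := inverse_segment (ltW ab)
    (fun s (_ : a <= s <= b) => contM (@cont_cst R R eps s) (@cZ s)) incZ'.
  exists (fun v => ((g (eps * pz v), 0), (px v, py v))); split.
    apply: continuous_subspaceT => v.
    have c3 : {for v, continuous (@pz R)} := @coord_continuous R 1 3 ord0 (inord 2) v.
    have ce y : {for y, continuous (fun x : R => eps * x)} by cont.
    have c4 : {for v, continuous (fun v => eps * pz v)} by exact: (contC (h := fun x => eps * x) (ce _) c3).
    have c5 : {for v, continuous (fun v => g (eps * pz v))} by exact: contC (cg _) c4.
    have c6 : {for v, continuous (@px R)} := @coord_continuous R 1 3 ord0 (inord 0) v.
    have c8 : {for v, continuous (@py R)} := @coord_continuous R 1 3 ord0 (inord 1) v.
    have c7 : {for v, continuous (fun=> 0 : R)} by exact: cont_cst.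
    exact: (cont_pair (cont_pair c5 c7) (cont_pair c6 c8)).
  move=> s th /DE sI; rewrite /rotated !vec3E /surf_point (segment_base_point DE).
  by have := gK s sI; rewrite (clI s sI) => ->.
(* The values at the poles are dictated by [pole_normal]: the chart orientation is [1] at the first
   end and [-1] at the second. *)
pose nuf s := if s == a then eps else if s == b then - eps else nu (T s).
have nuE s : a < s < b -> nuf s = nu (T s).
  by move=> /andP[h1 h2]; rewrite /nuf (gt_eqF h1) (lt_eqF h2).
have nua : nuf a = eps by rewrite /nuf eqxx.
have nub : nuf b = - eps by rewrite /nuf (gt_eqF ab) eqxx.
have ee : eps * eps = 1 by case: (fc_eps fc) => ->; ring.
exists eps, nuf; split => //.
- move=> s th Psi w sg eta ch; case: ch => [Is|sg' Ds cs0 isg].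
    by rewrite mulr1 => un; rewrite (nuE _ (In' s Is)); apply/esym; exact: (fc_angle fc Is un).
  move=> un; have [sg1 nin] := isg.
  have es : eps * sg' = 1 \/ eps * sg' = -1.
    by case: (fc_eps fc) => ->; case: sg1 => ->; rewrite ?mulr1 ?mul1r ?mulrNN ?mulr1; [left|right|right|left].
  rewrite (pole_normal rs Ds cs0 isg un es).
  have /DE/andP[] := Ds; rewrite le_eqVlt => /orP[/eqP sa _|sa].
    rewrite -sa nua; case: sg1 => sge; first by rewrite sge mulr1.
    exfalso; have [x /=] : exists x, 0 < x /\ cdom P (s + sg' * x).
      have /filter_ex[x [xx hx]] : \forall x \near 0^'+, 0 < x /\ cdom P (s + sg' * x).
        by apply: filterI nin; exact: nbhs_right_gt.
      by exists x.
    by rewrite sge -sa => -[x0 /DE]; lra.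
  rewrite le_eqVlt => /orP[/eqP sb|sb].
    rewrite sb nub; case: sg1 => sge; last by rewrite sge mulrN1.
    exfalso; have [x /=] : exists x, 0 < x /\ cdom P (s + sg' * x).
      have /filter_ex[x [xx hx]] : \forall x \near 0^'+, 0 < x /\ cdom P (s + sg' * x).
        by apply: filterI nin; exact: nbhs_right_gt.
      by exists x.
    by rewrite sge sb => -[x0 /DE]; lra.
  by have := X_gt0 s; rewrite sa sb XE ?cs0 ?ltxx => [/(_ isT)//|]; rewrite !ltW.
have lt1 s : a < s < b -> -1 < nuf s < 1.
  move=> sI; rewrite (nuE _ sI); have [Js _] := fc_T fc (In s sI); have [ps _ _] := sl _ Js.
  by rewrite -ltr_norml -(expr_lt1 (n := 2))// real_normK ?num_real// flow_angle_lt1.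
have key s s' : cdom P s -> cdom P s' -> s < s' -> eps * nuf s' < eps * nuf s.
  move=> /DE/andP[s1 s2] /DE/andP[s3 s4] ss.
  have e1 u : -1 < u < 1 -> -1 < eps * u < 1.
    by case: (fc_eps fc) => ->; rewrite ?mul1r// mulN1r => ?; lra.
  move: s1; rewrite le_eqVlt => /orP[/eqP sa|s1].
    rewrite -sa nua ee; move: s4; rewrite le_eqVlt => /orP[/eqP ->|s4].
      by rewrite nub mulrN ee; lra.
    by have := e1 _ (lt1 s' (ltac:(lra))); lra.
  move: s4; rewrite le_eqVlt => /orP[/eqP sb|s4].
    by rewrite sb in ss *; rewrite nub mulrN ee; have := e1 _ (lt1 s (ltac:(lra))); lra.
  have Is := In s (ltac:(lra)); have Is' := In s' (ltac:(lra)).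
  have [Js _] := fc_T fc Is; have [Js' _] := fc_T fc Is'.
  have := fc_mono fc Is Is' ss; rewrite !nuE; try lra.
  have dec := sphere_angle_decr kappa_le0 tau_gt0 cf cs sph S0 c1.
  by case: (fc_eps fc) => ->; rewrite ?mul1r ?mulN1r ?ltrN2; exact: dec.
case: (fc_eps fc) => e; [right|left] => s s' Ds Ds' ss; have := key s s' Ds Ds' ss; rewrite e; lra.
Qed.

End SphereCase.

(** * The families of unduloids and nodoids, and the identification of each orbit *)

Section Families.
Context {R : realType} (kappa tau : R) (h : R -> R).
Hypothesis kappa_le0 : kappa <= 0.
Hypothesis tau_gt0 : 0 < tau.
Let k (y : R) := h (clamp1 y).
Hypothesis cf : curvature_fun kappa k.
Implicit Types (s t x m M : R) (p phi z : R -> R).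

Local Notation S := (Sig kappa).
Local Notation io := (angmax kappa tau).
Local Notation half_period := (half_period kappa tau k).
Local Notation sol := (sol kappa tau k).

Lemma sol_height p phi : sol setT p phi ->
  exists z, forall t : R, is_derive t 1 z (cos (phi t) / io (p t)).
Proof.
move=> s; have c t : setT t -> {for t, continuous (fun t => cos (phi t) / io (p t))}.
  move=> _; have [p0 Dp Dphi] := s t I.
  have a := der_cont (der_angmax kappa_le0 tau_gt0 p0 Dp); have b := der_cont Dphi.
  have n := lt0r_neq0 (angmax_gt0 kappa tau_gt0 p0); cont.
have [z [_ Dz]] := primitive openT (@is_intervalT R) c (I : setT 0).
by exists z => t; exact: Dz.
Qed.

(** The value of [p] on the cylinder, solving [S p = 2 k 0]; the curvature condition at angle zero
    makes the radicand positive. *)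
Definition eq_p : R := Num.sqrt (4 * k 0 ^+ 2 + kappa).

Lemma eq_pP : 0 < eq_p /\ S eq_p = 2 * k 0.
Proof.
have [d d0 H] := cf_gap cf; have := H 0; rewrite expr0n/= => /(_ ler01).
rewrite subr0 mulr1 => h1; have w0 : 0 < 4 * k 0 ^+ 2 + kappa by lra.
have [m m0 km] := cf_low cf; have k0 : 0 < k 0 := lt_le_trans m0 (km 0).
split; first by rewrite sqrtr_gt0.
rewrite /Sig sqr_sqrtr ?ltW//.
have -> : 4 * k 0 ^+ 2 + kappa - kappa = (2 * k 0) ^+ 2 by ring.
by rewrite sqrtr_sqr gtr0_norm// mulr_gt0.
Qed.

Definition cyl_radius : R := rad_of kappa eq_p.

(** Radii below that of the cylinder correspond to [p] above the equilibrium, which is the condition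
    for a half-period to start with [cos = 1]. *)
Lemma unduloid_Sig m : 0 < m < cyl_radius -> 0 < inv_rad kappa m /\ 2 * k 0 < S (inv_rad kappa m) /\
  rad_of kappa (inv_rad kappa m) = m.
Proof.
move=> /andP[m0 mx]; have [e0 eS] := eq_pP.
have amb : 0 < 4 + kappa * m ^+ 2.
  apply: (lt_le_trans (rad_ambient kappa_le0 e0)); rewrite lerD2l ler_wnM2l// lerXn2r// ?nnegrE ltW//.
  exact: rad_gt0.
have p0 := inv_rad_gt0 m0 amb; have rm := radK kappa_le0 m0 amb; split => //; split => //.
rewrite -eS; apply: Sig_lt => //; first exact: ltW.
rewrite ltNge; apply/negP; rewrite le_eqVlt => /orP[/eqP e|lt].
  by move: mx; rewrite /cyl_radius -e rm ltxx.
by have := rad_lt kappa_le0 p0 lt; rewrite rm -/cyl_radius => ?; lra.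
Qed.

(** Membership is phrased through the underlying orbit, so that a surface can be identified with a
    member of the family by uniqueness of solutions. *)
Definition is_unduloid m (Q : profile R) := exists P1 p phi z (T : R), [/\ half_period P1 1 p phi T,
  forall t : R, is_derive t 1 z (cos (phi t) / io (p t)), Q = sol_profile kappa p z & m = rad_of kappa P1].
Definition is_nodoid m (Q : profile R) := exists P1 p phi z (T : R), [/\ half_period P1 (-1) p phi T,
  forall t : R, is_derive t 1 z (cos (phi t) / io (p t)), Q = sol_profile kappa p z & m = rad_of kappa (p T)].

Section HalfPeriodSurface.
Variables (P1 c0 : R) (p phi z : R -> R) (T : R).
Hypothesis hp : half_period P1 c0 p phi T.
Hypothesis Dz : forall t : R, is_derive t 1 z (cos (phi t) / io (p t)).
Local Notation Q := (sol_profile kappa p z).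
Let T0 : 0 < T. Proof. by case: hp. Qed.
Let sl : sol setT p phi. Proof. by case: hp. Qed.
Let L0 : 0 < 2 * T. Proof. by rewrite mulr_gt0. Qed.
Let per : [/\ periodic p (2 * T), periodic (fun t => cos (phi t)) (2 * T) &
      periodic (fun t => sin (phi t)) (2 * T)].
Proof. by case: hp => _ s [_ _ s0] [_ sT] _; apply: (sol_period kappa_le0 tau_gt0 cf s s0 sT). Qed.
Let p0 t : 0 < p t. Proof. by have [] := sl (I : setT t). Qed.

Lemma hp_nonconstant : nonconstant (cx Q).
Proof.
exists 0, T; rewrite /= lt_eqF//.
have [_ _ [e _ _] _ _] := hp; apply: rad_lt => //; rewrite e; exact: (hp_lt kappa_le0 hp).
Qed.

Lemma hp_periodic_cx : periodic (cx Q) (2 * T).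
Proof. by have [pp _ _] := per; move=> t; rewrite /= pp. Qed.

Lemma hp_periodic_z1 : periodic (derive1 (cz Q)) (2 * T).
Proof.
by have [pp pc _] := per; move=> t; rewrite /= (derive1_sol_z Dz) /= pp pc.
Qed.

Lemma hp_min : is_minimum (cx Q) (rad_of kappa P1).
Proof.
have P10 : 0 < P1 by have [_ _ [<- _ _] _ _] := hp; exact: p0.
split; first by exists 0; have [_ _ [e _ _] _ _] := hp; rewrite /= e.
move=> t /=; have /andP[_] := hp_bounds kappa_le0 tau_gt0 cf hp t.
by rewrite le_eqVlt => /orP[/eqP ->//|lt]; apply/ltW/rad_lt.
Qed.

Lemma hp_max : is_maximum (cx Q) (rad_of kappa (p T)).
Proof.
split; first by exists T.
move=> t /=; have /andP[+ _] := hp_bounds kappa_le0 tau_gt0 cf hp t.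
by rewrite le_eqVlt => /orP[/eqP ->//|lt]; apply/ltW/rad_lt.
Qed.

(** The period [2 T] is the least one, since strictly between [0] and [2 T] the radius never returns
    to its minimum. *)
Lemma hp_closes_up : z (2 * T) = z 0 -> closes_up Q (2 * T).
Proof.
have [pp pc ps] := per; move=> zz; split => //.
  split; first exact: hp_periodic_cx.
  by move=> t; rewrite /= (z_shift Dz pp pc) zz subrr addr0.
move=> L1 L10 pL _; rewrite leNgt; apply/negP => lt.
have := hp_strict kappa_le0 tau_gt0 cf hp (t := L1); rewrite L10 lt => /(_ isT).
have := pL 0; rewrite /= add0r => /(rad_inj kappa_le0 (p0 _) (p0 _)).
by have [_ _ [-> _ _] _ _] := hp => ->; rewrite ltxx.
Qed.

Lemma hp_proper : proper_surface kappa Q.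
Proof.
have [pp pc ps] := per.
apply: (sol_proper kappa_le0 sl Dz L0 pp pc).
by have [/hp_closes_up|] := eqVneq (z (2 * T)) (z 0); [right|left].
Qed.

Lemma hp_complete : complete_surface kappa tau Q.
Proof. by have [pp pc ps] := per; exact: (sol_complete kappa_le0 tau_gt0 cf sl Dz L0 pp pc ps). Qed.

Lemma hp_cx_gt0 s : 0 < cx Q s.
Proof. exact: rad_gt0. Qed.

Lemma hp_unduloid : c0 = 1 -> unduloid kappa tau h Q /\ embedded Q.
Proof.
move=> c1; have [pp pc ps] := per.
have cp t : 0 < cos (phi t) by exact: (hp_cos_gt0 kappa_le0 tau_gt0 cf hp).
split; last exact: (sol_embedded tau_gt0 sl Dz L0 pp pc).
split => //.
- exact: (sol_h_surface kappa_le0 tau_gt0 cf sl Dz).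
- exact: hp_cx_gt0.
- by split; [exact: hp_nonconstant|exists (2 * T); [|exact: hp_periodic_cx]].
- by left => s t _ _; exact: (sol_z_strict tau_gt0 sl Dz).
Qed.

Lemma hp_nodoid : c0 = -1 -> nodoid kappa tau h Q.
Proof.
move=> c1; have [_ _ [e1 e2 _] [cT _] _] := hp; split.
- exact: (sol_h_surface kappa_le0 tau_gt0 cf sl Dz).
- exact: hp_complete.
- by split => // s; exact: hp_cx_gt0.
- split; first exact: hp_nonconstant.
  by exists (2 * T) => //; split; [exact: hp_periodic_cx|exact: hp_periodic_z1].
- split; [exists T|exists 0]; rewrite /= (derive1_sol_z Dz) /=.
    by rewrite cT mul1r invr_gt0 angmax_gt0.
  by rewrite e2 c1 mulN1r oppr_lt0 invr_gt0 angmax_gt0.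
Qed.

End HalfPeriodSurface.

Lemma unduloid_exists m : 0 < m < cyl_radius -> exists Q, is_unduloid m Q.
Proof.
move=> /unduloid_Sig[P0 [S0 rm]].
have [p [phi [T hp]]] := half_period_exists kappa_le0 tau_gt0 cf P0 (or_introl (conj erefl S0)).
have [_ sl _ _ _] := hp; have [z Dz] := sol_height sl.
by exists (sol_profile kappa p z), (inv_rad kappa m), p, phi, z, T.
Qed.

(** The largest radius depends on the smallest one through the flow, without an explicit formula, so
    the index set is the set of values that occur. *)
Definition nodoid_radius M := exists P1 p phi (T : R), half_period P1 (-1) p phi T /\ M = rad_of kappa (p T).

Lemma nodoid_exists M : nodoid_radius M -> exists Q, is_nodoid M Q.
Proof.
move=> [P1 [p [phi [T [hp e]]]]]; have [_ sl _ _ _] := hp; have [z Dz] := sol_height sl.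
by exists (sol_profile kappa p z), P1, p, phi, z, T.
Qed.

(** By [nodoid_up], with one radius the set contains all larger radii inside the domain of the
    model; such a set is an interval, and halving the final [p] exhibits a second element. *)
Lemma nodoid_radius_interval : nondegenerate_interval nodoid_radius.
Proof.
have up P1 p phi T q : half_period P1 (-1) p phi T -> 0 < q <= p T -> nodoid_radius (rad_of kappa q).
  move=> hp /andP[q0]; rewrite le_eqVlt => /orP[/eqP ->|qT]; first by exists P1, p, phi, T.
  have qI : 0 < q < p T by rewrite q0.
  have [P' [p' [phi' [T' [hp' e]]]]] := nodoid_up kappa_le0 tau_gt0 cf hp qI.
  by exists P', p', phi', T'; rewrite e.
split.
  move=> M1 M2 [P1 [p1 [phi1 [T1 [hp1 ->]]]]] [P2 [p2 [phi2 [T2 [hp2 ->]]]]] M /andP[h1 h2].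
  have a := hp_pT_gt0 hp1; have b := hp_pT_gt0 hp2.
  have r1 := rad_gt0 kappa_le0 a; have M0 := lt_le_trans r1 h1.
  have amb : 0 < 4 + kappa * M ^+ 2.
    apply: (lt_le_trans (rad_ambient kappa_le0 b)); rewrite lerD2l ler_wnM2l// lerXn2r// ?nnegrE ltW//.
    exact: rad_gt0.
  have p0 := inv_rad_gt0 M0 amb; have rm := radK kappa_le0 M0 amb.
  rewrite -rm; apply: (up _ _ _ _ _ hp1); rewrite p0 /= leNgt; apply/negP => lt.
  by have := rad_lt kappa_le0 a lt; rewrite rm; lra.
(* A nodoid can be started from any positive [p]; the value [1] is an arbitrary choice. *)
have [p [phi [T hp]]] := half_period_exists kappa_le0 tau_gt0 cf ltr01 (or_intror erefl).
have a := hp_pT_gt0 hp.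
exists (rad_of kappa (p T)), (rad_of kappa (p T / 2)); split.
- by apply: (up _ _ _ _ _ hp); rewrite a lexx.
- by apply: (up _ _ _ _ _ hp); rewrite divr_gt0//=; lra.
- by apply: rad_lt => //; [rewrite divr_gt0|lra].
Qed.

Section Classify.
Variables (P : profile R) (eps : R) (J : set R) (p phi T G : R -> R).
Hypothesis rs : rotational_surface kappa P.
Hypothesis comp : complete_surface kappa tau P.
Hypothesis H : oriented_h_surface kappa tau h P eps.
Hypothesis fc : flow_chart kappa tau h P eps J p phi T G.
Hypothesis cs : complete_sol kappa tau k J p phi.
Let sl : sol J p phi := fc_sol fc.

(** A bound on [p] is a positive lower bound on the radius at interior parameters, which excludes
    points of the axis by continuity of the pole patch. *)
Lemma no_poles M (t1 : R) : J t1 -> (forall t, J t -> p t <= M) -> forall s, cdom P s -> (cdom P)^° s.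
Proof.
move=> J1 pM s Ds; apply: contrapT => nI; have [nd ge0 ends _ _] := rs; have [iD _] := nd.
have c0 : cx P s = 0 by case: (ends s Ds).
have [sg isg] := cdom_end nd Ds.
have M0 : 0 < M by have [p0 _ _] := sl J1; apply: lt_le_trans (pM _ J1).
have [d d0 Hd] := pole_cont rs Ds c0 isg (rad_gt0 kappa_le0 M0).
have [_ nin] := isg.
have [y [[y0 yd] Dy]] : exists y, (0 < y /\ y < d) /\ cdom P (s + sg * y).
  have /filter_ex[y [[y0 yd] Dy]] : \forall y \near 0^'+, (0 < y /\ y < d) /\ cdom P (s + sg * y).
    by apply: filterI nin; apply: filterI; [exact: nbhs_right_gt|exact: nbhs_right_lt].
  by exists y.
have Is : (cdom P)^° (s + sg * (y / 2)).
  case: isg => -[] e _; rewrite e ?mul1r ?mulN1r in Dy *.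
    by apply: (interior_between iD Ds Dy); lra.
  by apply: (interior_between iD Dy Ds); lra.
have [Jt e] := fc_T fc Is; have [p0 _ _] := sl Jt.
have [] := Hd (y / 2) (ltac:(lra)); rewrite -e (fc_cx fc)// => lt _.
have := pM _ Jt; rewrite le_eqVlt => /orP[/eqP pe|plt]; first by move: lt; rewrite pe ltxx.
by have := rad_lt kappa_le0 p0 plt; lra.
Qed.

(** The time of the orbit, shifted by [c], is the change of parameter. The two heights have equal
    derivatives, so they differ by a constant, the vertical translation. *)
Lemma congruent_sol pc phic z (c : R) : sol setT pc phic ->
  (forall t : R, is_derive t 1 z (cos (phic t) / io (pc t))) -> J = setT ->
  (forall s, cdom P s -> (cdom P)^° s) ->
  (forall t, p t = pc (t + c) /\ cos (phi t) = cos (phic (t + c))) ->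
  vertically_congruent P (sol_profile kappa pc z).
Proof.
move=> sc Dz JT DI E; have Jt t : J t by rewrite JT.
have D t : is_derive t 1 (fun t => z (t + c) - cz P (G t)) 0.
  have a := fc_cz fc (Jt t); have b := Dz (t + c); have [e1 e2] := E t.
  have d : is_derive t 1 (fun t => t + c) 1 by der; ring.
  have f := derC1 (g := fun t => t + c) b d.
  by der; rewrite e1 e2; ring.
have const t : z (t + c) - cz P (G t) = z (0 + c) - cz P (G 0).
  have [t0|/ltW t0] := leP t 0; first exact: (derive0_const t0 (fun s _ => D s)).
  exact/esym/(derive0_const t0 (fun s _ => D s)).
exists (z (0 + c) - cz P (G 0)), (fun s => T s + c); split.
- split.
  + by [].
  + move=> s s'; rewrite !inE => /DI Is /DI Is' /addIr e.
    by have [_ <-] := fc_T fc Is; have [_ <-] := fc_T fc Is'; rewrite e.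
  + move=> t _; have [IG e] := fc_G fc (Jt (t - c)).
    by exists (G (t - c)); [exact: nbhs_singleton IG|rewrite e subrK].
- apply: continuous_in_subspaceT => s; rewrite inE => /DI Is.
  by have a := fc_contT fc Is; cont.
- move=> s /DI Is; have [_ e] := fc_T fc Is; split => /=.
    by have [<- _] := E (T s); rewrite -(fc_cx fc (Jt (T s))) e.
  by rewrite -(const (T s)) e; ring.
Qed.

(** Uniqueness identifies the given orbit with the half-period orbit translated in time. Then [p] is
    bounded, so the orbit is defined for all times and the profile avoids the axis. *)
Lemma family_case t1 c0 P1 pc phic Tc : J t1 -> half_period P1 c0 pc phic Tc ->
  p t1 = P1 -> cos (phi t1) = c0 -> sin (phi t1) = 0 ->
  [/\ J = setT, forall s, cdom P s -> (cdom P)^° s &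
    forall t, p t = pc (t - t1) /\ cos (phi t) = cos (phic (t - t1))].
Proof.
move=> J1 hp e1 e2 e3; have [T0 sc [p0 cp0 sp0] [cT sT] sp] := hp.
have [oJ iJ _ _ _] := cs.
have sc' : sol J (fun t => pc (t + - t1)) (fun t => phic (t + - t1)).
  by apply: sol_sub (sol_shift (c := - t1) sc).
have i1 : p t1 = pc (t1 + - t1) by rewrite subrr p0.
have i2 : cos (phi t1) = cos (phic (t1 + - t1)) by rewrite subrr cp0.
have i3 : sin (phi t1) = sin (phic (t1 + - t1)) by rewrite subrr sp0.
have U := sol_unique kappa_le0 tau_gt0 cf iJ J1 sl sc' i1 i2 i3.
have pM t : J t -> p t <= P1.
  by move=> /U[-> _ _]; have /andP[] := hp_bounds kappa_le0 tau_gt0 cf hp (t + - t1).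
have JT := complete_bounded cs J1 pM.
split => //; first exact: no_poles J1 pM.
by move=> t; have [|-> -> _] := U t; rewrite ?JT.
Qed.

(** Half-periods start at the smallest radius while the family is indexed by the largest. The
    half-period through the given zero and that of the family member are therefore matched at their
    ends [Tc] and [T2], where the largest radii agree, and uniqueness identifies them up to a shift
    of time. *)
Lemma nodoid_case t1 (N : R -> profile R) : (forall M, nodoid_radius M -> is_nodoid M (N M)) ->
  J t1 -> sin (phi t1) = 0 -> cos (phi t1) = -1 ->
  exists2 M, nodoid_radius M & vertically_congruent P (N M).
Proof.
move=> NP J1 s1 c1; have [p1 _ _] := sl J1.
have [pc [phic [Tc hp]]] := half_period_exists kappa_le0 tau_gt0 cf p1 (or_intror erefl).
have [JT DI E] := family_case J1 hp erefl c1 s1.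
have rM : nodoid_radius (rad_of kappa (pc Tc)) by exists (p t1), pc, phic, Tc.
exists (rad_of kappa (pc Tc)) => //.
have [P2 [p2 [phi2 [z2 [T2 [hp2 Dz2 -> e2]]]]]] := NP _ rM.
have [_ sc _ [cT sT] _] := hp; have [_ s2 _ [cT2 sT2] _] := hp2.
have pT : pc Tc = p2 T2 by apply: (rad_inj kappa_le0 _ _ e2); [exact: (hp_pT_gt0 hp)|exact: (hp_pT_gt0 hp2)].
have s2' : sol setT (fun t => p2 (t + (T2 - Tc))) (fun t => phi2 (t + (T2 - Tc))).
  by apply: sol_sub (sol_shift (c := T2 - Tc) s2).
have TT : Tc + (T2 - Tc) = T2 by ring.
have i1 : pc Tc = p2 (Tc + (T2 - Tc)) by rewrite TT.
have i2 : cos (phic Tc) = cos (phi2 (Tc + (T2 - Tc))) by rewrite TT cT cT2.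
have i3 : sin (phic Tc) = sin (phi2 (Tc + (T2 - Tc))) by rewrite TT sT sT2.
have U t := sol_unique kappa_le0 tau_gt0 cf (@is_intervalT R) (I : setT Tc) sc s2' i1 i2 i3 (I : setT t).
apply: (congruent_sol (c := - t1 + (T2 - Tc)) s2 Dz2 JT DI) => t.
have -> : t + (- t1 + (T2 - Tc)) = t - t1 + (T2 - Tc) by ring.
by have [-> ->] := E t; have [-> -> _] := U (t - t1).
Qed.

Lemma unduloid_case t1 (U : R -> profile R) : (forall m, 0 < m < cyl_radius -> is_unduloid m (U m)) ->
  J t1 -> sin (phi t1) = 0 -> cos (phi t1) = 1 -> 2 * k 0 < S (p t1) ->
  exists2 m, 0 < m < cyl_radius & vertically_congruent P (U m).
Proof.
move=> UP J1 s1 c1 S1; have [p1 _ _] := sl J1.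
have [e0 eS] := eq_pP.
have mI : 0 < rad_of kappa (p t1) < cyl_radius.
  rewrite rad_gt0//=; apply: rad_lt => //; rewrite ltNge; apply/negP => le.
  by have := Sig_le kappa_le0 (ltW p1) le; rewrite eS; lra.
exists (rad_of kappa (p t1)) => //.
have [P2 [p2 [phi2 [z2 [T2 [hp2 Dz2 -> e2]]]]]] := UP _ mI.
have [_ s2 [i1 i2 i3] _ _] := hp2.
have P20 : 0 < P2 by have [q _ _] := s2 0 I; rewrite -i1.
have [JT DI E] := family_case J1 hp2 (rad_inj kappa_le0 p1 P20 e2) c1 s1.
exact: (congruent_sol (c := - t1) s2 Dz2 JT DI).
Qed.

Lemma cylinder_case t1 : J t1 -> sin (phi t1) = 0 -> cos (phi t1) = 1 -> S (p t1) = 2 * k 0 ->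
  vertically_congruent P (cylinder cyl_radius) /\ h_surface kappa tau (fun=> h 0) P.
Proof.
move=> J1 s1 c1 S1; have [oJ iJ _ _ _] := cs; have [p1 _ _] := sl J1.
have E := equilibrium kappa_le0 tau_gt0 cf iJ sl J1 s1 c1 S1.
have pM t : J t -> p t <= p t1 by move=> /E[-> _].
have JT := complete_bounded cs J1 pM; have Jt t : J t by rewrite JT.
have DI := no_poles J1 pM.
have [e0 eS] := eq_pP.
have pe : p t1 = eq_p.
  have h1 := Sig_sq kappa_le0 (p t1); have h2 := Sig_sq kappa_le0 eq_p.
  apply/eqP; rewrite -(eqrXn2 (n := 2))// ?ltW//; apply/eqP.
  by move: h1 h2; rewrite S1 eS; lra.
have xE s : cdom P s -> cx P s = cyl_radius.
  by move=> /DI Is; have [_ e] := fc_T fc Is; rewrite -e (fc_cx fc)//; have [-> _] := E (T s) (Jt _); rewrite pe.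
have i0 := angmax_gt0 kappa tau_gt0 p1.
have zE t : cz P (G t) = cz P (G 0) + t / io (p t1).
  have D x : is_derive x 1 (fun t => cz P (G t) - t / io (p t1)) 0.
    have a := fc_cz fc (Jt x); have [e1 [_ e2]] := E x (Jt x).
    by der; rewrite e1 e2; ring.
  suff : cz P (G t) - t / io (p t1) = cz P (G 0) - 0 / io (p t1) by rewrite mul0r subr0 => <-; ring.
  have [t0|/ltW t0] := leP t 0; first exact: (derive0_const t0 (fun s _ => D s)).
  exact/esym/(derive0_const t0 (fun s _ => D s)).
split.
  (* The standard cylinder is parametrized by height, so the height of the profile itself is the
     change of parameter. *)
  exists 0, (cz P); split.
  - split => //.
    + move=> s s'; rewrite !inE => /DI Is /DI Is' e.
      have [_ es] := fc_T fc Is; have [_ es'] := fc_T fc Is'.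
      have h1 := zE (T s); have h2 := zE (T s'); rewrite es in h1; rewrite es' in h2.
      have : T s / io (p t1) = T s' / io (p t1) by move: e; rewrite h1 h2 => /addrI.
      have in0 : (io (p t1))^-1 != 0 by rewrite invr_eq0 lt0r_neq0.
      by move=> /(mulIf in0) Tss; rewrite -es -es' Tss.
    + move=> y _; exists (G ((y - cz P (G 0)) * io (p t1))).
        by have [IG _] := fc_G fc (Jt ((y - cz P (G 0)) * io (p t1))); exact: nbhs_singleton IG.
      by rewrite zE mulfK ?lt0r_neq0//; ring.
  - apply: continuous_in_subspaceT => s; rewrite inE => /DI Is.
    have [/nbhs_singleton[_ d _ _ _] _ _ _] := regular_interior kappa_le0 rs Is.
    exact: derivable_cont.
  - by move=> s Ds /=; rewrite xE// addr0.
split => //; exists eps; split; first exact: fc_eps fc.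
move=> s th Psi w sg eta ch un.
have [_ Hc] := H; rewrite (Hc _ _ _ _ _ _ ch un); congr h.
case: ch un => [Is|sg' Ds c0 _]; last by move: (DI s Ds) => Is; have [_ x0 _ _] := regular_interior kappa_le0 rs Is; rewrite c0 ltxx in x0.
rewrite mulr1 => un; rewrite (fc_angle fc Is un) /flow_angle.
by have [_ [-> _]] := E (T s) (Jt _); rewrite mul0r.
Qed.

End Classify.

End Families.

Theorem theorem1p3 (R : realType) (kappa tau : R) (h : R -> R)
    (hkappa : kappa <= 0) (htau : 0 < tau) (hh : C1_class kappa h) :
  exists (Ju Jn : set R) (U N : R -> profile R),
    [/\ nondegenerate_interval Ju,
        nondegenerate_interval Jn,
        forall m, Ju m ->
          [/\ unduloid kappa tau h (U m), embedded (U m),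
              proper_surface kappa (U m) & is_minimum (cx (U m)) m],
        forall m, Jn m ->
          [/\ nodoid kappa tau h (N m), proper_surface kappa (N m) &
              is_maximum (cx (N m)) m] &
        forall P : profile R,
          h_surface kappa tau h P -> complete_surface kappa tau P ->
          [\/ vertically_congruent P
                (cylinder (2 / (Num.sqrt (4 * h 0 ^+ 2 + kappa) + 2 * h 0)))
              /\ h_surface kappa tau (fun=> h 0) P,
              [/\ h_sphere kappa tau h P, embedded P &
                  monotone_angle kappa tau h P],
              exists2 m, Ju m & vertically_congruent P (U m) |
              exists2 m, Jn m & vertically_congruent P (N m)]].
Proof.
have cf := curvature_fun_clamp hh; set k := fun y => h (clamp1 y) in cf.
have k0 : k 0 = h 0 by rewrite /k clamp1_id// lerN10 ler01.
have [e0 eS] : 0 < eq_p kappa h /\ Sig kappa (eq_p kappa h) = 2 * k 0 by exact: eq_pP.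
pose x0 := cyl_radius kappa h; have x00 : 0 < x0 by exact: rad_gt0.
pose Ju := [set m : R | 0 < m < x0]; pose Jn := nodoid_radius kappa tau h.
(* Members are selected by choice for every real index; outside the index set an arbitrary profile
   serves as value. *)
have exU m : exists Q, Ju m -> is_unduloid kappa tau h m Q.
  have [mI|nI] := pselect (Ju m); last by exists (cylinder 1) => /nI.
  by have [Q HQ] := unduloid_exists hkappa htau cf mI; exists Q.
have exN m : exists Q, Jn m -> is_nodoid kappa tau h m Q.
  have [mI|nI] := pselect (Jn m); last by exists (cylinder 1) => /nI.
  by have [Q HQ] := nodoid_exists hkappa htau mI; exists Q.
pose U m := projT1 (cid (exU m)); pose N m := projT1 (cid (exN m)).
have UP m : Ju m -> is_unduloid kappa tau h m (U m) by exact: projT2 (cid (exU m)).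
have NP m : Jn m -> is_nodoid kappa tau h m (N m) by exact: projT2 (cid (exN m)).
exists Ju, Jn, U, N; split.
- split; first by move=> a b /andP[a0 _] /andP[_ bx] c /andP[ac cb]; rewrite /Ju /=; lra.
  by exists (x0 / 3), (x0 / 2); rewrite /Ju /=; split; lra.
- exact: nodoid_radius_interval.
- move=> m /UP[P1 [p [phi [z [T [hp Dz -> ->]]]]]].
  have [u e] := hp_unduloid hkappa htau cf hp Dz erefl; split => //.
  + exact: (hp_proper hkappa htau cf hp Dz).
  + exact: (hp_min hkappa htau cf z hp).
- move=> m /NP[P1 [p [phi [z [T [hp Dz -> ->]]]]]]; split.
  + exact: (hp_nodoid hkappa htau cf hp Dz erefl).
  + exact: (hp_proper hkappa htau cf hp Dz).
  + exact: (hp_max hkappa htau cf z hp).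
move=> P [rs [eps H]] comp.
have [J [p [phi [T [G [fc cs [t Jt]]]]]]] := complete_flow hkappa htau cf rs comp H.
have ke : h (clamp1 0) = h 0 by rewrite clamp1_id// lerN10 ler01.
have cylE : 2 / (Num.sqrt (4 * h 0 ^+ 2 + kappa) + 2 * h 0) = x0.
  have e1 : eq_p kappa h = Num.sqrt (4 * h 0 ^+ 2 + kappa) by rewrite /eq_p ke.
  have e2 : Sig kappa (eq_p kappa h) = 2 * h 0 by rewrite eS /k ke.
  by rewrite /x0 /cyl_radius /rad_of e2 e1.
rewrite cylE; have [t1 J1 s1] := exists_zero hkappa htau cf cs Jt.
have up t2 : J t2 -> sin (phi t2) = 0 -> cos (phi t2) = 1 -> 2 * k 0 < Sig kappa (p t2) ->
  exists2 m, Ju m & vertically_congruent P (U m) by exact: (unduloid_case hkappa htau cf rs fc cs UP).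
have down t2 : J t2 -> sin (phi t2) = 0 -> cos (phi t2) = -1 ->
  exists2 m, Jn m & vertically_congruent P (N m) by exact: (nodoid_case hkappa htau cf rs fc cs NP).
have [c1|c1] := sin0_cos s1; last by apply: Or44; exact: down J1 s1 c1.
have [S1|S1|S1] := ltgtP (Sig kappa (p t1)) (2 * k 0).
- have [[t2 [J2 s2 [c2|[c2 S2]]]]|[r sph]] := from_maximal_radius hkappa htau cf cs J1 s1 c1 S1.
  + by apply: Or44; exact: down J2 s2 c2.
  + by apply: Or43; exact: up J2 s2 c2 S2.
  + by apply: Or42; exact: (sphere_conclusion hkappa htau cf rs comp H fc cs sph S1 c1).
- by apply: Or43; exact: up J1 s1 c1 S1.
- by apply: Or41; exact: (cylinder_case hkappa htau cf rs H fc cs J1 s1 c1 S1).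
Qed.
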